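(* Let $W\in\{S_n,W^{\mathsf{BC}}_n,W^{\mathsf D}_n\}$ with $n\ge2$, with simple generators $S$, and let $\mathcal G=\mathcal G(W)$. Let $\mathcal M$ and $\mathcal N$ be the free $\mathbb Z[x,x^{-1}]$-modules with bases $\{M_z:z\in\mathcal G\}$ and $\{N_z:z\in\mathcal G\}$. Then $szs\in\mathcal G$ whenever $z\in\mathcal G$ and $s\in\mathrm{Asc}^<(z)\sqcup\mathrm{Des}^<(z)$, and there is a unique left $\mathcal H$-module structure on $\mathcal M$ with $H_sM_z=M_{szs}$ if $s\in\mathrm{Asc}^<(z)$; $H_sM_z=M_{szs}+(x-x^{-1})M_z$ if $s\in\mathrm{Des}^<(z)$; $H_sM_z=-x^{-1}M_z$ if $s\in\mathrm{Asc}^=(z)$; $H_sM_z=xM_z$ if $s\in\mathrm{Des}^=(z)$, and a unique left $\mathcal H$-module structure on $\mathcal N$ with $H_sN_z=N_{szs}$ if $s\in\mathrm{Asc}^<(z)$; $H_sN_z=N_{szs}+(x-x^{-1})N_z$ if $s\in\mathrm{Des}^<(z)$; $H_sN_z=xN_z$ if $s\in\mathrm{Asc}^=(z)$; $H_sN_z=-x^{-1}N_z$ if $s\in\mathrm{Des}^=(z)$, for all $s\in S$, $z\in\mathcal G$. Moreover, if $W$ is not $W^{\mathsf D}_n$ with $n$ even, then $\mathcal M_{\mathbb Q}=\mathbb Q(x)\otimes_{\mathbb Z[x,x^{-1}]}\mathcal M$ and $\mathcal N_{\mathbb Q}=\mathbb Q(x)\otimes_{\mathbb Z[x,x^{-1}]}\mathcal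 N$ are both Gelfand models for $\mathcal H_{\mathbb Q}(W)$.
   Context: For $i>0$ let $s_i=(i,i+1)(-i,-i-1)$, $s_0=(-1,1)$, $s_{-1}=(1,-2)(-1,2)$, permutations of $\mathbb Z$ (or of $\{\pm1,\dots,\pm N\}$). $W^{\mathsf{BC}}_N$ is the group of permutations $w$ of $\{\pm1,\dots,\pm N\}$ with $w(-i)=-w(i)$, a Coxeter group with generators $s_0,\dots,s_{N-1}$; $W^{\mathsf D}_N$ is the subgroup with $|\{i\in[N]:w(i)<0\}|$ even, a Coxeter group with generators $s_{-1},s_1,\dots,s_{N-1}$; $S_N=\langle s_1,\dots,s_{N-1}\rangle\subset W^{\mathsf{BC}}_N$ (the symmetric group on $[N]$). $\ell$ is Coxeter length. Sets: $\mathcal F^{\mathsf A}_{n-1}=\{z\in S_{2n}:z=z^{-1},\ z(i)\ne i\ \forall i\in[2n]\}$; $\mathcal F^{\mathsf{BC}}_n=\{z\in W^{\mathsf{BC}}_{2n}:z=z^{-1},\ |z(i)|\ne i\ \forall i\in[2n]\}$; $\mathcal F^{\mathsf D}_n=\{z\in\mathcal F^{\mathsf{BC}}_n: |\{i\in[n]:z(i)<-i\}|\text{ even}\}$. An integer $i>0$ is a visible descent of $z$ if $z(i+1)<\min\{i,z(i)\}$ or $z(i)<-i$. $\mathcal G^{\mathsf A}_{n-1},\mathcal G^{\mathsf{BC}}_n,\mathcal G^{\mathsf D}_n$ are the subsets of $\mathcal F^{\mathsf A}_{n-1},\mathcal F^{\mathsf{BC}}_n,\mathcal F^{\mathsf D}_n$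 of elements with no visible descent greater than $n$; $\mathcal G(W)$ is $\mathcal G^{\mathsf A}_{n-1},\mathcal G^{\mathsf{BC}}_n,\mathcal G^{\mathsf D}_n$ for $W=S_n,W^{\mathsf{BC}}_n,W^{\mathsf D}_n$ respectively. For $z\in\mathcal G(W)$, $\ell(z)$ denotes length in $S_{2n}$, $W^{\mathsf{BC}}_{2n}$, or $W^{\mathsf D}_{2n}$ respectively. For $z\in\mathcal G$: $\mathrm{Des}^=(z)=\{s\in S:sz=zs\}$, $\mathrm{Asc}^=(z)=\{s\in S:zsz\in\{s_i:i>n\}\}$, $\mathrm{Des}^<(z)=\{s\in S:\ell(sz)<\ell(z)\}\setminus(\mathrm{Des}^=(z)\sqcup\mathrm{Asc}^=(z))$, $\mathrm{Asc}^<(z)=\{s\in S:\ell(sz)>\ell(z)\}\setminus(\mathrm{Des}^=(z)\sqcup\mathrm{Asc}^=(z))$. $\mathcal H=\mathcal H(W)$ is the Iwahori–Hecke algebra: free $\mathbb Z[x,x^{-1}]$-module with basis $\{H_w:w\in W\}$ and the algebra structure with $H_sH_w=H_{sw}$ if $\ell(sw)>\ell(w)$ and $H_sH_w=H_{sw}+(x-x^{-1})H_w$ if $\ell(sw)<\ell(w)$. $\mathcal H_{\mathbb Q}=\mathbb Q(x)\otimes\mathcal H$. A Gelfand model for $\mathcal H_{\mathbb Q}$ is a left module isomorphic to the direct sum of all irreducible $\mathcal H_{\mathbb Q}$-modules, each isomorphism class appearing exactly once. *)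

(* Defs.v *)
From mathcomp Require Import all_ssreflect all_algebra all_fingroup.
From mathcomp Require Import boolp.

Unset Implicit Arguments.
Unset Strict Implicit.
Unset Printing Implicit Defensive.

Import GRing.Theory Num.Theory.
Local Open Scope ring_scope.

(* The point set {-N,...,-1,0,1,...,N} is encoded as 'I_(2N+1):          *)
(* k : 'I_(2N+1) stands for the integer k - N.  A permutation w of this  *)
(* set with w(-i) = -w(i) necessarily fixes 0, so such w are exactly the *)
(* signed permutations of {+-1,...,+-N}.                                 *)

Definition pt (N : nat) := 'I_(N.*2).+1.
Definition toZ {N : nat} (k : pt N) : int := (k : nat)%:Z - N%:Z.
Definition ofZ (N : nat) (a : int) : pt N := inord (absz (a + N%:Z)).

Definition apZ {N : nat} (w : {perm pt N}) (a : int) : int :=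
  if (absz a <= N)%N then toZ (w (ofZ N a)) else a.

(* function composition a o b  (MathComp's product is (a * b) x = b (a x)) *)
Definition permc {T : finType} (a b : {perm T}) : {perm T} := (b * a)%g.

(* simple reflections, as permutations of {-N..N} (meaningful for the   *)
(* indices used below: 1 <= i < N, N >= 2)                               *)
Definition sgen (N i : nat) : {perm pt N} :=
  (tperm (ofZ N i%:Z) (ofZ N (i%:Z + 1)) *
   tperm (ofZ N (- i%:Z)) (ofZ N (- i%:Z - 1)))%g.
Definition s0 (N : nat) : {perm pt N} := tperm (ofZ N (-1)) (ofZ N 1).
Definition sm1 (N : nat) : {perm pt N} :=
  (tperm (ofZ N 1) (ofZ N (-2)) * tperm (ofZ N (-1)) (ofZ N 2))%g.

Inductive CoxType := TA | TBC | TD.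

Definition gens (t : CoxType) (N r : nat) : seq {perm pt N} :=
  let sA := [seq sgen N i | i <- iota 1 r.-1] in
  match t with
  | TA => sA
  | TBC => s0 N :: sA
  | TD => sm1 N :: sA
  end.

Definition words {gT : finGroupType} (S : seq gT) (k : nat) : {set gT} :=
  iter k (fun A : {set gT} => [set (g * a)%g | g in [set:: S], a in A]) [set 1%g].

(* Coxeter length = minimal word length in the generators (for elements *)
(* of the generated group, which have word length < #|gT|)              *)
Definition wordlen {gT : finGroupType} (S : seq gT) (w : gT) : nat :=
  find (fun k => w \in words S k) (iota 0 #|gT|.+1).

Definition isBC {N : nat} (w : {perm pt N}) : bool :=
  [forall k : pt N, apZ w (- toZ k) == - apZ w (toZ k)].
Definition fixBeyond {N : nat} (r : nat) (w : {perm pt N}) : bool :=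
  [forall k : pt N, (r%:Z < `|toZ k|) ==> (apZ w (toZ k) == toZ k)].
Definition evenNeg {N : nat} (r : nat) (w : {perm pt N}) : bool :=
  ~~ odd (count (fun i : nat => apZ w i%:Z < 0) (iota 1 r)).

(* the group W of type t and rank r, inside the signed permutations of  *)
(* {+-1..+-N} (N >= r), acting trivially on +-(r+1),...,+-N             *)
Definition Wgrp (t : CoxType) (N r : nat) : {set {perm pt N}} :=
  match t with
  | TA => <<[set:: gens TA N r]>>%g
  | TBC => [set w | isBC w && fixBeyond r w]
  | TD => [set w | [&& isBC w, fixBeyond r w & evenNeg r w]]
  end.

Notation P n := {perm pt (n.*2)}.

Definition FBCb (n : nat) (z : P n) : bool :=
  [&& z \in Wgrp TBC (n.*2) (n.*2), (z^-1)%g == z &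
      all (fun i : nat => `|apZ z i%:Z| != i%:Z) (iota 1 (n.*2))].

Definition Fb (t : CoxType) (n : nat) (z : P n) : bool :=
  match t with
  | TA => [&& z \in Wgrp TA (n.*2) (n.*2), (z^-1)%g == z &
             all (fun i : nat => apZ z i%:Z != i%:Z) (iota 1 (n.*2))]
  | TBC => FBCb n z
  | TD => FBCb n z && ~~ odd (count (fun i : nat => apZ z i%:Z < - i%:Z) (iota 1 n))
  end.

Definition visDes {N : nat} (z : {perm pt N}) (i : int) : Prop :=
  0 < i /\ (apZ z (i + 1) < Num.min i (apZ z i) \/ apZ z i < - i).

Definition Gset (t : CoxType) (n : nat) : {set P n} :=
  [set z | Fb t n z && `[< forall i : int, n%:Z < i -> ~ visDes z i >]].

Definition Sgen (t : CoxType) (n : nat) : seq (P n) := gens t (n.*2) n.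
Definition WW (t : CoxType) (n : nat) : {set P n} := Wgrp t (n.*2) n.
Definition lenW (t : CoxType) (n : nat) (w : P n) : nat := wordlen (Sgen t n) w.
Definition lenBig (t : CoxType) (n : nat) (w : P n) : nat :=
  wordlen (gens t (n.*2) (n.*2)) w.

Definition DesEq (n : nat) (s z : P n) : Prop := permc s z = permc z s.
Definition AscEq (n : nat) (s z : P n) : Prop :=
  exists i : nat, (n < i < n.*2)%N /\ permc z (permc s z) = sgen (n.*2) i.
Definition DesLt (t : CoxType) (n : nat) (s z : P n) : Prop :=
  (lenBig t n (permc s z) < lenBig t n z)%N /\ ~ DesEq n s z /\ ~ AscEq n s z.
Definition AscLt (t : CoxType) (n : nat) (s z : P n) : Prop :=
  (lenBig t n z < lenBig t n (permc s z))%N /\ ~ DesEq n s z /\ ~ AscEq n s z.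

(* Coefficients: K = Frac(Z[x]) = Q(x); Z[x,x^-1] is a subring of K.     *)

Definition K := {fraction {poly int}}.
Definition xK : K := @FracField.tofrac _ ('X : {poly int}).
Definition isLaurent (f : K) : Prop :=
  exists (k : nat) (p : {poly int}), f = @FracField.tofrac _ p / xK ^+ k.

(* A left H(W)-module structure on an F-module V (q the parameter x) is  *)
(* given by the actions rho w of the basis elements H_w (w in W): linear *)
(* maps with H_1 = id and H_s H_w = H_{sw} if l(sw) > l(w),             *)
(* H_s H_w = H_{sw} + (q - q^-1) H_w otherwise.                          *)

Section Hecke.
Variables (F : fieldType) (T : finType) (W : {set {perm T}})
  (S : seq {perm T}) (len : {perm T} -> nat) (q : F).

Definition heckeRep {V : lmodType F} (rho : {perm T} -> V -> V) : Prop :=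
  (forall w, w \in W -> forall (a : F) (u v : V),
      rho w (a *: u + v) = a *: rho w u + rho w v) /\
  (forall v, rho 1%g v = v) /\
  (forall s w v, s \in S -> w \in W ->
     rho s (rho w v) =
       if (len w < len (permc s w))%N then rho (permc s w) v
       else rho (permc s w) v + (q - q^-1) *: rho w v).

Definition subspace {V : lmodType F} (U : V -> Prop) : Prop :=
  U 0 /\ (forall u v, U u -> U v -> U (u + v)) /\
  (forall (a : F) u, U u -> U (a *: u)).

Definition invariant {V : lmodType F} (rho : {perm T} -> V -> V)
  (U : V -> Prop) : Prop :=
  forall w u, w \in W -> U u -> U (rho w u).

Definition irreducible {V : lmodType F} (rho : {perm T} -> V -> V) : Prop :=
  (exists v : V, v != 0) /\
  forall U : V -> Prop, subspace U -> invariant rho U ->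
    (forall u, U u -> u = 0) \/ (forall u, U u).

Definition intertwiner {V1 V2 : lmodType F} (rho1 : {perm T} -> V1 -> V1)
  (rho2 : {perm T} -> V2 -> V2) (f : V1 -> V2) : Prop :=
  (forall (a : F) u v, f (a *: u + v) = a *: f u + f v) /\
  (forall w v, w \in W -> f (rho1 w v) = rho2 w (f v)).

Definition isoRep {V1 V2 : lmodType F} (rho1 : {perm T} -> V1 -> V1)
  (rho2 : {perm T} -> V2 -> V2) : Prop :=
  exists f : V1 -> V2, intertwiner rho1 rho2 f /\ bijective f.

Definition gelfandModel {V : lmodType F} (rho : {perm T} -> V -> V) : Prop :=
  exists (k : nat) (Vs : 'I_k -> lmodType F)
         (rhos : forall j, {perm T} -> Vs j -> Vs j)
         (iota : forall j, Vs j -> V),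
    (forall j, heckeRep (rhos j) /\ irreducible (rhos j)) /\
    (forall i j, i != j -> ~ isoRep (rhos i) (rhos j)) /\
    (forall (V' : lmodType F) (rho' : {perm T} -> V' -> V'),
        heckeRep rho' -> irreducible rho' -> exists j, isoRep rho' (rhos j)) /\
    (forall j, intertwiner (rhos j) rho (iota j)) /\
    (forall v : V, exists vs : forall j, Vs j,
        v = \sum_(j < k) iota j (vs j) /\
        forall vs' : forall j, Vs j, v = \sum_(j < k) iota j (vs' j) ->
          forall j, vs' j = vs j).
End Hecke.

Arguments heckeRep {F T} W S len q {V} rho.
Arguments subspace {F V} U.
Arguments invariant {F T} W {V} rho U.
Arguments irreducible {F T} W {V} rho.
Arguments intertwiner {F T} W {V1 V2} rho1 rho2 f.
Arguments isoRep {F T} W {V1 V2} rho1 rho2.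
Arguments gelfandModel {F T} W S len q {V} rho.


(* Q(x) (x) M = K^G (functions G -> K, basis M_z = indicator of z); the  *)
(* free Z[x,x^-1]-module M is the lattice of vectors with Laurent        *)
(* coordinates.  A Z[x,x^-1]-linear H-action on M is the same as a       *)
(* K-linear H_Q-action on K^G preserving this lattice.                   *)

Definition Gt (t : CoxType) (n : nat) := {z : P n | z \in Gset t n}.
Definition Vmod (t : CoxType) (n : nat) : lmodType K := {ffun Gt t n -> K^o}.
Definition bM (t : CoxType) (n : nat) (z : P n) : Vmod t n :=
  [ffun y => ((val y == z)%:R : K)].

Definition laurentVec (t : CoxType) (n : nat) (v : Vmod t n) : Prop :=
  forall y, isLaurent (v y).

Definition preservesLattice (t : CoxType) (n : nat)
  (rho : P n -> Vmod t n -> Vmod t n) : Prop :=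
  forall w v, w \in WW t n -> laurentVec t n v -> laurentVec t n (rho w v).

Definition rulesM (t : CoxType) (n : nat) (rho : P n -> Vmod t n -> Vmod t n) : Prop :=
  forall s z, s \in Sgen t n -> z \in Gset t n ->
    (AscLt t n s z -> rho s (bM t n z) = bM t n (permc s (permc z s))) /\
    (DesLt t n s z -> rho s (bM t n z) =
                      bM t n (permc s (permc z s)) + (xK - xK^-1) *: bM t n z) /\
    (AscEq n s z -> rho s (bM t n z) = (- xK^-1) *: bM t n z) /\
    (DesEq n s z -> rho s (bM t n z) = xK *: bM t n z).

Definition rulesN (t : CoxType) (n : nat) (rho : P n -> Vmod t n -> Vmod t n) : Prop :=
  forall s z, s \in Sgen t n -> z \in Gset t n ->
    (AscLt t n s z -> rho s (bM t n z) = bM t n (permc s (permc z s))) /\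
    (DesLt t n s z -> rho s (bM t n z) =
                      bM t n (permc s (permc z s)) + (xK - xK^-1) *: bM t n z) /\
    (AscEq n s z -> rho s (bM t n z) = xK *: bM t n z) /\
    (DesEq n s z -> rho s (bM t n z) = (- xK^-1) *: bM t n z).

Definition isHrep (t : CoxType) (n : nat) (rho : P n -> Vmod t n -> Vmod t n) : Prop :=
  heckeRep (WW t n) (Sgen t n) (lenW t n) xK rho /\ preservesLattice t n rho.

Definition modM (t : CoxType) (n : nat) (rho : P n -> Vmod t n -> Vmod t n) : Prop :=
  isHrep t n rho /\ rulesM t n rho.
Definition modN (t : CoxType) (n : nat) (rho : P n -> Vmod t n -> Vmod t n) : Prop :=
  isHrep t n rho /\ rulesN t n rho.

(* Main.v *)
Require Import Defs.
From mathcomp Require Import all_ssreflect all_algebra all_fingroup.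
From mathcomp Require Import boolp zify ring.

Set Implicit Arguments.
Unset Strict Implicit.
Unset Printing Implicit Defensive.

Import GRing.Theory Num.Theory Order.TTheory.
Local Open Scope ring_scope.

(** Each generator acts through a signed transposition [sw p q], so the quadratic and braid
relations for the operators of the statement are checked pointwise on the values [z p, z q],
and Matsumoto's argument turns them into a module over the Hecke algebra.

For the Gelfand property, specialise at [x = 1], where the generators act by symmetric
matrices.  Faithfulness: a nonzero left ideal [I] killing the module contains, by an induction
that symmetrises over maximal blocks, an involution [zeta] and a vector on which the
centraliser of [zeta] acts by the sign of its action on the fixed points; this vector induces
an equivariant map from the module to [I], nonzero and killed by [I], against positivity of the
dot product.  Multiplicity freeness: the image [A] of the group algebra satisfies
[dim Sym A - dim Alt A = #involutions of W >= #G], and this forces the commutant of [A] to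
consist of symmetric matrices.  Both properties lift to [Q(x)] by clearing denominators, and
there a faithful self-adjoint module without antisymmetric intertwiners is a Gelfand model. *)

(** No characters and no splitting field are needed. If the generators are self-adjoint for an
    anisotropic form, two isomorphic irreducible summands would yield a nonzero skew-adjoint
    intertwiner, and a faithful module contains every irreducible; so it suffices to exclude the one
    and to prove the other. Both are statements about the vanishing of finite families in Q(x), and
    such a family can be rescaled so that it is defined, and not zero, at x = 1. There x - 1/x
    vanishes, lengths drop out of the rules, and the Hecke algebra becomes the group algebra of W
    over Q, where positivity is available.

    Only an inequality between the numbers of involutions and of index elements enters, so an
    injection is enough. The parity condition in type D serves twice. The change of all signs but
    one lies in W just when n is odd; these elements replace the single sign changes of type BC. And
    for odd n the map i -> |z i| cannot be a fixed-point-free involution of [n], so some place is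
    matched beyond n, and the sign there can be chosen to repair a parity. *)

(** * Permutations of the encoded points as functions on the integers *)

Section Points.
Variable N : nat.
Implicit Types (k : pt N) (a b w : {perm pt N}) (x y p q : int).

Lemma toZ_bound k : (absz (toZ k) <= N)%N.
Proof. have := ltn_ord k; rewrite /toZ; lia. Qed.

Lemma ofZK x : (absz x <= N)%N -> toZ (ofZ N x) = x.
Proof. by move=> h; rewrite /toZ /ofZ inordK; lia. Qed.

Lemma toZK k : ofZ N (toZ k) = k.
Proof.
apply: val_inj; rewrite /ofZ /= inordK /toZ; have := ltn_ord k; lia.
Qed.

Lemma apZ_toZ w k : apZ w (toZ k) = toZ (w k).
Proof. by rewrite /apZ toZ_bound toZK. Qed.

Lemma apZ_out w x : (N < absz x)%N -> apZ w x = x.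
Proof. by rewrite /apZ ltnNge => /negbTE->. Qed.

Lemma apZ_bound w x : (absz (apZ w x) <= N)%N = (absz x <= N)%N.
Proof.
rewrite /apZ; case: ifP => // h; exact: toZ_bound.
Qed.

Lemma apZM a b x : apZ (permc a b) x = apZ a (apZ b x).
Proof.
case: (leqP (absz x) N) => h; last by rewrite !apZ_out // apZ_out.
by rewrite -(ofZK h) !apZ_toZ /permc permM.
Qed.

Lemma apZ1 x : apZ (1 : {perm pt N})%g x = x.
Proof.
case: (leqP (absz x) N) => h; last by rewrite apZ_out.
by rewrite -(ofZK h) apZ_toZ perm1.
Qed.

Lemma apZVK w x : apZ w^-1%g (apZ w x) = x.
Proof. by rewrite -apZM /permc mulgV apZ1. Qed.

Lemma apZKV w x : apZ w (apZ w^-1%g x) = x.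
Proof. by rewrite -apZM /permc mulVg apZ1. Qed.

Lemma apZ_inj w : injective (apZ w).
Proof. exact: can_inj (apZVK w). Qed.

Lemma eq_apZ a b : apZ a =1 apZ b -> a = b.
Proof.
move=> h; apply/permP => k; apply: (can_inj toZK).
by rewrite -!apZ_toZ h.
Qed.

Lemma isBCP w : reflect (forall x, apZ w (- x) = - apZ w x) (isBC w).
Proof.
apply: (iffP forallP) => [h x|h k]; last by rewrite h.
case: (leqP (absz x) N) => hx; last by rewrite !apZ_out // abszN.
by rewrite -(ofZK hx); apply/eqP.
Qed.

(** One formula for all simple generators. Consecutive positive p, q give s_p; a negative first
    entry gives the special ones, [sw (-1) 1] being s_0 and [sw (-1) 2] being s_{-1}. *)
Definition sw p q x : int :=
  if x == p then q else if x == q then p else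
  if x == - p then - q else if x == - q then - p else x.

Lemma apZ_tperm p q x : (absz p <= N)%N -> (absz q <= N)%N ->
  apZ (tperm (ofZ N p) (ofZ N q)) x = if x == p then q else if x == q then p else x.
Proof.
move=> hp hq; case: (leqP (absz x) N) => hx; last first.
  by rewrite apZ_out //; case: eqP => [?|_]; [lia | case: eqP => //; lia].
rewrite -{1}(ofZK hx) apZ_toZ.
have E y : (absz y <= N)%N -> (ofZ N x == ofZ N y) = (x == y).
  by move=> hy; apply/eqP/eqP => [/(congr1 toZ)|->//]; rewrite !ofZK.
rewrite permE /= !E //; case: eqP => _; first by rewrite ofZK.
by case: eqP => _; rewrite ofZK.
Qed.

Lemma apZ_sgen i x : (0 < i < N)%N -> apZ (sgen N i) x = sw i%:Z (i%:Z + 1) x.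
Proof.
move=> h; rewrite /sgen -[(_ * _)%g]/(permc _ _) apZM !apZ_tperm; try lia.
rewrite /sw; repeat (case: (x =P _) => ?); repeat (case: eqP => ?); lia.
Qed.

Lemma apZ_s0 x : (0 < N)%N -> apZ (s0 N) x = sw (-1) 1 x.
Proof.
move=> h; rewrite /s0 apZ_tperm; try lia.
rewrite /sw; repeat (case: (x =P _) => ?); repeat (case: eqP => ?); lia.
Qed.

Lemma apZ_sm1 x : (1 < N)%N -> apZ (sm1 N) x = sw (-1) 2 x.
Proof.
move=> h; rewrite /sm1 -[(_ * _)%g]/(permc _ _) apZM !apZ_tperm; try lia.
rewrite /sw; repeat (case: (x =P _) => ?); repeat (case: eqP => ?); lia.
Qed.

(** The pair is oriented, p < q, and plays the role of a simple root: s is an ascent of w exactly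
    when the inverse of w keeps p below q. *)
Definition groot (t : CoxType) (r : nat) p q : bool :=
  [|| [&& 1 <= p, p < r%:Z & q == p + 1],
      [&& (if t is TBC then true else false), p == -1 & q == 1] |
      [&& (if t is TD then true else false), p == -1 & q == 2]].

Lemma gensP (t : CoxType) (r : nat) (s : {perm pt N}) : (2 <= r <= N)%N ->
  s \in gens t N r -> exists p q, groot t r p q /\ apZ s =1 sw p q.
Proof.
move=> hr.
have hA : s \in [seq sgen N i | i <- iota 1 r.-1] ->
    exists p q, groot t r p q /\ apZ s =1 sw p q.
  move=> /mapP[i]; rewrite mem_iota => hi ->.
  exists i%:Z, (i%:Z + 1); split; first by rewrite /groot; apply/orP; left; lia.
  by move=> x; rewrite apZ_sgen; lia.
case: t hA => //= hA; rewrite inE => /orP[/eqP->|//].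
- exists (-1), 1; split; first by rewrite /groot; lia.
  by move=> x; rewrite apZ_s0 //; lia.
- exists (-1), 2; split; first by rewrite /groot; lia.
  by move=> x; rewrite apZ_sm1 //; lia.
Qed.

Lemma groot_gens (t : CoxType) (r : nat) p q : (2 <= r <= N)%N ->
  groot t r p q -> exists2 s, s \in gens t N r & apZ s =1 sw p q.
Proof.
move=> hr /or3P[/and3P[h1 h2 /eqP->]|/and3P[ht /eqP-> /eqP->]|/and3P[ht /eqP-> /eqP->]].
- exists (sgen N (absz p)); last by move=> x; rewrite apZ_sgen; [congr sw; lia | lia].
  have : sgen N (absz p) \in [seq sgen N i | i <- iota 1 r.-1].
    by apply: map_f; rewrite mem_iota; lia.
  by case: t => //= h; rewrite inE h orbT.
- by case: t ht => // _; exists (s0 N); [rewrite inE eqxx | move=> x; rewrite apZ_s0 //; lia].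
- by case: t ht => // _; exists (sm1 N); [rewrite inE eqxx | move=> x; rewrite apZ_sm1 //; lia].
Qed.

End Points.

(** * Word length from an abstract exchange condition *)

Section Words.
Variables (gT : finGroupType) (S : seq gT).
Implicit Types (s a w : gT).


Lemma wordsS k w : w \in words S k.+1 ->
  exists g a, [/\ g \in S, a \in words S k & w = (g * a)%g].
Proof. by rewrite /words iterS => /imset2P[g a]; rewrite inE => gS aw ->; exists g, a. Qed.

Lemma wordsM k g a : g \in S -> a \in words S k -> (g * a)%g \in words S k.+1.
Proof. by move=> gS aw; rewrite /words iterS; apply: imset2_f; rewrite ?inE. Qed.

Lemma words0 w : (w \in words S 0) = (w == 1%g).
Proof. by rewrite /words /= inE. Qed.

Lemma words_Mr k w s : s \in S -> w \in words S k -> (w * s)%g \in words S k.+1.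
Proof.
move=> sS; elim: k w => [|k IH] w; last first.
  by move=> /wordsS[g [a [gS aw ->]]]; rewrite -mulgA; apply/wordsM/IH.
rewrite words0 => /eqP->; rewrite mul1g -[s]mulg1.
by apply: wordsM; rewrite ?words0.
Qed.

Lemma wordsSr k w : w \in words S k.+1 ->
  exists s a, [/\ s \in S, a \in words S k & w = (a * s)%g].
Proof.
elim: k w => [|k IH] w /wordsS[g [a [gS aw ->]]].
  move: aw; rewrite words0 => /eqP->; exists g, 1%g.
  by rewrite words0 mulg1 mul1g.
have [s [b [sS bw ->]]] := IH _ aw.
by exists s, (g * b)%g; split=> //; [exact: wordsM | rewrite mulgA].
Qed.

Lemma gen_words w : w \in <<[set:: S]>>%g <-> exists k, w \in words S k.
Proof.
split=> [/gen_prodgP[k [c cS ->{w}]]|[k]].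
  exists k; elim: k c cS => [|k IH] c cS; first by rewrite big_ord0 words0.
  rewrite big_ord_recl; apply: wordsM; last exact: IH.
  by have := cS ord0; rewrite inE.
elim: k w => [|k IH] w; first by rewrite words0 => /eqP->; exact: group1.
move=> /wordsS[g [a [gS aw ->]]]; apply: groupM; last exact: IH.
by apply: mem_gen; rewrite inE.
Qed.

Lemma gen_ind_r (Q : gT -> Prop) : Q 1%g ->
  (forall s a, s \in S -> a \in <<[set:: S]>>%g -> Q a -> Q (a * s)%g) ->
  forall w, w \in <<[set:: S]>>%g -> Q w.
Proof.
move=> Q1 QS w /gen_words[k]; elim: k w => [|k IH] w.
  by rewrite words0 => /eqP->.
move=> /wordsSr[s [a [sS aw ->]]]; apply: QS => //; last exact: IH.
by apply/gen_words; exists k.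
Qed.

(* The balls in the Cayley graph grow strictly until they fill the group. *)
Lemma words_short w : w \in <<[set:: S]>>%g ->
  exists2 k, (k <= #|gT|)%N & w \in words S k.
Proof.
pose A k : {set gT} := [set a | [exists i : 'I_k.+1, a \in words S i]].
have AP k a : reflect (exists2 i, (i <= k)%N & a \in words S i) (a \in A k).
  rewrite inE; apply: (iffP existsP) => [[i ai]|[i ik ai]].
    by exists i => //; rewrite -ltnS.
  by exists (Ordinal (ik : (i < k.+1)%N)).
have closed k : A k.+1 \subset A k -> <<[set:: S]>>%g \subset A k.
  move=> hk; apply/subsetP => a /gen_words[m]; elim: m a => [|m IH] a.
    by move=> am; apply/AP; exists 0%N.
  move=> /wordsS[g [b [gS bw ->]]].
  have /AP[i ik bi] := IH _ bw.
  by apply: (subsetP hk); apply/AP; exists i.+1; rewrite // wordsM.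
have grow k : <<[set:: S]>>%g \subset A k \/ (k < #|A k|)%N.
  elim: k => [|k [IH|IH]].
  - by right; apply/card_gt0P; exists 1%g; apply/AP; exists 0%N; rewrite ?words0.
  - left; apply: (subset_trans IH); apply/subsetP => a /AP[i ik ai].
    by apply/AP; exists i => //; exact: leqW.
  have sub : A k \subset A k.+1.
    by apply/subsetP => a /AP[i ik ai]; apply/AP; exists i => //; exact: leqW.
  case: (boolP (A k.+1 \subset A k)) => h.
    by left; apply: (subset_trans (closed _ h)).
  by right; apply: (leq_ltn_trans IH); apply: proper_card; rewrite properE sub.
case: (grow #|gT|) => [/subsetP h /h /AP[i ik wi]|]; first by exists i.
by rewrite ltnNge max_card.
Qed.

Lemma wordlen_words w : w \in <<[set:: S]>>%g -> w \in words S (wordlen S w).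
Proof.
move=> /words_short[k kle wk].
have hs : has (fun k => w \in words S k) (iota 0 #|gT|.+1).
  by apply/hasP; exists k; rewrite ?mem_iota.
have := nth_find 0%N hs; rewrite nth_iota ?add0n //.
by move: hs; rewrite has_find size_iota.
Qed.

Lemma wordlen_le w k : w \in words S k -> (wordlen S w <= k)%N.
Proof.
move=> wk; rewrite leqNgt; apply/negP => h.
have klt : (k < #|gT|.+1)%N.
  apply: (leq_trans h); rewrite /wordlen.
  by have := find_size (fun k => w \in words S k) (iota 0 #|gT|.+1); rewrite size_iota.
have := before_find 0%N h; rewrite nth_iota // add0n.
by rewrite wk.
Qed.

Lemma wordlen1 : wordlen S 1%g = 0%N.
Proof. by apply/eqP; rewrite -leqn0; apply: wordlen_le; rewrite words0. Qed.

(** [P s w] stands for s being an ascent of w, and [w * s] is the composite of s after w. [P_exch]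
    is the exchange condition in its smallest form: a factor t on the other side can destroy the
    ascent s only if it has the same effect as s. *)
Variable P : gT -> gT -> bool.
Hypothesis SS : forall s, s \in S -> (s * s)%g = 1%g.
Hypothesis P_1 : forall s, s \in S -> P s 1%g.
Hypothesis P_s : forall s w, s \in S -> w \in <<[set:: S]>>%g ->
  P s w -> ~~ P s (w * s)%g.
Hypothesis P_exch : forall s t w, s \in S -> t \in S -> w \in <<[set:: S]>>%g ->
  P s w -> ~~ P s (t * w)%g -> (w * s = t * w)%g.

(** The identity has ascent s and w has not, so along the word there is a letter at which s stops
    being an ascent. [P_exch] equates that letter with s applied on the other side, and the two
    cancel. *)
Lemma words_exch k s w : s \in S -> w \in words S k -> ~~ P s w ->
  (0 < k)%N /\ (w * s)%g \in words S k.-1.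
Proof.
move=> sS; elim: k w => [|k IH] w.
  by rewrite words0 => /eqP->; rewrite P_1.
move=> /wordsS[g [a [gS aw ->]]] nP; split=> //=.
have aG : a \in <<[set:: S]>>%g by apply/gen_words; exists k.
case: (boolP (P s a)) => Pa.
  by rewrite -(P_exch sS gS aG Pa nP) -mulgA SS // mulg1.
have [k0 h] := IH _ aw Pa.
by rewrite -mulgA -(prednK k0); exact: wordsM.
Qed.

Lemma wordlen_desc s w : s \in S -> w \in <<[set:: S]>>%g -> ~~ P s w ->
  wordlen S w = (wordlen S (w * s)%g).+1.
Proof.
move=> sS wG nP; have ww := wordlen_words wG.
have [k0 h] := words_exch sS ww nP.
apply/eqP; rewrite eqn_leq; apply/andP; split; last first.
  by rewrite -(prednK k0) ltnS; exact: wordlen_le.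
have wsG : (w * s)%g \in <<[set:: S]>>%g by apply: groupM => //; apply: mem_gen; rewrite inE.
have wE : w = (w * s * s)%g by rewrite -mulgA SS // mulg1.
by rewrite {1}wE; apply: wordlen_le; apply: words_Mr => //; apply: wordlen_words.
Qed.

Lemma wordlen_asc s w : s \in S -> w \in <<[set:: S]>>%g -> P s w ->
  wordlen S (w * s)%g = (wordlen S w).+1.
Proof.
move=> sS wG Pw.
have wsG : (w * s)%g \in <<[set:: S]>>%g by apply: groupM => //; apply: mem_gen; rewrite inE.
by rewrite (wordlen_desc sS wsG (P_s sS wG Pw)) -mulgA SS // mulg1.
Qed.

Lemma wordlen_lt s w : s \in S -> w \in <<[set:: S]>>%g ->
  (wordlen S w < wordlen S (w * s)%g)%N = P s w.
Proof.
move=> sS wG; case: (boolP (P s w)) => h; first by rewrite (wordlen_asc sS wG h) ltnSn.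
by rewrite (wordlen_desc sS wG h) ltnNge leqnSn.
Qed.

Lemma wordlen_gt s w : s \in S -> w \in <<[set:: S]>>%g ->
  (wordlen S (w * s)%g < wordlen S w)%N = ~~ P s w.
Proof.
move=> sS wG; case: (boolP (P s w)) => h; first by rewrite (wordlen_asc sS wG h) ltnNge leqnSn.
by rewrite (wordlen_desc sS wG h) ltnSn.
Qed.

Lemma has_descent w : w \in <<[set:: S]>>%g -> w != 1%g ->
  exists2 s, s \in S & ~~ P s w.
Proof.
move=> wG wn1; have ww := wordlen_words wG.
case E : (wordlen S w) ww => [|k]; first by rewrite words0 (negbTE wn1).
move=> /wordsSr[s [a [sS aw wE]]]; exists s => //.
rewrite -(wordlen_gt sS wG) E wE -mulgA SS // mulg1 ltnS.
exact: wordlen_le.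
Qed.
End Words.

Lemma odd_count_addb (T : Type) (a b : pred T) (s : seq T) :
  odd (count (fun x => a x (+) b x) s) = odd (count a s) (+) odd (count b s).
Proof.
elim: s => //= x s IH; rewrite !oddD IH; case: (a x); case: (b x) => /=;
by case: (odd _); case: (odd _).
Qed.

Lemma ltr_sum_two (r : nat) (f g : nat -> int) (a b : nat) :
  (a < r)%N -> (b < r)%N -> a != b ->
  (forall i, (i < r)%N -> i != a -> i != b -> f i = g i) ->
  f a + f b < g a + g b -> \sum_(i < r) f i < \sum_(i < r) g i.
Proof.
move=> ar br ab fg lt.
rewrite (bigD1 (Ordinal ar)) //= (bigD1 (Ordinal br)) /=; last by rewrite eq_sym; apply: contraNneq ab => -[->].
rewrite [ltRHS](bigD1 (Ordinal ar)) //= [X in _ < _ + X](bigD1 (Ordinal br)) /=; last first.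
  by rewrite eq_sym; apply: contraNneq ab => -[->].
rewrite !addrA (eq_bigr (fun i : 'I_r => g i)) ?ltrD2r // => i /andP[ia ib].
by apply: fg.
Qed.

(** * Order properties of signed transpositions *)

Section Roots.
Variables (t : CoxType) (r : nat).
Implicit Types (p q x : int).

Lemma grootP p q : groot t r p q ->
  [/\ 1 <= p, p < r%:Z & q = p + 1] \/
  ([/\ t = TBC, p = -1 & q = 1] \/ [/\ t = TD, p = -1 & q = 2]).
Proof.
rewrite /groot => /or3P[/and3P[? ? /eqP?]|/and3P[h /eqP? /eqP?]|/and3P[h /eqP? /eqP?]].
- by left.
- by right; left; case: t h.
- by right; right; case: t h.
Qed.

Lemma groot_neq0 p q : groot t r p q -> p != 0 /\ q != 0.
Proof. by rewrite /groot; case: t => /=; lia. Qed.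

Lemma swK p q : p != 0 /\ q != 0 -> involutive (sw p q).
Proof. move=> [p0 q0] x; rewrite /sw; repeat (case: (x =P _) => ?); repeat (case: eqP => ?); lia. Qed.

Lemma swN p q x : p != 0 /\ q != 0 -> sw p q (- x) = - sw p q x.
Proof. move=> [p0 q0]; rewrite /sw; repeat (case: eqP => ?); lia. Qed.

Lemma sw_l p q : sw p q p = q.
Proof. by rewrite /sw eqxx. Qed.

Lemma sw_r p q : sw p q q = p.
Proof. by rewrite /sw eqxx; case: eqP => // ->. Qed.

Lemma swNN p q x : p != 0 /\ q != 0 -> sw (- q) (- p) x = sw p q x.
Proof. by move=> [p0 q0]; rewrite /sw !opprK; repeat (case: eqP => ?); lia. Qed.

Lemma groot_inj p q p' q' : groot t r p q -> groot t r p' q' ->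
  sw p q =1 sw p' q' -> p = p' /\ q = q'.
Proof.
move=> /grootP h /grootP h' E; have := E p; rewrite sw_l /sw.
case: h => [[? ? ?]|[[? ? ?]|[? ? ?]]]; case: h' => [[? ? ?]|[[? ? ?]|[? ? ?]]];
  repeat (case: eqP => ?); lia.
Qed.

Lemma groot_lt p q : groot t r p q -> p < q.
Proof. by rewrite /groot; case: t => /=; lia. Qed.

(** The counterpart of the fact that a simple reflection makes only its own root negative: it
    exchanges neighbours, so no other pair changes its order. Opposite pairs are set apart for
    [sw_opp]. *)
Lemma sw_swap p q x y : groot t r p q -> x != 0 -> y != 0 ->
  x < y -> x != - y -> sw p q y <= sw p q x ->
  (x = p /\ y = q) \/ (x = - q /\ y = - p).
Proof.
move=> /grootP h; rewrite /sw.
case: h => [[? ? ->]|[[_ -> ->]|[_ -> ->]]]; repeat (case: eqP => ?); lia.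
Qed.

(** The extra alternative cannot be avoided: [sw (-1) 2] reverses both -1, 1 and -2, 2, although an
    opposite pair is not a root in type D. *)
Lemma sw_opp p q x y : groot t r p q -> x < y -> x = - y -> sw p q y <= sw p q x ->
  (x = p /\ y = q) \/ (p = -1 /\ q = 2).
Proof.
move=> /grootP h; rewrite /sw.
case: h => [[? ? ->]|[[_ -> ->]|[_ -> ->]]]; repeat (case: eqP => ?); lia.
Qed.

Lemma sw_conj (u : int -> int) p q p' q' : injective u -> (forall x, u (- x) = - u x) ->
  p' != 0 /\ q' != 0 -> (u p = p' /\ u q = q') \/ (u p = - q' /\ u q = - p') ->
  forall x, u (sw p q x) = sw p' q' (u x).
Proof.
move=> ui uN nz; case=> -[E1 E2] x.
  rewrite -E1 -E2 /sw -!uN !(inj_eq ui); repeat (case: eqP => _) => //.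
rewrite -(swNN _ nz) -E1 -E2 /sw -!uN !(inj_eq ui); repeat (case: eqP => _) => //.
Qed.

End Roots.

(** * Ascents and length in the generated group *)

Section Group.
Variables (N : nat) (t : CoxType) (r : nat).
Hypothesis hr : (2 <= r <= N)%N.
Implicit Types (s w : {perm pt N}) (p q x : int).

Notation S := (gens t N r).
Notation GG := (<<[set:: S]>>%g).

Lemma gens_invol s : s \in S -> (s * s)%g = 1%g.
Proof.
move=> /(gensP hr)[p [q [/groot_neq0 h sE]]]; apply: eq_apZ => x.
by rewrite -[(s * s)%g]/(permc s s) apZM !sE (swK h) apZ1.
Qed.

Lemma gensV s : s \in S -> (s^-1)%g = s.
Proof. by move=> /gens_invol h; apply: (mulgI s); rewrite mulgV h. Qed.

Lemma gens_isBC s : s \in S -> isBC s.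
Proof. by move=> /(gensP hr)[p [q [/groot_neq0 h sE]]]; apply/isBCP => x; rewrite !sE (swN _ h). Qed.

Lemma isBC1 : isBC (1%g : {perm pt N}).
Proof. by apply/isBCP => x; rewrite !apZ1. Qed.

Lemma isBCM (a b : {perm pt N}) : isBC a -> isBC b -> isBC (a * b)%g.
Proof.
move=> /isBCP ha /isBCP hb; apply/isBCP => x.
by rewrite -[(a * b)%g]/(permc b a) !apZM ha hb.
Qed.

Lemma isBCV w : isBC w -> isBC w^-1%g.
Proof.
move=> /isBCP h; apply/isBCP => x; apply: (@apZ_inj _ w).
by rewrite h !apZKV.
Qed.

Lemma gen_isBC w : w \in GG -> isBC w.
Proof.
move: w; apply: gen_ind_r => [|s a sS _ ha]; first exact: isBC1.
by apply: isBCM => //; exact: gens_isBC.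
Qed.

(** The geometric criterion for the length of s w to exceed that of w. The root is quantified
    because s is a bare permutation; [groot_inj] makes the choice irrelevant. *)
Definition asc s w : bool :=
  `[< exists p q, [/\ groot t r p q, apZ s =1 sw p q & apZ w^-1%g p < apZ w^-1%g q] >].

Lemma ascE s w p q : groot t r p q -> apZ s =1 sw p q ->
  asc s w = (apZ w^-1%g p < apZ w^-1%g q).
Proof.
move=> h sE; apply/asboolP/idP => [[p' [q' [h' sE' lt]]]|lt]; last by exists p, q.
have E : sw p q =1 sw p' q' by move=> x; rewrite -sE -sE'.
by have [-> ->] := groot_inj h h' E.
Qed.

Lemma asc_1 s : s \in S -> asc s 1%g.
Proof.
move=> /(gensP hr)[p [q [h sE]]]; rewrite (ascE _ h sE) invg1 !apZ1.
exact: groot_lt h.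
Qed.

Lemma apZVM w s p q x : s \in S -> apZ s =1 sw p q ->
  apZ (w * s)^-1%g x = apZ w^-1%g (sw p q x).
Proof.
by move=> sS sE; rewrite invMg (gensV sS) -[(s * _)%g]/(permc w^-1%g s) apZM sE.
Qed.

Lemma asc_s s w : s \in S -> w \in GG -> asc s w -> ~~ asc s (w * s)%g.
Proof.
move=> sS wG; have [p [q [h sE]]] := gensP hr sS.
rewrite !(ascE _ h sE) !(apZVM _ _ sS sE) sw_l sw_r => lt.
by rewrite -leNgt ltW.
Qed.

(** If t' reverses the pair formed by the images of p and q under the inverse of w, then by
    [sw_swap] this pair is, up to sign, the root of t'. Hence the inverse of w conjugates s into t',
    which is the claimed equality. *)
Lemma asc_exch s t' w : s \in S -> t' \in S -> w \in GG ->
  asc s w -> ~~ asc s (t' * w)%g -> (w * s = t' * w)%g.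
Proof.
move=> sS tS wG; have [p [q [h sE]]] := gensP hr sS.
have [p' [q' [h' tE]]] := gensP hr tS.
rewrite !(ascE _ h sE) invMg (gensV tS) -[(_ * t')%g]/(permc t' _) !apZM !tE -leNgt.
have wB := isBCV (gen_isBC wG); have /isBCP uN := wB; have ui := @apZ_inj _ w^-1%g.
have u0 : apZ w^-1%g 0 = 0 by have := uN 0; rewrite oppr0; move: (apZ _ _) => a; lia.
have nz x : x != 0 -> apZ w^-1%g x != 0 by apply: contraNneq => e; apply/eqP/ui; rewrite e u0.
have [p0 q0] := groot_neq0 h.
move=> lt le.
suff E : (apZ w^-1%g p = p' /\ apZ w^-1%g q = q') \/
         (apZ w^-1%g p = - q' /\ apZ w^-1%g q = - p').
  have := sw_conj ui uN (groot_neq0 h') E => C.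
  have : (permc w^-1 s = permc t' w^-1)%g.
    by apply: eq_apZ => x; rewrite !apZM sE tE C.
  rewrite /permc => /(congr1 (@invg _)); rewrite !invMg invgK (gensV sS) (gensV tS).
  by [].
(* Opposite images force p = -q, so s is the sign change of type BC, and the exceptional alternative
   of [sw_opp], which belongs to type D, cannot occur. *)
case: (eqVneq (apZ w^-1%g p) (- apZ w^-1%g q)) => eN; last exact: sw_swap h' (nz _ p0) (nz _ q0) lt eN le.
have pq : p = - q by apply: ui; rewrite eN uN.
case: (sw_opp h' lt eN le) => [|[? ?]]; first by left.
case: (grootP h) => [[]|[[e1 ? ?]|[e1 ? ?]]]; case: (grootP h') => [[]|[[e2 ? ?]|[e2 ? ?]]]; try lia.
by rewrite e1 in e2.
Qed.

Lemma lenS_lt s w : s \in S -> w \in GG ->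
  (wordlen S w < wordlen S (permc s w))%N = asc s w.
Proof. exact: (wordlen_lt gens_invol asc_1 asc_s asc_exch). Qed.

Lemma lenS_gt s w : s \in S -> w \in GG ->
  (wordlen S (permc s w) < wordlen S w)%N = ~~ asc s w.
Proof. exact: (wordlen_gt gens_invol asc_1 asc_s asc_exch). Qed.

Lemma lenS_desc s w : s \in S -> w \in GG -> ~~ asc s w ->
  wordlen S w = (wordlen S (permc s w)).+1.
Proof. exact: (wordlen_desc gens_invol asc_1 asc_exch). Qed.

Lemma ex_descent w : w \in GG -> w != 1%g -> exists2 s, s \in S & ~~ asc s w.
Proof. exact: (has_descent gens_invol asc_1 asc_s asc_exch). Qed.

End Group.

(** * The explicit groups are generated by their simple reflections *)

Section Generation.
Variables (N : nat) (t : CoxType) (r : nat).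
Hypothesis hr : (2 <= r <= N)%N.
Implicit Types (s w : {perm pt N}) (p q x : int).

Notation S := (gens t N r).
Notation GG := (<<[set:: S]>>%g).

Lemma fixBeyondP w : reflect (forall x, r%:Z < `|x| -> apZ w x = x) (fixBeyond r w).
Proof.
apply: (iffP forallP) => [h x hx|h k]; last by apply/implyP => /h ->.
case: (leqP (absz x) N) => xN; last by rewrite apZ_out.
have := h (ofZ N x); rewrite ofZK // hx /= => /eqP; exact.
Qed.

Lemma fixBeyond_bound w x : fixBeyond r w -> (absz x <= r)%N -> (absz (apZ w x) <= r)%N.
Proof.
move=> /fixBeyondP h hx; rewrite leqNgt; apply/negP => lt.
have /(@apZ_inj N w) E : apZ w (apZ w x) = apZ w x by apply: h; lia.
by rewrite E in lt; lia.
Qed.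

Lemma groot_fix p q x : groot t r p q -> r%:Z < `|x| -> sw p q x = x.
Proof.
move=> /grootP h hx; rewrite /sw.
case: h => [[? ? ->]|[[_ -> ->]|[_ -> ->]]]; repeat (case: eqP => ?); lia.
Qed.

Lemma fixBeyond_M w s : fixBeyond r w -> s \in S -> fixBeyond r (w * s)%g.
Proof.
move=> /fixBeyondP hw /(gensP hr)[p [q [h sE]]]; apply/fixBeyondP => x hx.
by rewrite -[(w * s)%g]/(permc s w) apZM hw // sE (groot_fix h hx).
Qed.

Lemma absz_apZ_inj w : isBC w -> {in [pred i : nat | (0 < i)%N] &,
  injective (fun i : nat => absz (apZ w i%:Z))}.
Proof.
move=> /isBCP wN i j; rewrite !inE => hi hj E.
have [/(@apZ_inj N w)|] : apZ w i = apZ w j \/ apZ w i = - apZ w j by lia.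
  by lia.
by rewrite -wN => /(@apZ_inj N w); lia.
Qed.

Lemma absz_apZ_perm w : isBC w -> fixBeyond r w ->
  perm_eq [seq absz (apZ w i%:Z) | i : nat <- iota 1 r] (iota 1 r).
Proof.
move=> wB wF; have /isBCP wN := wB.
have w0 : apZ w 0 = 0 by have := wN 0; rewrite oppr0; move: (apZ _ _) => a; lia.
have uq : uniq [seq absz (apZ w i%:Z) | i : nat <- iota 1 r].
  rewrite map_inj_in_uniq ?iota_uniq // => i j; rewrite !mem_iota => hi hj.
  by apply: (absz_apZ_inj wB); rewrite inE; lia.
apply: uniq_perm => //; first exact: iota_uniq.
have nz i : (0 < i)%N -> apZ w i%:Z != 0.
  by move=> hi; apply: contraTneq isT => e; have /(@apZ_inj N w) : apZ w i = apZ w 0; rewrite ?w0 //; lia.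
have sub : {subset [seq absz (apZ w i%:Z) | i : nat <- iota 1 r] <= iota 1 r}.
  move=> k /mapP[i]; rewrite !mem_iota => hi ->.
  have := @fixBeyond_bound w i%:Z wF; have := nz i; move: (apZ w i) => v; lia.
by have [|_ //] := uniq_min_size uq sub; rewrite size_map.
Qed.

(** Since |w| permutes [r], passing from w to s after w changes the parity by the number of j in [r]
    that s makes negative. For generators of type D this number is 0 or 2. *)
Lemma evenNeg_M w s : t = TD -> isBC w -> fixBeyond r w -> s \in S ->
  evenNeg r (w * s)%g = evenNeg r w.
Proof.
move=> tD wB wF /(gensP hr)[p [q [h sE]]]; rewrite /evenNeg; congr (~~ _).
have /isBCP wN := wB.
have w0 : apZ w 0 = 0 by have := wN 0; rewrite oppr0; move: (apZ _ _) => a; lia.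
pose e (j : nat) := sw p q j < 0.
rewrite (@eq_in_count _ _ (fun i : nat => (apZ w i < 0) (+) e (absz (apZ w i)))); last first.
  move=> i; rewrite mem_iota => hi; rewrite -[(w * s)%g]/(permc s w) apZM sE /e.
  have : apZ w i != 0.
    by apply: contraTneq isT => E; have /(@apZ_inj N w) : apZ w i = apZ w 0; rewrite ?w0 //; lia.
  move: (apZ w i) => v v0; case: (ltrP v 0) => hv /=.
    have -> : v = - (absz v)%:Z by lia.
    rewrite abszN absz_nat (swN _ (groot_neq0 h)) oppr_lt0 -leNgt le_eqVlt.
    case: eqP => // E; suff : (absz v)%:Z = 0 by lia.
    apply: (can_inj (swK (groot_neq0 h))); rewrite -E.
    by case: (groot_neq0 h) => p0 q0; rewrite /sw; repeat (case: eqP => ?); lia.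
  by have {1}-> : v = (absz v)%:Z by lia.
rewrite odd_count_addb -[X in _ (+) X]/(odd (count (preim (fun i : nat => absz (apZ w i)) e) _)).
rewrite -count_map (seq.permP (absz_apZ_perm wB wF)).
suff -> : odd (count e (iota 1 r)) = false by rewrite addbF.
case: (grootP h) => [[? ? qE]|[[tE]|[_ pE qE]]]; first 2 last.
- case: r hr => [|[|r']] // _; rewrite /= /e pE qE.
  suff -> : count (fun j : nat => sw (-1) 2 j < 0) (iota 3 r') = 0%N by [].
  apply/eqP; rewrite -leqn0 leqNgt -has_count; apply/hasPn => j; rewrite mem_iota => hj.
  by rewrite /sw; repeat (case: eqP => ?); lia.
- suff -> : count e (iota 1 r) = 0%N by [].
  apply/eqP; rewrite -leqn0 leqNgt -has_count; apply/hasPn => j; rewrite mem_iota => hj.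
  by rewrite /e qE /sw; repeat (case: eqP => ?); lia.
by rewrite tD in tE.
Qed.

(** In type A the group is given by generation; the explicit description as signed permutations
    positive on [r] lets one argument serve all types. *)
Definition Wset : {set {perm pt N}} :=
  match t with
  | TA => [set w | [&& isBC w, fixBeyond r w & all (fun i : nat => 0 < apZ w i%:Z) (iota 1 r)]]
  | _ => Wgrp t N r
  end.

Lemma Wset_BC w : w \in Wset -> isBC w /\ fixBeyond r w.
Proof.
by rewrite /Wset; case: t => /=; rewrite !inE; [move=> /and3P[-> -> _] | move=> /andP[-> ->] | move=> /and3P[-> -> _]].
Qed.

Lemma Wset_M w s : w \in Wset -> s \in S -> (w * s)%g \in Wset.
Proof.
move=> wW sS; have sB := gens_isBC hr sS; have [p [q [h sE]]] := gensP hr sS.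
move: wW; rewrite /Wset; case tE : t => /=; rewrite !inE.
- move=> /and3P[wB wF wp]; rewrite isBCM //= fixBeyond_M //=.
  apply/allP => i hi; have := allP wp _ hi; rewrite -[(w * s)%g]/(permc s w) apZM sE.
  move: (apZ w i) => v hv; rewrite /sw.
  case: (grootP h) => [[? ? ->]|[[e _ _]|[e _ _]]]; last 2 first.
  + by rewrite e in tE.
  + by rewrite e in tE.
  by repeat (case: eqP => ?); lia.
- by move=> /andP[wB wF]; rewrite isBCM //= fixBeyond_M.
- by move=> /and3P[wB wF wE]; rewrite isBCM //= fixBeyond_M //= evenNeg_M.
Qed.

Lemma fixBeyondV w : fixBeyond r w -> fixBeyond r w^-1%g.
Proof.
move=> /fixBeyondP h; apply/fixBeyondP => x hx.
by apply: (@apZ_inj _ w); rewrite apZKV h.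
Qed.

(** Write u for the inverse of w. In every type the absence of descents makes u increasing on [r]
    with |u 1| < u 2. Counting up from 2 and down from r squeezes u i to i for i >= 2, so u 1 is 1
    or -1; its sign is settled by positivity in type A, by the root (-1, 1) in type BC, and by the
    parity of signs in type D. *)
Lemma Wset_no_descent w : w \in Wset -> (forall s, s \in S -> asc t r s w) -> w = 1%g.
Proof.
move=> wW wasc; have [wB wF] := Wset_BC wW.
have root p q : groot t r p q -> apZ w^-1%g p < apZ w^-1%g q.
  by move=> h; have [s sS sE] := groot_gens hr h; rewrite -(ascE w h sE) wasc.
have /isBCP uN := isBCV wB; have uF := fixBeyondV wF.
have upos1 : t = TA -> 0 < apZ w^-1%g 1.
  move=> tE; move: wW; rewrite /Wset tE inE => /and3P[_ _ /allP wp].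
  rewrite ltNge; apply/negP => le; have /isBCP wN := wB.
  have b1 : (absz (apZ w^-1%g 1) <= r)%N by apply: fixBeyond_bound uF _; lia.
  have := wp (absz (apZ w^-1%g 1)); rewrite mem_iota.
  have -> : (absz (apZ w^-1%g 1))%:Z = - apZ w^-1%g 1 by lia.
  rewrite wN apZKV => H; suff : (0 : int) < -1 by [].
  apply: H; have : apZ w^-1%g 1 != 0.
    apply/eqP => e; have := apZKV w 1; rewrite e; have := wN 0; rewrite oppr0.
    by move: (apZ _ _) => a; lia.
  by move: b1; move: (apZ _ _) => a; lia.
set u := apZ w^-1%g in root uN.
have ub i : (i <= r)%N -> (absz (u i%:Z) <= r)%N.
  by move=> hi; apply: fixBeyond_bound uF _; lia.
have u0 : u 0 = 0 by have := uN 0; rewrite oppr0; move: (u _) => a; lia.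
have unz x : x != 0 -> u x != 0.
  by apply: contraNneq => e; apply/eqP/(@apZ_inj N w^-1%g); rewrite -!/u e u0.
have mono i : (0 < i < r)%N -> u i%:Z < u i.+1%:Z.
  by move=> hi; have := @root i%:Z (i%:Z + 1); rewrite -addn1 PoszD; apply; rewrite /groot; lia.
have u2 : `|u 1| < u 2.
  have m1 : u 1 < u 2 by apply: (mono 1%N); lia.
  case tE : t.
  - by have := upos1 tE; rewrite -/u; move: m1; move: (u 1) (u 2) => a b; lia.
  - have := @root (-1) 1; rewrite /groot tE uN => /(_ isT).
    by move: m1; move: (u 1) (u 2) => a b; lia.
  have := @root (-1) 2; rewrite /groot tE uN => /(_ isT).
  by move: m1; move: (u 1) (u 2) => a b; lia.
have up k : (k.+2 <= r)%N -> k.+2%:Z <= u k.+2%:Z.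
  elim: k => [|k IH] hk.
    by have := unz 1 isT; move: u2; move: (u 1) (u 2) => a b; lia.
  have := IH (ltnW hk); have := mono k.+2; rewrite hk => /(_ isT).
  by move: (u _) (u _) => a b; lia.
have dn k : (k < r)%N -> u (r - k)%N%:Z <= (r - k)%N%:Z.
  elim: k => [|k IH] hk.
    by have := @ub (r - 0)%N; move: (u _) => a; lia.
  have := IH (ltnW hk); have := mono (r - k.+1)%N.
  have -> : (r - k.+1).+1 = (r - k)%N by lia.
  by move: (u _) (u _) => a b; lia.
have ui i : (2 <= i <= r)%N -> u i%:Z = i%:Z.
  move=> hi; have := @up (i - 2)%N; have := @dn (r - i)%N.
  have -> : (i - 2).+2 = i by lia.
  have -> : (r - (r - i))%N = i by lia.
  by move: (u _) => a; lia.
have u1 : u 1 = 1.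
  have u1' : u 1 = 1 \/ u 1 = -1.
    have := unz 1 isT; have := ui 2%N; move: u2; move: (u 1) (u 2) => a b; lia.
  case: u1' => // e; case tE : t.
  - by have := upos1 tE; rewrite -/u; move: e; move: (u 1) => a; lia.
  - have := @root (-1) 1; rewrite /groot tE uN => /(_ isT).
    by move: e; move: (u 1) => a; lia.
  have wu x : apZ w (u x) = x by rewrite apZKV.
  move: wW; rewrite /Wset tE /= inE => /and3P[_ _]; rewrite /evenNeg.
  have w1 : apZ w 1 = -1 by rewrite -[1 in LHS]opprK -[- 1]e -uN wu.
  rewrite (_ : iota 1 r = [:: 1%N] ++ iota 2 r.-1); last by case: r hr.
  rewrite count_cat [count _ [:: _]]/= w1.
  suff -> : count (fun i : nat => apZ w i < 0) (iota 2 r.-1) = 0%N by [].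
  apply/eqP; rewrite -leqn0 leqNgt -has_count; apply/hasPn => j; rewrite mem_iota => hj.
  by rewrite -(ui j) ?wu; lia.
apply: (can_inj (@invgK _)); apply: eq_apZ => x; rewrite invg1 apZ1 -/u.
have upos (i : nat) : u i = i.
  case: i => [|[|i]] //; case: (leqP i.+2 r) => hi; first by apply: ui; lia.
  by have /fixBeyondP := uF; apply; lia.
by case: (intP x) => // i; rewrite ?uN upos.
Qed.

(** Sorting with a potential. Multiplying by a descent strictly increases the sum [E w] of i times
    the image of i under the inverse of w; this sum never exceeds r^3, so the process ends, and it
    can end only at 1. *)
Lemma Wset_sub_gen w : w \in Wset -> w \in GG.
Proof.
pose E w := \sum_(i < r) (i.+1%:Z * apZ w^-1%g i.+1%:Z).
have bd v : v \in Wset -> E v <= (r * (r * r))%N%:Z.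
  move=> vW; have [_ vF] := Wset_BC vW.
  have -> : (r * (r * r))%N%:Z = \sum_(i < r) (r * r)%N%:Z.
    by rewrite sumr_const card_ord -mulr_natl PoszM; lia.
  apply: ler_sum => i _; have := fixBeyond_bound (x := i.+1%:Z) (fixBeyondV vF).
  by have := ltn_ord i; move: (apZ _ _) => a; nia.
have [m] := ubnP (absz ((r * (r * r))%N%:Z - E w)); elim: m w => // m IH w hm wW.
case: (pselect (forall s, s \in S -> asc t r s w)) => [h|].
  by rewrite (Wset_no_descent wW h) group1.
move=> /existsNP[s /not_implyP[sS /negP ns]].
have wsW := Wset_M wW sS.
suff lt : E w < E (w * s)%g.
  have wsG : (w * s)%g \in GG.
    by apply: IH => //; have := bd _ wsW; have := bd _ wW; lia.
  by rewrite -(mulgK s w) groupM // groupV mem_gen // inE.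
have [p [q [h sE]]] := gensP hr sS; have [wB _] := Wset_BC wW.
have /isBCP uN := isBCV wB.
move: ns; rewrite (ascE w h sE) -leNgt le_eqVlt => /orP[/eqP/(@apZ_inj N w^-1%g) e|lt].
  by have := groot_lt h; lia.
pose g (i : nat) : int := i.+1%:Z * apZ w^-1%g (sw p q i.+1%:Z).
have -> : E (w * s)%g = \sum_(i < r) g i.
  by apply: eq_bigr => i _; rewrite (apZVM hr _ _ sS sE).
case: (grootP h) => [[p1 pr qE]|[[tE pE qE]|[tE pE qE]]].
- apply: (@ltr_sum_two r (fun i => i.+1%:Z * apZ w^-1%g i.+1%:Z) g (absz (p - 1)) (absz p)); try lia.
    move=> i ir ia ib; rewrite /g; congr (_ * apZ _ _).
    by rewrite qE /sw; repeat (case: eqP => ?); lia.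
  rewrite /g; have -> : (absz (p - 1)).+1%:Z = p by lia.
  have -> : (absz p).+1%:Z = q by lia.
  rewrite sw_l sw_r; move: lt; move: (apZ _ p) (apZ _ q) => a b; nia.
(* The sign change alters only the summand of the point 1; that of 2 is carried along unchanged to
   fit the two-place comparison. *)
- apply: (@ltr_sum_two r (fun i => i.+1%:Z * apZ w^-1%g i.+1%:Z) g 0 1); try lia.
    move=> i ir ia ib; rewrite /g; congr (_ * apZ _ _).
    by rewrite pE qE /sw; repeat (case: eqP => ?); lia.
  rewrite /g pE qE /sw /=; move: lt; rewrite pE qE uN; move: (apZ _ 1) (apZ _ 2) => a b; nia.
- apply: (@ltr_sum_two r (fun i => i.+1%:Z * apZ w^-1%g i.+1%:Z) g 0 1); try lia.
    move=> i ir ia ib; rewrite /g; congr (_ * apZ _ _).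
    by rewrite pE qE /sw; repeat (case: eqP => ?); lia.
  rewrite /g pE qE /sw /= -[- 2]/(- (2 : int)) !uN.
  by move: lt; rewrite pE qE uN; move: (apZ _ 1) (apZ _ 2) => a b; nia.
Qed.

Lemma Wset_gen : Wset = GG.
Proof.
apply/setP => w; apply/idP/idP; first exact: Wset_sub_gen.
move: w; apply: gen_ind_r => [|s a sS _ aW]; last exact: Wset_M.
have F1 : fixBeyond r (1%g : {perm pt N}) by apply/fixBeyondP => x _; rewrite apZ1.
rewrite /Wset; case: t => /=; rewrite inE isBC1 F1 //=.
  by apply/allP => i; rewrite mem_iota apZ1; lia.
rewrite /evenNeg.
suff -> : count (fun i : nat => apZ (1%g : {perm pt N}) i < 0) (iota 1 r) = 0%N by [].
apply/eqP; rewrite -leqn0 leqNgt -has_count; apply/hasPn => j; rewrite mem_iota => hj.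
by rewrite apZ1; lia.
Qed.

Lemma Wgrp_gen : Wgrp t N r = GG.
Proof. by have := Wset_gen; rewrite /Wset; case: t. Qed.

End Generation.

(** * The index set: involutions without large visible descents *)

Section Gelements.
Variables (n : nat).
Hypothesis hn : (2 <= n)%N.
Implicit Types (t : CoxType) (z s : P n) (p q x : int) (f : int -> int).

(** What the three index sets share, stated for maps of the integers so that conjugation by a
    generator becomes composition with [sw]. The last clause negates visible descents beyond n; the
    requirements special to a type are kept in [tcond]. *)
Definition gcond f : Prop :=
  [/\ forall x, f (- x) = - f x, forall x, f (f x) = x,
      forall x, x != 0 -> `|x| <= n.*2%:Z -> `|f x| != `|x|,
      forall x, n.*2%:Z < `|x| -> f x = x &
      forall i, n%:Z < i -> (i <= f (i + 1) \/ f i <= f (i + 1)) /\ - i <= f i].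

Definition tcond t z : Prop :=
  match t with
  | TA => forall x, 0 < x -> 0 < apZ z x
  | TBC => True
  | TD => ~~ odd (count (fun i : nat => apZ z i%:Z < - i%:Z) (iota 1 n))
  end.

Let hN : (2 <= n.*2 <= n.*2)%N. Proof. lia. Qed.
Let hnN : (2 <= n <= n.*2)%N. Proof. lia. Qed.

Lemma gcond0 f : gcond f -> f 0 = 0.
Proof. by case=> fN _ _ _ _; have := fN 0; rewrite oppr0; move: (f 0) => a; lia. Qed.

Lemma gcond_inj f : gcond f -> injective f.
Proof. by case=> _ fK _ _ _; exact: can_inj fK. Qed.

Lemma gcond_nz f x : gcond f -> x != 0 -> f x != 0.
Proof. by move=> h; apply: contraNneq => e; apply/eqP/(gcond_inj h); rewrite e gcond0. Qed.

Lemma gcond_neq f x : gcond f -> x != 0 -> `|x| <= n.*2%:Z -> f x != x /\ f x != - x.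
Proof. by case=> _ _ h _ _ x0 xb; have := h x x0 xb; lia. Qed.

Lemma visDesN z : (forall i : int, n%:Z < i -> ~ visDes z i) <->
  (forall i : int, n%:Z < i ->
     (i <= apZ z (i + 1) \/ apZ z i <= apZ z (i + 1)) /\ - i <= apZ z i).
Proof.
split=> h i hi; last first.
  by move=> [_]; rewrite lt_min; have := h i hi; move: (apZ _ _) (apZ _ _) => a b; lia.
have : ~ (apZ z (i + 1) < Num.min i (apZ z i) \/ apZ z i < - i).
  by move=> H; apply: (h i hi); split=> //; lia.
by rewrite lt_min; move: (apZ _ _) (apZ _ _) => a b; lia.
Qed.

Lemma GsetP t z : z \in Gset t n <-> gcond (apZ z) /\ tcond t z.
Proof.
have fB (w : P n) : fixBeyond n.*2 w by apply/fixBeyondP => x hx; apply: apZ_out; lia.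
have fpf (z' : P n) : isBC z' -> all (fun i : nat => `|apZ z' i%:Z| != i%:Z) (iota 1 n.*2) <->
    (forall x, x != 0 -> `|x| <= n.*2%:Z -> `|apZ z' x| != `|x|).
  move=> /isBCP zN; split=> [/allP h x x0 xb|h]; last first.
    by apply/allP => i; rewrite mem_iota => hi; have := h i%:Z; move: (apZ _ _) => a; lia.
  have := h (absz x); rewrite mem_iota => H.
  have {}H : `|apZ z' (absz x)| != absz x by apply: H; lia.
  case: (ltrP 0 x) => x1.
    have e : (absz x)%:Z = x by lia.
    by rewrite e in H; move: H; move: (apZ _ _) => a; lia.
  have e : (absz x)%:Z = - x by lia.
  by rewrite e zN in H; move: H; move: (apZ _ _) => a; lia.
have inv (z' : P n) : ((z'^-1)%g == z') <-> (forall x, apZ z' (apZ z' x) = x).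
  split=> [/eqP E x|E]; first by rewrite -{1}E apZVK.
  by apply/eqP/eq_apZ => x; apply: (@apZ_inj _ z'); rewrite apZKV E.
have BC (z' : P n) : FBCb n z' <-> [/\ isBC z', (z'^-1)%g == z' &
   all (fun i : nat => `|apZ z' i%:Z| != i%:Z) (iota 1 n.*2)].
  rewrite /FBCb /= inE fB andbT; split=> [/and3P[] //|[-> -> ->] //].
have out x : n.*2%:Z < `|x| -> apZ z x = x by move=> hx; rewrite apZ_out //; lia.
rewrite inE; split.
  move=> /andP[F /asboolP/visDesN nv].
  suff [zB zi zf tc] : [/\ isBC z, (z^-1)%g == z,
      all (fun i : nat => `|apZ z i%:Z| != i%:Z) (iota 1 n.*2) & tcond t z].
    by split=> //; split=> //; [exact/isBCP | exact/inv | exact/fpf].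
  case: t F; rewrite /Fb.
  - rewrite (Wgrp_gen TA hN) -Wset_gen // /Wset inE => /and3P[].
    move=> /and3P[zB _ /allP zp] zi zf.
    have pos x : 0 < x -> 0 < apZ z x.
      move=> hx; case: (leqP (absz x) n.*2) => xb; last by rewrite apZ_out.
      have := zp (absz x); rewrite mem_iota; have -> : (absz x)%:Z = x by lia.
      by apply; lia.
    split=> //; apply/allP => i hi; have := allP zf i hi; have := pos i.
    by move: hi; rewrite mem_iota; move: (apZ _ _) => a; lia.
  - by move=> /BC[].
  - by move=> /andP[/BC[]].
move=> [[zN zK zf zo nv] tc]; apply/andP; split; last by apply/asboolP/visDesN.
have zB : isBC z by apply/isBCP.
have zi : (z^-1)%g == z by apply/inv.
have za : all (fun i : nat => `|apZ z i%:Z| != i%:Z) (iota 1 n.*2) by apply/fpf.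
case: t tc; rewrite /Fb /tcond => tc.
- apply/and3P; split=> //; last first.
    by apply/allP => i hi; have := allP za i hi; move: (apZ _ _) => a; lia.
  rewrite (Wgrp_gen TA hN) -Wset_gen // /Wset inE zB fB /=.
  by apply/allP => i; rewrite mem_iota => hi; apply: tc; lia.
- exact/BC.
- by apply/andP; split=> //; exact/BC.
Qed.

Lemma Gset_gcond t z : z \in Gset t n -> gcond (apZ z).
Proof. by move=> /GsetP[]. Qed.

(** The map i -> |z i| exchanges the negative places with |z i| > i and those with |z i| < i, so
    they are equally many. Thus every index element lies in the big group of type D. *)
Lemma gcond_evenNeg z : gcond (apZ z) -> evenNeg n.*2 z.
Proof.
move=> zg; have [zN zK zf zo _] := zg; rewrite /evenNeg.
set l := iota 1 n.*2; set f := apZ z in zN zK zf zo *.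
pose A (i : nat) := (f i < 0) && (i%:Z < - f i).
pose B (i : nat) := (f i < 0) && (- f i < i%:Z).
have -> : count (fun i : nat => f i < 0) l = (count A l + count B l)%N.
  rewrite -count_predUI (_ : count (predI A B) l = 0)%N; last first.
    by apply/eqP; rewrite -leqn0 leqNgt -has_count; apply/hasPn => i _; rewrite /= /A /B; lia.
  rewrite addn0; apply: eq_in_count => i; rewrite mem_iota => hi; rewrite /= /A /B.
  by have := zf i; move: (f i) => a; lia.
suff -> : count A l = count B l by rewrite addnn odd_double.
have bd i : (0 < i < 1 + n.*2)%N -> (absz (f i) <= n.*2)%N by move=> hi; rewrite apZ_bound; lia.
have inj : {in l &, injective (fun i : nat => absz (f i))}.
  move=> i j; rewrite !mem_iota => hi hj E.
  have [/(gcond_inj zg)|] : f i = f j \/ f i = - f j by lia.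
    by lia.
  by rewrite -zN => /(gcond_inj zg); lia.
have half (X Y : pred nat) : (forall i : nat, i \in l -> X i ->
    (absz (f i) \in l) && Y (absz (f i))) -> (count X l <= count Y l)%N.
  move=> h; rewrite -!size_filter -(size_map (fun i : nat => absz (f i))).
  apply: uniq_leq_size; last first.
    move=> k /mapP[i]; rewrite mem_filter => /andP[Xi il] ->.
    by rewrite mem_filter andbC; exact: h.
  rewrite map_inj_in_uniq ?filter_uniq ?iota_uniq // => i j.
  by rewrite !mem_filter => /andP[_ il] /andP[_ jl]; exact: inj.
have neg i : f i < 0 -> f (absz (f i)) = - i.
  move=> h; have -> : (absz (f i))%:Z = - f i by lia.
  by rewrite zN zK.
apply/eqP; rewrite eqn_leq; apply/andP; split; apply: half => i; rewrite !mem_iota => hi.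
  move=> /andP[h1 h2]; rewrite /B neg //; have := bd i hi; lia.
move=> /andP[h1 h2]; rewrite /A neg //; have := bd i hi; lia.
Qed.

Lemma Gset_big t z : z \in Gset t n -> z \in <<[set:: gens t n.*2 n.*2]>>%g.
Proof.
move=> zG; rewrite -Wset_gen //; have [zg tc] := (GsetP t z).1 zG.
have zB : isBC z by case: zg => zN _ _ _ _; apply/isBCP.
have fB : fixBeyond n.*2 z by apply/fixBeyondP => x hx; rewrite apZ_out //; lia.
rewrite /Wset; case: t {zG} tc => /= tc; rewrite inE zB fB //=.
  by apply/allP => i; rewrite mem_iota => hi; apply: tc; lia.
exact: gcond_evenNeg.
Qed.

Lemma groot_big t p q : groot t n p q -> groot t n.*2 p q.
Proof.
move=> /grootP[[? ? ->]|[[-> -> ->]|[-> -> ->]]] //.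
by rewrite /groot; apply/orP; left; lia.
Qed.

Lemma Sgen_big t s : s \in Sgen t n -> s \in gens t n.*2 n.*2.
Proof.
have sub : {subset [seq sgen n.*2 i | i <- iota 1 n.-1] <= [seq sgen n.*2 i | i <- iota 1 n.*2.-1]}.
  by move=> x /mapP[i hi ->]; apply: map_f; move: hi; rewrite !mem_iota; lia.
rewrite /Sgen; case: t => /=; first exact: sub.
  by rewrite !inE => /orP[->//|/sub ->]; rewrite orbT.
by rewrite !inE => /orP[->//|/sub ->]; rewrite orbT.
Qed.

(** [kDE] and [kAE] read off Des= and Asc= from the two values f p and f q; [DesEqP] and [AscEqP]
    justify this. *)
Definition kDE p q f : bool := `|f p| == `|q|.
Definition kAE p q f : bool := [&& f q == f p + 1, n%:Z < `|f p| & n%:Z < `|f q|].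

Lemma groot_le t p q : groot t n p q -> `|p| <= n%:Z /\ `|q| <= n%:Z.
Proof. by move=> /grootP[[? ? ->]|[[_ -> ->]|[_ -> ->]]]; lia. Qed.

Lemma sw_abs p q x : `|x| != `|p| -> `|x| != `|q| -> sw p q x = x.
Proof. clear hn hN hnN; by rewrite /sw; repeat (case: eqP => ?); lia. Qed.

Lemma gcond_DE t p q f : gcond f -> groot t n p q -> kDE p q f ->
  (f p = q /\ f q = p) \/ (f p = - q /\ f q = - p).
Proof.
move=> [fN fK _ _ _] _ /eqP h.
have [E|E] : f p = q \/ f p = - q by lia.
  by left; split=> //; rewrite -E fK.
by right; split=> //; rewrite -[q]opprK -E fN fK.
Qed.

Lemma DesEqP t s z p q : z \in Gset t n -> groot t n p q -> apZ s =1 sw p q ->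
  DesEq n s z <-> kDE p q (apZ z).
Proof.
move=> zG h sE; have zg := Gset_gcond zG; have [zN zK zf _ _] := zg.
have [p0 q0] := groot_neq0 h; have [pn qn] := groot_le h; have pq := groot_lt h.
split=> [E|E].
  apply: contraT => ne.
  have : apZ (permc s z) p = apZ (permc z s) p by rewrite E.
  rewrite !apZM !sE sw_l sw_abs; first by move=> /(gcond_inj zg); lia.
    by apply: zf => //; lia.
  by [].
apply: eq_apZ => x; rewrite !apZM !sE; symmetry.
case: (gcond_DE zg h E) => -[e1 e2].
  rewrite (@sw_conj (apZ z) p q q p) //; first 2 last.
  - by left.
  - by rewrite /sw; repeat (case: eqP => ?); lia.
  - exact: gcond_inj.
by rewrite (@sw_conj (apZ z) p q p q) //; [exact: gcond_inj | right].
Qed.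

(** That z s z is some s_i with i > n means that z carries p, q to i, i + 1 up to sign, in some
    order. The reversed order would be a visible descent at i, so only f q = f p + 1 survives. *)
Lemma AscEqP t s z p q : z \in Gset t n -> groot t n p q -> apZ s =1 sw p q ->
  AscEq n s z <-> kAE p q (apZ z).
Proof.
move=> zG h sE; have zg := Gset_gcond zG; have [zN zK zf zo nv] := zg.
have [p0 q0] := groot_neq0 h; have [pn qn] := groot_le h; have pq := groot_lt h.
split=> [[i [hi E]]|/and3P[/eqP e h1 h2]].
  have : apZ (permc z (permc s z)) i = apZ (sgen n.*2 i) i by rewrite E.
  rewrite 2!apZM sE apZ_sgen ?sw_l; last lia.
  move=> /(congr1 (apZ z)); rewrite zK => E1.
  have := nv i; rewrite -E1.
  have ne : apZ z i != apZ z (i%:Z + 1) by apply/eqP => /(gcond_inj zg); lia.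
  have zi := zK i; have zi1 := zK (i%:Z + 1).
  move: E1 ne zi zi1; set a := apZ z i; set b := apZ z (i%:Z + 1) => E1 ne zi zi1.
  have [|[|[|]]] : a = p \/ a = q \/ a = - p \/ a = - q.
    by move: E1 ne; rewrite /sw; repeat (case: eqP => ?); lia.
  - move=> ea; rewrite ea sw_l in E1.
    have fp : apZ z p = i by rewrite -ea.
    have fq : apZ z q = i%:Z + 1 by rewrite E1.
    by move=> _; rewrite /kAE fp fq; lia.
  - by move=> ea; rewrite ea sw_r => H; have := H _; lia.
  - move=> ea; rewrite ea swN // sw_l => H; have := H _; lia.
  - move=> ea; rewrite ea (swN _ (conj p0 q0)) sw_r in E1.
    have fq : apZ z q = - i%:Z by rewrite -[q]opprK -ea zN zi.
    have fp : apZ z p = - (i%:Z + 1) by rewrite -[p]opprK E1 zN zi1.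
    by move=> _; rewrite /kAE fp fq; lia.
have bp : (absz (apZ z p) <= n.*2)%N by rewrite apZ_bound; lia.
have bq : (absz (apZ z q) <= n.*2)%N by rewrite apZ_bound; lia.
case: (ltrP 0 (apZ z p)) => sg.
  exists (absz (apZ z p)); split; first by lia.
  apply: eq_apZ => x; rewrite 2!apZM sE apZ_sgen; last by lia.
  rewrite (@sw_conj (apZ z) p q (absz (apZ z p))%:Z ((absz (apZ z p))%:Z + 1)) ?zK //.
  - exact: gcond_inj.
  - by lia.
  - by left; lia.
exists (absz (apZ z q)); split; first by lia.
apply: eq_apZ => x; rewrite 2!apZM sE apZ_sgen; last by lia.
rewrite (@sw_conj (apZ z) p q (absz (apZ z q))%:Z ((absz (apZ z q))%:Z + 1)) ?zK //.
- exact: gcond_inj.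
- by lia.
- by right; lia.
Qed.

Lemma asc_big t s z p q : z \in Gset t n -> groot t n p q -> apZ s =1 sw p q ->
  asc t n.*2 s z = (apZ z p < apZ z q).
Proof.
move=> zG h sE; rewrite (ascE _ (groot_big h) sE).
have [_ zK _ _ _] := Gset_gcond zG.
suff -> : (z^-1)%g = z by [].
by apply: eq_apZ => x; apply: (@apZ_inj _ z); rewrite apZKV zK.
Qed.

Lemma AscLtP t s z p q : s \in Sgen t n -> z \in Gset t n -> groot t n p q -> apZ s =1 sw p q ->
  AscLt t n s z <-> [/\ apZ z p < apZ z q, ~~ kDE p q (apZ z) & ~~ kAE p q (apZ z)].
Proof.
move=> sS zG h sE; rewrite /AscLt /lenBig lenS_lt ?Gset_big ?Sgen_big // (asc_big zG h sE).
rewrite (propext (DesEqP zG h sE)) (propext (AscEqP zG h sE)).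
by split=> [[-> [/negP-> /negP->]]|[-> /negP ? /negP ?]].
Qed.

Lemma DesLtP t s z p q : s \in Sgen t n -> z \in Gset t n -> groot t n p q -> apZ s =1 sw p q ->
  DesLt t n s z <-> [/\ apZ z q < apZ z p, ~~ kDE p q (apZ z) & ~~ kAE p q (apZ z)].
Proof.
move=> sS zG h sE; rewrite /DesLt /lenBig lenS_gt ?Gset_big ?Sgen_big // (asc_big zG h sE).
rewrite (propext (DesEqP zG h sE)) (propext (AscEqP zG h sE)) -leNgt le_eqVlt.
have -> : (apZ z q == apZ z p) = false.
  by apply/eqP => /(@apZ_inj _ z); have := groot_lt h; lia.
rewrite orFb; by split=> [[-> [/negP-> /negP->]]|[-> /negP ? /negP ?]].
Qed.

(** A visible descent at i > n can arise only when the generator reverses f i < f (i + 1). By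
    [sw_swap] these values are then p, q or -q, -p, whence f q = f p + 1 beyond n, the excluded
    case. *)
Lemma conj_gcond t p q f : gcond f -> groot t n p q -> ~~ kAE p q f ->
  gcond (fun x => sw p q (f (sw p q x))).
Proof.
move=> fg h nA; have [fN fK ff fo nv] := fg.
have nz := groot_neq0 h; have pq := groot_lt h; have [pn qn] := groot_le h.
have big x : n%:Z < `|x| -> sw p q x = x by move=> hx; apply: sw_abs; lia.
have small x : `|x| <= n%:Z -> `|sw p q x| <= n%:Z.
  by rewrite /sw; repeat (case: eqP => ?); lia.
split=> [x|x|x x0 xb|x xb|i hi].
- by rewrite !swN // fN swN.
- by rewrite swK // fK swK.
- have y0 : sw p q x != 0.
    have [p0 q0] := nz.
    by rewrite /sw; do 4?[case: ifP => _]; lia.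
  have yb : `|sw p q x| <= n.*2%:Z.
    by case: (lerP `|x| n%:Z) => hx; [have := small _ hx; move: (sw _ _ _) => y; lia | rewrite big].
  apply: contraNneq (ff _ y0 yb) => E; apply/eqP.
  have [E'|E'] : sw p q (f (sw p q x)) = x \/ sw p q (f (sw p q x)) = - x by lia.
    by rewrite -{2}E' swK.
  have e : sw p q x = - f (sw p q x).
    by apply: (can_inj (swK nz)); rewrite swK // swN // E' opprK.
  by rewrite {2}e normrN.
- by rewrite (big x) ?fo ?big //; lia.
- have [h1 h2] := nv i hi; rewrite (big i) ?(big (i + 1)); try lia.
  have i1 : i + 1 != 0 by lia.
  have i0 : i != 0 by lia.
  have a0 := gcond_nz fg i0; have b0 := gcond_nz fg i1.
  have ab : f i != f (i + 1) by apply/eqP => /(gcond_inj fg); lia.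
  have abN : f i != - f (i + 1) by rewrite -fN; apply/eqP => /(gcond_inj fg); lia.
  split; last first.
    by case: (lerP `|f i| n%:Z) => hx; [have := small _ hx; move: (sw _ _ _) => y; lia | rewrite big].
  case: h1 => h1; first by left; rewrite big //; lia.
  right; rewrite leNgt; apply/negP => lt.
  have lt' : f i < f (i + 1) by lia.
  have le' := ltW lt.
  case: (sw_swap h a0 b0 lt' abN le') => -[e1 e2]; move/negP: nA; apply.
    by rewrite /kAE -e1 -e2 !fK; lia.
  have fq : f q = - i by rewrite -[q]opprK -e1 fN fK.
  have fp : f p = - (i + 1) by rewrite -[p]opprK -e2 fN fK.
  by rewrite /kAE fp fq; lia.
Qed.

Lemma odd_count2 (c : pred nat) (j1 j2 : nat) : (0 < j1 <= n)%N -> (0 < j2 <= n)%N -> j1 != j2 ->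
  (forall i : nat, (0 < i <= n)%N -> i != j1 -> i != j2 -> ~~ c i) -> c j1 = c j2 ->
  ~~ odd (count c (iota 1 n)).
Proof.
move=> h1 h2 ne h0 e.
have cnt j : (0 < j <= n)%N -> count (fun i => (i == j) && c j1) (iota 1 n) = c j1.
  move=> hj; case: (c j1).
    rewrite (eq_count (a2 := pred1 j)) => [|i]; last by rewrite /= andbT.
    by rewrite count_uniq_mem ?iota_uniq // mem_iota; lia.
  by rewrite (eq_count (a2 := pred0)) ?count_pred0 // => i; rewrite /= andbF.
rewrite (@eq_in_count _ _ (fun i => ((i == j1) && c j1) (+) ((i == j2) && c j1))).
  by rewrite odd_count_addb !cnt // addbb.
move=> i; rewrite mem_iota => hi.
case: (i =P j1) => [->|n1]; first by rewrite (negbTE ne) /= addbF.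
case: (i =P j2) => [->|n2] /=; first by rewrite e.
by apply/negbTE/h0; lia.
Qed.

Lemma apZ_conj s z p q x : apZ s =1 sw p q ->
  apZ (permc s (permc z s)) x = sw p q (apZ z (sw p q x)).
Proof. by move=> sE; rewrite !apZM !sE. Qed.

Lemma sw_lt_neg p q (i : nat) x : groot TD n p q -> `|i%:Z| != `|p| /\ `|i%:Z| != `|q| ->
  x != - i%:Z -> (0 < i)%N -> (sw p q x < - i%:Z) = (x < - i%:Z).
Proof.
move=> /grootP h [h1 h2] h3 h4; rewrite /sw.
case: h => [[? ? ?]|[[//]|[_ ? ?]]]; clear hn hN hnN;
  (case: eqP => ?; [lia|]); (case: eqP => ?; [lia|]); (case: eqP => ?; [lia|]);
  (case: eqP => ?; [lia|]); lia.
Qed.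

(** What is new compared with [conj_gcond] is the parity in type D: conjugation can alter the
    condition z i < -i only at |p| and |q|, and it alters it at both or at neither. *)
Lemma conj_Gset t s z p q : z \in Gset t n -> groot t n p q -> apZ s =1 sw p q ->
  ~~ kDE p q (apZ z) -> ~~ kAE p q (apZ z) -> permc s (permc z s) \in Gset t n.
Proof.
move=> /GsetP[zg tc] h sE nD nA; have [zN zK zf zo _] := zg.
have E x := @apZ_conj s z p q x sE; apply/GsetP; split.
  have := conj_gcond zg h nA; congr gcond; apply/funext => x; exact/esym/E.
have [pn qn] := groot_le h.
case tE : t h tc => /= h tc //.
  move=> x hx; rewrite E; case: (grootP h) => [[p1 _ ->]|[[]|[]]] //.
  have pos y : 0 < y -> 0 < sw p (p + 1) y.
    by move=> hy; rewrite /sw; repeat (case: eqP => ?); lia.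
  exact/pos/tc/pos.
rewrite -[odd _]addbF -(negbTE tc) -odd_count_addb.
have nf x := gcond_neq (x := x) zg.
have [j1 [j2 [e1 e2 ej]]] : exists j1 j2 : nat, [/\ j1%:Z = `|p|, j2%:Z = q & (j1 < j2)%N].
  by exists (absz p), (absz q); case: (grootP h) => [[? ? ?]|[[]|[_ ? ?]]] //; split; lia.
have nD' : `|apZ z p| != `|q| by [].
have zpq : `|apZ z q| != `|p|.
  apply: contraNneq nD' => e.
  have [e'|e'] : apZ z q = p \/ apZ z q = - p by lia.
    by rewrite -e' zK.
  by have -> : p = - apZ z q; [lia | rewrite zN zK normrN].
have zpp := zf p; have zqq := zf q.
have [p0 q0] := groot_neq0 h.
apply: (@odd_count2 _ j1 j2); [clear - e1 p0 pn; lia | clear - e2 q0 qn ej; lia | clear - ej; lia | |].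
- move=> i hi n1 n2; rewrite E.
  have {n1 n2} [n1 n2] : `|i%:Z| != `|p| /\ `|i%:Z| != `|q| by clear - n1 n2 e1 e2; lia.
  rewrite (sw_abs n1 n2); have [nf1 nf2] : apZ z i != i /\ apZ z i != - i%:Z.
    by apply: nf; clear - hi; lia.
  by rewrite (sw_lt_neg h (conj n1 n2) nf2) ?addbb //; clear - hi; lia.
- have sa : sw p q (apZ z q) = apZ z q by apply: sw_abs => //; apply: zf => //; clear - qn; lia.
  have sb : sw p q (apZ z p) = apZ z p by apply: sw_abs => //; apply: zf => //; clear - pn; lia.
  have {}zpp : `|apZ z p| != `|p| by apply: zpp => //; clear - pn; lia.
  have {}zqq : `|apZ z q| != `|q| by apply: zqq => //; clear - qn; lia.
  have anz := gcond_nz zg p0; have bnz := gcond_nz zg q0.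
  rewrite !E; case: (grootP h) => [[p1 pn' qE]|[[]|[_ pE qE]]] //.
    have e1' : j1%:Z = p by clear - p1 e1; lia.
    rewrite e1' e2 sw_l sw_r sa sb; move: zpp zqq nD' zpq; clear - p1 qE.
    by move: (apZ z p) (apZ z q) => a b; lia.
  have e1' : j1%:Z = - p by clear - pE e1; lia.
  rewrite e1' e2 (swN _ (groot_neq0 h)) sw_l sw_r !zN (swN _ (groot_neq0 h)) sa sb.
  move: zpp zqq nD' zpq anz bnz; clear - pE qE.
  by move: (apZ z p) (apZ z q) => a b; lia.
Qed.

End Gelements.

(** * The four kinds of a generator at a point: [KD], [KA], [KU], [KL] for Des=, Asc=, Asc<, Des< *)

Inductive kind := KD | KA | KU | KL.

Definition cjf (p q : int) (f : int -> int) (x : int) : int := sw p q (f (sw p q x)).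

Section Kinds.
Variables (n : nat).
Hypothesis hn : (2 <= n)%N.
Implicit Types (t : CoxType) (p q x y : int) (f : int -> int).

Definition kv (q A B : int) : kind :=
  if `|A| == `|q| then KD
  else if [&& B == A + 1, n%:Z < `|A| & n%:Z < `|B|] then KA
  else if A < B then KU else KL.

Definition knd p q f := kv q (f p) (f q).

Lemma kvP q A B : match kv q A B with
  | KD => `|A| = `|q|
  | KA => [/\ `|A| != `|q|, B = A + 1, n%:Z < `|A| & n%:Z < `|B|]
  | KU => [/\ `|A| != `|q|, A < B & ~~ [&& B == A + 1, n%:Z < `|A| & n%:Z < `|B|]]
  | KL => [/\ `|A| != `|q|, B <= A & ~~ [&& B == A + 1, n%:Z < `|A| & n%:Z < `|B|]]
  end.
Proof.
rewrite /kv; case: eqP => // ne; case: ifP => [/and3P[/eqP]|/negbT nA] //.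
by case: ltrP.
Qed.

(** An inverted consecutive pair beyond n is a visible descent. Consequently conjugating a point of
    kind [KL] lands in [KU] and never in [KA]. *)
Lemma gcond_noRev f x y : gcond n f -> x < y -> `|x| <= n%:Z -> `|y| <= n%:Z ->
  n%:Z < `|f x| -> n%:Z < `|f y| -> f x != f y + 1.
Proof.
move=> [fN fK _ _ nv] xy xn yn hx hy; apply/eqP => e.
case: (ltrP 0 (f y)) => sg.
  have := nv (f y); rewrite -e !fK; clear - xy xn yn hy sg; lia.
have e' : - f x + 1 = - f y by clear - e; lia.
have := nv (- f x); rewrite e' !fN !fK; clear - xy xn yn hx sg e hy; lia.
Qed.

Lemma groot_vals t p q f : gcond n f -> groot t n p q -> `|f p| != `|q| ->
  [/\ `|f p| != `|p|, `|f q| != `|p| & `|f q| != `|q|].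
Proof.
move=> fg h ne; have [fN fK ff _ _] := fg.
have [p0 q0] := groot_neq0 h; have [pn qn] := groot_le hn h.
split; [by apply: ff => //; clear - pn; lia | | by apply: ff => //; clear - qn; lia].
apply: contraNneq ne => e.
have [e'|e'] : f q = p \/ f q = - p by clear - e; lia.
  by rewrite -e' fK.
by rewrite -[p]opprK -e' fN fK normrN.
Qed.

Lemma cjf_l p q f : `|f q| != `|p| -> `|f q| != `|q| -> cjf p q f p = f q.
Proof. by move=> h1 h2; rewrite /cjf sw_l sw_abs. Qed.

Lemma cjf_r p q f : `|f p| != `|p| -> `|f p| != `|q| -> cjf p q f q = f p.
Proof. by move=> h1 h2; rewrite /cjf sw_r sw_abs. Qed.

Lemma knd_flip t p q f : gcond n f -> groot t n p q ->
  (knd p q f = KU -> knd p q (cjf p q f) = KL) /\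
  (knd p q f = KL -> knd p q (cjf p q f) = KU).
Proof.
move=> fg h; have [pn qn] := groot_le hn h; have pq := groot_lt h.
have nr := gcond_noRev fg pq pn qn.
have nf : f p <> f q by move=> /(gcond_inj fg); clear - pq; lia.
have := kvP q (f p) (f q); rewrite -/(knd p q f).
split=> k; move: H; rewrite k => -[ne lt nA];
  have [n1 n2 n3] := groot_vals fg h ne;
  rewrite /knd cjf_l // cjf_r //; have := kvP q (f q) (f p);
  case: (kv q (f q) (f p)) => //.
- by move=> e; rewrite e eqxx in n3.
- by move=> [_ e _ _]; clear - e lt; lia.
- by move=> [_ lt' _]; clear - lt lt'; lia.
- by move=> e; rewrite e eqxx in n3.
- by move=> [_ e h1 h2]; have := nr h2 h1; rewrite e eqxx.
- by move=> [_ le' _]; clear - lt le' nf; lia.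
Qed.

Lemma cjfK t p q f : groot t n p q -> cjf p q (cjf p q f) = f.
Proof. by move=> /groot_neq0 nz; apply/funext => x; rewrite /cjf !(swK nz). Qed.

Lemma knd_gcond t p q f : gcond n f -> groot t n p q ->
  knd p q f = KU \/ knd p q f = KL -> gcond n (cjf p q f).
Proof.
move=> fg h k; apply: (conj_gcond hn fg h).
by have := kvP q (f p) (f q); rewrite -/(knd p q f); case: k => -> [].
Qed.

End Kinds.

(** * Operators on functions and the propagation of braid relations *)

Section Operators.
Variables (n : nat).
Hypothesis hn : (2 <= n)%N.
Variables (R : comNzRingType) (a eA eD : R).
Hypotheses (qA : eA * eA = 1 + a * eA) (qD : eD * eD = 1 + a * eD).
Implicit Types (t : CoxType) (p q x y : int) (f : int -> int) (F G : (int -> int) -> R).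

Notation knd := (knd n).
Notation gcond := (gcond n).

(** The coordinate at f of the image under H_s of the vector with coordinates F. The formula looks
    like the one for basis vectors because conjugation exchanges [KU] and [KL], so the matrix of H_s
    is symmetric. The scalars [eA] and [eD] stay abstract to cover both modules. *)
Definition op p q F f : R :=
  match knd p q f with
  | KD => eD * F f
  | KA => eA * F f
  | KU => F (cjf p q f)
  | KL => F (cjf p q f) + a * F f
  end.

Definition isr p q := exists t, groot t n p q.

Lemma op_U p q F f : knd p q f = KU -> op p q F f = F (cjf p q f).
Proof. by rewrite /op => ->. Qed.

Lemma op_ext p q F G : isr p q -> (forall f, gcond f -> F f = G f) ->
  forall f, gcond f -> op p q F f = op p q G f.
Proof.
move=> [t h] E f fg; rewrite /op; case k : (knd p q f); rewrite ?E //.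
- by apply: (knd_gcond hn fg h); left.
- by apply: (knd_gcond hn fg h); right.
Qed.

Lemma op_lin p q F G b f : op p q (fun f => F f + b * G f) f = op p q F f + b * op p q G f.
Proof. by rewrite /op; case: (knd _ _ _); ring. Qed.

Lemma op_quad p q F f : isr p q -> gcond f -> op p q (op p q F) f = F f + a * op p q F f.
Proof.
move=> [t h] fg; rewrite {1 3}/op; case k : (knd p q f).
- by rewrite /op k mulrA qD; ring.
- by rewrite /op k mulrA qA; ring.
- by rewrite /op (proj1 (knd_flip hn fg h) k) (cjfK _ h).
- by rewrite /op k (proj2 (knd_flip hn fg h) k) (cjfK _ h).
Qed.

Section Pair.
Variables (p q p' q' : int).
Hypotheses (hs : isr p q) (ht : isr p' q').
Notation s := (op p q).
Notation t := (op p' q').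
Notation cs := (cjf p q).
Notation ct := (cjf p' q').

Lemma t_quad F f : gcond f -> t (t F) f = F f + a * t F f.
Proof. exact: op_quad. Qed.

Definition br2 f := forall F, s (t F) f = t (s F) f.
Definition br3 f := forall F, s (t (s F)) f = t (s (t F)) f.
Definition br4 f := forall F, s (t (s (t F))) f = t (s (t (s F))) f.

(** A value at [cs f] is the value at f of an s-image, so the relation at [cs f] is one between
    longer words at f, and it follows from the relation at f and the quadratic relations. Hence only
    points from which neither generator leads down have to be checked. *)
Lemma br3_up f : gcond f -> knd p q f = KU -> br3 f -> br3 (cs f).
Proof.
move=> fg k b F; rewrite -(op_U (s (t (s F))) k) -(op_U (t (s (t F))) k) op_quad // (b (t F)) (b F).
have -> : t (s (t (t F))) f = t (s (fun f => F f + a * t F f)) f.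
  by apply: op_ext => // g gg; apply: op_ext => // u ug; exact: t_quad.
have -> : t (s (fun f => F f + a * t F f)) f = t (fun f => s F f + a * s (t F) f) f.
  by apply: op_ext => // g gg; exact: op_lin.
by rewrite op_lin.
Qed.

Lemma br4_up f : gcond f -> knd p q f = KU -> br4 f -> br4 (cs f).
Proof.
move=> fg k b F; rewrite -(op_U (s (t (s (t F)))) k) -(op_U (t (s (t (s F)))) k) op_quad // (b F) (b (s F)).
have -> : t (s (t (s (s F)))) f = t (s (t (fun f => F f + a * s F f))) f.
  apply: op_ext => // g gg; apply: op_ext => // u ug; apply: op_ext => // v vg.
  exact: op_quad.
have -> : t (s (t (fun f => F f + a * s F f))) f = t (s (fun f => t F f + a * t (s F) f)) f.
  by apply: op_ext => // g gg; apply: op_ext => // u ug; exact: op_lin.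
have -> : t (s (fun f => t F f + a * t (s F) f)) f = t (fun f => s (t F) f + a * s (t (s F)) f) f.
  by apply: op_ext => // g gg; exact: op_lin.
by rewrite op_lin.
Qed.

(** The bottom of a free dihedral orbit. The two lemmas after [op_eqk] treat its degenerations: a
    chain of three points with the same scalar at both ends, and a single point. *)
Lemma br3_hex f : knd p q f = KU -> knd p' q' f = KU ->
  knd p' q' (cs f) = KU -> knd p q (ct f) = KU ->
  knd p q (ct (cs f)) = KU -> knd p' q' (cs (ct f)) = KU ->
  cs (ct (cs f)) = ct (cs (ct f)) -> br3 f.
Proof. by move=> k1 k2 k3 k4 k5 k6 e F; rewrite (op_U _ k1) (op_U _ k3) (op_U _ k5) (op_U _ k2) (op_U _ k4) (op_U _ k6) e. Qed.

Definition eqk (k : kind) : option R :=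
  match k with KD => Some eD | KA => Some eA | _ => None end.

Lemma op_eqk u v F f e : eqk (knd u v f) = Some e -> op u v F f = e * F f.
Proof. by rewrite /op; case: (knd u v f) => // -[->]. Qed.

Lemma br3_chain f e : eqk (knd p q f) = Some e -> knd p' q' f = KU -> knd p q (ct f) = KU ->
  eqk (knd p' q' (cs (ct f))) = Some e -> br3 f.
Proof.
move=> k1 k2 k3 k4 F; 
rewrite (op_eqk _ k1) (op_U (s F) k2) (op_U F k3) (op_U (s (t F)) k2) (op_U (t F) k3).
by rewrite (op_eqk _ k4).
Qed.

Lemma br3_pt f e : eqk (knd p q f) = Some e -> eqk (knd p' q' f) = Some e -> br3 f.
Proof.
move=> k1 k2 F; rewrite (op_eqk (t (s F)) k1) (op_eqk (s F) k2) (op_eqk F k1).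
by rewrite (op_eqk (s (t F)) k2) (op_eqk (t F) k1) (op_eqk F k2).
Qed.

(** The free orbit for order four; it may fold to a chain of four points or of two, as in the lemmas
    below. *)
Lemma br4_oct f : knd p q f = KU -> knd p' q' f = KU ->
  knd p' q' (cs f) = KU -> knd p q (ct f) = KU ->
  knd p q (ct (cs f)) = KU -> knd p' q' (cs (ct f)) = KU ->
  knd p' q' (cs (ct (cs f))) = KU -> knd p q (ct (cs (ct f))) = KU ->
  cs (ct (cs (ct f))) = ct (cs (ct (cs f))) -> br4 f.
Proof. by move=> k1 k2 k3 k4 k5 k6 k7 k8 e F; rewrite (op_U _ k1) (op_U _ k3) (op_U _ k5) (op_U _ k7) (op_U _ k2) (op_U _ k4) (op_U _ k6) (op_U _ k8) e. Qed.

Lemma br4_chain4 f e : eqk (knd p' q' f) = Some e -> knd p q f = KU -> knd p' q' (cs f) = KU ->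
  knd p q (ct (cs f)) = KU -> eqk (knd p' q' (cs (ct (cs f)))) = Some e -> br4 f.
Proof.
move=> k1 k2 k3 k4 k5 F; rewrite (op_eqk (s (t (s F))) k1) (op_U (t (s F)) k2) (op_U (s F) k3) (op_U F k4).
by rewrite (op_U (t (s (t F))) k2) (op_U (s (t F)) k3) (op_U (t F) k4) (op_eqk F k5).
Qed.

Lemma br4_chain2 f e : gcond f -> eqk (knd p' q' f) = Some e -> knd p q f = KU ->
  eqk (knd p' q' (cs f)) = Some e -> br4 f.
Proof.
move=> fg k1 k2 k3 F; case: hs => r h; have k4 := proj1 (knd_flip hn fg h) k2.
have sL G : s G (cs f) = G f + a * G (cs f) by rewrite /op k4 (cjfK _ h).
rewrite (op_eqk (s (t (s F))) k1) (op_U (t (s F)) k2) (op_eqk (s F) k3) sL.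
by rewrite (op_U (t (s (t F))) k2) (op_eqk (s (t F)) k3) sL (op_eqk F k1) (op_eqk F k3); ring.
Qed.

Lemma br2_same f : knd p q (ct f) = knd p q f -> knd p' q' (cs f) = knd p' q' f ->
  cs (ct f) = ct (cs f) -> br2 f.
Proof.
move=> k1 k2 e F; rewrite /op k1 k2 e.
by case: (knd p q f); case: (knd p' q' f); ring.
Qed.

(** For the position in which f carries one root to the other: both generators then conjugate f in
    the same way and the two operators agree along the orbit. *)
Lemma br2_spec f : knd p q f = knd p' q' f -> cs f = ct f ->
  knd p q (cs f) = knd p' q' (cs f) -> cs (cs f) = ct (cs f) -> br2 f.
Proof.
move=> k1 e1 k2 e2 F; rewrite /op -k1 -e1 -k2 -e2.
by case: (knd p q f).
Qed.
End Pair.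
End Operators.

(** * Braid relations of order three *)

Notation knd_of := knd.

Lemma sw_cmp t r p q B C : groot t r p q -> `|B| != `|p| -> `|B| != `|q| -> B != 0 ->
  (sw p q C < B) = (C < B) /\ (B < sw p q C) = (B < C).
Proof.
move=> /grootP h h1 h2 h3; rewrite /sw.
case: h => [[? ? ?]|[[_ ? ?]|[_ ? ?]]];
 (case: eqP => ?; [lia|]); (case: eqP => ?; [lia|]); (case: eqP => ?; [lia|]);
  (case: eqP => ?; [lia|]); lia.
Qed.

Section Braids.
Variables (n : nat).
Hypothesis hn : (2 <= n)%N.
Variables (R : comNzRingType) (a eA eD : R).
Hypotheses (qA : eA * eA = 1 + a * eA) (qD : eD * eD = 1 + a * eD).
Implicit Types (t : CoxType) (p q r x y : int) (f : int -> int).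

Notation knd := (knd n).
Notation gcond := (gcond n).
Notation br2 := (br2 n a eA eD).
Notation br3 := (br3 n a eA eD).
Notation br4 := (br4 n a eA eD).
Notation isr := (isr n).

(** The pairs [sw p q], [sw q r] of order three: consecutive indices, or -1, 2, 3 for s_{-1} and s_2
    in type D. *)
Definition tri p q r : Prop :=
  [/\ 1 <= p, q = p + 1, r = p + 2 & r <= n%:Z] \/ [/\ p = -1, q = 2, r = 3 & r <= n%:Z].

Section Triple.
Variables (p q r : int).
Hypothesis tr : tri p q r.

Lemma tri_pq : isr p q.
Proof.
case: tr => [[h1 h2 h3 h4]|[h1 h2 h3 h4]]; [exists TA | exists TD]; rewrite /groot.
  by apply/orP; left; lia.
by rewrite h1 h2; apply/orP; right.
Qed.

Lemma tri_qr : isr q r.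
Proof.
exists TA; rewrite /groot; apply/orP; left.
by case: tr => [[h1 h2 h3 h4]|[h1 h2 h3 h4]]; lia.
Qed.

Lemma tri_abs : [/\ p < q, q < r, `|p| != `|q|, `|p| != `|r| & `|q| != `|r|].
Proof. by clear hn; case: tr => [[h1 h2 h3 h4]|[h1 h2 h3 h4]]; split; lia. Qed.

Lemma tri_nz : [/\ p != 0, q != 0 & r != 0] /\ [/\ `|p| <= n%:Z, `|q| <= n%:Z & `|r| <= n%:Z].
Proof. by clear hn; case: tr => [[h1 h2 h3 h4]|[h1 h2 h3 h4]]; split; split; lia. Qed.

Lemma sw_tri x : sw p q (sw q r (sw p q x)) = sw q r (sw p q (sw q r x)).
Proof.
clear hn.
have [[p0 q0 r0] _] := tri_nz; have [? ? n1 n2 n3] := tri_abs.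
case: (`|x| =P `|p|) => [e|xp].
  have [->|->] : x = p \/ x = - p by clear - e; lia.
    by rewrite sw_l sw_l (@sw_abs q r p) // sw_l (@sw_abs p q r) ?sw_l // 1?eq_sym // sw_l.
  by rewrite !swN // sw_l sw_l (@sw_abs q r p) // sw_l (@sw_abs p q r) // 1?eq_sym // sw_l.
case: (`|x| =P `|q|) => [e|xq].
  have [->|->] : x = q \/ x = - q by clear - e; lia.
    by rewrite sw_r (@sw_abs q r p) // sw_l sw_l (@sw_abs p q r) 1?eq_sym // sw_r.
  by rewrite !swN // sw_r (@sw_abs q r p) // sw_l sw_l (@sw_abs p q r) 1?eq_sym // sw_r.
case: (`|x| =P `|r|) => [e|xr].
  have [->|->] : x = r \/ x = - r by clear - e; lia.
    by rewrite (@sw_abs p q r) 1?eq_sym // sw_r sw_r (@sw_abs q r p).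
  by rewrite !swN // (@sw_abs p q r) 1?eq_sym // sw_r sw_r (@sw_abs q r p).
move/eqP: xp => xp; move/eqP: xq => xq; move/eqP: xr => xr.
by rewrite (@sw_abs p q x) // (@sw_abs q r x) // (@sw_abs p q x) // (@sw_abs q r x).
Qed.

Lemma cjf_tri f : cjf p q (cjf q r (cjf p q f)) = cjf q r (cjf p q (cjf q r f)).
Proof. by apply/funext => x; rewrite /cjf (sw_tri x) (sw_tri (f (sw q r (sw p q (sw q r x))))). Qed.

Definition free3 x := [/\ `|x| != `|p|, `|x| != `|q| & `|x| != `|r|].

Lemma cj3_pq f A B C : free3 A -> free3 B -> free3 C -> [/\ f p = A, f q = B & f r = C] ->
  [/\ cjf p q f p = B, cjf p q f q = A & cjf p q f r = C].
Proof.
move=> [a1 a2 a3] [b1 b2 b3] [c1 c2 c3] [fp fq fr]; have [_ _ n1 n2 n3] := tri_abs.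
split; [by rewrite cjf_l ?fq | by rewrite cjf_r ?fp |].
have rr : sw p q r = r by rewrite sw_abs // eq_sym.
by rewrite /cjf rr fr sw_abs.
Qed.

Lemma cj3_qr f A B C : free3 A -> free3 B -> free3 C -> [/\ f p = A, f q = B & f r = C] ->
  [/\ cjf q r f p = A, cjf q r f q = C & cjf q r f r = B].
Proof.
move=> [a1 a2 a3] [b1 b2 b3] [c1 c2 c3] [fp fq fr]; have [_ _ n1 n2 n3] := tri_abs.
split; [|by rewrite cjf_l ?fr | by rewrite cjf_r ?fq].
have rr : sw q r p = p by rewrite sw_abs.
by rewrite /cjf rr fp sw_abs.
Qed.

Lemma kvU q0 A B : `|A| != `|q0| -> A < B ->
  ~~ [&& B == A + 1, n%:Z < `|A| & n%:Z < `|B|] -> kv n q0 A B = KU.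
Proof. by rewrite /kv => /negbTE-> -> /negbTE->. Qed.

Lemma kvA q0 A B : `|A| != `|q0| ->
  [&& B == A + 1, n%:Z < `|A| & n%:Z < `|B|] -> kv n q0 A B = KA.
Proof. by rewrite /kv => /negbTE-> ->. Qed.

Section Points3.
Variable f : int -> int.
Hypothesis fg : gcond f.

Lemma gflip x y : `|f x| = `|y| -> `|f y| = `|x|.
Proof.
case: fg => fN fK _ _ _ e; have [e'|e'] : f x = y \/ f x = - y by clear - e; lia.
  by rewrite -e' fK.
by rewrite -[y]opprK -e' fN fK normrN.
Qed.

Lemma gflipN x y : f x = - y -> f y = - x.
Proof. by case: fg => fN fK _ _ _ e; rewrite -[y]opprK -e fN fK. Qed.

Lemma gK x y : f x = y -> f y = x.
Proof. by case: fg => fN fK _ _ _ <-. Qed.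

Lemma tri_fpf : [/\ `|f p| != `|p|, `|f q| != `|q| & `|f r| != `|r|].
Proof.
have [[p0 q0 r0] [pn qn rn]] := tri_nz; case: fg => _ _ ff _ _.
by split; apply: ff => //; [clear - pn | clear - qn | clear - rn]; lia.
Qed.

(** The matching of p with r remains to be excluded: f p = r contradicts the increase, and f p = -r
    leaves no admissible value for f q between -r and -p. *)
Lemma tri_free : `|f p| != `|q| -> `|f q| != `|r| -> f p < f q -> f q < f r ->
  [/\ free3 (f p), free3 (f q) & free3 (f r)].
Proof.
move=> ne1 ne2 lt1 lt2; have [fpp fqq frr] := tri_fpf.
have [[p0 q0 r0] _] := tri_nz; have q1 := gcond_nz hn fg q0.
have fqp : `|f q| != `|p| by apply: contraNneq ne1 => /gflip ->.
have frq : `|f r| != `|q| by apply: contraNneq ne2 => /gflip ->.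
have fpr : `|f p| != `|r|.
  apply/eqP => e; have [e'|e'] : f p = r \/ f p = - r by clear - e; lia.
    have := gK e'; clear - lt1 lt2 tr e'; case: tr => [[? ? ? ?]|[? ? ? ?]]; lia.
  have := gflipN e'; clear - lt1 lt2 tr e' fqq fqp q1.
  by case: tr => [[? ? ? ?]|[? ? ? ?]]; lia.
have frp : `|f r| != `|p| by apply: contraNneq fpr => /gflip ->.
by split; split.
Qed.

(** The orbit runs through the three matchings of p with q, p with r and q with r, up to sign; the
    scalar at both ends is [eD]. *)
Lemma tri_DE1 : `|f p| = `|q| -> f q < f r -> knd q r f = KU -> br3 p q q r f.
Proof.
move=> Hs lt k2; have [fpp fqq frr] := tri_fpf; have fq := gflip Hs.
have [[p0 q0 r0] [pn qn rn]] := tri_nz; have [pq qr n1 n2 n3] := tri_abs.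
have r1 := gcond_nz hn fg r0.
have fr1 : `|f r| != `|p| by apply: contraNneq n3 => /gflip e; rewrite -Hs e.
have fr2 : `|f r| != `|q| by apply: contraNneq n2 => /gflip e; rewrite -fq e.
have [vp1 vp2] : `|cjf q r f p| = `|r| /\ (cjf q r f p < f r).
  have E : cjf q r f p = sw q r (f p) by rewrite /cjf (@sw_abs q r p).
  rewrite E; have [e|e] : f p = q \/ f p = - q by clear - Hs; lia.
    rewrite e sw_l; split=> //; move: lt; rewrite (gK e).
    by clear - fr1 fr2 frr tr r1; case: tr => [[? ? ? ?]|[? ? ? ?]]; lia.
  rewrite e swN // sw_l normrN; split=> //; move: lt; rewrite (gflipN e).
  by clear - fr1 fr2 frr tr r1; case: tr => [[? ? ? ?]|[? ? ? ?]]; lia.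
have vq : cjf q r f q = f r by rewrite cjf_l.
apply: (@br3_chain n R a eA eD p q q r f eD) => //.
- by rewrite /knd_of /kv Hs eqxx.
- rewrite /knd_of vq; apply: kvU => //; first by rewrite vp1 eq_sym.
  by clear - vp1 rn; lia.
- have vv : `|cjf p q (cjf q r f) q| = `|r|.
    have -> : cjf p q (cjf q r f) q = sw p q (cjf q r f p) by rewrite {1}/cjf sw_r.
    by rewrite sw_abs // vp1 eq_sym.
  by rewrite /knd_of /kv vv eqxx.
Qed.

Lemma tri_DE2 : `|f q| = `|r| -> f p < f q -> knd p q f = KU -> br3 p q q r f.
Proof.
move=> Ht lt k1; have [fpp fqq frr] := tri_fpf; have fr := gflip Ht.
have [[p0 q0 r0] [pn qn rn]] := tri_nz; have [pq qr n1 n2 n3] := tri_abs.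
have p1 := gcond_nz hn fg p0.
have fp1 : `|f p| != `|q| by apply: contraNneq n2 => /gflip e; rewrite -e Ht.
have fp2 : `|f p| != `|r| by apply: contraNneq n1 => /gflip e; rewrite -e fr.
have [vr1 vr2] : `|cjf p q f r| = `|p| /\ (f p < cjf p q f r).
  have E : cjf p q f r = sw p q (f r) by rewrite /cjf (@sw_abs p q r) // eq_sym.
  rewrite E; have [e|e] : f q = r \/ f q = - r by clear - Ht; lia.
    rewrite (gK e) sw_r; split=> //; move: lt; rewrite e.
    by clear - fp1 fp2 fpp tr p1; case: tr => [[? ? ? ?]|[? ? ? ?]]; lia.
  rewrite (gflipN e) swN // sw_r normrN; split=> //; move: lt; rewrite e.
  by clear - fp1 fp2 fpp tr p1; case: tr => [[? ? ? ?]|[? ? ? ?]]; lia.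
have vq : cjf p q f q = f p by rewrite cjf_r.
have vp : `|cjf p q f p| = `|r|.
  by rewrite cjf_l // Ht eq_sym.
suff b : br3 q r p q f by move=> F; exact/esym/b.
apply: (@br3_chain n R a eA eD q r p q f eD) => //.
- by rewrite /knd_of /kv Ht eqxx.
- rewrite /knd_of vq; apply: kvU => //.
  by clear - vr1 pn; lia.
- have vv : `|cjf q r (cjf p q f) p| = `|q|.
    have -> : cjf q r (cjf p q f) p = sw q r (cjf p q f p) by rewrite {1}/cjf (@sw_abs q r p).
    have [->|->] : cjf p q f p = r \/ cjf p q f p = - r by clear - vp; lia.
      by rewrite sw_r.
    by rewrite swN // sw_r normrN.
  by rewrite /knd_of /kv vv eqxx.
Qed.

(** The three values are free of p, q, r and get permuted by the two generators. The orbit is a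
    hexagon unless neighbouring values are consecutive beyond n; one such pair folds it to a chain
    with scalar [eA], two such pairs to a point. *)
Lemma tri_mid : `|f p| != `|q| -> `|f q| != `|r| -> f p < f q -> f q < f r -> br3 p q q r f.
Proof.
move=> ne1 ne2 lt1 lt2; have [F1 F2 F3] := tri_free ne1 ne2 lt1 lt2.
have V := And3 (erefl (f p)) (erefl (f q)) (erefl (f r)).
have Vt := cj3_qr F1 F2 F3 V; have Vst := cj3_pq F1 F3 F2 Vt.
have Vs := cj3_pq F1 F2 F3 V; have Vts := cj3_qr F2 F1 F3 Vs.
have lt3 : f p < f r by clear - lt1 lt2; lia.
have nA : ~~ [&& f r == f p + 1, n%:Z < `|f p| & n%:Z < `|f r|] by clear - lt1 lt2; lia.
have [a1 a2 a3] := F1; have [b1 b2 b3] := F2; have [c1 c2 c3] := F3.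
case: Vs Vt Vst Vts => [s1 s2 s3] [t1 t2 t3] [st1 st2 st3] [ts1 ts2 ts3].
have kt : knd q r (cjf p q f) = KU by rewrite /knd_of s2 s3 (kvU a3 lt3 nA).
have ks : knd p q (cjf q r f) = KU by rewrite /knd_of t1 t2 (kvU a2 lt3 nA).
case: (boolP [&& f q == f p + 1, n%:Z < `|f p| & n%:Z < `|f q|]) => A1;
case: (boolP [&& f r == f q + 1, n%:Z < `|f q| & n%:Z < `|f r|]) => A2.
- apply: (@br3_pt n R a eA eD p q q r f eA); first by rewrite /knd_of (kvA ne1 A1).
  by rewrite /knd_of (kvA ne2 A2).
- apply: (@br3_chain n R a eA eD p q q r f eA _ _ ks).
  + by rewrite /knd_of (kvA ne1 A1).
  + by rewrite /knd_of (kvU ne2 lt2 A2).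
  + by rewrite /knd_of st2 st3 (kvA a3 A1).
- suff b : br3 q r p q f by move=> F; exact/esym/b.
  apply: (@br3_chain n R a eA eD q r p q f eA _ _ kt).
  + by rewrite /knd_of (kvA ne2 A2).
  + by rewrite /knd_of (kvU ne1 lt1 A1).
  + by rewrite /knd_of ts1 ts2 (kvA b2 A2).
- have k1 : knd p q f = KU by rewrite /knd_of (kvU ne1 lt1 A1).
  have k2 : knd q r f = KU by rewrite /knd_of (kvU ne2 lt2 A2).
  have k3 : knd p q (cjf q r (cjf p q f)) = KU by rewrite /knd_of ts1 ts2 (kvU b2 lt2 A2).
  have k4 : knd q r (cjf p q (cjf q r f)) = KU by rewrite /knd_of st2 st3 (kvU a3 lt1 A1).
  exact: (br3_hex a eA eD k1 k2 kt ks k3 k4 (cjf_tri f)).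
Qed.

Lemma tri_bottom : knd p q f <> KL -> knd q r f <> KL -> br3 p q q r f.
Proof.
have [[p0 q0 r0] [pn qn rn]] := tri_nz; have [pq qr n1 n2 n3] := tri_abs.
have := kvP n q (f p) (f q); have := kvP n r (f q) (f r).
rewrite -/(knd p q f) -/(knd q r f).
case k1 : (knd p q f); case k2 : (knd q r f) => Ht Hs N1 N2;
  try (by case: N1); try (by case: N2); move=> {N1 N2}.
- by have := gflip Hs; rewrite Ht => e; rewrite e eqxx in n2.
- by have := gflip Hs; case: Ht => _ _ h _ e; clear - h e pn; lia.
- by case: Ht => _ lt _; exact: tri_DE1.
- by case: Hs => _ _ _ h; clear - h Ht rn; lia.
- by case: Hs Ht => m1 m2 _ _ [m3 m4 _ _]; apply: tri_mid => //; clear - m2 m4; lia.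
- by case: Hs Ht => m1 m2 _ _ [m3 m4 _]; apply: tri_mid => //; clear - m2; lia.
- by case: Hs => _ lt _; exact: tri_DE2.
- by case: Hs Ht => m1 m2 _ [m3 m4 _ _]; apply: tri_mid => //; clear - m4; lia.
- by case: Hs Ht => m1 m2 _ [m3 m4 _]; exact: tri_mid.
Qed.
End Points3.

Definition mu3 f : nat := ((f q < f p)%R + (f r < f q)%R + (f r < f p)%R)%N.

(** Induction on the number of inversions among f p, f q, f r: a generator of kind [KL] leads to a
    point with fewer, from which [br3_up] returns. *)
Lemma braid3 f : gcond f -> br3 p q q r f.
Proof.
have [t1 h1] := tri_pq; have [t2 h2] := tri_qr.
have [[p0 q0 r0] [pn qn rn]] := tri_nz; have [pq qr n1 n2 n3] := tri_abs.
have [m] := ubnP (mu3 f); elim: m f => [f|m IH f hm fg]; first by rewrite ltn0.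
case: (pselect (knd p q f = KL)) => [k|k1].
  have [_ /(_ k) kU] := knd_flip hn fg h1.
  have gg := knd_gcond hn fg h1 (or_intror k).
  suff b : br3 p q q r (cjf p q f).
    by have := br3_up hn qA qD tri_pq tri_qr gg kU b; rewrite (cjfK f h1).
  apply: IH gg; suff lt : (mu3 (cjf p q f) < mu3 f)%N by exact: leq_trans lt hm.
  have := kvP n q (f p) (f q); rewrite -/(knd p q f) k => -[ne le _].
  have [m1 m2 m3] := groot_vals hn fg h1 ne.
  have vr : cjf p q f r = sw p q (f r) by rewrite /cjf (@sw_abs p q r) // eq_sym.
  have [c1 _] := sw_cmp (f r) h1 m1 ne (gcond_nz hn fg p0).
  have [c2 _] := sw_cmp (f r) h1 m2 m3 (gcond_nz hn fg q0).
  have nf : f p <> f q by move=> /(gcond_inj fg); clear - pq; lia.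
  rewrite /mu3 cjf_l // cjf_r // vr c1 c2; clear - le nf.
  have -> : (f p < f q) = false by lia.
  have -> : (f q < f p) = true by lia.
  by lia.
case: (pselect (knd q r f = KL)) => [k|k2]; last exact: tri_bottom.
have [_ /(_ k) kU] := knd_flip hn fg h2.
have gg := knd_gcond hn fg h2 (or_intror k).
suff b : br3 p q q r (cjf q r f).
  have b' : br3 q r p q (cjf q r f) by move=> F; exact/esym/b.
  have := br3_up hn qA qD tri_qr tri_pq gg kU b'; rewrite (cjfK f h2) => b'' F.
  exact/esym/b''.
apply: IH gg; suff lt : (mu3 (cjf q r f) < mu3 f)%N by exact: leq_trans lt hm.
have := kvP n r (f q) (f r); rewrite -/(knd q r f) k => -[ne le _].
have [m1 m2 m3] := groot_vals hn fg h2 ne.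
have vp : cjf q r f p = sw q r (f p) by rewrite /cjf (@sw_abs q r p).
have [_ c1] := sw_cmp (f p) h2 m1 ne (gcond_nz hn fg q0).
have [_ c2] := sw_cmp (f p) h2 m2 m3 (gcond_nz hn fg r0).
have nf : f q <> f r by move=> /(gcond_inj fg); clear - qr; lia.
rewrite /mu3 cjf_l // cjf_r // vp c1 c2; clear - le nf.
have -> : (f q < f r) = false by lia.
have -> : (f r < f q) = true by lia.
by lia.
Qed.

End Triple.
End Braids.

(** * The braid relation of order four in type BC *)

Section Braids.
Variables (n : nat).
Hypothesis hn : (2 <= n)%N.
Implicit Types (t : CoxType) (p q r x y : int) (f : int -> int).
Notation knd := (knd n).
Notation gcond := (gcond n).

Lemma groot_s0 : groot TBC n (-1) 1.
Proof. by rewrite /groot !eqxx orbT. Qed.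

Lemma groot_s1 t : groot t n 1 2.
Proof. by rewrite /groot; apply/orP; left; lia. Qed.

Lemma groot_sm1 : groot TD n (-1) 2.
Proof. by rewrite /groot !eqxx !orbT. Qed.

Lemma sw0 x : sw (-1) 1 x = if `|x| == 1 then - x else x.
Proof. by clear; rewrite /sw; repeat (case: eqP => ?); lia. Qed.

Definition big2 x := 2 < `|x|.

Lemma cj_s0 f A B : (forall x, f (- x) = - f x) -> big2 A -> big2 B -> f 1 = A -> f 2 = B ->
  cjf (-1) 1 f 1 = - A /\ cjf (-1) 1 f 2 = B.
Proof.
move=> fN a2 b2 fA fB; rewrite /cjf !sw0 /= fB.
rewrite -[-1]/(- (1 : int)) fN fA; move: a2 b2; rewrite /big2 => a2 b2.
have -> : (`|- A| == 1) = false by clear - a2; lia.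
by have -> : (`|B| == 1) = false by clear - b2; lia.
Qed.

Lemma cj_s1 f A B : big2 A -> big2 B -> f 1 = A -> f 2 = B ->
  cjf 1 2 f 1 = B /\ cjf 1 2 f 2 = A.
Proof.
rewrite /big2 => a2 b2 fA fB.
by split; [rewrite cjf_l fB //; clear - b2; lia | rewrite cjf_r fA //; clear - a2; lia].
Qed.

Lemma gcond12 f : gcond f -> `|f 1| != 2 -> big2 (f 1) /\ big2 (f 2).
Proof.
move=> fg ne; have [m1 m2 m3] := groot_vals hn fg (groot_s1 TA) ne.
have := gcond_nz hn fg (isT : (1 : int) != 0); have := gcond_nz hn fg (isT : (2 : int) != 0).
by move: ne m1 m2 m3; rewrite /big2; clear; move: (f 1) (f 2) => u v; lia.
Qed.

Lemma knd0 f : (forall x, f (- x) = - f x) -> `|f 1| != 1 ->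
  knd (-1) 1 f = if 0 < f 1 then KU else KL.
Proof.
move=> fN ne; rewrite /knd_of -[-1]/(- (1 : int)) fN /kv normrN (negbTE ne).
have -> : [&& f 1 == - f 1 + 1, n%:Z < `|f 1| & n%:Z < `|f 1|] = false by clear - ne hn; lia.
by congr (if _ then _ else _); clear; lia.
Qed.

Lemma cjf_odd p q f : p != 0 /\ q != 0 -> (forall x, f (- x) = - f x) ->
  forall x, cjf p q f (- x) = - cjf p q f x.
Proof. by move=> nz fN x; rewrite /cjf swN // fN swN. Qed.

Lemma sw01_4 x : sw (-1) 1 (sw 1 2 (sw (-1) 1 (sw 1 2 x))) = sw 1 2 (sw (-1) 1 (sw 1 2 (sw (-1) 1 x))).
Proof.
clear; rewrite !sw0; case: (`|x| =P 1) => e.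
  have [->|->] : x = 1 \/ x = -1 by lia.
  - by [].
  - by [].
case: (`|x| =P 2) => e2.
  have [->|->] : x = 2 \/ x = -2 by lia.
  - by [].
  - by [].
have E : sw 1 2 x = x by apply: sw_abs; apply/eqP.
by move/eqP/negbTE: e => e; rewrite !(E, e).
Qed.

Variables (R : comNzRingType) (a eA eD : R).
Hypotheses (qA : eA * eA = 1 + a * eA) (qD : eD * eD = 1 + a * eD).

Notation br2 := (br2 n a eA eD).
Notation br3 := (br3 n a eA eD).
Notation br4 := (br4 n a eA eD).
Notation isr := (isr n).

(** The number of positive roots of B_2 on which the pair (f 1, f 2) is negative; it drops at each
    conjugation of kind [KL]. *)
Definition mu4 f : nat := ((f 1 < 0)%R + (f 2 < 0)%R + (f 2 < f 1)%R + (f 1 + f 2 < 0)%R)%N.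

(** If f matches 1 with 2 up to sign, s_1 is the scalar [eD] at both points of the s_0-orbit.
    Otherwise f 1 and f 2 move freely with their signs, and the orbit is an octagon, or a chain of
    four points when the two values are consecutive beyond n. *)
Lemma braid4_bottom f : gcond f -> 0 < f 1 -> knd 1 2 f <> KL -> br4 (-1) 1 1 2 f.
Proof.
move=> fg pos; have [fN fK ff _ _] := fg.
have f1 : `|f 1| != 1 by apply: ff => //; clear - hn; lia.
have k0 : knd (-1) 1 f = KU by rewrite knd0 // pos.
have i0 : isr (-1) 1 by exists TBC; exact: groot_s0.
have nz0 : (-1 : int) != 0 /\ (1 : int) != 0 by [].
have nz1 : (1 : int) != 0 /\ (2 : int) != 0 by [].
have k0' g : (forall x, g (- x) = - g x) -> big2 (g 1) -> 0 < g 1 -> knd (-1) 1 g = KU.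
  by move=> gN b p; rewrite knd0 ?p //; move: b; rewrite /big2; clear; move: (g 1) => u; lia.
case: (`|f 1| =P 2) => [e|/eqP ne] kt.
  have kD : knd 1 2 f = KD by rewrite /knd_of /kv e eqxx.
  apply: (@br4_chain2 n hn R a eA eD (-1) 1 1 2 i0 f eD fg) => //.
    by rewrite kD.
  have v : `|cjf (-1) 1 f 1| = 2.
    rewrite /cjf !sw0 /= -[-1]/(- (1 : int)) fN normrN (negbTE f1) normrN.
    exact: e.
  by rewrite /knd_of /kv v eqxx.
have [b1 b2] := gcond12 fg ne.
have lt : f 1 < f 2.
  have := kvP n 2 (f 1) (f 2); rewrite -/(knd 1 2 f); case: (knd 1 2 f) kt => // _.
  - by move=> e; rewrite e eqxx in ne.
  - by move=> [_ -> _ _]; clear; lia.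
  - by case.
have b1N : big2 (- f 1) by rewrite /big2 normrN.
have b2N : big2 (- f 2) by rewrite /big2 normrN.
have sN := cjf_odd nz0 fN; have tN := cjf_odd nz1 fN.
have [s1 s2] := cj_s0 fN b1 b2 erefl erefl.
have [t1 t2] := cj_s1 b1 b2 erefl erefl.
have [ts1 ts2] := cj_s1 b1N b2 s1 s2.
have tsN := cjf_odd nz1 sN.
have [sts1 sts2] := cj_s0 tsN b2 b1N ts1 ts2.
have [st1 st2] := cj_s0 tN b2 b1 t1 t2.
have stN := cjf_odd nz0 tN.
have [tst1 tst2] := cj_s1 b2N b1 st1 st2.
have tstN := cjf_odd nz1 stN.
have nn x : big2 x -> `|x| != `|2| by rewrite /big2; clear; lia.
have k3 : knd 1 2 (cjf (-1) 1 f) = KU.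
  by rewrite /knd_of s1 s2; apply: kvU; [exact: nn | clear - pos lt; lia | clear - pos lt; lia].
have k5 : knd (-1) 1 (cjf 1 2 (cjf (-1) 1 f)) = KU.
  apply: (k0' _ tsN); rewrite ts1; [exact: b2 | clear - pos lt; lia].
case: (boolP [&& f 2 == f 1 + 1, n%:Z < `|f 1| & n%:Z < `|f 2|]) => A.
  apply: (@br4_chain4 n R a eA eD (-1) 1 1 2 f eA _ k0 k3 k5).
    by rewrite /knd_of (kvA (nn _ b1) A).
  rewrite /knd_of sts1 sts2 (@kvA n 2 (- f 2) (- f 1) (nn _ b2N)) // !normrN.
  by clear - A; lia.
have k2 : knd 1 2 f = KU by rewrite /knd_of (kvU (nn _ b1) lt A).
have k4 : knd (-1) 1 (cjf 1 2 f) = KU.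
  apply: (k0' _ tN); rewrite t1; [exact: b2 | clear - pos lt; lia].
have k6 : knd 1 2 (cjf (-1) 1 (cjf 1 2 f)) = KU.
  by rewrite /knd_of st1 st2; apply: kvU; [exact: nn | clear - pos lt; lia | clear - pos lt; lia].
have k7 : knd 1 2 (cjf (-1) 1 (cjf 1 2 (cjf (-1) 1 f))) = KU.
  rewrite /knd_of sts1 sts2; apply: kvU; [exact: nn | clear - lt; lia |].
  by rewrite !normrN; clear - A; lia.
have k8 : knd (-1) 1 (cjf 1 2 (cjf (-1) 1 (cjf 1 2 f))) = KU.
  by apply: (k0' _ tstN); rewrite tst1.
apply: (br4_oct a eA eD k0 k2 k3 k4 k5 k6 k7 k8).
by apply/funext => x; rewrite /cjf sw01_4 -(sw01_4 x).
Qed.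

Lemma braid4 f : gcond f -> br4 (-1) 1 1 2 f.
Proof.
have i0 : isr (-1) 1 by exists TBC; exact: groot_s0.
have i1 : isr 1 2 by exists TA; exact: groot_s1.
have [m] := ubnP (mu4 f); elim: m f => [f|m IH f hm fg]; first by rewrite ltn0.
have [fN fK ff _ _] := fg.
have f1 : `|f 1| != 1 by apply: ff => //; clear - hn; lia.
have f2 : `|f 2| != 2 by apply: ff => //; clear - hn; lia.
have f10 := gcond_nz hn fg (isT : (1 : int) != 0).
have f20 := gcond_nz hn fg (isT : (2 : int) != 0).
case: (ltrP 0 (f 1)) => pos; last first.
  have k : knd (-1) 1 f = KL by rewrite knd0 // ltNge pos.
  have [_ /(_ k) kU] := knd_flip hn fg groot_s0.
  have gg := knd_gcond hn fg groot_s0 (or_intror k).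
  suff b : br4 (-1) 1 1 2 (cjf (-1) 1 f).
    by have := br4_up hn qA qD i0 i1 gg kU b; rewrite (cjfK f groot_s0).
  apply: IH gg; suff lt : (mu4 (cjf (-1) 1 f) < mu4 f)%N by exact: leq_trans lt hm.
  have v1 : cjf (-1) 1 f 1 = - f 1.
    by rewrite /cjf !sw0 /= -[-1]/(- (1 : int)) fN normrN (negbTE f1).
  case: (`|f 1| =P 2) => [e|/eqP ne].
    have e1 : f 1 = - 2 by clear - e pos; lia.
    have e2 : f 2 = -1 by rewrite -[2]opprK -e1 fN fK.
    have v2 : cjf (-1) 1 f 2 = 1 by rewrite /cjf !sw0 /= e2.
    by rewrite /mu4 v1 v2 e1 e2.
  have [b1 b2] := gcond12 fg ne.
  have [_ v2] := cj_s0 fN b1 b2 erefl erefl.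
  rewrite /mu4 v1 v2; move: pos f10 b1 b2; rewrite /big2; clear.
  by move: (f 1) (f 2) => u v; lia.
case: (pselect (knd 1 2 f = KL)) => [k|k2]; last exact: braid4_bottom.
have [_ /(_ k) kU] := knd_flip hn fg (groot_s1 TA).
have gg := knd_gcond hn fg (groot_s1 TA) (or_intror k).
have bs g : br4 (-1) 1 1 2 g <-> br4 1 2 (-1) 1 g by split=> b F; exact/esym/b.
suff b : br4 (-1) 1 1 2 (cjf 1 2 f).
  have := br4_up hn qA qD i1 i0 gg kU ((bs _).1 b); rewrite (cjfK f (groot_s1 TA)).
  exact: (bs f).2.
apply: IH gg; suff lt : (mu4 (cjf 1 2 f) < mu4 f)%N by exact: leq_trans lt hm.
have := kvP n 2 (f 1) (f 2); rewrite -/(knd 1 2 f) k => -[ne le _].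
have [b1 b2] := gcond12 fg ne; have [v1 v2] := cj_s1 b1 b2 erefl erefl.
have nf : f 1 <> f 2 by move=> /(gcond_inj fg).
rewrite /mu4 v1 v2; move: le nf; clear.
by move: (f 1) (f 2) => u v; lia.
Qed.

End Braids.

(** * Commuting pairs of generators *)

Lemma sw_D_comm y : sw (-1) 2 (sw 1 2 y) = sw 1 2 (sw (-1) 2 y).
Proof.
case: (`|y| =P 1) => e.
  have [->|->] : y = 1 \/ y = -1 by clear - e; lia.
  - by [].
  - by [].
case: (`|y| =P 2) => e2.
  have [->|->] : y = 2 \/ y = -2 by clear - e2; lia.
  - by [].
  - by [].
have E1 : sw 1 2 y = y by apply: sw_abs; apply/eqP.
have E2 : sw (-1) 2 y = y by apply: sw_abs; apply/eqP.
by rewrite E1 E2 E1.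
Qed.

Section Braids.
Variables (n : nat).
Hypothesis hn : (2 <= n)%N.
Variables (R : comNzRingType) (a eA eD : R).
Hypotheses (qA : eA * eA = 1 + a * eA) (qD : eD * eD = 1 + a * eD).
Implicit Types (t : CoxType) (p q r x y : int) (f : int -> int).

Notation knd := (knd n).
Notation gcond := (gcond n).
Notation br2 := (br2 n a eA eD).
Notation isr := (isr n).

(** These two generators commute although they move the same points. When f matches 1 with 2 up to
    sign both act by [eD]; otherwise neither changes the kind of the other. *)
Lemma braid2D f : gcond f -> br2 (-1) 2 1 2 f.
Proof.
move=> fg; have [fN fK ff _ _] := fg.
have i0 : groot TD n (-1) 2 := groot_sm1 n.
have i1 : groot TD n 1 2 := groot_s1 hn TD.
have fm1 : f (-1) = - f 1 by rewrite -[-1]/(- (1 : int)) fN.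
case: (`|f 1| =P 2) => [e|/eqP ne].
  have kD1 : knd 1 2 f = KD by rewrite /knd_of /kv e eqxx.
  have kD0 : knd (-1) 2 f = KD by rewrite /knd_of /kv fm1 normrN e eqxx.
  by move=> F; rewrite /op kD0 kD1.
have [b1 b2] := gcond12 hn fg ne.
have b1' : `|f 1| != `|2| /\ `|f 1| != `|1| by move: b1; rewrite /big2; clear; move: (f 1) => u; lia.
have b2' : `|f 2| != `|2| /\ `|f 2| != `|1| by move: b2; rewrite /big2; clear; move: (f 2) => u; lia.
have [t1 t2] := cj_s1 b1 b2 erefl erefl.
have s2 : cjf (-1) 2 f 2 = - f 1.
  by rewrite /cjf sw_r fm1 sw_abs // normrN; [case: b1' | case: b1'].
have s1 : cjf (-1) 2 f 1 = - f 2.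
  rewrite /cjf; have -> : sw (-1) 2 1 = - 2 by [].
  by rewrite fN sw_abs // normrN; [case: b2' | case: b2'].
have tN : cjf 1 2 f (-1) = - f 2.
  rewrite /cjf; have -> : sw 1 2 (-1) = - 2 by [].
  by rewrite fN sw_abs // normrN; [case: b2' | case: b2'].
apply: br2_same.
- rewrite /knd_of tN t2 fm1 /kv !normrN (negbTE (proj1 b2')) (negbTE (proj1 b1')).
  have -> : (f 1 == - f 2 + 1) = (f 2 == - f 1 + 1) by clear; move: (f 1) (f 2) => u v; lia.
  have -> : (- f 2 < f 1) = (- f 1 < f 2) by clear; move: (f 1) (f 2) => u v; lia.
  by rewrite [X in _ && X]andbC.
- rewrite /knd_of s1 s2 /kv !normrN (negbTE (proj1 b2')) (negbTE (proj1 b1')).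
  have -> : (- f 1 == - f 2 + 1) = (f 2 == f 1 + 1) by clear; move: (f 1) (f 2) => u v; lia.
  have -> : (- f 2 < - f 1) = (f 1 < f 2) by clear; move: (f 1) (f 2) => u v; lia.
  by rewrite [X in _ && X]andbC.
- apply/funext => x; rewrite /cjf.
  by rewrite sw_D_comm (sw_D_comm x).
Qed.

Section Disjoint.
Variables (t : CoxType) (p q p' q' : int).
Hypotheses (hs : groot t n p q) (ht : groot t n p' q').
Hypotheses (d1 : `|p| != `|p'|) (d2 : `|p| != `|q'|) (d3 : `|q| != `|p'|) (d4 : `|q| != `|q'|).

Lemma sw_disj_comm x : sw p q (sw p' q' x) = sw p' q' (sw p q x).
Proof.
have nz := groot_neq0 hs; have nz' := groot_neq0 ht.
have fl (u v : int) : `|u| != `|v| -> `|v| != `|u| by rewrite eq_sym.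
case: (`|x| =P `|p|) => [e|/eqP xp].
  have [->|->] : x = p \/ x = - p by clear - e; lia.
    by rewrite sw_l (sw_abs d1 d2) sw_l (sw_abs d3 d4).
  by rewrite (swN p nz) (swN p nz') (sw_abs d1 d2) (swN p nz) sw_l (swN q nz') (sw_abs d3 d4).
case: (`|x| =P `|q|) => [e|/eqP xq].
  have [->|->] : x = q \/ x = - q by clear - e; lia.
    by rewrite sw_r (sw_abs d3 d4) sw_r (sw_abs d1 d2).
  by rewrite (swN q nz) (swN q nz') (sw_abs d3 d4) (swN q nz) sw_r (swN p nz') (sw_abs d1 d2).
rewrite (sw_abs xp xq); case: (`|x| =P `|p'|) => [e|/eqP xp'].
  have [->|->] : x = p' \/ x = - p' by clear - e; lia.
    by rewrite sw_l (sw_abs (fl _ _ d2) (fl _ _ d4)).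
  by rewrite (swN p' nz') sw_l (swN q' nz) (sw_abs (fl _ _ d2) (fl _ _ d4)).
case: (`|x| =P `|q'|) => [e|/eqP xq'].
  have [->|->] : x = q' \/ x = - q' by clear - e; lia.
    by rewrite sw_r (sw_abs (fl _ _ d1) (fl _ _ d3)).
  by rewrite (swN q' nz') sw_r (swN p' nz) (sw_abs (fl _ _ d1) (fl _ _ d3)).
by rewrite (sw_abs xp' xq') (sw_abs xp xq).
Qed.

(** The exceptional position for a disjoint pair: f carries p, q to p', q' in one of the orders, up
    to a common sign, and so conjugates one generator into the other. *)
Definition spec f : Prop :=
  (f p = p' /\ f q = q') \/ (f p = - q' /\ f q = - p') \/
  (f p = q' /\ f q = p') \/ (f p = - p' /\ f q = - q').

Lemma spec_knd f : gcond f -> spec f -> knd p q f = knd p' q' f.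
Proof.
move=> fg; have [fN fK _ _ _] := fg.
have [pn qn] := groot_le hn hs; have [pn' qn'] := groot_le hn ht.
have pq := groot_lt hs; have pq' := groot_lt ht.
have inv x y : f x = y -> f y = x by move=> <-.
have invN x y : f x = - y -> f y = - x by move=> e; rewrite -[y]opprK -e fN fK.
have U x y z : `|x| != `|z| -> x < y -> `|x| <= n%:Z -> kv n z x y = KU.
  by move=> h1 h2 h3; apply: kvU => //; clear - h3; lia.
have L x y z : `|x| != `|z| -> y < x -> `|x| <= n%:Z -> kv n z x y = KL.
  move=> h1 h2 h3; have := kvP n z x y; case: (kv n z x y) => //.
  - by move=> e; rewrite e eqxx in h1.
  - by move=> [_ _ h _]; clear - h h3; lia.
  - by move=> [_ h _]; clear - h h2; lia.
rewrite /knd_of => -[[e1 e2]|[[e1 e2]|[[e1 e2]|[e1 e2]]]].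
- rewrite e1 e2 (inv _ _ e1) (inv _ _ e2) !U //; clear - d1 d2 d3 d4; lia.
- rewrite e1 e2 (invN _ _ e1) (invN _ _ e2) !U // ?normrN //; clear - pq pq' d1 d2 d3 d4; lia.
- rewrite e1 e2 (inv _ _ e1) (inv _ _ e2) !L //; clear - d1 d2 d3 d4; lia.
- rewrite e1 e2 (invN _ _ e1) (invN _ _ e2) !L // ?normrN //; clear - pq pq' d1 d2 d3 d4; lia.
Qed.

Lemma spec_cjf f : gcond f -> spec f -> cjf p q f = cjf p' q' f.
Proof.
move=> fg sp; have [fN fK _ _ _] := fg; have fi := gcond_inj fg.
have nz := groot_neq0 hs; have nz' := groot_neq0 ht.
have sym u v x : sw u v x = sw v u x -> True by [].
have swC u v x : u != 0 /\ v != 0 -> sw u v x = sw v u x.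
  by move=> [u0 v0]; clear - u0 v0; rewrite /sw; repeat (case: eqP => ?); lia.
have E x : f (sw p q x) = sw p' q' (f x).
  have nz'' : q' != 0 /\ p' != 0 by case: nz'.
  case: sp => [h|[h|[h|h]]].
  - by apply: sw_conj => //; left.
  - by apply: sw_conj => //; right.
  - by rewrite (swC p' q') //; apply: sw_conj => //; left.
  - by rewrite (swC p' q') //; apply: sw_conj => //; right; case: h.
have E' x : f (sw p' q' x) = sw p q (f x) by apply: fi; rewrite fK E fK.
by apply/funext => x; rewrite /cjf E E' sw_disj_comm.
Qed.

Lemma spec_cs f : gcond f -> spec f -> spec (cjf p q f).
Proof.
move=> fg sp.
have fl (u v : int) : `|u| != `|v| -> `|v| != `|u| by rewrite eq_sym.
have [e1 e2] : cjf p q f p = f q /\ cjf p q f q = f p.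
  by split; [apply: cjf_l | apply: cjf_r]; case: sp => [[h1 h2]|[[h1 h2]|[[h1 h2]|[h1 h2]]]];
    rewrite ?h1 ?h2 ?normrN; exact: fl.
by rewrite /spec e1 e2; case: sp => [[-> ->]|[[-> ->]|[[-> ->]|[-> ->]]]]; tauto.
Qed.

(** The hypothesis on opposite values controls the exception in [sw_opp]: p = -q means type BC,
    where [sw (-1) 2] is not a generator. *)
Lemma sw_disj_lt x y : x != 0 -> y != 0 -> x < y -> (x = - y -> p = - q) ->
  ~ (x = p' /\ y = q') -> ~ (x = - q' /\ y = - p') -> sw p' q' x < sw p' q' y.
Proof.
move=> x0 y0 lt xN n1 n2; rewrite ltNge; apply/negP => le.
case: (eqVneq x (- y)) => e; last by case: (sw_swap ht x0 y0 lt e le) => -[? ?]; [apply: n1 | apply: n2].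
have pqN := xN e.
case: (sw_opp ht lt e le) => [h|[e1 e2]]; first by apply: n1.
have := grootP hs; have := grootP ht; rewrite e1 e2 pqN => h' h.
case: h => [[i1 i2 i3]|[[tE _ _]|[_ i1 i2]]]; [by clear - i1 i3; lia | | by clear - i1 i2; lia].
case: h' => [[//]|[[_ _ //]|[tE' _ _]]].
by rewrite tE in tE'.
Qed.

Lemma knd_disj f : gcond f -> ~ spec f -> knd p q (cjf p' q' f) = knd p q f.
Proof.
move=> fg ns; have [fN fK _ _ _] := fg.
have [pn qn] := groot_le hn hs; have [pn' qn'] := groot_le hn ht.
have [p0 q0] := groot_neq0 hs; have nz' := groot_neq0 ht; have pq := groot_lt hs.
have fl (u v : int) : `|u| != `|v| -> `|v| != `|u| by rewrite eq_sym.
have vp : cjf p' q' f p = sw p' q' (f p) by rewrite /cjf (sw_abs d1 d2).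
have vq : cjf p' q' f q = sw p' q' (f q) by rewrite /cjf (sw_abs d3 d4).
have x0 := gcond_nz hn fg p0; have y0 := gcond_nz hn fg q0.
have xy : f p <> f q by move=> /(gcond_inj fg); clear - pq; lia.
have xN : f p = - f q -> p = - q by rewrite -fN => /(gcond_inj fg).
rewrite /knd_of vp vq /kv.
have sabs x : (`|sw p' q' x| == `|q|) = (`|x| == `|q|).
  by clear - d3 d4; rewrite /sw; do 4?[case: ifPn => ?]; lia.
have sbig x : (n%:Z < `|sw p' q' x|) = (n%:Z < `|x|).
  by clear - pn' qn'; rewrite /sw; do 4?[case: ifPn => ?]; lia.
have sfix x : n%:Z < `|x| -> sw p' q' x = x.
  by move=> h; apply: sw_abs; clear - h pn' qn'; lia.
rewrite sabs !sbig.
have -> : [&& sw p' q' (f q) == sw p' q' (f p) + 1, n%:Z < `|f p| & n%:Z < `|f q|] =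
          [&& f q == f p + 1, n%:Z < `|f p| & n%:Z < `|f q|].
  case: (boolP (n%:Z < `|f p|)) => h1; last by rewrite !andbF.
  case: (boolP (n%:Z < `|f q|)) => h2; last by rewrite !andbF.
  by rewrite !sfix.
suff -> : (sw p' q' (f p) < sw p' q' (f q)) = (f p < f q) by [].
case: (ltrP (f p) (f q)) => lt.
  apply: sw_disj_lt => //; first by move=> h; apply: ns; left.
  by move=> h; apply: ns; right; left.
apply/negbTE; rewrite -leNgt; apply: ltW; apply: sw_disj_lt => //.
- by clear - lt xy; lia.
- by move=> e; apply: xN; clear - e; lia.
- by move=> [h1 h2]; apply: ns; right; right; left.
- by move=> [h1 h2]; apply: ns; right; right; right.
Qed.

End Disjoint.

Lemma spec_sym p q p' q' f : gcond f -> spec p q p' q' f -> spec p' q' p q f.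
Proof.
move=> [fN fK _ _ _]; have inv x y : f x = y -> f y = x by move=> <-.
have invN x y : f x = - y -> f y = - x by move=> e; rewrite -[y]opprK -e fN fK.
move=> [[e1 e2]|[[e1 e2]|[[e1 e2]|[e1 e2]]]]; rewrite /spec.
- by left; rewrite (inv _ _ e1) (inv _ _ e2).
- by right; left; rewrite (invN _ _ e1) (invN _ _ e2).
- by right; right; left; rewrite (inv _ _ e1) (inv _ _ e2).
- by right; right; right; rewrite (invN _ _ e1) (invN _ _ e2).
Qed.

Lemma braid2 t p q p' q' f : groot t n p q -> groot t n p' q' ->
  `|p| != `|p'| -> `|p| != `|q'| -> `|q| != `|p'| -> `|q| != `|q'| ->
  gcond f -> br2 p q p' q' f.
Proof.
move=> hs ht d1 d2 d3 d4 fg.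
have fl (u v : int) : `|u| != `|v| -> `|v| != `|u| by rewrite eq_sym.
case: (pselect (spec p q p' q' f)) => [sp|ns].
  have k := spec_knd hs ht d1 d2 d3 d4 fg sp.
  have e := spec_cjf hs ht d1 d2 d3 d4 fg sp.
  have spc := spec_cs d1 d2 d3 d4 fg sp.
  have gg : gcond (cjf p q f).
    apply: (conj_gcond hn fg hs); have [pn' qn'] := groot_le hn ht.
    rewrite /kAE; clear - sp pn' qn'.
    by case: sp => [[-> ->]|[[-> ->]|[[-> ->]|[-> ->]]]]; rewrite ?normrN; lia.
  have k' := spec_knd hs ht d1 d2 d3 d4 gg spc.
  have e' := spec_cjf hs ht d1 d2 d3 d4 gg spc.
  exact: (br2_spec a eA eD k e k' e').
apply: br2_same.
- exact: (knd_disj hs ht d1 d2 d3 d4 fg ns).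
- apply: (knd_disj ht hs (fl _ _ d1) (fl _ _ d3) (fl _ _ d2) (fl _ _ d4) fg).
  by move=> /(spec_sym fg).
- apply/funext => x; rewrite /cjf (sw_disj_comm hs ht d1 d2 d3 d4 (f _)).
  by rewrite (sw_disj_comm hs ht d1 d2 d3 d4 x).
Qed.

End Braids.

(** * From operators with braid relations to a Hecke module *)

Lemma neg_arith (x y : int) : x < 0 -> y < x ->
  [/\ y <= - x, y <= - y, x <= - y, - x <= - y & x <= - x].
Proof. by move=> h1 h2; split; lia. Qed.

Section Matsumoto.
Variables (t : CoxType) (n : nat).
Hypothesis hn : (2 <= n)%N.
Let hnN : (2 <= n <= n.*2)%N. Proof. lia. Qed.
Implicit Types (s w u : P n) (p q : int).

Notation S := (Sgen t n).
Notation W := (WW t n).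
Notation len := (lenW t n).
Notation asc := (asc t n).

Lemma WW_gen : W = <<[set:: S]>>%g.
Proof. exact: Wgrp_gen. Qed.

Lemma WW1 : (1%g : P n) \in W. Proof. by rewrite WW_gen group1. Qed.

Lemma WWM s w : s \in S -> w \in W -> permc s w \in W.
Proof. by rewrite WW_gen => sS wW; rewrite groupM // mem_gen // inE. Qed.

Lemma WWS s : s \in S -> s \in W.
Proof. by rewrite WW_gen => sS; rewrite mem_gen // inE. Qed.

Lemma SS s w : s \in S -> permc s (permc s w) = w.
Proof. by move=> sS; rewrite /permc -mulgA (gens_invol hnN sS) mulg1. Qed.

Lemma Sasc_perm s w : s \in S -> w \in W -> asc s w -> ~~ asc s (permc s w).
Proof. by rewrite WW_gen => sS wW; exact: asc_s. Qed.

Lemma Sdesc_perm s w : s \in S -> w \in W -> ~~ asc s w -> asc s (permc s w).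
Proof.
move=> sS wW; apply: contraNT => h; have [p [q [r sE]]] := gensP hnN sS.
move: h; rewrite !(ascE _ r sE) !(apZVM hnN _ _ sS sE) sw_l sw_r -leNgt le_eqVlt.
by case: eqP => [/(@apZ_inj _ w^-1%g)|_ //]; have := groot_lt r; lia.
Qed.

Lemma len_ltE s w : s \in S -> w \in W -> (len w < len (permc s w))%N = asc s w.
Proof. by rewrite WW_gen => sS wW; exact: lenS_lt. Qed.

Lemma len_desc s w : s \in S -> w \in W -> ~~ asc s w -> len w = (len (permc s w)).+1.
Proof. by rewrite WW_gen => sS wW; exact: lenS_desc. Qed.

Lemma W_desc w : w \in W -> w != 1%g -> exists2 s, s \in S & ~~ asc s w.
Proof. by rewrite WW_gen; exact: ex_descent. Qed.

(** [rel2], [rel3] and [rel4] are the relative positions of two simple roots with braid order 2, 3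
    and 4, each listed in one orientation. The second case of [rel2] is the commuting pair s_{-1},
    s_1. *)
Definition rel2 p q p' q' : Prop :=
  [/\ `|p| != `|p'|, `|p| != `|q'|, `|q| != `|p'| & `|q| != `|q'|] \/
  [/\ p = -1, q = 2, p' = 1 & q' = 2].
Definition rel3 p q p' q' : Prop := p' = q /\ tri n p q q'.
Definition rel4 p q p' q' : Prop := [/\ p = -1, q = 1, p' = 1 & q' = 2].

Lemma root_pairs p q p' q' : groot t n p q -> groot t n p' q' -> p <> p' \/ q <> q' ->
  [\/ rel2 p q p' q' \/ rel2 p' q' p q, rel3 p q p' q' \/ rel3 p' q' p q |
      rel4 p q p' q' \/ rel4 p' q' p q].
Proof.
have key i q1 j q2 : groot t n i q1 -> groot t n j q2 -> i < j ->
    rel2 i q1 j q2 \/ rel2 j q2 i q1 \/ rel3 i q1 j q2 \/ rel4 i q1 j q2.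
  move=> /grootP h /grootP h' lt; rewrite /rel2 /rel3 /rel4 /tri.
  case: h' => [[j1 j2 j3]|[[tE j1 j2]|[tE j1 j2]]];
    case: h => [[i1 i2 i3]|[[tE' i1 i2]|[tE' i1 i2]]]; try (by exfalso; lia).
  - case: (eqVneq j (i + 1)) => e; last by left; left; split; lia.
    by right; right; left; split; [lia | left; split; lia].
  - case: (eqVneq j 1) => e; last by left; left; split; lia.
    by right; right; right; split; lia.
  - case: (eqVneq j 1) => e; first by left; right; split; lia.
    case: (eqVneq j 2) => e2; last by left; left; split; lia.
    by right; right; left; split; [lia | right; split; lia].
move=> h h' ne; case: (ltgtP p p') => lt.
- by case: (key _ _ _ _ h h' lt) => [|[|[|]]] H; [constructor 1; left|constructor 1; right|constructor 2; left|constructor 3; left].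
- by case: (key _ _ _ _ h' h lt) => [|[|[|]]] H; [constructor 1; right|constructor 1; left|constructor 2; right|constructor 3; right].
exfalso; case: (grootP h) => [[i1 i2 i3]|[[tE i1 i2]|[tE i1 i2]]];
  case: (grootP h') => [[j1 j2 j3]|[[tE' j1 j2]|[tE' j1 j2]]]; try lia.
- by rewrite tE in tE'.
- by rewrite tE in tE'.
Qed.

Variables (F : fieldType) (c : F) (V : lmodType F) (T : P n -> V -> V).
Hypothesis Tlin : forall s, s \in S -> forall (a : F) (u v : V), T s (a *: u + v) = a *: T s u + T s v.
Hypothesis Tquad : forall s, s \in S -> forall v, T s (T s v) = v + c *: T s v.
Hypothesis Tbr : forall s s' p q p' q', s \in S -> s' \in S ->
  groot t n p q -> groot t n p' q' -> apZ s =1 sw p q -> apZ s' =1 sw p' q' ->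
  [/\ rel2 p q p' q' -> forall v, T s (T s' v) = T s' (T s v),
      rel3 p q p' q' -> forall v, T s (T s' (T s v)) = T s' (T s (T s' v)) &
      rel4 p q p' q' -> forall v, T s (T s' (T s (T s' v))) = T s' (T s (T s' (T s v)))].

Definition descent w : P n := head 1%g [seq s <- S | ~~ asc s w].

Lemma descentP w : w \in W -> w != 1%g -> descent w \in S /\ ~~ asc (descent w) w.
Proof.
move=> wW w1; have [s sS sa] := W_desc wW w1; rewrite /descent.
have : s \in [seq s <- S | ~~ asc s w] by rewrite mem_filter sa.
case E : [seq s <- S | ~~ asc s w] => [|x l] //= _.
have : x \in [seq s <- S | ~~ asc s w] by rewrite E mem_head.
by rewrite mem_filter => /andP[].
Qed.

(** The action along the reduced word that strips the chosen descent each time; that any other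
    descent could be stripped instead is [rho_desc]. *)
Fixpoint rhoN (k : nat) (w : P n) (v : V) : V :=
  if k is k'.+1 then T (descent w) (rhoN k' (permc (descent w) w) v) else v.

Definition rho w v := rhoN (len w) w v.

Lemma rho_1 v : rho 1%g v = v.
Proof. by rewrite /rho /lenW wordlen1. Qed.

Lemma rho_descent w v : w \in W -> w != 1%g ->
  rho w v = T (descent w) (rho (permc (descent w) w) v).
Proof.
move=> wW w1; have [dS da] := descentP wW w1.
by rewrite {1}/rho (len_desc dS wW da).
Qed.

Lemma apZV_perm s w p q x : s \in S -> apZ s =1 sw p q ->
  apZ (permc s w)^-1%g x = apZ w^-1%g (sw p q x).
Proof. exact: apZVM. Qed.

Lemma desc_neq1 s w : s \in S -> ~~ asc s w -> w != 1%g.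
Proof. by move=> sS; apply: contraNneq => ->; exact: (asc_1 hnN). Qed.

Section Dihedral.
Variables (w s d : P n) (v : V) (p q p' q' : int).
Hypotheses (wW : w \in W) (sS : s \in S) (dS : d \in S).
Hypotheses (r : groot t n p q) (r' : groot t n p' q').
Hypotheses (sE : apZ s =1 sw p q) (dE : apZ d =1 sw p' q').
Hypotheses (sd : ~~ asc s w) (dd : ~~ asc d w).
Hypothesis IH : forall u e, (len u < len w)%N -> u \in W -> e \in S -> ~~ asc e u ->
  rho u v = T e (rho (permc e u) v).

Let u x := apZ w^-1%g x.

Let uN x : u (- x) = - u x.
Proof.
by move: x; apply/isBCP; apply: isBCV; move: wW; rewrite WW_gen; exact: gen_isBC.
Qed.

Let us : u q < u p.
Proof.
move: sd; rewrite (ascE _ r sE) -leNgt le_eqVlt => /orP[/eqP/(@apZ_inj _ w^-1%g) e|//].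
by have := groot_lt r; rewrite e ltxx.
Qed.

Let ud : u q' < u p'.
Proof.
move: dd; rewrite (ascE _ r' dE) -leNgt le_eqVlt => /orP[/eqP/(@apZ_inj _ w^-1%g) e|//].
by have := groot_lt r'; rewrite e ltxx.
Qed.

Let lt1 e z : e \in S -> z \in W -> ~~ asc e z -> (len (permc e z) < len z)%N.
Proof. by move=> eS zW ed; rewrite (len_desc eS zW ed). Qed.

Let sw_desc := (fun z x => @apZV_perm s z p q x sS sE).
Let dw_desc := (fun z x => @apZV_perm d z p' q' x dS dE).

(** In this lemma and its analogues for orders 3 and 4, the two alternating words of braid length
    are stripped letter by letter with [IH]. That each letter is a descent is an inequality between
    values of [u] on the two roots, deduced from [us] and [ud]. *)
Lemma dihedral2 : rel2 p q p' q' -> T s (rho (permc s w) v) = T d (rho (permc d w) v).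
Proof.
move=> rl; have [b2 _ _] := Tbr sS dS r r' sE dE.
have [C D1 D2] : [/\ forall x, sw p q (sw p' q' x) = sw p' q' (sw p q x),
    u (sw p q q') < u (sw p q p') & u (sw p' q' q) < u (sw p' q' p)].
  case: rl => [[d1 d2 d3 d4]|[e1 e2 e3 e4]].
    have fl (a b : int) : `|a| != `|b| -> `|b| != `|a| by rewrite eq_sym.
    split; first by move=> x; apply: (sw_disj_comm r r').
      by rewrite !sw_abs //; apply: fl.
    by rewrite !sw_abs.
  have := us; have := ud; rewrite e1 e2 e3 e4 => ud' us'; split; first exact: sw_D_comm.
    have -> : sw (-1) 2 2 = - 1 by [].
    have -> : sw (-1) 2 1 = - 2 by [].
    by rewrite !uN ltrN2.
  have -> : sw 1 2 2 = 1 by [].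
  have -> : sw 1 2 (-1) = - 2 by [].
  by move: us'; rewrite -[-1]/(- (1 : int)) !uN ltrNr.
have k1 : ~~ asc d (permc s w) by rewrite (ascE _ r' dE) !sw_desc -leNgt ltW.
have k2 : ~~ asc s (permc d w) by rewrite (ascE _ r sE) !dw_desc -leNgt ltW.
rewrite (IH (lt1 sS wW sd) (WWM sS wW) dS k1) (IH (lt1 dS wW dd) (WWM dS wW) sS k2) b2 //.
congr (T d (T s (rho _ v))); apply: eq_apZ => x.
by rewrite !apZM !(sE, dE) C.
Qed.

Lemma dihedral3 : rel3 p q p' q' -> T s (rho (permc s w) v) = T d (rho (permc d w) v).
Proof.
move=> rl; have [_ b3 _] := Tbr sS dS r r' sE dE.
case: (rl) => e tr; have [pq qr n1 n2 n3] := tri_abs tr.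
have sq : sw p q q' = q' by rewrite sw_abs // eq_sym.
have dp : sw p' q' p = p by rewrite e sw_abs.
have k1 : ~~ asc d (permc s w).
  rewrite (ascE _ r' dE) !sw_desc -leNgt sq e sw_r ltW //.
  by apply: lt_trans us; rewrite -e.
have k2 : ~~ asc s (permc d w).
  rewrite (ascE _ r sE) !dw_desc -leNgt dp e sw_l ltW //.
  by apply: lt_trans us; rewrite -e.
have W1 := WWM sS wW; have W2 := WWM dS wW.
have k3 : ~~ asc s (permc d (permc s w)).
  by rewrite (ascE _ r sE) !dw_desc !sw_desc -leNgt dp sw_l e sw_l sq ltW // -e.
have k4 : ~~ asc d (permc s (permc d w)).
  have sp : sw p q p' = p by rewrite e sw_r.
  rewrite (ascE _ r' dE) !sw_desc !dw_desc -leNgt sp dp sq sw_r ltW //.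
  by rewrite e; exact: us.
have l1 := lt1 sS wW sd; have l2 := lt1 dS wW dd.
have l3 := ltn_trans (lt1 dS W1 k1) l1; have l4 := ltn_trans (lt1 sS W2 k2) l2.
rewrite (IH l1 W1 dS k1) (IH l3 (WWM dS W1) sS k3).
rewrite (IH l2 W2 sS k2) (IH l4 (WWM sS W2) dS k4) b3 //.
congr (T d (T s (T d (rho _ v)))); apply: eq_apZ => x.
by rewrite !apZM !(sE, dE) e (sw_tri tr).
Qed.

Lemma dihedral4 : rel4 p q p' q' -> T s (rho (permc s w) v) = T d (rho (permc d w) v).
Proof.
move=> rl; have [_ _ b4] := Tbr sS dS r r' sE dE.
case: (rl) => e1 e2 e3 e4.
have u1 : u 1 < 0.
  by move: us; rewrite e1 e2 -[-1]/(- (1 : int)) uN; move: (u 1) => x; lia.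
have u2 : u 2 < u 1 by move: ud; rewrite e3 e4.
have [a1 a2 a4 a5 a6] := neg_arith u1 u2.
have W1 := WWM sS wW; have W2 := WWM dS wW.
have k1 : ~~ asc d (permc s w).
  rewrite (ascE _ r' dE) !sw_desc -leNgt e1 e2 e3 e4.
  have -> : sw (-1) 1 2 = 2 by [].
  have -> : sw (-1) 1 1 = - 1 by [].
  by rewrite -/(u _) -/(u _) ?uN; exact: a1.
have k2 : ~~ asc s (permc d w).
  rewrite (ascE _ r sE) !dw_desc -leNgt e1 e2 e3 e4.
  have -> : sw 1 2 1 = 2 by [].
  have -> : sw 1 2 (-1) = - 2 by [].
  by rewrite -/(u _) -/(u _) ?uN; exact: a2.
have W3 := WWM dS W1; have W4 := WWM sS W2.
have k3 : ~~ asc s (permc d (permc s w)).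
  rewrite (ascE _ r sE) !dw_desc !sw_desc -leNgt e1 e2 e3 e4.
  have -> : sw (-1) 1 (sw 1 2 1) = 2 by [].
  have -> : sw (-1) 1 (sw 1 2 (-1)) = - 2 by [].
  by rewrite -/(u _) -/(u _) ?uN; exact: a2.
have k4 : ~~ asc d (permc s (permc d w)).
  rewrite (ascE _ r' dE) !sw_desc !dw_desc -leNgt e1 e2 e3 e4.
  have -> : sw 1 2 (sw (-1) 1 2) = 1 by [].
  have -> : sw 1 2 (sw (-1) 1 1) = - 2 by [].
  by rewrite -/(u _) -/(u _) ?uN; exact: a4.
have k5 : ~~ asc d (permc s (permc d (permc s w))).
  rewrite (ascE _ r' dE) !sw_desc !dw_desc !sw_desc -leNgt e1 e2 e3 e4.
  have -> : sw (-1) 1 (sw 1 2 (sw (-1) 1 2)) = - 1 by [].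
  have -> : sw (-1) 1 (sw 1 2 (sw (-1) 1 1)) = - 2 by [].
  by rewrite -/(u _) -/(u _) ?uN; exact: a5.
have k6 : ~~ asc s (permc d (permc s (permc d w))).
  rewrite (ascE _ r sE) !dw_desc !sw_desc !dw_desc -leNgt e1 e2 e3 e4.
  have -> : sw 1 2 (sw (-1) 1 (sw 1 2 1)) = 1 by [].
  have -> : sw 1 2 (sw (-1) 1 (sw 1 2 (-1))) = - 1 by [].
  by rewrite -/(u _) -/(u _) ?uN; exact: a6.
have l1 := lt1 sS wW sd; have l2 := lt1 dS wW dd.
have l3 := ltn_trans (lt1 dS W1 k1) l1; have l4 := ltn_trans (lt1 sS W2 k2) l2.
have l5 := ltn_trans (lt1 sS W3 k3) l3; have l6 := ltn_trans (lt1 dS W4 k4) l4.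
rewrite (IH l1 W1 dS k1) (IH l3 W3 sS k3) (IH l5 (WWM sS W3) dS k5).
rewrite (IH l2 W2 sS k2) (IH l4 W4 dS k4) (IH l6 (WWM dS W4) sS k6) b4 //.
congr (T d (T s (T d (T s (rho _ v))))); apply: eq_apZ => x.
by rewrite !apZM !(sE, dE) e1 e2 e3 e4 sw01_4.
Qed.
End Dihedral.

(* Two left descents of [w] generate a dihedral group whose longest element is a
   left factor of [w], so the braid relation compares the two factorisations. *)
Lemma rho_desc w s v : w \in W -> s \in S -> ~~ asc s w -> rho w v = T s (rho (permc s w) v).
Proof.
have [m] := ubnP (len w); elim: m w s v => [w s v|m IH w s v hm wW sS sd]; first by rewrite ltn0.
have w1 := desc_neq1 sS sd.
have [dS dd] := descentP wW w1; rewrite rho_descent //; move: (descent w) dS dd => d dS dd.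
have IH' u e : (len u < len w)%N -> u \in W -> e \in S -> ~~ asc e u ->
    rho u v = T e (rho (permc e u) v).
  by move=> lt; apply: IH; exact: leq_trans lt hm.
have [p [q [r sE]]] := gensP hnN sS; have [p' [q' [r' dE]]] := gensP hnN dS.
case: (pselect (p <> p' \/ q <> q')) => [ne|eq]; last first.
  have [ep eq'] : p = p' /\ q = q' by split; apply: contrapT => h; apply: eq; [left | right].
  by have -> : s = d by apply: eq_apZ => x; rewrite sE dE ep eq'.
case: (root_pairs r r' ne) => -[rl|rl].
- exact/esym/(dihedral2 wW sS dS r r' sE dE sd dd IH' rl).
- exact: (dihedral2 wW dS sS r' r dE sE dd sd IH' rl).
- exact/esym/(dihedral3 wW sS dS r r' sE dE sd dd IH' rl).
- exact: (dihedral3 wW dS sS r' r dE sE dd sd IH' rl).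
- exact/esym/(dihedral4 wW sS dS r r' sE dE sd dd IH' rl).
- exact: (dihedral4 wW dS sS r' r dE sE dd sd IH' rl).
Qed.

Lemma rho_asc w s v : w \in W -> s \in S -> asc s w -> rho (permc s w) v = T s (rho w v).
Proof.
move=> wW sS sa; rewrite (@rho_desc (permc s w) s v) ?WWM ?SS //.
exact: Sasc_perm.
Qed.

Lemma rho_gen s v : s \in S -> rho s v = T s v.
Proof.
move=> sS; have := @rho_asc 1%g s v WW1 sS (asc_1 hnN sS).
by rewrite /permc mul1g rho_1.
Qed.

Lemma W_ind (Q : P n -> Prop) : Q 1%g ->
  (forall s w, s \in S -> w \in W -> ~~ asc s w -> Q (permc s w) -> Q w) ->
  forall w, w \in W -> Q w.
Proof.
move=> Q1 QS w; have [m] := ubnP (len w); elim: m w => [w|m IH w hm wW]; first by rewrite ltn0.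
case: (eqVneq w 1%g) => [->//|w1]; have [s sS sd] := W_desc wW w1.
apply: (QS s) => //; apply: IH; last exact: WWM.
by move: hm; rewrite (len_desc sS wW sd).
Qed.

Lemma rho_heckeRep (x : F) : c = x - x^-1 -> heckeRep W S len x rho.
Proof.
move=> cE; split; last split.
- move=> w wW a u v; move: w wW a u v; apply: W_ind => [a u v|s w sS wW sd IH a u v].
    by rewrite !rho_1.
  by rewrite !(rho_desc _ wW sS sd) IH Tlin.
- exact: rho_1.
- move=> s w v sS wW; rewrite (rho_gen _ sS) len_ltE //; case: ifPn => sa.
    by rewrite rho_asc.
  by rewrite (rho_desc _ wW sS sa) Tquad // cE.
Qed.

Lemma rho_closed (L : V -> Prop) : (forall s v, s \in S -> L v -> L (T s v)) ->
  forall w v, w \in W -> L v -> L (rho w v).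
Proof.
move=> LT w v wW Lv; move: w wW; apply: W_ind => [|s w sS wW sd IH]; first by rewrite rho_1.
by rewrite (rho_desc _ wW sS sd); exact: LT.
Qed.
End Matsumoto.

(** * Determination by generators, and Laurent coefficients *)

Lemma heckeRep_uniq (t : CoxType) (n : nat) (hn : (2 <= n)%N) (F : fieldType) (x : F) (V : lmodType F)
    (rho1 rho2 : P n -> V -> V) :
  heckeRep (WW t n) (Sgen t n) (lenW t n) x rho1 ->
  heckeRep (WW t n) (Sgen t n) (lenW t n) x rho2 ->
  (forall s, s \in Sgen t n -> rho1 s =1 rho2 s) ->
  forall w, w \in WW t n -> rho1 w =1 rho2 w.
Proof.
move=> [_ [r11 r1S]] [_ [r21 r2S]] E; apply: (W_ind hn) => [v|s w sS wW sd IH v].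
  by rewrite r11 r21.
have sa := Sdesc_perm hn sS wW sd; have swW := WWM hn sS wW.
have := r1S s (permc s w) v sS swW; have := r2S s (permc s w) v sS swW.
by rewrite (len_ltE hn sS swW) sa (SS hn _ sS) => <- <-; rewrite E // IH.
Qed.

Lemma xK_neq0 : xK != 0.
Proof. by rewrite /xK tofrac_eq0 polyX_eq0. Qed.

Lemma laurentD f g : isLaurent f -> isLaurent g -> isLaurent (f + g).
Proof.
move=> [k [p ->]] [l [r ->]]; exists (k + l)%N, (p * 'X^l + r * 'X^k).
rewrite addf_div ?expf_neq0 ?xK_neq0 // exprD.
by rewrite tofracD !tofracM !tofracXn.
Qed.

Lemma laurentM f g : isLaurent f -> isLaurent g -> isLaurent (f * g).
Proof.
move=> [k [p ->]] [l [r ->]]; exists (k + l)%N, (p * r).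
by rewrite mulf_div tofracM exprD.
Qed.

Lemma laurentP (p : {poly int}) : isLaurent (FracField.tofrac p).
Proof. by exists 0%N, p; rewrite expr0 divr1. Qed.

Lemma laurentX : isLaurent xK. Proof. exact: laurentP. Qed.

Lemma laurentXV : isLaurent xK^-1.
Proof. by exists 1%N, 1; rewrite tofrac1 mul1r expr1. Qed.

Lemma laurentN f : isLaurent f -> isLaurent (- f).
Proof.
move=> h; rewrite -mulN1r; apply: laurentM => //.
by have := laurentP (-1); rewrite tofracN tofrac1.
Qed.

(** * Existence and uniqueness of the two module structures *)

Section Module.
Variables (t : CoxType) (n : nat).
Hypothesis hn : (2 <= n)%N.
Let hnN : (2 <= n <= n.*2)%N. Proof. lia. Qed.
Variables (eA eD : K).
Let a : K := xK - xK^-1.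
Hypotheses (qA : eA * eA = 1 + a * eA) (qD : eD * eD = 1 + a * eD).

Notation V := (Vmod t n).
Notation S := (Sgen t n).
Notation cj s z := (permc s (permc z s)).

Definition mkG z (h : z \in Gset t n) : Gt t n := exist _ z h.

(** M is the case (eA, eD) = (-1/x, x) and N the case (x, -1/x); both scalars are roots of the
    quadratic relation, which is what the construction needs. *)
Definition rulesG (rho : P n -> V -> V) : Prop :=
  forall s z, s \in S -> z \in Gset t n ->
    (AscLt t n s z -> rho s (bM t n z) = bM t n (cj s z)) /\
    (DesLt t n s z -> rho s (bM t n z) = bM t n (cj s z) + a *: bM t n z) /\
    (AscEq n s z -> rho s (bM t n z) = eA *: bM t n z) /\
    (DesEq n s z -> rho s (bM t n z) = eD *: bM t n z).

Definition zkind (s z : P n) : kind :=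
  if `[< DesEq n s z >] then KD else if `[< AscEq n s z >] then KA
  else if `[< AscLt t n s z >] then KU else KL.

Lemma zkindE s z p q : s \in S -> z \in Gset t n -> groot t n p q -> apZ s =1 sw p q ->
  zkind s z = knd n p q (apZ z).
Proof.
move=> sS zG r sE; rewrite /zkind /knd /kv.
rewrite (propext (DesEqP hn zG r sE)) (propext (AscEqP hn zG r sE)).
rewrite (propext (AscLtP hn sS zG r sE)) !asboolb /kDE /kAE.
case: ifP => // kd; case: ifP => // ka.
rewrite (_ : asbool _ = (apZ z p < apZ z q)) //.
apply/asboolP/idP => [[]|h] //; split; [exact: h | exact: negbT kd | exact: negbT ka].
Qed.

Lemma zkindP s z : s \in S -> z \in Gset t n ->
  match zkind s z with
  | KD => DesEq n s z
  | KA => AscEq n s z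
  | KU => AscLt t n s z
  | KL => DesLt t n s z
  end.
Proof.
move=> sS zG; have [p [q [r sE]]] := gensP hnN sS.
have := zkindE sS zG r sE; rewrite {2}/zkind.
case: asboolP => // nD; case: asboolP => // nA; case: asboolP => // nU _.
apply/(DesLtP hn sS zG r sE).
move: nD nA nU; rewrite (propext (DesEqP hn zG r sE)) (propext (AscEqP hn zG r sE)).
rewrite (propext (AscLtP hn sS zG r sE)) => /negP nD /negP nA nU.
split=> //; rewrite ltNge le_eqVlt negb_or; apply/andP; split.
  by apply/eqP => /(@apZ_inj _ z) e; have := groot_lt r; rewrite e ltxx.
by apply/negP => lt; apply: nU.
Qed.

Lemma cj_G s z : s \in S -> z \in Gset t n -> zkind s z = KU \/ zkind s z = KL ->
  cj s z \in Gset t n.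
Proof.
move=> sS zG k; have [p [q [r sE]]] := gensP hnN sS.
have := zkindP sS zG; case: k => ->.
  by move=> /(AscLtP hn sS zG r sE)[_ nD nA]; exact: (conj_Gset hn zG r sE).
by move=> /(DesLtP hn sS zG r sE)[_ nD nA]; exact: (conj_Gset hn zG r sE).
Qed.

Lemma cjK s z : s \in S -> cj s (cj s z) = z.
Proof. by move=> sS; rewrite /permc -!mulgA (gens_invol hnN sS) mulg1 mulgA (gens_invol hnN sS) mul1g. Qed.

Lemma apZ_cj (s z : P n) p q : apZ s =1 sw p q -> apZ (cj s z) = cjf p q (apZ z).
Proof. by move=> sE; apply/funext => x; rewrite (apZ_conj _ _ sE). Qed.

Lemma zkind_flip s z : s \in S -> z \in Gset t n ->
  (zkind s z = KU -> zkind s (cj s z) = KL) /\ (zkind s z = KL -> zkind s (cj s z) = KU).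
Proof.
move=> sS zG; have [p [q [r sE]]] := gensP hnN sS.
have [h1 h2] := knd_flip hn (Gset_gcond hn zG) r; have kE := zkindE sS zG r sE.
split=> k; have cG : cj s z \in Gset t n by apply: cj_G => //; rewrite k; [left + right].
  by rewrite (zkindE sS cG r sE) (apZ_cj _ sE) h1 // -kE.
by rewrite (zkindE sS cG r sE) (apZ_cj _ sE) h2 // -kE.
Qed.

(** Coordinates viewed as a function on maps of the integers, so that [op] applies; the value 0
    outside the index set is a filler, since [op] never leads out of it. *)
Definition lift (v : V) (f : int -> int) : K :=
  if [pick y : Gt t n | `[< apZ (val y) = f >]] is Some y then v y else 0.

Lemma liftE v y : lift v (apZ (val y)) = v y.
Proof.
rewrite /lift; case: pickP => [x /asboolP e|/(_ y)]; last by move=> /asboolP.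
by congr (v _); apply: val_inj; apply: eq_apZ => i; rewrite e.
Qed.

Definition inG (f : int -> int) := exists y : Gt t n, apZ (val y) = f.

Lemma inG_gcond f : inG f -> gcond n f.
Proof. by move=> [y <-]; exact: (Gset_gcond hn (valP y)). Qed.

Lemma inG_cjf p q f : groot t n p q -> inG f -> knd n p q f = KU \/ knd n p q f = KL ->
  inG (cjf p q f).
Proof.
move=> r [y <-] k; have [s sS sE] := groot_gens hnN r.
have cG : cj s (val y) \in Gset t n.
  by apply: cj_G => //; [exact: valP | rewrite (zkindE sS (valP y) r sE)].
by exists (mkG cG); rewrite /= (apZ_cj _ sE).
Qed.

Lemma op_extG p q F G : groot t n p q -> (forall f, inG f -> F f = G f) ->
  forall f, inG f -> op n a eA eD p q F f = op n a eA eD p q G f.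
Proof.
move=> r E f fG; rewrite /op; case k : (knd n p q f); rewrite ?E //.
- by apply: inG_cjf => //; left.
- by apply: inG_cjf => //; right.
Qed.

Definition root_of (s : P n) : int * int :=
  match pselect (exists pq : int * int, groot t n pq.1 pq.2 /\ apZ s =1 sw pq.1 pq.2) with
  | left h => projT1 (cid h)
  | right _ => (0, 0)
  end.

Lemma root_ofE s p q : groot t n p q -> apZ s =1 sw p q -> root_of s = (p, q).
Proof.
move=> r sE; rewrite /root_of; case: pselect => [h|[]]; last by exists (p, q).
case: (cid h) => -[p' q'] /= [r' sE'].
have [-> ->] : p = p' /\ q = q'; last by [].
by apply: (groot_inj r r') => x; rewrite -sE -sE'.
Qed.

Definition Top (s : P n) (v : V) : V :=
  [ffun y : Gt t n => op n a eA eD (root_of s).1 (root_of s).2 (lift v) (apZ (val y)) : K^o].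

Lemma lift_Top s v p q f : groot t n p q -> apZ s =1 sw p q -> inG f ->
  lift (Top s v) f = op n a eA eD p q (lift v) f.
Proof. by move=> r sE [y <-]; rewrite liftE ffunE (root_ofE r sE). Qed.

Lemma Top_lin s : s \in S -> forall (b : K) (u v : V), Top s (b *: u + v) = b *: Top s u + Top s v.
Proof.
move=> sS b u v; apply/ffunP => y; rewrite !ffunE.
have E f : lift (b *: u + v) f = lift v f + b * lift u f.
  rewrite /lift; case: pickP => [x _|_]; first by rewrite !ffunE addrC.
  by rewrite mulr0 addr0.
have -> : lift (b *: u + v) = (fun f => lift v f + b * lift u f) by apply/funext.
by rewrite op_lin addrC.
Qed.

Lemma Top_quad s : s \in S -> forall v, Top s (Top s v) = v + a *: Top s v.
Proof.
move=> sS v; have [p [q [r sE]]] := gensP hnN sS; apply/ffunP => y; rewrite ffunE (root_ofE r sE).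
have yG : inG (apZ (val y)) by exists y.
rewrite (op_extG r (fun f => lift_Top v r sE) yG) op_quad //; last first.
  exact: inG_gcond.
  by exists t.
by rewrite !ffunE (root_ofE r sE) liftE.
Qed.

Lemma Top_braid s s' p q p' q' : s \in S -> s' \in S ->
  groot t n p q -> groot t n p' q' -> apZ s =1 sw p q -> apZ s' =1 sw p' q' ->
  [/\ rel2 p q p' q' -> forall v, Top s (Top s' v) = Top s' (Top s v),
      rel3 n p q p' q' -> forall v, Top s (Top s' (Top s v)) = Top s' (Top s (Top s' v)) &
      rel4 p q p' q' -> forall v, Top s (Top s' (Top s (Top s' v))) = Top s' (Top s (Top s' (Top s v)))].
Proof.
move=> sS sS' r r' sE sE'.
pose o := op n a eA eD p q; pose o' := op n a eA eD p' q'.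
have L v f : inG f -> lift (Top s v) f = o (lift v) f by exact: lift_Top.
have L' v f : inG f -> lift (Top s' v) f = o' (lift v) f by exact: lift_Top.
have X F G : (forall f, inG f -> F f = G f) -> forall f, inG f -> o F f = o G f by exact: op_extG.
have X' F G : (forall f, inG f -> F f = G f) -> forall f, inG f -> o' F f = o' G f by exact: op_extG.
have E v w : (forall f, inG f -> lift v f = lift w f) -> v = w.
  by move=> h; apply/ffunP => y; rewrite -!liftE; apply: h; exists y.
have A1 v f : inG f -> lift (Top s (Top s' v)) f = o (o' (lift v)) f.
  by move=> fG; rewrite L //; apply: X => // g gG; exact: L'.
have A1' v f : inG f -> lift (Top s' (Top s v)) f = o' (o (lift v)) f.
  by move=> fG; rewrite L' //; apply: X' => // g gG; exact: L.
have A2 v f : inG f -> lift (Top s (Top s' (Top s v))) f = o (o' (o (lift v))) f.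
  by move=> fG; rewrite L //; apply: X => // g gG; exact: A1'.
have A2' v f : inG f -> lift (Top s' (Top s (Top s' v))) f = o' (o (o' (lift v))) f.
  by move=> fG; rewrite L' //; apply: X' => // g gG; exact: A1.
have A3 v f : inG f -> lift (Top s (Top s' (Top s (Top s' v)))) f = o (o' (o (o' (lift v)))) f.
  by move=> fG; rewrite (L _ _ fG); apply: X => // g gG; exact: A2'.
have A3' v f : inG f -> lift (Top s' (Top s (Top s' (Top s v)))) f = o' (o (o' (o (lift v)))) f.
  by move=> fG; rewrite (L' _ _ fG); apply: X' => // g gG; exact: A2.
split=> rl v; apply: E => f fG; have fg := inG_gcond fG.
- apply: (etrans (A1 v f fG)); apply: (etrans _ (esym (A1' v f fG))); case: rl => [[d1 d2 d3 d4]|[e1 e2 e3 e4]].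
    exact: (braid2 hn a eA eD r r' d1 d2 d3 d4 fg (lift v)).
  by rewrite /o /o' e1 e2 e3 e4; exact: (braid2D hn a eA eD fg (lift v)).
- apply: (etrans (A2 v f fG)); apply: (etrans _ (esym (A2' v f fG))); case: rl => e tr; rewrite /o /o' e.
  exact: (braid3 hn qA qD tr fg (lift v)).
- apply: (etrans (A3 v f fG)); apply: (etrans _ (esym (A3' v f fG))).
  by case: rl => e1 e2 e3 e4; rewrite /o /o' e1 e2 e3 e4; exact: (braid4 hn qA qD fg (lift v)).
Qed.

Lemma Top_val s v (y : Gt t n) : s \in S ->
  Top s v y = match zkind s (val y) with
  | KD => eD * v y
  | KA => eA * v y
  | KU => lift v (apZ (cj s (val y)))
  | KL => lift v (apZ (cj s (val y))) + a * v y
  end.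
Proof.
move=> sS; have [p [q [r sE]]] := gensP hnN sS.
by rewrite ffunE (root_ofE r sE) /op /= -(zkindE sS (valP y) r sE) -(apZ_cj _ sE) liftE.
Qed.

Lemma lift_cj s v (y : Gt t n) : s \in S -> zkind s (val y) = KU \/ zkind s (val y) = KL ->
  exists2 y', val y' = cj s (val y) & lift v (apZ (cj s (val y))) = v y'.
Proof.
move=> sS k; have cG := cj_G sS (valP y) k; exists (mkG cG) => //.
by rewrite -[cj s (val y)]/(val (mkG cG)) liftE.
Qed.

(** [Top] is defined by coordinates and the rules by images of basis vectors, that is by rows and by
    columns. The two agree because conjugation by s is an involution that exchanges [KU] and
    [KL]. *)
Lemma Top_rules : rulesG Top.
Proof.
move=> s z sS zG; have fl := zkind_flip sS.
have kz := zkindP sS zG.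
have val_cj (y : Gt t n) : (cj s (val y) == z) = (val y == cj s z).
  by apply/eqP/eqP => [<-|->]; rewrite cjK.
have Tv (y : Gt t n) : Top s (bM t n z) y =
    match zkind s (val y) with
    | KD => eD * (val y == z)%:R
    | KA => eA * (val y == z)%:R
    | KU => (val y == cj s z)%:R
    | KL => (val y == cj s z)%:R + a * (val y == z)%:R
    end.
  rewrite (Top_val _ _ sS) [bM t n z y]ffunE; have lc := @lift_cj s (bM t n z) y sS.
  case: (zkind s (val y)) lc => // lc.
    by have [|y' e ->] := lc; [left | rewrite ffunE e val_cj].
  by have [|y' e ->] := lc; [right | rewrite ffunE e val_cj].
have kU : AscLt t n s z -> zkind s z = KU.
  move=> [lt [nD nA]]; rewrite /zkind; do 2 (case: asboolP => // _).
  by case: asboolP => // -[].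
have kL : DesLt t n s z -> zkind s z = KL.
  move=> [lt [nD nA]]; rewrite /zkind; do 2 (case: asboolP => // _).
  by case: asboolP => // -[lt' _]; have := ltn_trans lt lt'; rewrite ltnn.
have kD : DesEq n s z -> zkind s z = KD by move=> h; rewrite /zkind; case: asboolP.
have kA : AscEq n s z -> zkind s z = KA.
  move=> h; have [p [q [r sE]]] := gensP hnN sS; rewrite (zkindE sS zG r sE).
  move: h => /(AscEqP hn zG r sE) h; rewrite /knd /kv.
  have -> : (`|apZ z p| == `|q|) = false.
    by move: h; rewrite /kAE; have [_ qn] := groot_le hn r; clear - qn; move: (apZ z p) (apZ z q) => u v; lia.
  by rewrite -/(kAE n p q (apZ z)) h.
have cz k : zkind s z = k -> (k = KU \/ k = KL) -> zkind s (cj s z) = (if k is KU then KL else KU).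
  by move=> kk; case=> e; rewrite e in kk *; [exact: (fl _ zG).1 | exact: (fl _ zG).2].
have ncj (y : Gt t n) : zkind s (val y) = KU \/ zkind s (val y) = KL ->
    val y == cj s z -> zkind s z = (if zkind s (val y) is KU then KL else KU).
  move=> k /eqP e; have -> : z = cj s (val y) by rewrite e cjK.
  by case: k => k; rewrite k; [exact: (fl _ (valP y)).1 | exact: (fl _ (valP y)).2].
split; [|split; [|split]] => h; apply/ffunP => y; rewrite Tv; rewrite !ffunE.
- have k := kU h; have k' := cz _ k (or_introl erefl).
  case ky : (zkind s (val y)).
  + case: eqP => [e|_]; first by rewrite e k in ky.
    case: eqP => [e|_]; first by rewrite e k' in ky.
    by rewrite mulr0.
  + case: eqP => [e|_]; first by rewrite e k in ky.
    case: eqP => [e|_]; first by rewrite e k' in ky.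
    by rewrite mulr0.
  + by [].
  + case: (val y =P z) => [e|_]; first by rewrite e k in ky.
    by rewrite mulr0 addr0.
- have k := kL h; have k' := cz _ k (or_intror erefl).
  case ky : (zkind s (val y)).
  + case: (val y =P z) => [e|_]; first by rewrite e k in ky.
    case: eqP => [e|_]; first by rewrite e k' in ky.
    by rewrite mulr0 scaler0 addr0.
  + case: (val y =P z) => [e|_]; first by rewrite e k in ky.
    case: eqP => [e|_]; first by rewrite e k' in ky.
    by rewrite mulr0 scaler0 addr0.
  + case: (val y =P z) => [e|_]; first by rewrite e k in ky.
    by rewrite scaler0 addr0.
  + by [].
- have k := kA h; case ky : (zkind s (val y)).
  + case: (val y =P z) => [e|_]; first by rewrite e k in ky.
    by rewrite mulr0 scaler0.
  + by [].
  + case: (boolP (val y == cj s z)) => e.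
      by have := ncj y (or_introl ky) e; rewrite k ky.
    by case: (val y =P z) => [e'|_]; [rewrite e' k in ky | rewrite scaler0].
  + case: (boolP (val y == cj s z)) => e.
      by have := ncj y (or_intror ky) e; rewrite k ky.
    by case: (val y =P z) => [e'|_]; [rewrite e' k in ky | rewrite scaler0 add0r mulr0].
- have k := kD h; case ky : (zkind s (val y)).
  + by [].
  + case: (val y =P z) => [e|_]; first by rewrite e k in ky.
    by rewrite mulr0 scaler0.
  + case: (boolP (val y == cj s z)) => e.
      by have := ncj y (or_introl ky) e; rewrite k ky.
    by case: (val y =P z) => [e'|_]; [rewrite e' k in ky | rewrite scaler0].
  + case: (boolP (val y == cj s z)) => e.
      by have := ncj y (or_intror ky) e; rewrite k ky.
    by case: (val y =P z) => [e'|_]; [rewrite e' k in ky | rewrite scaler0 add0r mulr0].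
Qed.

Hypotheses (lA : isLaurent eA) (lD : isLaurent eD).

Lemma module_exists : exists rho, isHrep t n rho /\ rulesG rho.
Proof.
pose R := rho t Top; exists R.
have RE s v : s \in S -> R s v = Top s v.
  by move=> sS; exact: (rho_gen hn Top_braid).
split; first split.
- exact: (rho_heckeRep hn Top_lin Top_quad Top_braid).
- apply: (rho_closed hn Top_braid) => s v sS vL y.
  have la : isLaurent a by apply: laurentD; [exact: laurentX | apply/laurentN/laurentXV].
  rewrite (Top_val _ _ sS); have lc := @lift_cj s v y sS.
  case: (zkind s (val y)) lc => lc.
  + exact: laurentM.
  + exact: laurentM.
  + by have [|y' e ->] := lc; [left | exact: vL].
  + have [|y' e ->] := lc; first by right.
    by apply: laurentD; [exact: vL | apply: laurentM => //; exact: vL].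
- by move=> s z sS zG; rewrite !RE //; exact: Top_rules.
Qed.

Lemma bM_expand (v : V) : v = \sum_(y : Gt t n) v y *: bM t n (val y).
Proof.
apply/ffunP => x; rewrite sum_ffunE (bigD1 x) //= !ffunE eqxx big1 ?addr0.
  by rewrite /GRing.scale /= mulr1.
by move=> y yx; rewrite !ffunE (inj_eq val_inj) eq_sym (negbTE yx) scaler0.
Qed.

Lemma module_unique rho1 rho2 : isHrep t n rho1 -> rulesG rho1 -> isHrep t n rho2 -> rulesG rho2 ->
  forall w, w \in WW t n -> rho1 w =1 rho2 w.
Proof.
move=> [H1 _] R1 [H2 _] R2; apply: (heckeRep_uniq hn H1 H2) => s sS v.
have lin (rho : P n -> V -> V) : heckeRep (WW t n) S (lenW t n) xK rho -> forall v : V,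
    rho s v = \sum_(y : Gt t n) v y *: rho s (bM t n (val y)).
  move=> [L _] u; have sW := WWS hn sS.
  have r0 : rho s 0 = 0.
    have := L s sW (-1) 0 0; rewrite scaler0 addr0 scaleN1r => e.
    by rewrite {1}e addNr.
  rewrite {1}(bM_expand u); elim/big_rec2: _ => // y u1 u2 _ <-.
  by rewrite L.
rewrite (lin _ H1) (lin _ H2); apply: eq_bigr => y _; congr (_ *: _).
have := R1 s (val y) sS (valP y); have := R2 s (val y) sS (valP y).
have := zkindP sS (valP y); case: (zkind s (val y)) => k [U [L [A D]]] [U' [L' [A' D']]].
- by rewrite D // D'.
- by rewrite A // A'.
- by rewrite U // U'.
- by rewrite L // L'.
Qed.

End Module.

Lemma nat_min (T : Type) (Q : T -> Prop) (m : T -> nat) :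
  (exists x, Q x) -> exists2 x, Q x & forall y, Q y -> (m x <= m y)%N.
Proof.
move=> [x0 Qx0]; apply: contrapT => H.
suff none : forall k x, Q x -> (m x < k)%N -> False by exact: (none (m x0).+1 x0).
elim=> // k IH x Qx mx; apply: H; exists x => // y Qy.
by rewrite leqNgt; apply/negP => lt; apply: (IH y Qy); exact: leq_trans lt mx.
Qed.

(** * When the commutant of a matrix algebra is symmetric *)

Section SymmetricAlgebras.
Variables (F : realFieldType) (d : nat).
Implicit Types (a b c t s v : 'M[F]_d) (x y w : 'cV[F]_d).

Lemma mxsq_eq0 (p q : nat) (m : 'M[F]_(p, q)) : \tr (m^T *m m) = 0 -> m = 0.
Proof.
move=> /eqP h; apply/matrixP => i j; rewrite mxE; apply/eqP; move: h.
have E : \tr (m^T *m m) = \sum_j \sum_i m i j ^+ 2.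
  by apply: eq_bigr => k _; rewrite mxE; apply: eq_bigr => l _; rewrite mxE expr2.
rewrite E psumr_eq0 => [/allP/(_ j)|k _]; last by apply: sumr_ge0 => l _; exact: sqr_ge0.
rewrite mem_index_enum => /(_ isT) /=; rewrite psumr_eq0 => [/allP/(_ i)|l _]; last exact: sqr_ge0.
by rewrite mem_index_enum sqrf_eq0 => /(_ isT).
Qed.

Lemma colsq_eq0 x : (x^T *m x) 0 0 = 0 -> x = 0.
Proof. by move=> h; apply: mxsq_eq0; rewrite /mxtrace big_ord1. Qed.

(** The determinant is a polynomial in l with value 1 at 0, so it does not vanish at all positive
    integers. *)
Lemma det_perturb (k : nat) (Z : 'M[F]_k) : exists2 l : F, l != 0 & \det (1%:M + l *: Z) != 0.
Proof.
pose p : {poly F} := \det (1%:M + 'X *: map_mx polyC Z).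
have pE l : p.[l] = \det (1%:M + l *: Z).
  rewrite -horner_evalE /p -det_map_mx; congr (\det _); apply/matrixP => i j.
  rewrite !mxE /= ?horner_evalE ?/horner_eval hornerD hornerM hornerX hornerC.
  by case: (i == j); rewrite ?mulr1n ?mulr0n ?hornerE.
have p0 : p != 0.
  apply: contraTneq (oner_neq0 F) => e; have := pE 0.
  by rewrite e horner0 scale0r addr0 det1 => <-; rewrite eqxx.
have [i ni] : exists i : nat, ~~ root p i.+1%:R.
  apply: contrapT => H.
  have all_root : all (root p) [seq i.+1%:R | i <- iota 0 (size p)].
    by apply/allP => r /mapP[i _ ->]; apply: contrapT => /negP ni; apply: H; exists i.
  have uq : uniq [seq i.+1%:R : F | i <- iota 0 (size p)].
    by rewrite map_inj_uniq ?iota_uniq // => i j /eqP; rewrite eqr_nat => /eqP[].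
  by have := max_poly_roots p0 all_root uq; rewrite size_map size_iota ltnn.
by exists i.+1%:R; [rewrite pnatr_eq0 | rewrite -pE].
Qed.

(** Freeness is an open condition: in the coordinates dual to X the perturbed family has the matrix
    1 + l Z. *)
Lemma free_perturb (V : vectType F) (k : nat) (X : k.-tuple V) (Y : 'I_k -> V) : free X ->
  exists2 l : F, l != 0 & free [tuple X`_i + l *: Y i | i < k].
Proof.
move=> fX; pose Z := \matrix_(i < k, j < k) coord X j (Y i).
have [l l0 dl] := det_perturb Z; exists l => //; apply/freeP => c Hc.
pose C := \row_i c i.
suff C0 : C = 0 by move=> i; have /matrixP/(_ 0 i) := C0; rewrite !mxE.
have U : 1%:M + l *: Z \in unitmx by rewrite unitmxE unitfE.
suff CZ : C *m (1%:M + l *: Z) = 0 by rewrite -[C](mulmxK U) CZ mul0mx.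
apply/rowP => j; rewrite !mxE.
have := congr1 (coord X j) Hc; rewrite linear0 linear_sum /= => e.
rewrite -[RHS]e; apply: eq_bigr => i _; rewrite linearZ /= !mxE; congr (_ * _).
by rewrite nth_mktuple linearD linearZ /= (coord_free _ _ fX) eq_sym.
Qed.

Variable A : {vspace 'M[F]_d}.
Hypothesis AM : forall a b, a \in A -> b \in A -> a *m b \in A.

Definition symA : {vspace 'M[F]_d} := (A :&: lker (linfun (@trmx F d d) - \1%VF)%R)%VS.
Definition altA : {vspace 'M[F]_d} := (A :&: lker (linfun (@trmx F d d) + \1%VF)%R)%VS.

Lemma symAP a : a \in symA = (a \in A) && (a^T == a).
Proof. by rewrite memv_cap memv_ker add_lfunE opp_lfunE id_lfunE lfunE subr_eq0. Qed.

Lemma altAP a : a \in altA = (a \in A) && (a^T == - a).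
Proof. by rewrite memv_cap memv_ker add_lfunE id_lfunE lfunE addr_eq0. Qed.

Definition ad t : 'End('M[F]_d) := linfun (mulmx t) - linfun (mulmxr t).

Lemma adE t s : ad t s = t *m s - s *m t.
Proof. by rewrite /ad add_lfunE opp_lfunE !lfunE. Qed.

Definition cent t : {vspace 'M[F]_d} := (symA :&: lker (ad t))%VS.

Lemma centP t s : s \in cent t = (s \in symA) && (t *m s == s *m t).
Proof. by rewrite memv_cap memv_ker adE subr_eq0. Qed.

Lemma ad_alt t s : t \in symA -> s \in symA -> ad t s \in altA.
Proof.
rewrite !symAP altAP => /andP[tA /eqP tT] /andP[sA /eqP sT]; rewrite adE.
by rewrite rpredB ?AM //= linearB /= !trmx_mul tT sT opprB.
Qed.

Lemma dim_cent t : (\dim (cent t) + \dim (ad t @: symA) = \dim symA)%N.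
Proof. exact: limg_ker_dim. Qed.

(** An element with the smallest centraliser behaves like a regular one. Let b = [s, v]. If b were
    not in the image of [ad t], then for t' = t + l s the image of [ad t'] would contain a perturbed
    basis of the image of [ad t] together with b = [t', v] / l, against minimality. So b = [t, a]
    for some a; b commutes with t, hence tr (b b) = tr (b [t, a]) = 0, and b = 0 because b is
    antisymmetric. *)
Lemma cent_comm t : t \in symA ->
  (forall t', t' \in symA -> (\dim (cent t) <= \dim (cent t'))%N) ->
  forall s v, s \in cent t -> v \in cent t -> s *m v = v *m s.
Proof.
move=> tS tmin s v sC vC.
move: (sC) (vC); rewrite !centP => /andP[sS /eqP ts] /andP[vS /eqP tv].
pose b := ad s v.
have bI : b \in (ad t @: symA)%VS.
  apply: contraT => nb; pose I := (ad t @: symA)%VS.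
  have h (i : 'I_(\dim I)) : exists u, u \in symA /\ ad t u = (vbasis I)`_i :> 'M[F]_d.
    have /memv_imgP[u uS ->] : (vbasis I)`_i \in I; last by exists u.
    by apply: vbasis_mem; rewrite mem_nth ?size_tuple.
  pose x i := projT1 (cid (h i)).
  have xS i : x i \in symA by rewrite /x; case: (cid _) => u [].
  have xE i : ad t (x i) = (vbasis I)`_i by rewrite /x; case: (cid _) => u [].
  pose X := [tuple of rcons (vbasis I) b].
  have fX : free X.
    have pX : perm_eq X (b :: vbasis I) by rewrite /X /= perm_rcons.
    rewrite (perm_free pX) free_cons.
    by rewrite (span_basis (vbasisP I)) nb (basis_free (vbasisP I)).
  pose Y (i : 'I_(\dim I).+1) : 'M[F]_d := if insub (i : nat) is Some j then ad s (x j) else 0.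
  have [l l0 fY] := free_perturb Y fX.
  pose t' := t + l *: s; have t'S : t' \in symA by rewrite rpredD ?rpredZ.
  have adt' u : ad t' u = ad t u + l *: ad s u.
    by rewrite !adE /t' mulmxDl mulmxDr -scalemxAl -scalemxAr scalerBr opprD addrACA.
  set Z := [tuple X`_i + l *: Y i | i < (\dim I).+1] in fY.
  have sub : (<<Z>> <= ad t' @: symA)%VS.
    apply/span_subvP => u /tnthP[i ->]; rewrite tnth_mktuple /X /= nth_rcons size_tuple.
    case: ltnP => hi.
      rewrite /Y insubT /= -(xE (Ordinal hi)) -adt'; exact: memv_img.
    have iE : nat_of_ord i = \dim I by apply/eqP; rewrite eqn_leq hi -ltnS ltn_ord.
    have -> : Y i = 0 by rewrite /Y insubN // iE ltnn.
    rewrite iE eqxx scaler0 addr0.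
    have -> : b = l^-1 *: ad t' v.
      by rewrite adt' adE tv subrr add0r scalerA mulVf // scale1r.
    by rewrite memvZ // memv_img.
  have := dimvS sub; rewrite (eqP fY) size_tuple => lt.
  have := tmin _ t'S; rewrite -(leq_add2r (\dim (ad t @: symA))) dim_cent -(dim_cent t') leq_add2l.
  by rewrite leqNgt lt.
have [a aS bE] := memv_imgP bI.
have bt : t *m b = b *m t.
  rewrite /b adE mulmxBr mulmxBl !mulmxA ts tv -!mulmxA tv ts !mulmxA.
  by [].
suff b0 : b = 0 by apply/eqP; rewrite -subr_eq0 -adE -/b b0.
have : b \in altA by exact: ad_alt.
rewrite altAP => /andP[_ /eqP bT]; apply: mxsq_eq0; rewrite bT mulNmx linearN /=.
rewrite {2}bE adE mulmxBr linearB /= !mulmxA -bt -!mulmxA [X in _ - X]mxtrace_mulC.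
by rewrite -!mulmxA mxtrace_mulC -!mulmxA subrr oppr0.
Qed.

(** For t with minimal centraliser Z in Sym A, [ad t] maps Sym A into Alt A, so dim Z >= d. As Z
    consists of commuting symmetric matrices, some vector x is killed by no nonzero element of Z, so
    Z x is the whole space. Then c x = a x for some a in Z, and since c commutes with Z this gives c
    = a, a symmetric matrix. *)
Lemma comm_sym : (\dim altA + d <= \dim symA)%N ->
  forall c, (forall a, a \in A -> a *m c = c *m a) -> c^T = c.
Proof.
move=> dimA c cA.
have [t tS tmin] := nat_min (Q := fun t => t \in symA) (fun t => \dim (cent t))
  (ex_intro _ 0 (mem0v _)).
have Zc := cent_comm tS tmin.
have ZS a : a \in cent t -> a \in A /\ a^T = a.
  by rewrite centP symAP => /andP[/andP[-> /eqP ->]].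
have ZM a b : a \in cent t -> b \in cent t -> a *m b \in cent t.
  move=> aZ bZ; have [aA aT] := ZS a aZ; have [bA bT] := ZS b bZ.
  move: (aZ) (bZ); rewrite !centP !symAP => /andP[_ /eqP ta] /andP[_ /eqP tb].
  by rewrite AM //= trmx_mul aT bT (Zc b a) // eqxx /= mulmxA ta -mulmxA tb mulmxA.
pose ev x : 'Hom('M[F]_d, 'cV[F]_d) := linfun (mulmxr x).
have evE x a : ev x a = a *m x by rewrite lfunE.
pose ann x : {vspace 'M[F]_d} := (cent t :&: lker (ev x))%VS.
have annP x a : a \in ann x = (a \in cent t) && (a *m x == 0).
  by rewrite memv_cap memv_ker evE.
have [x _ xmin] := nat_min (Q := fun _ : 'cV[F]_d => True) (fun x => \dim (ann x))
  (ex_intro _ 0 I).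
(* If a x = 0 but a w is not zero, replacing x by x + a w shrinks the annihilator: for b killing the
   new vector, b x and b a w are orthogonal, as b b a x = 0, and opposite, so both vanish. *)
have ann0 : ann x = 0%VS.
  apply/eqP; rewrite -subv0; apply/subvP => a; rewrite annP memv0 => /andP[aZ /eqP ax].
  have [_ aT] := ZS a aZ; apply: contraT => a0.
  have [w aw] : exists w : 'cV[F]_d, a *m w != 0.
    apply: contrapT => H; move/eqP: a0; apply; apply/matrixP => i j.
    have : a *m (delta_mx j 0 : 'cV[F]_d) = 0.
      by apply: contrapT => /eqP h; apply: H; exists (delta_mx j 0).
    by rewrite -colE => /matrixP/(_ i 0); rewrite !mxE.
  have key b : b \in ann (x + a *m w) -> b *m x = 0 /\ b *m (a *m w) = 0.
    rewrite annP mulmxDr => /andP[bZ /eqP e]; have [_ bT] := ZS b bZ.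
    have e' : b *m x = - (b *m (a *m w)) by apply/eqP; rewrite -addr_eq0 e.
    have bx : b *m x = 0.
      apply: colsq_eq0; rewrite {2}e' mulmxN trmx_mul bT.
      have -> : x^T *m b *m (b *m (a *m w)) = (b *m (b *m (a *m x)))^T *m w.
        rewrite !trmx_mul aT bT !mulmxA; congr (_ *m w).
        by rewrite -[LHS]mulmxA (Zc b a) // !mulmxA -[x^T *m b *m a]mulmxA (Zc b a) // !mulmxA.
      by rewrite ax !mulmx0 trmx0 mul0mx oppr0 mxE.
    by split=> //; move: e; rewrite bx add0r.
  have sub : (ann (x + a *m w)%R <= ann x)%VS.
    by apply/subvP => b bA; rewrite annP (key b bA).1 eqxx andbT; move: bA; rewrite annP => /andP[].
  have := xmin (x + a *m w) I; rewrite (geq_leqif (dimv_leqif_sup sub)) => /subvP/(_ a).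
  rewrite annP aZ ax eqxx => /(_ isT) /key[_ e']; move/eqP: aw; case; apply: colsq_eq0.
  by rewrite trmx_mul aT -mulmxA e' mulmx0 mxE.
have dimZ : (d <= \dim (cent t))%N.
  have sub : (ad t @: symA <= altA)%VS by apply/subvP => u /memv_imgP[s sS ->]; exact: ad_alt.
  rewrite -(leq_add2r (\dim (ad t @: symA))) dim_cent; apply: leq_trans dimA.
  by rewrite addnC leq_add2r dimvS.
have full : (ev x @: cent t)%VS = fullv.
  apply/eqP; rewrite eqEdim subvf /= dimvf /dim /= muln1.
  have := limg_ker_dim (ev x) (cent t); rewrite -/(ann x) ann0 dimv0 add0n => ->.
  exact: dimZ.
have [a aZ ca] : exists2 a, a \in cent t & c *m x = a *m x.
  have /memv_imgP[a aZ e] : c *m x \in (ev x @: cent t)%VS by rewrite full memvf.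
  by exists a => //; rewrite e evE.
suff -> : c = a by have [] := ZS a aZ.
apply/matrixP => i j; have /memv_imgP[b bZ e] : (delta_mx j 0 : 'cV[F]_d) \in (ev x @: cent t)%VS.
  by rewrite full memvf.
have [bA _] := ZS b bZ.
have : c *m (delta_mx j 0 : 'cV[F]_d) = a *m delta_mx j 0.
  by rewrite e evE mulmxA -cA // -mulmxA ca mulmxA (Zc b a) // -mulmxA.
by rewrite -!colE => /matrixP/(_ i 0); rewrite !mxE.
Qed.

End SymmetricAlgebras.

(** * Projections and adjoints for an anisotropic form *)

Section Orthogonality.
Variables (F : fieldType) (V : vectType F) (B : V -> V -> F).
Hypothesis Bl : forall (a : F) u v w, B (a *: u + v) w = a * B u w + B v w.
Hypothesis Bs : forall u v, B u v = B v u.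
Hypothesis B0 : forall v, B v v = 0 -> v = 0.

Lemma Br (a : F) u v w : B w (a *: u + v) = a * B w u + B w v.
Proof. by rewrite Bs Bl !(Bs w). Qed.

Lemma Bl0 w : B 0 w = 0.
Proof. by have := Bl (-1) 0 0 w; rewrite scaler0 addr0 mulN1r => e; rewrite e addNr. Qed.

Lemma Br0 w : B w 0 = 0. Proof. by rewrite Bs Bl0. Qed.

Lemma BlB u v w : B (u - v) w = B u w - B v w.
Proof. by rewrite -scaleN1r addrC Bl mulN1r addrC. Qed.

Lemma BrB u v w : B w (u - v) = B w u - B w v.
Proof. by rewrite Bs BlB !(Bs w). Qed.

(** Bridges the predicates used in the definition of irreducibility and subspaces with a dimension:
    a space of maximal dimension inside Q is all of Q. *)
Lemma subspace_vspace (Q : V -> Prop) : subspace Q -> exists U : {vspace V}, forall v, v \in U <-> Q v.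
Proof.
move=> [Q0 [QD QZ]].
pose ok (U : {vspace V}) := forall v, v \in U -> Q v.
have ok0 : ok 0%VS by move=> v; rewrite memv0 => /eqP->.
have [U okU Umax] := nat_min (fun U => \dim (fullv : {vspace V}) - \dim U)%N (ex_intro ok 0%VS ok0).
exists U => v; split=> [/okU //|Qv].
have ok' : ok (U + <[v]>)%VS.
  move=> w /memv_addP[u uU [x /vlineP[k ->] ->]]; apply: QD; first exact: okU.
  exact: QZ.
have := Umax _ ok'; have d1 := dimvS (subvf (U + <[v]>)); have d2 := dimvS (addvSl U <[v]>).
move=> d3; have d4 : (\dim (U + <[v]>) <= \dim U)%N.
  move: d1 d2 d3; move: (\dim fullv) (\dim (U + <[v]>)) (\dim U) => x y z; lia.
have /eqP e : U == (U + <[v]>)%VS by rewrite eqEdim addvSl.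
by rewrite e; apply: (subvP (addvSr U <[v]>)); exact: memv_line.
Qed.

(** The form is used over Q(x), so anisotropy takes the place of positivity: the component of x
    orthogonal to the earlier vectors is zero or has a norm that can be inverted. *)
Lemma gram_schmidt (l : seq V) v :
  exists u, u \in <<l>>%VS /\ forall w, w \in <<l>>%VS -> B w (v - u) = 0.
Proof.
elim: l v => [|x l IH] v.
  by exists 0; split=> [|w]; rewrite span_nil ?mem0v // memv0 => /eqP->; rewrite Bl0.
have [u1 [u1l h1]] := IH v; have [u2 [u2l h2]] := IH x.
have sub w : w \in <<l>>%VS -> w \in <<x :: l>>%VS.
  by rewrite span_cons; apply: (subvP (addvSr _ _)).
have xl : x \in <<x :: l>>%VS by rewrite span_cons; apply: (subvP (addvSl _ _)); exact: memv_line.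
pose x' := x - u2.
case: (eqVneq (B x' x') 0) => e.
  have {}e := B0 e; have xE : x = u2 by apply/eqP; rewrite -subr_eq0 -/x' e.
  exists u1; split; first exact: sub.
  move=> w; rewrite span_cons => /memv_addP[y /vlineP[k ->] [z zl ->]].
  by rewrite Bl (h1 z) // xE h1 // mulr0 addr0.
pose c := B x' (v - u1) / B x' x'.
have x'x : B x' x' = B x x' by rewrite {1}/x' BlB (h2 _ u2l) subr0.
exists (u1 + c *: x'); split; first by apply: rpredD; [exact: sub | apply: rpredZ; apply: rpredB => //; exact: sub].
have hl z : z \in <<l>>%VS -> B z (v - (u1 + c *: x')) = 0.
  by move=> zl; rewrite opprD addrA BrB (h1 z zl) -[c *: x']addr0 Br (h2 z zl) Br0 mulr0 addr0 subr0.
move=> w; rewrite span_cons => /memv_addP[y /vlineP[k ->] [z zl ->]].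
rewrite Bl (hl z zl) addr0; suff -> : B x (v - (u1 + c *: x')) = 0 by rewrite mulr0.
have xE : x = x' + u2 by rewrite subrK.
have add y1 z1 : B (x' + y1) z1 = B x' z1 + B y1 z1 by rewrite -{1}[x']scale1r Bl mul1r.
rewrite {1}xE add (hl _ u2l) addr0.
rewrite opprD addrA BrB -[c *: x']addr0 Br Br0 addr0 /c divfK // subrr.
by [].
Qed.

Lemma orth_proj (Q : V -> Prop) : subspace Q ->
  forall v, exists u, Q u /\ forall w, Q w -> B w (v - u) = 0.
Proof.
move=> sQ v; have [U UQ] := subspace_vspace sQ.
have [u [ul h]] := gram_schmidt (vbasis U) v.
move: ul h; rewrite (span_basis (vbasisP U)) => ul h.
by exists u; split=> [|w Qw]; [exact/UQ | apply: h; exact/UQ].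
Qed.

Lemma nondeg v : (forall u, B u v = 0) -> v = 0.
Proof. by move=> h; apply: B0; exact: h. Qed.

Lemma riesz (h : V -> F) : (forall (a : F) u v, h (a *: u + v) = a * h u + h v) ->
  exists r, forall u, h u = B u r.
Proof.
move=> hl.
have h0 : h 0 = 0 by have := hl (-1) 0 0; rewrite scaler0 addr0 mulN1r => e; rewrite e addNr.
have sQ : subspace (fun u => h u = 0).
  split; [|split] => // [x y hx hy|a x hx].
    by rewrite -[x]scale1r hl hx hy mulr0 addr0.
  by rewrite -[a *: x]addr0 hl hx h0 mulr0 addr0.
case: (pselect (forall u, h u = 0)) => [h_0|]; first by exists 0 => u; rewrite h_0 Br0.
move=> /existsNP[u0 hu0]; have [p [hp op]] := orth_proj sQ u0.
pose e := u0 - p.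
have he : h e = h u0.
  by have := hl (-1) p u0; rewrite scaleN1r addrC -/e => ->; rewrite hp mulr0 add0r.
have e0 : B e e != 0.
  apply/eqP => /B0 E; apply: hu0; by rewrite -he E.
have hu0' : h e != 0 by rewrite he; apply/eqP.
exists ((h e / B e e) *: e) => u.
rewrite -[_ *: e]addr0 Br Br0 addr0.
have : h (u - (h u / h e) *: e) = 0.
  have := hl (- (h u / h e)) e u; rewrite scaleNr addrC => ->.
  by rewrite mulNr divfK // addNr.
move=> /op; rewrite -/e BlB -[_ *: e]addr0 Bl Bl0 addr0 => /eqP; rewrite subr_eq0 => /eqP ->.
by field; rewrite hu0' e0.
Qed.

Lemma adjoint (c : V -> V) : (forall (a : F) u v, c (a *: u + v) = a *: c u + c v) ->
  exists c' : V -> V, forall u v, B (c u) v = B u (c' v).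
Proof.
move=> cl; have h v : exists r, forall u, B (c u) v = B u r.
  by apply: riesz => a u w; rewrite cl Bl.
by exists (fun v => projT1 (cid (h v))) => u v; case: (cid (h v)).
Qed.

End Orthogonality.


(** * A criterion for Gelfand models of a Hecke algebra *)

Section Gelfand.
Variables (F : fieldType) (T : finType) (W : {set {perm T}}) (S : seq {perm T})
  (len : {perm T} -> nat) (q : F).
Hypothesis W1 : (1%g : {perm T}) \in W.
Hypothesis Wind : forall Q : {perm T} -> Prop, Q 1%g ->
  (forall s w, s \in S -> w \in W -> (len w < len (permc s w))%N -> Q w -> Q (permc s w)) ->
  forall w, w \in W -> Q w.
Hypothesis SW : forall s, s \in S -> s \in W.
Hypothesis WM : forall s w, s \in S -> (permc s w \in W) = (w \in W).
Hypothesis SK : forall s w, s \in S -> permc s (permc s w) = w.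
Hypothesis Freal : forall (I : finType) (a : I -> F), \sum_i a i ^+ 2 = 0 -> forall i, a i = 0.

Notation hrep := (heckeRep W S len q).
Notation c := (q - q^-1).

Section Rep.
Variables (V : lmodType F) (rho : {perm T} -> V -> V).
Hypothesis H : hrep rho.

Lemma hrepL w a u v : w \in W -> rho w (a *: u + v) = a *: rho w u + rho w v.
Proof. by move=> wW; apply H.1. Qed.

Lemma hrep0 w : w \in W -> rho w 0 = 0.
Proof. by move=> wW; have := hrepL (-1) 0 0 wW; rewrite scaler0 addr0 scaleN1r => e; rewrite e addNr. Qed.

Lemma hrepD w u v : w \in W -> rho w (u + v) = rho w u + rho w v.
Proof. by move=> wW; rewrite -[u]scale1r hrepL // !scale1r. Qed.

Lemma hrepZ w a u : w \in W -> rho w (a *: u) = a *: rho w u.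
Proof. by move=> wW; rewrite -[a *: u]addr0 hrepL // hrep0 // addr0. Qed.

Lemma hrep_asc s w v : s \in S -> w \in W -> (len w < len (permc s w))%N ->
  rho (permc s w) v = rho s (rho w v).
Proof. by move=> sS wW lt; rewrite H.2.2 // lt. Qed.

Lemma gen_invariant (U : V -> Prop) : (forall s u, s \in S -> U u -> U (rho s u)) -> Defs.invariant W rho U.
Proof.
move=> h w u wW Uu; move: w wW; apply: Wind; first by rewrite H.2.1.
by move=> s w sS wW lt Uw; rewrite hrep_asc //; apply: h.
Qed.

Definition Rop (a : {ffun {perm T} -> F^o}) v := \sum_(w in W) (a w : F) *: rho w v.

(** Left multiplication by H_s on coefficient vectors, which thus carry the regular module; by
    [Lop_self] it is self-adjoint for [dot]. *)
Definition Lop (s : {perm T}) (a : {ffun {perm T} -> F^o}) : {ffun {perm T} -> F^o} :=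
  [ffun w => (a (permc s w) : F) + (if (len w < len (permc s w))%N then 0 else c * (a w : F)) : F^o].

Lemma Rop_lin b a1 a2 v : Rop (b *: a1 + a2) v = b *: Rop a1 v + Rop a2 v.
Proof.
rewrite /Rop scaler_sumr -big_split; apply: eq_bigr => w _.
by rewrite !ffunE scalerDl scalerA.
Qed.

Lemma Rop_gen s a v : s \in S -> Rop (Lop s a) v = rho s (Rop a v).
Proof.
move=> sS; rewrite /Rop (big_morph _ (fun u v => hrepD u v (SW sS)) (hrep0 (SW sS))).
rewrite [RHS](eq_bigr (fun w => (a w : F) *: rho (permc s w) v +
   (if (len w < len (permc s w))%N then 0 else c * a w) *: rho w v)) => [|w wW]; last first.
  rewrite hrepZ ?SW // H.2.2 //; case: ifP => _; first by rewrite scale0r addr0.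
  by rewrite scalerDr scalerA mulrC.
rewrite [RHS]big_split [X in _ = X + _](reindex_inj (can_inj (fun w => SK w sS))) /=.
rewrite [X in _ = X + _](eq_bigl (mem W)) => [|w]; last by rewrite /= WM.
rewrite -big_split; apply: eq_bigr => w wW; rewrite !ffunE SK // scalerDl.
by [].
Qed.
End Rep.

Definition dot (a b : {ffun {perm T} -> F^o}) : F := \sum_w (a w : F) * (b w : F).

Lemma dot_lin k a b d : dot (k *: a + b) d = k * dot a d + dot b d.
Proof.
rewrite /dot mulr_sumr -big_split; apply: eq_bigr => w _; rewrite !ffunE.
by rewrite mulrDl -mulrA.
Qed.

Lemma dot_sym a b : dot a b = dot b a.
Proof. by apply: eq_bigr => w _; rewrite mulrC. Qed.

Lemma dot_aniso a : dot a a = 0 -> a = 0.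
Proof.
move=> h; apply/ffunP => w; rewrite ffunE.
by apply: (Freal (a := fun w => a w : F)); rewrite -[RHS]h; apply: eq_bigr => x _; rewrite expr2.
Qed.

Lemma Lop_self s a b : s \in S -> dot (Lop s a) b = dot a (Lop s b).
Proof.
move=> sS; rewrite /dot.
under eq_bigr do rewrite ffunE mulrDl.
under [RHS]eq_bigr do rewrite ffunE mulrDr.
rewrite !big_split; congr (_ + _); last first.
  have e (x y z : F) : x * y * z = y * (x * z) by ring.
  have e0 (x y : F) : 0 * x = y * 0 by rewrite mul0r mulr0.
  by apply: eq_bigr => w _; case: ifP => _; [exact: e0 | exact: e].
rewrite [RHS](reindex_inj (can_inj (fun w => SK w sS))) /=.
by apply: eq_bigr => w _; rewrite SK // mulrC.
Qed.

Section Model.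
Variables (V : vectType F) (rho : {perm T} -> V -> V) (B : V -> V -> F).
Hypothesis H : hrep rho.
Hypothesis Bl : forall (a : F) u v w, B (a *: u + v) w = a * B u w + B v w.
Hypothesis Bs : forall u v, B u v = B v u.
Hypothesis B0 : forall v, B v v = 0 -> v = 0.
Hypothesis Bself : forall s u v, s \in S -> B (rho s u) v = B u (rho s v).
Hypothesis faith : forall a : {perm T} -> F,
  (forall v, \sum_(w in W) a w *: rho w v = 0) -> forall w, w \in W -> a w = 0.
Hypothesis nocomm : forall k : V -> V, (forall (a : F) u v, k (a *: u + v) = a *: k u + k v) ->
  (forall s v, s \in S -> k (rho s v) = rho s (k v)) ->
  (forall u v, B (k u) v = - B u (k v)) -> forall v, k v = 0.

Definition invs (U : {vspace V}) := forall s u, s \in S -> u \in U -> rho s u \in U.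

Lemma invsW U w u : invs U -> w \in W -> u \in U -> rho w u \in U.
Proof. by move=> iU wW uU; apply: (gen_invariant H (U := fun u => u \in U)). Qed.

(** Self-adjoint generators preserve the orthogonal complement of an invariant subspace, so the
    orthogonal projection commutes with them. *)
Lemma equivariant_projection U : invs U -> exists p : V -> V,
  [/\ forall (a : F) u v, p (a *: u + v) = a *: p u + p v,
      forall v, p v \in U, forall v, v \in U -> p v = v,
      forall v, (forall w, w \in U -> B w v = 0) -> p v = 0 &
      forall s v, s \in S -> p (rho s v) = rho s (p v)].
Proof.
move=> iU; have sU : subspace (fun u => u \in U).
  by split; [exact: mem0v | split=> [u v|a u]; [exact: memvD | exact: memvZ]].
have h v := orth_proj Bl Bs B0 sU v.
pose p v := projT1 (cid (h v)).
have pU v : p v \in U by rewrite /p; case: (cid (h v)) => x [].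
have pO v w : w \in U -> B w (v - p v) = 0 by rewrite /p; case: (cid (h v)) => x /= [xU hx]; exact: hx.
have uni v u : u \in U -> (forall w, w \in U -> B w (v - u) = 0) -> p v = u.
  move=> uU uO; apply/eqP; rewrite -subr_eq0; apply/eqP; apply: B0.
  have E : p v - u = (v - u) - (v - p v) by rewrite opprB [RHS]addrC addrA subrK.
  have dU : p v - u \in U by rewrite memvB.
  by rewrite {2}E (BrB Bl Bs) uO // pO // subrr.
exists p; split=> //.
- move=> a u v; apply: uni; first by rewrite memvD // memvZ.
  move=> w wU; have -> : a *: u + v - (a *: p u + p v) = a *: (u - p u) + (v - p v).
    by rewrite scalerBr opprD addrACA.
  by rewrite (Br Bl Bs) !pO // mulr0 addr0.
- by move=> v vU; apply: uni => // w _; rewrite subrr (Br0 Bl Bs).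
- by move=> v vO; apply: uni; [exact: mem0v | move=> w wU; rewrite subr0 vO].
- move=> s v sS; apply: uni; first exact: iU.
  move=> w wU; have -> : rho s v - rho s (p v) = rho s (v - p v).
    by rewrite -!scaleN1r (hrepD H) ?(hrepZ H) ?SW.
  by rewrite -Bself // pO // iU.
Qed.

Definition irrs (U : {vspace V}) := [/\ invs U, U != 0%VS &
  forall U', invs U' -> (U' <= U)%VS -> U' = 0%VS \/ U' = U].

(** A nonzero invariant subspace of least dimension is irreducible; its orthogonal complement in U
    is invariant and smaller. *)
Lemma orthogonal_decomposition U : invs U -> exists k (Us : nat -> {vspace V}),
  [/\ forall j, (j < k)%N -> irrs (Us j) /\ (Us j <= U)%VS,
      forall i j u v, (i < k)%N -> (j < k)%N -> i != j -> u \in Us i -> v \in Us j -> B u v = 0 &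
      forall v, v \in U -> exists2 vs : nat -> V, (forall j, (j < k)%N -> vs j \in Us j) & v = \sum_(j < k) vs j].
Proof.
have [m] := ubnP (\dim U); elim: m U => // m IH U hm iU.
case: (eqVneq U 0%VS) => [->|nU].
  exists 0%N, (fun=> 0%VS); split=> // v; rewrite memv0 => /eqP->; exists (fun=> 0) => //.
  by rewrite big_ord0.
pose ok (X : {vspace V}) := [/\ invs X, X != 0%VS & (X <= U)%VS].
have okU : ok U by split.
have [U1 [i1 n1 s1] min1] := nat_min (fun X => \dim X) (ex_intro ok U okU).
have irr1 : irrs U1.
  split=> // U' i' s'; case: (eqVneq U' 0%VS) => [->|n']; [by left | right].
  apply/eqP; rewrite eqEdim s' min1 //; split=> //; exact: subv_trans s1.
have [U2 U2P] : exists U2 : {vspace V}, forall v, v \in U2 <-> v \in U /\ forall w, w \in U1 -> B w v = 0.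
  apply: subspace_vspace; split; [|split].
  - by split; [exact: mem0v | move=> w _; rewrite (Br0 Bl Bs)].
  - move=> u v [uU uO] [vU vO]; split; first exact: memvD.
    by move=> w wU; rewrite -[u]scale1r (Br Bl Bs) uO // vO // mulr0 addr0.
  - move=> a u [uU uO]; split; first exact: memvZ.
    by move=> w wU; rewrite -[a *: u]addr0 (Br Bl Bs) uO // (Br0 Bl Bs) mulr0 addr0.
have i2 : invs U2.
  move=> s u sS /U2P[uU uO]; apply/U2P; split; first exact: iU.
  by move=> w wU; rewrite -Bself // uO // i1.
have s2 : (U2 <= U)%VS by apply/subvP => v /U2P[].
have lt2 : (\dim U2 < m)%N.
  rewrite -ltnS; apply: leq_trans hm; rewrite ltnS ltn_neqAle dimvS // andbT.
  apply/negP => /eqP e; have /eqP E : U2 == U by rewrite eqEdim s2 e /=.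
  have : vpick U1 = 0.
    apply: B0; have /U2P[_] : vpick U1 \in U2 by rewrite E; apply: (subvP s1); exact: memv_pick.
    by apply; exact: memv_pick.
  by move/eqP; rewrite vpick0 (negbTE n1).
have [k [Us [Us1 Us2 Us3]]] := IH U2 lt2 i2.
exists k.+1, (fun j => if j is j'.+1 then Us j' else U1); split.
- case=> [|j] //; rewrite ltnS => /Us1[a b]; split=> //; exact: subv_trans s2.
- case=> [|i] [|j] u v //; rewrite ?ltnS.
  + by move=> _ jk _ uU /(subvP (Us1 _ jk).2)/U2P[_]; exact.
  + by move=> ik _ _ /(subvP (Us1 _ ik).2)/U2P[_ h] vU; rewrite Bs h.
  + by move=> ik jk ij; apply: Us2.
move=> v vU; have [p [pl pU pid pO pS]] := equivariant_projection i1.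
have [|vs vsU e] := Us3 (v - p v).
  apply/U2P; split; first by rewrite memvB // (subvP s1).
  move=> w wU; suff <- : B w (v - p v - p (v - p v)) = 0.
    have -> : p (v - p v) = 0; last by rewrite subr0.
    have -> : v - p v = (-1) *: p v + v by rewrite scaleN1r addrC.
    by rewrite pl pid // scaleN1r addNr.
  have [u [uU hu]] := orth_proj Bl Bs B0 (V := V) (Q := fun u => u \in U1)
    (conj (mem0v U1) (conj (@memvD _ _ U1) (fun a u => @memvZ _ _ U1 a u))) (v - p v).
  have E : p (v - p v) = u.
    have : p (v - p v - u) = 0 by apply: pO.
    by rewrite -[v - p v - u]addrC -scaleN1r pl pid // scaleN1r addrC => /eqP; rewrite subr_eq0 => /eqP.
  by rewrite E hu.
exists (fun j => if j is j'.+1 then vs j' else p v); first by case.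
by rewrite big_ord_recl /= -e addrC subrK.
Qed.

(** In an orthogonal decomposition into irreducibles, [nocomm] keeps two summands from being
    isomorphic, and [faith] makes every irreducible occur: it embeds into the regular module, whose
    elements act on V without kernel. *)
Theorem gelfand_criterion : gelfandModel W S len q rho.
Proof.
have [|k [Us [Us1 Us2 Us3]]] := @orthogonal_decomposition fullv; first by move=> s u _ _; exact: memvf.
have iU (j : 'I_k) : invs (Us j) by have [[]] := Us1 j (ltn_ord j).
pose rhos (j : 'I_k) w (x : subvs_of (Us j)) : subvs_of (Us j) := vsproj (Us j) (rho w (vsval x)).
have rhosE j w x : w \in W -> vsval (rhos j w x) = rho w (vsval x).
  by move=> wW; rewrite /rhos vsprojK // invsW // subvsP.
have vi (j : 'I_k) : injective (@vsval _ _ (Us j)) := val_inj.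
have hr j : hrep (rhos j).
  split; [|split].
  - move=> w wW a u v; apply: vi; by rewrite rhosE // linearP (hrepL H) // -!rhosE // linearP.
  - by move=> v; apply: vi; rewrite rhosE // H.2.1.
  - move=> s w v sS wW; apply: vi.
    have -> : vsval (rhos j s (rhos j w v)) = rho s (rho w (vsval v)) by rewrite rhosE ?SW // rhosE.
    have pW : permc s w \in W by rewrite WM.
    rewrite H.2.2 //; case: ifP => _; first by rewrite rhosE.
    by rewrite linearD linearZ; congr (_ + _ *: _); apply/esym; exact: rhosE.
have irr j : irreducible W (rhos j).
  have [[_ nz mn] _] := Us1 j (ltn_ord j); split.
    exists (vsproj (Us j) (vpick (Us j))); apply/eqP => /(congr1 vsval).
    by rewrite vsprojK ?memv_pick // linear0 => /eqP; rewrite vpick0 (negbTE nz).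
  move=> Q [Q0 [QD QZ]] Qi.
  have [U' U'P] : exists U' : {vspace V}, forall v, v \in U' <-> exists2 x, Q x & v = vsval x.
    apply: subspace_vspace; split; [|split].
    - by exists 0; rewrite ?linear0.
    - by move=> _ _ [x Qx ->] [y Qy ->]; exists (x + y); rewrite ?linearD //; apply: QD.
    - by move=> a _ [x Qx ->]; exists (a *: x); rewrite ?linearZ //; apply: QZ.
  have [||e|e] := mn U'.
  - move=> s u sS /U'P[x Qx ->]; apply/U'P; exists (rhos j s x); last by rewrite rhosE // SW.
    by apply: Qi; rewrite ?SW.
  - by apply/subvP => _ /U'P[x _ ->]; exact: subvsP.
  - left=> x Qx; have : vsval x \in U' by apply/U'P; exists x.
    by rewrite e memv0 => /eqP h; apply: vi; rewrite h linear0.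
  - right=> x; have : vsval x \in U' by rewrite e subvsP.
    by move=> /U'P[y Qy h]; rewrite (val_inj h : x = y).
have genI (V1 V2 : lmodType F) (r1 : {perm T} -> V1 -> V1) (r2 : {perm T} -> V2 -> V2) (f : V1 -> V2) :
    hrep r1 -> hrep r2 -> (forall (a : F) u v, f (a *: u + v) = a *: f u + f v) ->
    (forall s v, s \in S -> f (r1 s v) = r2 s (f v)) -> intertwiner W r1 r2 f.
  move=> h1 h2 fl fs; split=> // w v wW; move: w wW v; apply: Wind.
    by move=> v; rewrite h1.2.1 h2.2.1.
  by move=> s w sS wW lt IHw v; rewrite (hrep_asc h1) // (hrep_asc h2) // fs // IHw.
exists k, (fun j => subvs_of (Us j) : lmodType F), rhos, (fun j x => vsval x).
split; first by move=> j; split; [exact: hr | exact: irr].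
split; [|split; [|split]].
- move=> i j ij [f [[fl fW] bf]].
  have [p [pl pU pid pO pS]] := equivariant_projection (iU i).
  pose k0 v := vsval (f (vsproj (Us i) (p v))).
  have k0l (a : F) u v : k0 (a *: u + v) = a *: k0 u + k0 v.
    by rewrite /k0 pl linearP fl linearP.
  have k0s s v : s \in S -> k0 (rho s v) = rho s (k0 v).
    move=> sS; rewrite /k0 pS // -rhosE ?SW // -fW ?SW //; congr (vsval (f _)).
    by apply: vi; rewrite rhosE ?SW // !vsprojK // iU.
  have [k1 k1E] := adjoint Bl Bs B0 k0l.
  have k1E' u v : B (k1 u) v = B u (k0 v) by rewrite Bs -k1E Bs.
  have inB u v : (forall w, B w u = B w v) -> u = v.
    move=> h; apply/eqP; rewrite -subr_eq0; apply/eqP; apply: (nondeg B0) => w.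
    by rewrite (BrB Bl Bs) h subrr.
  have k1l (a : F) u v : k1 (a *: u + v) = a *: k1 u + k1 v.
    by apply: inB => w; rewrite (Br Bl Bs) -!k1E (Br Bl Bs).
  have k1s s v : s \in S -> k1 (rho s v) = rho s (k1 v).
    by move=> sS; apply: inB => w; rewrite -k1E -!Bself // -k1E k0s.
  (* An isomorphism between two summands, extended by zero, gives [k0] with square zero. Its
     difference from the adjoint [k1] is a skew-adjoint intertwiner, hence zero; but a self-adjoint
     map with square zero vanishes. *)
  have E v : k0 v = k1 v.
    apply/eqP; rewrite -subr_eq0; apply/eqP; move: v; apply: nocomm.
    + by move=> a u v; rewrite k0l k1l scalerBr opprD addrACA.
    + move=> s v sS; rewrite k0s // k1s //.
      by rewrite -!scaleN1r (hrepD H) ?(hrepZ H) ?SW.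
    + by move=> u v; rewrite (BlB Bl) (BrB Bl Bs) k1E' -k1E opprB.
  have [[_ nz _] _] := Us1 i (ltn_ord i).
  have uU := memv_pick (Us i); set u := vpick (Us i) in uU.
  have nu : u != 0 by rewrite vpick0.
  have : k0 u = 0.
    apply: B0; rewrite {2}E -k1E; suff -> : k0 (k0 u) = 0 by rewrite (Bl0 Bl).
    rewrite {1}/k0 pO ?linear0; last first.
      by move=> w wU; apply: (Us2 i j) => //; exact: subvsP.
    have -> : f 0 = 0 by have := fl (-1) 0 0; rewrite scaler0 addr0 scaleN1r => e; rewrite e addNr.
    by rewrite linear0.
  rewrite /k0 pid //; have f0 : f 0 = 0 by have := fl (-1) 0 0; rewrite scaler0 addr0 scaleN1r => e; rewrite e addNr.
  move=> h; have {}h : f (vsproj (Us i) u) = f 0 by apply: vi; rewrite h f0 linear0.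
  by move/(bij_inj bf)/(congr1 vsval): h; rewrite vsprojK // linear0 => /eqP; rewrite (negbTE nu).
- move=> V' rho' H' [[v' nv'] irr'].
  have R'0 v : Rop rho' 0 v = 0.
    by have := Rop_lin rho' (-1) 0 0 v; rewrite scaler0 addr0 scaleN1r => e; rewrite e addNr.
  have surj u : exists a, Rop rho' a v' = u.
    have [||h|] := irr' (fun u => exists a, Rop rho' a v' = u).
    + split; [|split]; first by exists 0.
      * move=> _ _ [a <-] [b <-]; exists (1 *: a + b); by rewrite Rop_lin scale1r.
      * move=> x _ [a <-]; exists (x *: a + 0); by rewrite Rop_lin R'0 addr0.
    + apply: (gen_invariant H') => s _ sS [a <-]; exists (Lop s a); exact: Rop_gen.
    + case/negP: nv'; apply/eqP; apply: h.
      exists [ffun w => (w == 1%g)%:R : F^o]; rewrite /Rop (bigD1 1%g) //= ffunE eqxx scale1r H'.2.1.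
      by rewrite big1 ?addr0 // => w /andP[_ /negbTE nw]; rewrite ffunE nw scale0r.
    + exact.
  (* V' is the quotient of the regular module by the left ideal N annihilating v'. Representatives
     orthogonal to N are unique, and the generators are self-adjoint, so the section [f0] below is
     equivariant. *)
  pose N (a : {ffun {perm T} -> F^o}) := Rop rho' a v' = 0.
  have sN : subspace N.
    split; [exact: R'0 | split=> [a b ha hb|x a ha]].
      by rewrite /N -[a]scale1r Rop_lin ha hb scaler0 addr0.
    by rewrite /N -[x *: a]addr0 Rop_lin ha R'0 scaler0 addr0.
  have Nst s a : s \in S -> N a -> N (Lop s a).
    by move=> sS h; rewrite /N (Rop_gen H') // h (hrep0 H') // SW.
  have ex u : exists b, Rop rho' b v' = u /\ forall a, N a -> dot a b = 0.
    have [a ha] := surj u; have [d [dN dO]] := orth_proj dot_lin dot_sym dot_aniso sN a.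
    exists (a - d); split=> //.
    have -> : a - d = (-1) *: d + a by rewrite scaleN1r addrC.
    by rewrite Rop_lin dN scaler0 add0r.
  pose f0 u := projT1 (cid (ex u)).
  have f0R u : Rop rho' (f0 u) v' = u by rewrite /f0; case: (cid (ex u)) => x [].
  have f0O u a : N a -> dot a (f0 u) = 0 by rewrite /f0; case: (cid (ex u)) => x /= [xU hx]; exact: hx.
  have f0u u b : Rop rho' b v' = u -> (forall a, N a -> dot a b = 0) -> f0 u = b.
    move=> hb bO; apply/eqP; rewrite -subr_eq0; apply/eqP; apply: dot_aniso.
    have dN : N (f0 u - b).
      have -> : f0 u - b = (-1) *: b + f0 u by rewrite scaleN1r addrC.
      by rewrite /N Rop_lin hb f0R scaleN1r addNr.
    by rewrite (BrB dot_lin dot_sym) f0O // bO // subrr.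
  have f0l (a : F) u v : f0 (a *: u + v) = a *: f0 u + f0 v.
    apply: f0u; first by rewrite Rop_lin !f0R.
    by move=> d dN; rewrite (Br dot_lin dot_sym) !f0O // mulr0 addr0.
  have f0s s u : s \in S -> f0 (rho' s u) = Lop s (f0 u).
    move=> sS; apply: f0u; first by rewrite (Rop_gen H') // f0R.
    by move=> d dN; rewrite -Lop_self // f0O //; exact: Nst.
  (* The representative of v' is a nonzero element of the algebra, so by faithfulness it acts
     nontrivially on some vector of V. *)
  have [v0 nv0] : exists v0, Rop rho (f0 v') v0 != 0.
    apply: contrapT => h.
    have h0 w : w \in W -> f0 v' w = 0.
      apply: (faith (a := fun w => f0 v' w : F)) => v; apply: contrapT => hv.
      by apply: h; exists v; apply/eqP.
    case/negP: nv'; rewrite -(f0R v') /Rop big1 // => w wW; by rewrite h0 // scale0r.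
  pose f u := Rop rho (f0 u) v0.
  have fl (a : F) u v : f (a *: u + v) = a *: f u + f v by rewrite /f f0l Rop_lin.
  have fs s u : s \in S -> f (rho' s u) = rho s (f u).
    by move=> sS; rewrite /f f0s // (Rop_gen H).
  have [vs vsU vsE] := Us3 (f v') (memvf _).
  have [j nj] : exists j : 'I_k, vs j != 0.
    apply: contrapT => h; case/negP: nv0; rewrite -/(f v') vsE big1 // => j _.
    by apply: contrapT => hj; apply: h; exists j; apply/eqP.
  have [p [pl pU pid pO pS]] := equivariant_projection (iU j).
  pose g u := vsproj (Us j) (p (f u)).
  have gl (a : F) u v : g (a *: u + v) = a *: g u + g v by rewrite /g fl pl linearP.
  have g0 : g 0 = 0 by have := gl (-1) 0 0; rewrite scaler0 addr0 scaleN1r => e; rewrite e addNr.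
  have gi : intertwiner W rho' (rhos j) g.
    apply: genI => // s v sS; apply: vi; rewrite rhosE ?SW // /g !vsprojK ?pU //.
    by rewrite fs // pS.
  have gv : g v' != 0.
    apply/eqP => /(congr1 vsval); rewrite /g vsprojK // linear0.
    have -> : f v' = 1 *: vs j + (f v' - vs j) by rewrite scale1r addrC subrK.
    rewrite pl pid ?vsU // scale1r (pO (f v' - vs j)) ?addr0; first by move/eqP; rewrite (negbTE nj).
    move=> w wU; rewrite vsE (bigD1 j) //= addrC addrK.
    rewrite (big_morph (B w) (fun u v => _ : B w (u + v) = B w u + B w v) (Br0 Bl Bs w)) => [|u v].
      rewrite big1 // => i ij; apply: (Us2 j i) => //; [by rewrite eq_sym | exact: vsU].
    by rewrite -{1}[u]scale1r (Br Bl Bs) mul1r.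
  have gker u : g u = 0 -> u = 0.
    move: u; have [||h|h] := irr' (fun u => g u = 0) => //.
    + split; [exact: g0 | split=> [u v hu hv|a u hu]].
        by rewrite -[u]scale1r gl hu hv scaler0 addr0.
      by rewrite -[a *: u]addr0 gl hu g0 scaler0 addr0.
    + by move=> w u wW hu; rewrite gi.2 // hu (hrep0 (hr j)).
    + by case/negP: gv; apply/eqP.
  have ginj : injective g.
    move=> u v e; apply/eqP; rewrite -subr_eq0; apply/eqP; apply: gker.
    have -> : u - v = (-1) *: v + u by rewrite scaleN1r addrC.
    by rewrite gl e scaleN1r addNr.
  have gsur x : exists u, g u = x.
    move: x; have [||h|h] := (irr j).2 (fun x => exists u, g u = x) => //.
    + split; [by exists 0 | split=> [_ _ [u <-] [v <-]|a _ [u <-]]].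
        by exists (1 *: u + v); rewrite gl scale1r.
      by exists (a *: u + 0); rewrite gl g0 addr0.
    + by move=> w _ wW [u <-]; exists (rho' w u); rewrite gi.2.
    + by case/negP: gv; apply/eqP; apply: h; exists v'.
  exists j, g; split=> //.
  exists (fun x => projT1 (cid (gsur x))) => [u|x].
    by apply: ginj; case: (cid (gsur (g u))).
  by case: (cid (gsur x)).
- move=> j; split; first by move=> a u v; rewrite linearP.
  by move=> w v wW; rewrite rhosE.
- move=> v; have [vs vsU vsE] := Us3 v (memvf _).
  exists (fun j => vsproj (Us j) (vs j)); split.
    by rewrite vsE; apply: eq_bigr => j _; rewrite vsprojK // vsU.
  move=> vs' vsE' j; apply: vi; rewrite vsprojK ?vsU //.
  apply/eqP; rewrite -subr_eq0; apply/eqP; apply: B0.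
  have : \sum_(i < k) (vsval (vs' i) - vs i) = 0 by rewrite sumrB -vsE' -vsE subrr.
  move/(congr1 (B (vsval (vs' j) - vs j))); rewrite (Br0 Bl Bs).
  rewrite (big_morph (B _) (fun u v => _ : B _ (u + v) = B _ u + B _ v) (Br0 Bl Bs _)) => [|x y]; last first.
    by rewrite -{1}[x]scale1r (Br Bl Bs) mul1r.
  rewrite (bigD1 j) //= big1 ?addr0 // => i ij.
  by apply: (Us2 j i) => //; rewrite ?memvB ?subvsP ?vsU // eq_sym.
Qed.

End Model.
End Gelfand.

(** * Permutations that commute with an involution *)

Section PermTools.
Variable n : nat.
Implicit Types (g h z : {perm 'I_n}) (B R X : {set 'I_n}) (l : seq ('I_n * 'I_n)).

Definition swaps l : {perm 'I_n} := (\prod_(p <- l) tperm p.1 p.2)%g.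

Lemma swaps_cons p l : swaps (p :: l) = (tperm p.1 p.2 * swaps l)%g.
Proof. by rewrite /swaps big_cons. Qed.

Lemma swaps_out l x : x \notin unzip1 l -> x \notin unzip2 l -> swaps l x = x.
Proof.
elim: l => [|[b y] l IH]; first by rewrite /swaps big_nil perm1.
rewrite /= !inE !negb_or => /andP[xb x1] /andP[xy x2].
by rewrite swaps_cons permM tpermD ?IH //= eq_sym.
Qed.

Lemma swaps_in l b x : uniq (unzip1 l ++ unzip2 l) -> (b, x) \in l ->
  swaps l b = x /\ swaps l x = b.
Proof.
elim: l => // -[c y] l IH; rewrite /= mem_cat inE !negb_or => /andP[/and3P[c1 cy c2]].
rewrite cat_uniq /= negb_or => /and3P[u1 /andP[y1 h2] /andP[y2 u2]].
have u' : uniq (unzip1 l ++ unzip2 l) by rewrite cat_uniq u1 u2 h2.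
rewrite inE swaps_cons => /orP[/eqP[-> ->]|bl].
  by rewrite !permM tpermL tpermR /= !swaps_out.
have [e1 e2] := IH u' bl.
have b1 : b \in unzip1 l by apply/mapP; exists (b, x).
have x2 : x \in unzip2 l by apply/mapP; exists (b, x).
have nb : b != c by apply: contraNneq c1 => <-.
have nby : b != y by apply: contraNneq y1 => <-.
have nx : x != y by apply: contraNneq y2 => <-.
have nxc : x != c by apply: contraNneq c2 => <-.
by rewrite !permM /= !tpermD // eq_sym.
Qed.

Lemma perm_on_disj_comm g h B X : perm_on B g -> perm_on X h -> [disjoint B & X] -> (g * h = h * g)%g.
Proof.
move=> gB hX /pred0P d; apply/permP => x; rewrite !permM.
have nd y : y \in B -> y \in X -> False by move=> yB yX; have := d y; rewrite /= yB yX.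
case: (boolP (x \in B)) => xB.
  have gxB : g x \in B by rewrite perm_closed.
  rewrite (out_perm hX (_ : g x \notin X)) ?(out_perm hX (_ : x \notin X)) //.
    by apply/negP => /(nd _ xB).
  by apply/negP => /(nd _ gxB).
rewrite (out_perm gB xB); case: (boolP (x \in X)) => xX.
  by rewrite (out_perm gB) //; apply/negP => h1; apply: (nd _ h1); rewrite perm_closed.
by rewrite (out_perm hX xX) (out_perm gB xB).
Qed.

Lemma perm_on_inv g B : perm_on B g -> perm_on B g^-1%g.
Proof.
move=> gB; apply/subsetP => x; rewrite !inE; apply: contraR => xB.
by rewrite -{1}(out_perm gB xB) permK.
Qed.

Lemma perm_on_mul g h B : perm_on B g -> perm_on B h -> perm_on B (g * h)%g.
Proof. exact: perm_onM. Qed.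

Lemma perm_on_tperm x y B : x \in B -> y \in B -> perm_on B (tperm x y).
Proof.
move=> xB yB; apply/subsetP => w; rewrite inE; case: tpermP => [->|->|] //.
by rewrite eqxx.
Qed.

(** At most one fixed point is what makes the sign on fixed points trivial for permutations of the
    block B commuting with z. *)
Lemma matching_exists B : exists z, [/\ (z * z = 1)%g, perm_on B z & (#|[set x in B | z x == x]| <= 1)%N].
Proof.
have [m] := ubnP #|B|; elim: m B => // m IH B hm.
case: (leqP #|B| 1) => [hB|/card_gt1P[x [y [xB yB xy]]]].
  exists 1%g; split; [by rewrite mulg1 | exact: perm_on1 |].
  by apply: leq_trans hB; apply: subset_leq_card; apply/subsetP => x; rewrite inE => /andP[].
pose B' := B :\ x :\ y.
have B'B : (#|B'| < #|B|)%N.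
  by apply: proper_card; apply/properP; split; [apply/subsetP => w; rewrite !inE => /and3P[] | exists x; rewrite // !inE eqxx andbF].
have [z [zz zB zf]] := IH B' (leq_trans B'B hm).
have d : [disjoint [set x; y] & B'].
  by rewrite disjoint_subset; apply/subsetP => w; rewrite !inE => /orP[/eqP->|/eqP->]; rewrite eqxx ?andbF.
have tX : perm_on [set x; y] (tperm x y) by apply: perm_on_tperm; rewrite !inE eqxx ?orbT.
have C := perm_on_disj_comm tX zB d.
exists (tperm x y * z)%g; split.
- by rewrite mulgA -[(tperm x y * z * _)%g]mulgA -C !mulgA tperm2 mul1g zz.
- apply: perm_on_mul; first exact: perm_on_tperm.
  by apply: (subset_trans zB); apply/subsetP => w; rewrite !inE => /and3P[].
apply: leq_trans zf; apply: subset_leq_card; apply/subsetP => w; rewrite !inE permM.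
case: tpermP => [->|->|/eqP wx /eqP wy] /andP[wB].
- by rewrite (out_perm zB) ?(eq_sym y) ?(negbTE xy) // !inE eqxx.
- by rewrite (out_perm zB) ?(negbTE xy) // !inE eqxx andbF.
- by move=> ->; rewrite wx wy wB.
Qed.

Definition fixS R z : {set 'I_n} := [set x in R | z x == x].
(** The sign of g on the fixed points of z, a linear character of the centraliser of z: the one that
    occurs in the involution model of the symmetric group. *)
Definition chi (R : {set 'I_n}) z g : bool := odd_perm (restr_perm (fixS R z) g).

Lemma fix_stab R z g : perm_on R g -> (g * z = z * g)%g -> g \in 'N(fixS R z | 'P)%g.
Proof.
move=> gR gz; rewrite inE; apply/andP; split; first by rewrite inE.
rewrite inE; apply/subsetP => x; rewrite !inE /= apermE => /andP[xR /eqP zx].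
rewrite perm_closed // xR /=; apply/eqP.
by rewrite -permM gz permM zx.
Qed.

Lemma chiM R z g h : perm_on R g -> (g * z = z * g)%g -> perm_on R h -> (h * z = z * h)%g ->
  chi R z (g * h)%g = chi R z g (+) chi R z h.
Proof.
move=> gR gz hR hz; rewrite /chi (morphM (restr_perm_morphism _)) ?fix_stab //.
by rewrite odd_permM.
Qed.

Lemma chi_eq R R' z z' g g' :
  perm_on R g -> (g * z = z * g)%g -> perm_on R' g' -> (g' * z' = z' * g')%g ->
  (forall x, (if x \in fixS R z then g x else x) = (if x \in fixS R' z' then g' x else x)) ->
  chi R z g = chi R' z' g'.
Proof.
move=> gR gz gR' gz' E; rewrite /chi; congr odd_perm; apply/permP => x.
have r1 S (k : {perm 'I_n}) : k \in 'N(S | 'P)%g -> restr_perm S k x = if x \in S then k x else x.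
  move=> kN; case: ifPn => xS; first by rewrite restr_permE.
  by rewrite (out_perm (restr_perm_on S k)).
by rewrite !r1 ?fix_stab.
Qed.

Lemma chi1 R z : chi R z 1%g = false.
Proof. by rewrite /chi morph1 odd_perm1. Qed.

(** Two-element orbits of z in X1 are paired with those in X2; each pair contributes two
    transpositions, which move no fixed point of z. A leftover fixed point on each side contributes
    one transposition of fixed points. So the character of the product is the parity of the list. *)
Lemma equiv_swaps R z (X1 X2 : {set 'I_n}) : (z * z = 1)%g ->
  X1 \subset R -> X2 \subset R -> [disjoint X1 & X2] ->
  (forall x, x \in X1 -> z x \in X1) -> (forall x, x \in X2 -> z x \in X2) ->
  #|X1| = #|X2| -> #|fixS X1 z| = #|fixS X2 z| -> (#|fixS X1 z| <= 1)%N ->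
  exists l, [/\ uniq (unzip1 l ++ unzip2 l), unzip1 l =i X1, unzip2 l =i X2,
    (swaps l * z = z * swaps l)%g & chi R z (swaps l) = odd (size l)].
Proof.
move=> zz X1R X2R d s1 s2 c cf f1.
have zK x : z (z x) = x by rewrite -permM zz perm1.
have [m] := ubnP #|X1|; elim: m X1 X2 X1R X2R d s1 s2 c cf f1 => // m IH X1 X2 X1R X2R d s1 s2 c cf f1 hm.
have ndis x : x \in X1 -> x \in X2 -> False.
  by move=> h1 h2; move/pred0P/(_ x): d; rewrite /= h1 h2.
case: (pselect (exists x, x \in X1 /\ z x != x)) => [[x [xX zx]]|none].
  have fcard X : (#|fixS X z| < #|X|)%N -> exists y, y \in X /\ z y != y.
    move=> lt; apply: contrapT => no; move: lt; rewrite ltnNge => /negP; apply.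
    apply: subset_leq_card; apply/subsetP => y yX; rewrite inE yX /=.
    by apply: contrapT => h; apply: no; exists y; split=> //; apply/negP.
  have [y [yX zy]] : exists y, y \in X2 /\ z y != y.
    apply: fcard; rewrite -cf -c; apply: proper_card; apply/properP; split.
      by apply/subsetP => w; rewrite inE => /andP[].
    by exists x => //; rewrite inE (negbTE zx) andbF.
  have xy : x != y by apply/eqP => e; apply: (ndis x) => //; rewrite e.
  have xzy : x != z y by apply/eqP => e; apply: (ndis x) => //; rewrite e s2.
  have zxy : z x != y by apply/eqP => e; apply: (ndis (z x)); rewrite ?s1 // e.
  have zxzy : z x != z y by rewrite (inj_eq perm_inj).
  pose rm (X : {set 'I_n}) w := X :\ w :\ z w.
  have rmS X w v : v \in rm X w -> v \in X by rewrite !inE => /and3P[].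
  have rmst X w : (forall v, v \in X -> z v \in X) -> forall v, v \in rm X w -> z v \in rm X w.
    move=> st v; rewrite !inE => /and3P[v1 v2 vX]; rewrite st // andbT (inj_eq perm_inj) v2 /=.
    by apply: contraNneq v1 => <-; rewrite zK.
  have rmc X w : w \in X -> z w \in X -> z w != w -> #|X| = (#|rm X w|).+2.
    by move=> wX zwX zw; rewrite (cardsD1 w) wX (cardsD1 (z w)) !inE zw zwX.
  have rmf X w : z w != w -> fixS (rm X w) z = fixS X z.
    move=> zw; apply/setP => v; rewrite !inE; case: (eqVneq v w) => [->|vw]; first by rewrite (negbTE zw) !andbF.
    case: (eqVneq v (z w)) => [->|vzw] //=; by rewrite zK eq_sym (negbTE zw) andbF.
  have [|||||||||l [ul l1 l2 lz lc]] := IH (rm X1 x) (rm X2 y).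
  - by apply: (subset_trans _ X1R); apply/subsetP => v /rmS.
  - by apply: (subset_trans _ X2R); apply/subsetP => v /rmS.
  - by rewrite disjoint_subset; apply/subsetP => v /rmS v1; rewrite inE; apply/negP => /rmS; exact: ndis.
  - exact: rmst.
  - exact: rmst.
  - by have := rmc X1 x xX (s1 _ xX) zx; have := rmc X2 y yX (s2 _ yX) zy; rewrite c => -> [].
  - by rewrite !rmf.
  - by rewrite rmf.
  - by move: hm; rewrite (rmc X1 x xX (s1 _ xX) zx) !ltnS => h; exact: ltnW.
  have n1 v : v \in unzip1 l -> [/\ v \in X1, v != x & v != z x].
    by rewrite l1 !inE => /and3P[-> ->].
  have n2 v : v \in unzip2 l -> [/\ v \in X2, v != y & v != z y].
    by rewrite l2 !inE => /and3P[-> ->].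
  have xl1 : x \notin unzip1 l by apply/negP => /n1[_]; rewrite eqxx.
  have zxl1 : z x \notin unzip1 l by apply/negP => /n1[_ _]; rewrite eqxx.
  have yl2 : y \notin unzip2 l by apply/negP => /n2[_]; rewrite eqxx.
  have zyl2 : z y \notin unzip2 l by apply/negP => /n2[_ _]; rewrite eqxx.
  have yl1 : y \notin unzip1 l by apply/negP => /n1[/ndis h]; case: (h yX).
  have zyl1 : z y \notin unzip1 l by apply/negP => /n1[/ndis h]; case: (h (s2 _ yX)).
  have xl2 : x \notin unzip2 l by apply/negP => /n2[/(ndis _ xX)].
  have zxl2 : z x \notin unzip2 l by apply/negP => /n2[/(ndis _ (s1 _ xX))].
  have tz : (tperm x y * tperm (z x) (z y) * z = z * (tperm x y * tperm (z x) (z y)))%g.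
    have e1 : (tperm x y ^ z = tperm (z x) (z y))%g by rewrite tpermJ.
    have e2 : (tperm (z x) (z y) ^ z = tperm x y)%g by rewrite tpermJ !zK.
    have : ((tperm x y * tperm (z x) (z y)) ^ z = tperm x y * tperm (z x) (z y))%g.
      rewrite conjMg e1 e2; apply: (perm_on_disj_comm (B := [set z x; z y]) (X := [set x; y])).
      - by apply: perm_on_tperm; rewrite !inE eqxx ?orbT.
      - by apply: perm_on_tperm; rewrite !inE eqxx ?orbT.
      rewrite disjoint_subset; apply/subsetP => v; rewrite !inE => /orP[/eqP->|/eqP->]; rewrite negb_or.
        by rewrite zx zxy.
      by rewrite eq_sym xzy zy.
    by move=> e; rewrite -[in RHS]e conjgE !mulgA mulgV mul1g.
  have sE : swaps ((x, y) :: (z x, z y) :: l) = (tperm x y * tperm (z x) (z y) * swaps l)%g.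
    by rewrite !swaps_cons mulgA.
  have C : (swaps ((x, y) :: (z x, z y) :: l) * z = z * swaps ((x, y) :: (z x, z y) :: l))%g.
    by rewrite sE -mulgA lz [in RHS]mulgA -tz -!mulgA.
  have U : uniq ((x :: z x :: unzip1 l) ++ (y :: z y :: unzip2 l)).
    move: ul; rewrite !cat_uniq => /and3P[u1 h u2]; apply/and3P; split.
    - by rewrite /= inE negb_or eq_sym zx xl1 zxl1 u1.
    - rewrite /= !inE !negb_or (eq_sym y) xy (eq_sym y) zxy yl1 (eq_sym (z y)) xzy (eq_sym (z y)) zxzy zyl1 /=.
      apply/hasPn => w wl; move/hasPn/(_ w wl): h; rewrite !inE !negb_or => ->; rewrite andbT.
      by apply/andP; split; apply/eqP => e; move: wl; rewrite e ?(negbTE xl2) ?(negbTE zxl2).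
    - by rewrite /= inE negb_or eq_sym zy yl2 zyl2 u2.
  exists ((x, y) :: (z x, z y) :: l); split=> //.
  - move=> w; rewrite /= !inE l1 !inE; case: (eqVneq w x) => [->|wx] /=; first by rewrite xX.
    by case: (eqVneq w (z x)) => [->|wzx] //=; rewrite s1.
  - move=> w; rewrite /= !inE l2 !inE; case: (eqVneq w y) => [->|wy] /=; first by rewrite yX.
    by case: (eqVneq w (z y)) => [->|wzy] //=; rewrite s2.
  rewrite /= negbK -lc.
  have onR (l' : seq ('I_n * 'I_n)) : {subset unzip1 l' <= R} -> {subset unzip2 l' <= R} -> perm_on R (swaps l').
    elim: l' => [|[b c'] l' IHl] h1 h2; first by rewrite /swaps big_nil perm_on1.
    rewrite swaps_cons; apply: perm_on_mul.
      by apply: perm_on_tperm; [apply: h1 | apply: h2]; rewrite /= inE eqxx.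
    by apply: IHl => w hw; [apply: h1 | apply: h2]; rewrite /= inE hw orbT.
  have R1 w : w \in X1 -> w \in R by apply/subsetP.
  have R2 w : w \in X2 -> w \in R by apply/subsetP.
  apply: chi_eq => //.
  - apply: onR => w /=; rewrite !inE => /or3P[/eqP->|/eqP->|h].
    + exact: R1.
    + by apply: R1; apply: s1.
    + by case: (n1 w h) => /R1.
    + exact: R2.
    + by apply: R2; apply: s2.
    + by case: (n2 w h) => /R2.
  - by apply: onR => w h; [case: (n1 w h) => /R1 | case: (n2 w h) => /R2].
  move=> w; case: ifP => //; rewrite inE => /andP[_ /eqP zw].
  rewrite sE !permM; congr (swaps l _).
  have nw v : z v != v -> w != v by move=> h; apply/eqP => e; move: h; rewrite -e zw eqxx.
  have nzw v : z v != v -> w != z v by move=> h; apply: nw; rewrite zK eq_sym.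
  by rewrite (@tpermD _ x y w) 1?[_ == w]eq_sym ?nw // (@tpermD _ _ _ w) 1?[_ == w]eq_sym ?nzw.
have fX w : w \in X1 -> z w = w.
  by move=> wX; apply: contrapT => h; apply: none; exists w; split=> //; apply/eqP.
have fE : fixS X1 z = X1.
  by apply/setP => w; rewrite inE; case: (boolP (w \in X1)) => //= wX; rewrite fX ?eqxx.
have fX2 w : w \in X2 -> z w = w.
  have : fixS X2 z = X2.
    by apply/eqP; rewrite eqEcard -cf fE c leqnn andbT; apply/subsetP => v; rewrite inE => /andP[].
  by move=> e; rewrite -{1}e inE => /andP[_ /eqP].
move: f1; rewrite fE leq_eqVlt ltnS leqn0 => /orP[/cards1P[x e1]|]; last first.
  rewrite cards_eq0 => /eqP e1; move: c; rewrite e1 cards0 => /esym/eqP; rewrite cards_eq0 => /eqP e2.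
  exists [::]; split=> //; [by move=> w; rewrite !inE | by move=> w; rewrite e2 !inE | |].
    by rewrite /swaps big_nil mul1g mulg1.
  by rewrite /swaps big_nil chi1.
have /cards1P[y e2] : #|X2| == 1%N by rewrite -c e1 cards1.
have xX : x \in X1 by rewrite e1 inE.
have yX : y \in X2 by rewrite e2 inE.
have xy : x != y by apply/eqP => e; apply: (ndis x) => //; rewrite e.
have C : (tperm x y * z = z * tperm x y)%g.
  by have : (tperm x y ^ z = tperm x y)%g; [rewrite tpermJ fX ?fX2 | move=> e; rewrite -[in RHS]e conjgE !mulgA mulgV mul1g].
have tR : perm_on R (tperm x y) by apply: perm_on_tperm; [apply: (subsetP X1R) | apply: (subsetP X2R)].
have sE : swaps [:: (x, y)] = tperm x y by rewrite /swaps big_seq1.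
exists [:: (x, y)]; rewrite sE; split=> //.
- by rewrite /= inE xy.
- by move=> w; rewrite e1 !inE.
- by move=> w; rewrite e2 !inE.
rewrite /= /chi -(_ : tperm x y = restr_perm (fixS R z) (tperm x y)) ?odd_tperm ?xy //.
apply/permP => w; case: (boolP (w \in fixS R z)) => wF.
  by rewrite restr_permE // fix_stab.
rewrite (out_perm (restr_perm_on _ _) wF) tpermD //; apply: contraNneq wF => <-.
  by rewrite inE (subsetP X1R) // fX ?eqxx.
by rewrite inE (subsetP X2R) // fX2 ?eqxx.
Qed.

End PermTools.

(** * A vector transforming by the sign character of a centraliser *)

Section Star.
Variables (F : realFieldType) (n : nat) (V : lmodType F).
Variables (act : {perm 'I_n} -> V -> V) (B : V -> V -> F) (col : 'I_n -> bool).
Hypothesis actl : forall g (a : F) u v, act g (a *: u + v) = a *: act g u + act g v.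
Hypothesis act1 : forall v, act 1%g v = v.
Hypothesis actM : forall g h v, act (g * h)%g v = act h (act g v).
Hypothesis Bl : forall (a : F) u v w, B (a *: u + v) w = a * B u w + B v w.
Hypothesis Bs : forall u v, B u v = B v u.
Hypothesis Bp : forall v, v != 0 -> 0 < B v v.
Hypothesis Bi : forall g u v, B (act g u) (act g v) = B u v.

Lemma act0 g : act g 0 = 0.
Proof. by have := actl g (-1) 0 0; rewrite scaler0 addr0 scaleN1r => e; rewrite e addNr. Qed.
Lemma actD g u v : act g (u + v) = act g u + act g v.
Proof. by rewrite -[u]scale1r actl !scale1r. Qed.
Lemma actZ g a u : act g (a *: u) = a *: act g u.
Proof. by rewrite -[a *: u]addr0 actl act0 addr0. Qed.
Lemma act_sum g (I : finType) (Q : pred I) f : act g (\sum_(i | Q i) f i) = \sum_(i | Q i) act g (f i).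
Proof. exact: (big_morph _ (actD g) (act0 g)). Qed.
Lemma B0l w : B 0 w = 0.
Proof. by have := Bl (-1) 0 0 w; rewrite scaler0 addr0 mulN1r => e; rewrite e addNr. Qed.
Lemma BDl u v w : B (u + v) w = B u w + B v w.
Proof. by rewrite -[u]scale1r Bl scale1r mul1r. Qed.
Lemma BZl a u w : B (a *: u) w = a * B u w.
Proof. by rewrite -[a *: u]addr0 Bl B0l addr0. Qed.
Lemma Bsuml (I : finType) (Q : pred I) f w : B (\sum_(i | Q i) f i) w = \sum_(i | Q i) B (f i) w.
Proof. exact: (big_morph (fun u => B u w) (fun u v => BDl u v w) (B0l w)). Qed.
Lemma Bsumr (I : finType) (Q : pred I) f w : B w (\sum_(i | Q i) f i) = \sum_(i | Q i) B w (f i).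
Proof. by rewrite Bs Bsuml; apply: eq_bigr => i _; rewrite Bs. Qed.
Lemma BDr u v w : B w (u + v) = B w u + B w v.
Proof. by rewrite Bs BDl !(Bs w). Qed.
Lemma Badj g u v : B (act g u) v = B u (act g^-1%g v).
Proof. by rewrite -{1}[v]act1 -(mulVg g) actM Bi. Qed.

Definition sym (X : {set 'I_n}) v := \sum_(s | perm_on X s) act s v.

(** [sym X] is self-adjoint and its square is a positive multiple of itself, so the value is a
    positive multiple of the norm of [sym X v]. *)
Lemma sym_pos X v : 0 <= B v (sym X v).
Proof.
have h s : perm_on X s -> act s (sym X v) = sym X v.
  move=> sX; rewrite /sym act_sum [RHS](reindex_inj (mulIg s)) /=.
  apply: eq_big => [r|r _]; last by rewrite actM.
  by apply/idP/idP => rX; [exact: perm_on_mul | rewrite -(mulgK s r); apply: perm_on_mul => //; exact: perm_on_inv].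
have : 0 <= B (sym X v) (sym X v).
  by case: (eqVneq (sym X v) 0) => [->|/Bp/ltW //]; rewrite B0l.
rewrite {1}/sym Bsuml (eq_bigr (fun=> B v (sym X v))) => [|s sX]; last first.
  by rewrite Badj h // perm_on_inv.
rewrite sumr_const -mulr_natl pmulr_rge0 // ltr0n; apply/card_gt0P; exists 1%g; exact: perm_on1.
Qed.

(** Coset decomposition: the permutations of x |: X are grouped by the point y sent to x, and
    removing the transposition of x and y leaves a permutation of X. *)
Lemma sym_rec (X : {set 'I_n}) (x : 'I_n) (v : V) : x \notin X ->
  sym (x |: X) v = sym X (v + \sum_(y in X) act (tperm x y) v).
Proof.
move=> xX.
have -> : v + \sum_(y in X) act (tperm x y) v = \sum_(y in x |: X) act (tperm x y) v.
  by rewrite big_setU1 //= tperm1 act1.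
rewrite /sym (partition_big (fun s : {perm 'I_n} => (s^-1)%g x) (mem (x |: X))) /=; last first.
  by move=> s sX; rewrite perm_closed ?setU11 // perm_on_inv.
rewrite (eq_bigr (fun y => \sum_(s | perm_on X s) act s (act (tperm x y) v))) => [|y yX].
  by rewrite exchange_big /=; apply: eq_bigr => s _; rewrite act_sum.
rewrite (reindex_inj (mulgI (tperm x y))) /=; apply: eq_big => [s|s _]; last by rewrite actM.
have tX : perm_on (x |: X) (tperm x y) by apply: perm_on_tperm => //; rewrite setU11.
have sx : ((tperm x y * s)^-1%g x == y) = (s x == x).
  by rewrite invMg permM tpermV -(inj_eq (@perm_inj _ (tperm x y))) tpermK tpermR -(inj_eq (@perm_inj _ s)) permKV eq_sym.
rewrite sx; apply/andP/idP => [[h /eqP e]|h].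
  have sX : perm_on (x |: X) s by rewrite -[s]mul1g -(tperm2 x y) -mulgA; apply: perm_on_mul.
  apply/subsetP => w ws; have := subsetP sX w ws; rewrite !inE => /orP[/eqP we|//].
  by move: ws; rewrite inE we e eqxx.
split; last by rewrite (out_perm h).
apply: perm_on_mul => //; apply: (subset_trans h); exact: subsetUr.
Qed.

Section Block.
Variables (Bk X0 : {set 'I_n}) (v : V).
Hypothesis dis : [disjoint Bk & X0].
Hypothesis vB : forall h, perm_on Bk h -> act h v = v.
(** A relation of Garnir type: since v is invariant under permutations of Bk, it says that v
    symmetrised over x |: Bk is zero. It will come from the maximality of the block. *)
Hypothesis rel : forall x, x \in X0 -> v + \sum_(y in Bk) act (tperm x y) v = 0.

(** Induction on the list. [rel] at x, transported through the remaining swaps, expresses the term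
    with the extra swap (b, x) through terms without it, with v' replaced by v' plus its images
    under the transpositions of x with the points of X'. By [sym_rec] this is one more step of
    symmetrisation. The constant collects the factors 1 / (#|Bk| - size l). *)
Lemma block_key l v' : (forall h, perm_on Bk h -> act h v' = v') ->
  uniq (unzip1 l ++ unzip2 l) -> {subset unzip1 l <= Bk} -> {subset unzip2 l <= X0} ->
  exists2 k, 0 < k & (-1) ^+ size l * B (act (swaps l) v) v' = k * B v (sym [set x in unzip2 l] v').
Proof.
elim: l v' => [|[b x] l IH] v' v'B ul l1 l2.
  exists 1 => //; rewrite expr0 !mul1r /swaps big_nil act1; congr (B v _).
  rewrite /sym (big_pred1 1%g) ?act1 // => s.
  apply/idP/eqP => [h|->]; last exact: perm_on1.
  by apply/permP => w; rewrite perm1 (out_perm h) // inE.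
have nd y : y \in Bk -> y \in X0 -> False.
  by move=> h1 h2; move/pred0P/(_ y): dis; rewrite /= h1 h2.
have [bB xX] : b \in Bk /\ x \in X0 by split; [apply: l1 | apply: l2]; rewrite /= inE eqxx.
have l1' : {subset unzip1 l <= Bk} by move=> w h; apply: l1; rewrite /= inE h orbT.
have l2' : {subset unzip2 l <= X0} by move=> w h; apply: l2; rewrite /= inE h orbT.
move: (ul); rewrite /= mem_cat inE !negb_or => /andP[/and3P[bl1 bx bl2]].
rewrite cat_uniq /= negb_or => /and3P[u1 /andP[xl1 h2] /andP[xl2 u2]].
have ul' : uniq (unzip1 l ++ unzip2 l) by rewrite cat_uniq u1 u2 h2.
pose X' := [set w in unzip2 l].
pose v'' := v' + \sum_(y in X') act (tperm x y) v'.
have v''B h : perm_on Bk h -> act h v'' = v''.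
  move=> hB; rewrite /v'' actD v'B // act_sum; congr (_ + _); apply: eq_bigr => y; rewrite inE => yl.
  have tX : perm_on X0 (tperm x y) by apply: perm_on_tperm => //; exact: l2'.
  by rewrite -actM -(perm_on_disj_comm hB tX dis) actM v'B.
have [k k0 kE] := IH v'' v''B ul' l1' l2'.
have e1 : \sum_(y in Bk) B (act (swaps l) (act (tperm x y) v)) v' = - B (act (swaps l) v) v'.
  have := rel xX => /(congr1 (fun u => B (act (swaps l) u) v')).
  rewrite act0 B0l actD BDl act_sum Bsuml addrC => /eqP; rewrite addr_eq0 => /eqP ->.
  by [].
pose L1 := [set w in unzip1 l].
have L1B : L1 \subset Bk by apply/subsetP => w; rewrite inE => /l1'.
have swl w : w \in unzip1 l -> swaps l w \in unzip2 l.
  move=> /mapP[[c y] cl ->]; rewrite (swaps_in ul' cl).1; by apply/mapP; exists (c, y).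
have swl2 w : w \in unzip2 l -> swaps l w \in unzip1 l.
  move=> /mapP[[c y] cl ->]; rewrite (swaps_in ul' cl).2; by apply/mapP; exists (c, y).
have swK : involutive (swaps l).
  move=> w; case: (boolP (w \in unzip1 l)) => [/mapP[[c y] cl ->]|w1].
    by rewrite (swaps_in ul' cl).1 (swaps_in ul' cl).2.
  case: (boolP (w \in unzip2 l)) => [/mapP[[c y] cl ->]|w2].
    by rewrite (swaps_in ul' cl).2 (swaps_in ul' cl).1.
  by rewrite !swaps_out.
have xfix : swaps l x = x by rewrite swaps_out.
have e2 : \sum_(y in Bk) B (act (swaps l) (act (tperm x y) v)) v' =
   \sum_(y in X') B (act (swaps l) v) (act (tperm x y) v') +
   (#|Bk| - size l)%:R * B (act (swaps ((b, x) :: l)) v) v'.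
  rewrite (bigID (mem L1)) /=; congr (_ + _).
    rewrite (eq_bigl (fun y => y \in L1)) => [|y]; last first.
      by case: (boolP (y \in L1)) => [/(subsetP L1B)->|]; rewrite ?andbT ?andbF.
    rewrite (reindex_inj (@perm_inj _ (swaps l))) /=; apply: eq_big => [y|y].
      rewrite !inE; apply/idP/idP => [/swl|/swl2 //]; by rewrite swK.
    rewrite inE => /swl; rewrite swK => yl; rewrite -actM.
    have -> : (tperm x (swaps l y) * swaps l = swaps l * tperm x y)%g.
      by have := tpermJ x (swaps l y) (swaps l); rewrite swK xfix => <-; rewrite conjgE !mulgA mulgV mul1g.
    by rewrite actM Badj tpermV.
  rewrite (eq_bigr (fun=> B (act (swaps ((b, x) :: l)) v) v')) => [|y /andP[yB]].
    rewrite sumr_const [RHS]mulr_natl; congr GRing.natmul.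
    rewrite (eq_card (B := Bk :\: L1)) => [|w]; last by rewrite in_setD [RHS]andbC.
    rewrite cardsD (setIidPr L1B); congr (_ - _)%N.
    by rewrite cardsE (card_uniqP u1) size_map.
  rewrite inE => yl1; case: (eqVneq y b) => [->|yb].
    by rewrite -actM swaps_cons /= tpermC.
  have yl2 : y \notin unzip2 l by apply/negP => /l2'; exact: nd.
  have tB : perm_on Bk (tperm y b) by apply: perm_on_tperm.
  have tl : (tperm y b * swaps l = swaps l * tperm y b)%g.
    have := tpermJ y b (swaps l); rewrite !swaps_out // => e.
    by rewrite -[in RHS]e conjgE !mulgA mulgV mul1g.
  have xy : x != y by apply/eqP => e; apply: (nd y) => //; rewrite -e.
  have -> : act (swaps ((b, x) :: l)) v = act (tperm y b) (act (swaps l) (act (tperm x y) v)).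
    have X : (tperm y b * swaps ((b, x) :: l) = tperm x y * (swaps l * tperm y b))%g.
      rewrite swaps_cons /= -tl !mulgA; congr (_ * _)%g.
      have xb : b != x by [].
      have := tpermJ x y (tperm y b); rewrite tpermL tpermD // ?(eq_sym y) // => e.
      by rewrite (tpermC b x) -e conjgE tpermV !mulgA tperm2 mul1g.
    by rewrite -[in LHS](vB tB) -actM X !actM.
  by rewrite [RHS]Badj tpermV v'B.
have sz : (size l < #|Bk|)%N.
  have : (#|b |: L1| <= #|Bk|)%N.
    by apply: subset_leq_card; apply/subsetP => w; rewrite !inE => /orP[/eqP->|/l1'].
  by rewrite cardsU1 inE bl1 cardsE (card_uniqP u1) size_map.
have q0 : (0 : F) < (#|Bk| - size l)%:R by rewrite ltr0n subn_gt0.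
exists (k / (#|Bk| - size l)%:R); first exact: divr_gt0.
have -> : [set w in unzip2 ((b, x) :: l)] = x |: X' by apply/setP => w; rewrite !inE.
rewrite sym_rec ?inE // -/v'' mulrAC -kE.
apply: (mulfI (lt0r_neq0 q0)); rewrite [RHS]mulrC divfK ?lt0r_neq0 //.
have -> : B (act (swaps l) v) v'' = - ((#|Bk| - size l)%:R * B (act (swaps ((b, x) :: l)) v) v').
  by rewrite /v'' BDr Bsumr -[X in X + _]opprK -e1 e2; ring.
by rewrite /= exprS; ring.
Qed.

Lemma block_pos l : uniq (unzip1 l ++ unzip2 l) -> {subset unzip1 l <= Bk} -> {subset unzip2 l <= X0} ->
  0 <= (-1) ^+ size l * B (act (swaps l) v) v.
Proof.
move=> u l1 l2; have [k k0 ->] := block_key vB u l1 l2.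
by apply: mulr_ge0; [exact: ltW | exact: sym_pos].
Qed.
End Block.

(** The colour of i will record the eigenvalue of a sign element attached to i; colour-preserving
    permutations preserve the common eigenspace. *)
Definition cp (g : {perm 'I_n}) := forall x, col (g x) = col x.
Definition cpb (g : {perm 'I_n}) := [forall x, col (g x) == col x].

Lemma cpP g : reflect (cp g) (cpb g).
Proof. by apply: (iffP forallP) => h x; [apply/eqP | rewrite h]. Qed.

Lemma cpM g h : cp g -> cp h -> cp (g * h)%g.
Proof. by move=> a b x; rewrite permM b a. Qed.

Lemma cpV g : cp g -> cp g^-1%g.
Proof. by move=> a x; rewrite -{2}(permKV g x) a. Qed.

Lemma cp_on g (X : {set 'I_n}) b : perm_on X g -> (forall x, x \in X -> col x = b) -> cp g.
Proof.
move=> gX hX x; case: (boolP (x \in X)) => xX; last by rewrite (out_perm gX).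
by rewrite !hX // perm_closed.
Qed.

Definition sub (U : V -> Prop) := U 0 /\ (forall a u v, U u -> U v -> U (a *: u + v)).

Lemma sub_sum U (I : finType) (Q : pred I) f : sub U -> (forall i, Q i -> U (f i)) -> U (\sum_(i | Q i) f i).
Proof.
move=> [U0 UL] h; apply: (big_ind U) => // x y hx hy.
by rewrite -[x]scale1r; apply: UL.
Qed.

(** Take a largest block of the colour of x0, containing x0, for which U has a nonzero invariant
    vector, and apply the induction hypothesis to the invariants and the rest of R. The involution
    found there is extended by a matching of the block, and the vector v is averaged against the
    character. The average is not zero since its product with v is a sum of nonnegative terms, the
    term of the identity being positive. *)
Lemma star (R : {set 'I_n}) (U : V -> Prop) : sub U ->
  (forall g u, perm_on R g -> cp g -> U u -> U (act g u)) -> (exists2 u, U u & u != 0) ->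
  exists z, [/\ (z * z = 1)%g, perm_on R z, cp z & exists v, [/\ U v, v != 0 &
    forall g, perm_on R g -> cp g -> (g * z = z * g)%g -> act g v = (-1) ^+ chi R z g *: v]].
Proof.
have [m] := ubnP #|R|; elim: m R U => // m IH R U hm sU stU [u0 Uu0 nu0].
case: (set_0Vmem R) => [R0|[x0 x0R]].
  exists 1%g; split; [by rewrite mulg1 | exact: perm_on1 | by move=> x; rewrite perm1 |].
  exists u0; split=> // g gR _ _.
  have -> : g = 1%g by apply/permP => x; rewrite perm1 (out_perm gR) // R0 inE.
  by rewrite act1 chi1 scale1r.
pose inv (X : {set 'I_n}) u := U u /\ forall h, perm_on X h -> act h u = u.
pose good (X : {set 'I_n}) := [/\ X \subset R, x0 \in X, (forall x, x \in X -> col x = col x0) & exists2 u, inv X u & u != 0].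
have g0 : good [set x0].
  split; [by rewrite sub1set | by rewrite inE | by move=> x /set1P-> |].
  exists u0 => //; split=> // h hX.
  have -> : h = 1%g; last by rewrite act1.
  apply/permP => x; rewrite perm1; case: (boolP (x \in [set x0])) => [xx|]; last exact: out_perm.
  by have := perm_closed x hX; rewrite xx !inE => /eqP ->; move/set1P: xx.
have [Bk [BR x0B Bc [u1 u1B nu1]] Bmax] := nat_min (fun X : {set 'I_n} => #|R| - #|X|)%N (ex_intro good _ g0).
pose R' := R :\: Bk.
have dBR : [disjoint Bk & R'].
  by rewrite disjoint_subset; apply/subsetP => x xB; rewrite !inE xB.
have cR : (#|R'| < m)%N.
  have : (#|R'| < #|R|)%N.
    by apply: proper_card; apply/properP; split; [exact: subsetDl | exists x0; rewrite // !inE x0B].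
  by move=> h; apply: leq_trans h _; rewrite -ltnS.
have onS (X Y : {set 'I_n}) g : X \subset Y -> perm_on X g -> perm_on Y g by move=> XY h; apply: subset_trans h XY.
have R'R : R' \subset R by exact: subsetDl.
have [|g u gR' cg [Uu uB]||z' [zz' zR' cz' [v [[Uv vB] nv vE]]]] := IH R' (inv Bk) cR.
- split; first by split=> [|h _]; [case: sU | exact: act0].
  move=> a x y [Ux xB] [Uy yB]; split; first by apply sU.2.
  by move=> h hB; rewrite actl xB ?yB.
- split; first by apply: stU => //; exact: onS gR'.
  by move=> h hB; rewrite -actM -(perm_on_disj_comm hB gR' dBR) actM uB.
- by exists u1.
(* Otherwise this sum would be a nonzero vector of U invariant under the permutations of x |: Bk,
   and the block could be enlarged. *)
have rel x : x \in [set y in R' | col y == col x0] -> v + \sum_(y in Bk) act (tperm x y) v = 0.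
  rewrite inE => /andP[xR' /eqP cx]; apply: contrapT => /eqP nw.
  have xB : x \notin Bk by move: xR'; rewrite inE => /andP[].
  have xR : x \in R by apply: (subsetP R'R).
  have B'c y : y \in x |: Bk -> col y = col x0 by rewrite !inE => /orP[/eqP->|/Bc].
  have wE : v + \sum_(y in Bk) act (tperm x y) v = \sum_(y in x |: Bk) act (tperm x y) v.
    by rewrite big_setU1 //= tperm1 act1.
  have gd : good (x |: Bk).
    split=> //.
    - by apply/subsetP => y; rewrite !inE => /orP[/eqP->|/(subsetP BR)].
    - by rewrite inE x0B orbT.
    exists (v + \sum_(y in Bk) act (tperm x y) v) => //; rewrite wE; split.
      apply: sub_sum => // y yB; apply: stU => //.
        apply: perm_on_tperm => //; move: yB; rewrite !inE => /orP[/eqP->//|/(subsetP BR) //].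
      by apply: (cp_on (X := x |: Bk) (b := col x0)) => //; apply: perm_on_tperm; rewrite ?setU11.
    move=> h hB; rewrite act_sum [RHS](reindex_inj (@perm_inj _ h)) /=; apply: eq_big => [y|y yB].
      by rewrite perm_closed.
    rewrite -actM; set t := (tperm x y * h * tperm x (h y))%g.
    have tB : perm_on Bk t.
      apply/subsetP => w ws; have : w \in x |: Bk.
        have : perm_on (x |: Bk) t.
          by do 2?apply: perm_on_mul => //; apply: perm_on_tperm; rewrite ?perm_closed ?setU11.
        by move/subsetP; apply.
      rewrite !inE => /orP[/eqP we|//]; move: ws; rewrite inE we /t !permM tpermL tpermR.
      by rewrite eqxx.
    have -> : (tperm x y * h = t * tperm x (h y))%g by rewrite /t -mulgA tperm2 mulg1.
    by rewrite actM vB.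
  have := Bmax _ gd; rewrite cardsU1 xB /=.
  have : (#|x |: Bk| <= #|R|)%N.
    by apply: subset_leq_card; apply/subsetP => y; rewrite !inE => /orP[/eqP->|/(subsetP BR)].
  rewrite cardsU1 xB /=; move: #|R| #|Bk| => c1 c2; clear; lia.
have [zB [zzB zBB zBf]] := matching_exists Bk.
have zC := perm_on_disj_comm zBB zR' dBR.
pose z := (zB * z')%g.
have nR' x : x \in Bk -> x \notin R' by rewrite inE => ->.
have nB x : x \in R' -> x \notin Bk by rewrite inE => /andP[].
have zOB x : x \in Bk -> z x = zB x.
  by move=> xB; rewrite permM (out_perm zR') // nR' // perm_closed.
have zOR x : x \in R' -> z x = z' x.
  by move=> xB; rewrite permM (out_perm zBB) // nB.
have zz : (z * z = 1)%g by rewrite /z mulgA -[(zB * z' * zB)%g]mulgA -zC !mulgA zzB mul1g zz'.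
have zR : perm_on R z by apply: perm_on_mul; [exact: onS zBB | exact: onS zR'].
have cz : cp z by apply: cpM => //; exact: (cp_on zBB Bc).
have zBst x : (z x \in Bk) = (x \in Bk).
  case: (boolP (x \in Bk)) => xB; first by rewrite zOB // perm_closed.
  apply/negbTE; case: (boolP (x \in R')) => xR; first by rewrite zOR // nB // perm_closed.
  by rewrite /z permM (out_perm zBB) ?(out_perm zR').
have fB : fixS Bk z = [set x in Bk | zB x == x].
  by apply/setP => x; rewrite !inE; case: (boolP (x \in Bk)) => // xB; rewrite zOB.
exists z; split=> //.
pose C g := [&& perm_on R g, cpb g & (g * z == z * g)%g].
have Cm g h : C g -> C h -> C (g * h)%g.
  move=> /and3P[gR /cpP cg /eqP gz] /and3P[hR /cpP ch /eqP hz]; apply/and3P; split.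
  - exact: perm_on_mul.
  - by apply/cpP; exact: cpM.
  - by rewrite -mulgA hz mulgA gz mulgA.
have Cv g : C g -> C g^-1%g.
  move=> /and3P[gR /cpP cg /eqP gz]; apply/and3P; split.
  - exact: perm_on_inv.
  - by apply/cpP; exact: cpV.
  - by apply/eqP; apply: (mulgI g); rewrite mulKVg (mulgA g z) gz mulgK.
pose e := \sum_(g | C g) (-1) ^+ chi R z g *: act g v.
exists e; split.
- apply: sub_sum => // g /and3P[gR /cpP cg _].
  by rewrite -[_ *: _]addr0; apply sU.2; [apply: stU | case: sU].
- suff : 0 < B e v by apply: contraTneq => ->; rewrite B0l ltxx.
  have C1 : C 1%g.
    by apply/and3P; split; [exact: perm_on1 | apply/cpP => x; rewrite perm1 | rewrite mul1g mulg1].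
  rewrite /e Bsuml (bigD1 1%g) //= chi1 scale1r act1.
  apply: ltr_wpDr; last exact: Bp.
  (* The element g displaces the block. A product [tau] of swaps commuting with z exchanges the two
     differences, so that [c] preserves the block and acts on v by its sign. What remains is the
     sign of the number of swaps times the product of [tau] v with v, which is nonnegative by
     [block_pos]. *)
  apply: sumr_ge0 => g /andP[/and3P[gR /cpP cg /eqP gz] _]; rewrite BZl.
  pose X1 := Bk :\: g @: Bk; pose X2 := g @: Bk :\: Bk.
  have gzx x : g (z x) = z (g x) by rewrite -!permM gz.
  have gBz x : (z x \in g @: Bk) = (x \in g @: Bk).
    apply/imsetP/imsetP => -[y yB ey].
      exists (z y); first by rewrite zBst.
      by rewrite gzx -ey -permM zz perm1.
    by exists (z y); rewrite ?zBst // gzx ey.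
  have cgB : #|g @: Bk| = #|Bk| by rewrite card_imset //; exact: perm_inj.
  have gBR : g @: Bk \subset R.
    by apply/subsetP => _ /imsetP[x xB ->]; rewrite perm_closed //; apply: (subsetP BR).
  have cI (D1 D2 : {set 'I_n}) : #|D1| = #|D2| -> #|D1 :\: D2| = #|D2 :\: D1|.
    by move=> E; rewrite !cardsD E setIC.
  have fI (D1 D2 : {set 'I_n}) : fixS (D1 :\: D2) z = fixS D1 z :\: fixS D2 z.
    by apply/setP => x; rewrite !inE; case: (z x == x); rewrite ?andbT ?andbF.
  have cfB : #|fixS Bk z| = #|fixS (g @: Bk) z|.
    have -> : fixS (g @: Bk) z = g @: fixS Bk z.
      apply/setP => x; rewrite inE; apply/andP/imsetP => [[/imsetP[y yB ->] /eqP h]|[y]].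
        by exists y => //; rewrite inE yB /=; apply/eqP/(@perm_inj _ g); rewrite gzx.
      by rewrite inE => /andP[yB /eqP zy] ->; split; [exact: imset_f | rewrite -gzx zy].
    by rewrite card_imset //; exact: perm_inj.
  have [||||||||l [ul l1 l2 lz lchi]] := @equiv_swaps _ R z X1 X2 zz.
  - by apply: (subset_trans _ BR); exact: subsetDl.
  - by apply: (subset_trans _ gBR); exact: subsetDl.
  - by rewrite disjoint_subset; apply/subsetP => x; rewrite !inE => /andP[_ ->].
  - by move=> x; rewrite !inE gBz zBst.
  - by move=> x; rewrite !inE gBz zBst.
  - by apply: cI; rewrite cgB.
  - by rewrite !fI; apply: cI.
  - by rewrite fI; apply: leq_trans (subset_leq_card (subsetDl _ _)) _; rewrite fB.
  set tau := swaps l in lz lchi.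
  have X2c x : x \in X2 -> x \in [set y in R' | col y == col x0].
    rewrite !inE => /andP[xB /imsetP[y yB ey]]; rewrite xB /= ey cg Bc // eqxx andbT.
    by rewrite perm_closed //; exact: (subsetP BR).
  have tR : perm_on R tau.
    apply/subsetP => x; rewrite inE; apply: contraR => xR; rewrite /tau swaps_out // ?l1 ?l2.
      by apply: contra xR; rewrite inE => /andP[_ /(subsetP BR)].
    by apply: contra xR; rewrite inE => /andP[_ /(subsetP gBR)].
  have tswap x : [/\ x \in X1 -> tau x \in X2, x \in X2 -> tau x \in X1 & x \notin X1 -> x \notin X2 -> tau x = x].
    split=> [||h1 h2]; last by rewrite /tau swaps_out // ?l1 ?l2.
      rewrite -l1 -l2 => /mapP[[c y] cl ->]; rewrite /tau (swaps_in ul cl).1; by apply/mapP; exists (c, y).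
    rewrite -l1 -l2 => /mapP[[c y] cl ->]; rewrite /tau (swaps_in ul cl).2; by apply/mapP; exists (c, y).
  have tt : (tau * tau = 1)%g.
    apply/permP => x; rewrite permM perm1; case: (boolP (x \in X1)) => [|h1].
      rewrite -l1 => /mapP[[c y] cl ->]; by rewrite /tau (swaps_in ul cl).1 (swaps_in ul cl).2.
    case: (boolP (x \in X2)) => [|h2].
      rewrite -l2 => /mapP[[c y] cl ->]; by rewrite /tau (swaps_in ul cl).2 (swaps_in ul cl).1.
    by have [_ _ h] := tswap x; rewrite !h.
  pose c := (g * tau)%g.
  have cz_ : (c * z = z * c)%g by rewrite /c -mulgA lz mulgA gz mulgA.
  have cR_ : perm_on R c by exact: perm_on_mul.
  have cBB x : x \in Bk -> c x \in Bk.
    move=> xB; have gx : g x \in g @: Bk by exact: imset_f.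
    rewrite /c permM; case: (boolP (g x \in Bk)) => gxB.
      by have [_ _ ->] := tswap (g x) => //; rewrite !inE ?gx ?gxB.
    have [_ h _] := tswap (g x); have : g x \in X2 by rewrite !inE gx gxB.
    by move/h; rewrite inE => /andP[].
  have cstab (X : {set 'I_n}) (h : {perm 'I_n}) : (forall x, x \in X -> h x \in X) -> h \in 'N(X | 'P)%g.
    move=> hX; rewrite inE; apply/andP; split; first by rewrite inE.
    by rewrite inE; apply/subsetP => x xX; rewrite inE /= apermE hX.
  have cBst : c @: Bk = Bk.
    apply/eqP; rewrite eqEcard card_imset ?leqnn ?andbT; last exact: perm_inj.
    by apply/subsetP => _ /imsetP[x xB ->]; exact: cBB.
  have cB_iff x : (c x \in Bk) = (x \in Bk) by rewrite -{1}cBst mem_imset //; exact: perm_inj.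
  have cRR x : x \in R' -> c x \in R'.
    by rewrite !inE cB_iff perm_closed.
  pose cB := restr_perm Bk c; pose cR' := restr_perm R' c.
  have cBN := cstab Bk c cBB; have cRN := cstab R' c cRR.
  have rBE x : cB x = if x \in Bk then c x else x.
    by case: ifPn => xB; [rewrite /cB restr_permE | rewrite (out_perm (restr_perm_on _ _))].
  have rRE x : cR' x = if x \in R' then c x else x.
    by case: ifPn => xB; [rewrite /cR' restr_permE | rewrite (out_perm (restr_perm_on _ _))].
  have cE : c = (cB * cR')%g.
    apply/permP => x; rewrite permM rBE; case: ifPn => xB.
      by rewrite rRE ifN // nR' // cBB.
    rewrite rRE; case: ifPn => // xR; rewrite (out_perm cR_) //.
    by apply: contra xR => xR; rewrite !inE xB.
  have cRon : perm_on R' cR' by exact: restr_perm_on.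
  have cRz : (cR' * z' = z' * cR')%g.
    apply/permP => x; rewrite !permM !rRE; case: (boolP (x \in R')) => xR.
      rewrite perm_closed // xR -!zOR ?cRR //.
      by rewrite -!permM cz_.
    by rewrite (out_perm zR') // (negbTE xR).
  have cpt : cp tau.
    apply: (cp_on (X := X1 :|: X2) (b := col x0)).
      apply/subsetP => x; rewrite !inE -!in_setD => h; apply: contraR h; rewrite negb_or => /andP[h1 h2].
      by have [_ _ ->] := tswap x; rewrite ?eqxx.
    by move=> x; rewrite in_setU => /orP[|/X2c]; [rewrite inE => /andP[_ /Bc] | rewrite inE => /andP[_ /eqP]].
  have cpc : cp c by exact: cpM.
  have cpR : cp cR' by move=> x; rewrite rRE; case: ifP.
  have actc : act c v = (-1) ^+ chi R' z' cR' *: v.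
    by rewrite {1}cE actM vB ?vE //; exact: restr_perm_on.
  have gE : g = (c * tau)%g by rewrite /c -mulgA tt mulg1.
  (* The block does not contribute to the sign, as z fixes at most one of its points. *)
  have chic : chi R z c = chi R' z' cR'.
    apply: chi_eq => // x; rewrite rRE !inE.
    case: (boolP (x \in Bk)) => xB /=; last first.
      case: (boolP (x \in R)) => xR //=; rewrite -zOR ?inE ?xB //.
    case: (boolP (x \in R)) => xR //=; case: eqVneq => // zx.
    have h1 : x \in fixS Bk z by rewrite inE xB zx eqxx.
    have h2 : c x \in fixS Bk z by rewrite inE cBB //= -permM cz_ permM zx eqxx.
    by apply/eqP; move: zBf; rewrite -fB => /card_le1_eqP/(_ _ _ h1 h2) ->.
  rewrite {2}gE actM actc actZ BZl gE chiM // chic lchi signr_addb mulrACA -expr2 sqrr_sign mul1r signr_odd.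
  apply: (block_pos (Bk := Bk) (X0 := [set y in R' | col y == col x0])) => //.
  + by rewrite disjoint_subset; apply/subsetP => x xB; rewrite !inE xB.
  + by move=> x; rewrite l1 inE => /andP[].
  + by move=> x; rewrite l2 => /X2c.
move=> h hR ch hz.
have Ch : C h by apply/and3P; split; [| exact/cpP | apply/eqP].
rewrite /e act_sum scaler_sumr [RHS](reindex_inj (mulIg h)) /=; apply: eq_big => [g|g Cg].
  by apply/idP/idP => [Cg|Cg]; [exact: Cm | rewrite -(mulgK h g); apply: Cm => //; exact: Cv].
move/and3P: Cg => [gR /cpP cg /eqP gz].
by rewrite actZ actM chiM // signr_addb scalerA [X in _ = X *: _]mulrCA -expr2 sqrr_sign mulr1.
Qed.

End Star.

Lemma even_fpf (T : finType) (X : {set T}) (f : T -> T) :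
  (forall x, x \in X -> [/\ f x \in X, f (f x) = x & f x != x]) -> ~~ odd #|X|.
Proof.
have [m] := ubnP #|X|; elim: m X => // m IH X hm h.
case: (set_0Vmem X) => [->|[x xX]]; first by rewrite cards0.
have [fX ff fx] := h x xX.
have e : #|X| = (#|X :\ x :\ f x|).+2 by rewrite (cardsD1 x) xX (cardsD1 (f x)) !inE fx fX.
rewrite e /= negbK; apply: IH; first by rewrite e in hm; apply: ltnW.
move=> y; rewrite !inE => /and3P[y1 y2 yX]; have [a b c] := h y yX; split=> //.
rewrite a andbT; apply/andP; split.
  by apply: contraNneq y2 => E; rewrite -b E ff.
by apply: contraNneq y1 => <-; rewrite b.
Qed.

(** * Signed permutations from functions and from sign patterns *)

Section MkPerm.
Variable N : nat.

Definition mkP (f : int -> int) : {perm pt N} :=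
  if [pick w : {perm pt N} | `[< apZ w =1 f >]] is Some w then w else 1%g.

Lemma mkPE f : injective f -> (forall x, (absz x <= N)%N -> (absz (f x) <= N)%N) ->
  (forall x, (N < absz x)%N -> f x = x) -> apZ (mkP f) =1 f.
Proof.
move=> fi fb fo; rewrite /mkP; case: pickP => [w /asboolP //|no].
have gi : injective (fun k : pt N => ofZ N (f (toZ k))).
  move=> a b /(congr1 toZ); rewrite !ofZK ?fb ?toZ_bound // => /fi.
  exact: (can_inj (@toZK N)).
have /asboolP[] := no (perm gi) => x.
case: (leqP (absz x) N) => hx; last by rewrite apZ_out // fo.
by rewrite -{1}(ofZK hx) apZ_toZ permE ofZK // ?ofZK // fb.
Qed.
End MkPerm.

Section Signed.
Variables (n : nat).
Hypothesis hn : (2 <= n)%N.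
Implicit Types (pi : {perm 'I_n}) (e : 'I_n -> bool).

(** The index i in 'I_n stands for the point i + 1 of [n], and [e i] tells whether its image is
    negative. *)
Definition spf pi e (x : int) : int :=
  if insub (absz x).-1 is Some i then
    if x == 0 then 0 else
    if (0 < x) (+) e i then (pi i).+1%:Z else - (pi i).+1%:Z
  else x.

Lemma spf_pos pi e (i : 'I_n) : spf pi e i.+1%:Z = if e i then - (pi i).+1%:Z else (pi i).+1%:Z.
Proof. by rewrite /spf /= valK /=; case: (e i). Qed.

Lemma spf_neg pi e x : spf pi e (- x) = - spf pi e x.
Proof.
rewrite /spf abszN; case: insubP => // i _ _; rewrite oppr_eq0; case: eqP => [_|x0]; first by rewrite oppr0.
have -> : (0 < - x) = ~~ (0 < x) by lia.
by case: (0 < x); case: (e i) => //=; rewrite opprK.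
Qed.

Lemma spf_out pi e x : (n < absz x)%N -> spf pi e x = x.
Proof. by move=> h; rewrite /spf insubN //; lia. Qed.

Lemma pt_cases x : [\/ x = 0, (n < absz x)%N | exists i : 'I_n, x = i.+1%:Z \/ x = - i.+1%:Z].
Proof.
case: (eqVneq x 0) => [|x0]; first by constructor 1.
case: (leqP (absz x) n) => h; last by constructor 2.
have h' : ((absz x).-1 < n)%N by lia.
constructor 3; exists (Ordinal h') => /=; lia.
Qed.

Lemma spf0 pi e : spf pi e 0 = 0.
Proof. by rewrite /spf; case: insubP. Qed.

Lemma spf_abs pi e (i : 'I_n) : absz (spf pi e i.+1%:Z) = (pi i).+1.
Proof. by rewrite spf_pos; case: (e i) => //; rewrite abszN. Qed.

Definition sp pi e : P n := mkP n.*2 (spf pi e).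

Lemma spE pi e : apZ (sp pi e) =1 spf pi e.
Proof.
apply: mkPE.
- have c p2 e2 x : spf (p2^-1)%g (fun i => e2 ((p2^-1)%g i)) (spf p2 e2 x) = x.
    case: (pt_cases x) => [->|h|[i [->|->]]]; first by rewrite !spf0.
    + by rewrite !spf_out // spf_out.
    + by rewrite spf_pos; case E : (e2 i); rewrite ?spf_neg spf_pos permK E // opprK.
    + by rewrite !spf_neg; congr (- _); rewrite spf_pos; case E : (e2 i); rewrite ?spf_neg spf_pos permK E // opprK.
  exact: can_inj (c pi e).
- move=> x hx; case: (pt_cases x) => [->|h|[i [->|->]]]; first by rewrite spf0.
  + by rewrite spf_out.
  + by rewrite spf_abs; have := ltn_ord (pi i); lia.
  + by rewrite spf_neg abszN spf_abs; have := ltn_ord (pi i); lia.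
- by move=> x hx; rewrite spf_out //; lia.
Qed.

Lemma eq_sp (w : P n) pi e : (forall x, apZ w (- x) = - apZ w x) -> (forall x, (n < absz x)%N -> apZ w x = x) ->
  (forall i : 'I_n, apZ w i.+1%:Z = if e i then - (pi i).+1%:Z else (pi i).+1%:Z) -> w = sp pi e.
Proof.
move=> wN wo wp; apply: eq_apZ => x; rewrite spE.
case: (pt_cases x) => [->|h|[i [->|->]]].
- by rewrite spf0; have := wN 0; rewrite oppr0; move: (apZ w 0) => y; lia.
- by rewrite spf_out // wo.
- by rewrite spf_pos wp.
- by rewrite spf_neg wN spf_pos wp.
Qed.

Lemma spM pi e pi' e' :
  permc (sp pi e) (sp pi' e') = sp (pi' * pi)%g (fun i => e' i (+) e (pi' i)).
Proof.
apply: eq_sp => [x|x h|i]; rewrite !apZM !spE ?spf_neg //.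
  by rewrite !spf_out // spf_out.
by rewrite spf_pos; case: (e' i); rewrite ?spf_neg spf_pos permM; case: (e _); rewrite ?opprK.
Qed.

Lemma sp1 : sp 1%g (fun=> false) = 1%g.
Proof. by apply/esym/eq_sp => [x|x h|i]; rewrite !apZ1 ?perm1. Qed.

Lemma sp_ext pi e e' : e =1 e' -> sp pi e = sp pi e'.
Proof. by move=> /funext ->. Qed.

Lemma sp_isBC pi e : isBC (sp pi e).
Proof. by apply/isBCP => x; rewrite !spE spf_neg. Qed.

Lemma sp_fix pi e : fixBeyond n (sp pi e).
Proof. by apply/fixBeyondP => x h; rewrite spE spf_out //; lia. Qed.

Let hnN : (2 <= n <= n.*2)%N. Proof. lia. Qed.

Lemma WW_set t : WW t n = Wset n.*2 t n.
Proof. by rewrite /WW Wgrp_gen // Wset_gen. Qed.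

Lemma sp_iota (c : pred nat) : count c (iota 1 n) = #|[set i : 'I_n | c i.+1]|.
Proof.
rewrite cardsE cardE /enum_mem size_filter -(addn0 1%N) iotaDl count_map.
rewrite -val_enum_ord count_map enumT; apply: eq_count => i.
by first [done | rewrite /= add1n | rewrite /= add1n ?inE].
Qed.

Lemma spW t pi e : (sp pi e \in WW t n) =
  match t with TA => [forall i, ~~ e i] | TBC => true | TD => ~~ odd #|[set i | e i]| end.
Proof.
rewrite WW_set /Wset; case: t => /=; rewrite !inE sp_isBC sp_fix //=.
- apply/allP/forallP => [h i|h j].
    have := h i.+1; rewrite mem_iota spE spf_pos; have := ltn_ord i; case: (e i) => //; lia.
  rewrite mem_iota => hj; have hj' : (j.-1 < n)%N by lia.
  have := h (Ordinal hj'); have := spf_pos pi e (Ordinal hj'); rewrite /= prednK; last by lia.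
  by rewrite spE => ->; case: (e _).
- rewrite /evenNeg sp_iota; congr (~~ odd #|pred_of_set _|); apply/setP => i.
  by rewrite !inE spE spf_pos; case: (e i).
Qed.

Lemma sp_ex t g : g \in WW t n -> exists pi e, g = sp pi e.
Proof.
rewrite WW_set => /Wset_BC[/isBCP gN /fixBeyondP gf].
have gb (i : 'I_n) : ((absz (apZ g i.+1%:Z)).-1 < n)%N /\ apZ g i.+1%:Z != 0.
  have gi := @apZ_inj _ g; have g0 : apZ g 0 = 0 by have := gN 0; rewrite oppr0; move: (apZ g 0) => y; lia.
  split; last by apply/eqP; rewrite -g0 => /gi.
  have := ltn_ord i; case: (leqP (absz (apZ g i.+1%:Z)) n) => h; first by lia.
  by have := gf (apZ g i.+1%:Z); rewrite (_ : _ < _); [move=> /(_ isT)/gi | ]; lia.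
pose f (i : 'I_n) := Ordinal (gb i).1.
have fi : injective f.
  move=> i j /(congr1 val) /= h; have [_ a] := gb i; have [_ b] := gb j.
  have : apZ g i.+1%:Z = apZ g j.+1%:Z \/ apZ g i.+1%:Z = apZ g (- j.+1%:Z).
    by rewrite gN; move: a b h; move: (apZ g _) (apZ g _) => x y; lia.
  by move=> [] /(@apZ_inj _ g) E; apply: val_inj => /=; lia.
exists (perm fi), (fun i => apZ g i.+1%:Z < 0); apply: eq_sp; [exact: gN | by move=> x h; apply: gf; lia | move=> i].
by rewrite permE /=; have := (gb i).2; move: (apZ g _) => y; case: ifP; lia.
Qed.

End Signed.

(** * The Vandermonde determinant as an alternating weight *)

Section Vander.
Variables (n : nat).

Definition vdet (y : 'I_n -> rat) : rat := \det (Vandermonde n (\row_i y i)).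

Lemma vdet_perm y (s : {perm 'I_n}) : vdet (fun i => y (s i)) = (-1) ^+ s * vdet y.
Proof.
rewrite /vdet.
have -> : Vandermonde n (\row_i y (s i)) = col_perm s (Vandermonde n (\row_i y i)).
  by apply/matrixP => i j; rewrite !mxE.
by rewrite col_permE det_mulmx det_perm odd_permV mulrC.
Qed.

Lemma vdet_neq0 y : injective y -> vdet y != 0.
Proof.
move=> yi; rewrite /vdet det_Vandermonde; apply/prodf_neq0 => i _; apply/prodf_neq0 => j ij.
rewrite !mxE subr_eq0; apply/eqP => /yi e; by rewrite e ltnn in ij.
Qed.
End Vander.

(** * An index element restricting to a given involution *)

Section StdElement.
Variables (t : CoxType) (n : nat).
Hypothesis hn : (2 <= n)%N.
Variable zeta : {perm 'I_n}.
Hypothesis zz : (zeta * zeta = 1)%g.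

Let zK i : zeta (zeta i) = i. Proof. by rewrite -permM zz perm1. Qed.
Let fx := enum (fixS setT zeta).
Let k := size fx.

Let fxP i : (i \in fx) = (zeta i == i).
Proof. by rewrite mem_enum !inE. Qed.

Let kn : (k <= n)%N.
Proof. by rewrite /k -cardE -[X in (_ <= X)%N](card_ord n) max_card. Qed.

Let kodd : ~~ odd (n - k).
Proof.
have -> : (n - k)%N = #|~: fixS setT zeta|.
  by rewrite cardsCs setCK card_ord /k -cardE.
apply: (even_fpf (f := zeta)) => i; rewrite !inE /= => h.
by rewrite zK eq_sym h; split.
Qed.

(** On [n] this is zeta, except that the k fixed points of zeta, in increasing order, are matched
    with n + 1, ..., n + k. The n - k points left up to 2n are paired with their neighbours, which
    is possible because n - k is even. *)
Let h (m : nat) : nat :=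
  if m == 0 then 0 else
  if insub m.-1 is Some i then (if zeta i == i then n.+1 + index i fx else (zeta i).+1) else
  if (m <= n + k)%N then (nth 0 (map val fx) (m - n.+1)).+1 else
  if (m <= n.*2)%N then (if odd (m - (n + k)) then m.+1 else m.-1) else m.

Let h_small (i : 'I_n) : h i.+1 = if zeta i == i then (n.+1 + index i fx)%N else (zeta i).+1.
Proof. by rewrite /h /= valK. Qed.

Let h_mid a : (a < k)%N -> exists2 i : 'I_n, zeta i = i & h (n.+1 + a) = i.+1 /\ index i fx = a.
Proof.
move=> ak; have n0 : (0 < n)%N by lia.
pose i := nth (Ordinal n0) fx a; have ifx : i \in fx by rewrite mem_nth.
exists i; first by apply/eqP; rewrite -fxP.
split; last by rewrite index_uniq // enum_uniq.
rewrite /h insubN; last by rewrite -leqNgt; lia.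
have -> : (n.+1 + a == 0)%N = false by lia.
have -> : (n.+1 + a <= n + k)%N by lia.
by rewrite addKn (nth_map (Ordinal n0)).
Qed.

Let h_big m : (n + k < m <= n.*2)%N -> h m = if odd (m - (n + k)) then m.+1 else m.-1.
Proof.
move=> /andP[h1 h2]; rewrite /h insubN; last by rewrite -leqNgt; lia.
have -> : (m == 0)%N = false by lia.
have -> : (m <= n + k)%N = false by lia.
by rewrite h2.
Qed.

Let h_out m : (n.*2 < m)%N -> h m = m.
Proof.
move=> h1; rewrite /h insubN; last by rewrite -leqNgt; lia.
have -> : (m == 0)%N = false by lia.
have -> : (m <= n + k)%N = false by lia.
by have -> : (m <= n.*2)%N = false by lia.
Qed.

Let h_cases m : (0 < m <= n.*2)%N -> [\/ exists i : 'I_n, m = i.+1,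
  exists2 a, (a < k)%N & m = (n.+1 + a)%N | (n + k < m)%N].
Proof.
move=> hm; case: (leqP m n) => h1.
  by have h' : (m.-1 < n)%N by [lia]; constructor 1; exists (Ordinal h') => /=; lia.
case: (leqP m (n + k)) => h2; last by constructor 3.
by constructor 2; exists (m - n.+1)%N; lia.
Qed.

Let h_main m : (0 < m <= n.*2)%N -> [/\ (0 < h m <= n.*2)%N, h (h m) = m & h m != m].
Proof.
move=> hm; case: (h_cases hm) => [[i e]|[a ak e]|hb].
- rewrite e h_small; case: (eqVneq (zeta i) i) => zi.
    have ik : (index i fx < k)%N by rewrite index_mem fxP zi.
    have [j zj [-> ej]] := h_mid ik; have := ltn_ord i; have := ltn_ord j; split; try lia.
    have /eqP := ej; rewrite -[X in _ == X]/(index i fx) => /eqP E.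
    have ji : j = i.
      by rewrite -[j](nth_index i (s := fx)) ?fxP ?zj // E nth_index // fxP zi.
    by rewrite ji.
  rewrite h_small zK; have -> : (i == zeta i) = false by rewrite eq_sym (negbTE zi).
  split; [by have := ltn_ord (zeta i); lia | by [] |].
  by rewrite eqSS; apply: contraNneq zi => E; apply/eqP/val_inj.
- have [i zi [hi ei]] := h_mid ak; rewrite e hi h_small zi eqxx ei.
  by have := ltn_ord i; split=> //; lia.
rewrite h_big ?hb ?(proj2 (andP hm)) //; move: kodd kn hm hb; case o : (odd (m - (n + k))) => ko k1 h1 h2.
  have h3 : (m < n.*2)%N by lia.
  by split; [lia | rewrite h_big; [|lia]; have -> : odd (m.+1 - (n + k)) = false by [lia]; lia | lia].
by split; [lia | rewrite h_big; [|lia]; have -> : odd (m.-1 - (n + k)) by [lia]; lia | lia].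
Qed.

Let h0 : h 0 = 0. Proof. by []. Qed.

Let f (x : int) : int := if 0 < x then (h (absz x))%:Z else - (h (absz x))%:Z.

Let f_pos m : f m%:Z = (h m)%:Z.
Proof. by rewrite /f; case: m => [|m] //=; rewrite h0. Qed.

Let f_neg x : f (- x) = - f x.
Proof.
rewrite /f abszN; case: (ltrgtP 0 x) => hx; last by rewrite -hx /= h0.
  by have -> : (0 < - x) = false by lia.
by have -> : (0 < - x) by [lia]; rewrite opprK.
Qed.

Let fall (Q : int -> Prop) : (forall x, Q x -> Q (- x)) -> (forall m : nat, Q m%:Z) -> forall x, Q x.
Proof.
move=> QN Qp x; case: (leP 0 x) => hx; first by have -> : x = (absz x)%:Z by lia.
by have -> : x = - (absz x)%:Z by [lia]; apply: QN.
Qed.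

Let f_gcond : gcond n f.
Proof.
split.
- exact: f_neg.
- apply: fall => [x e|m]; first by rewrite !f_neg e.
  rewrite !f_pos; case: (posnP m) => [->|m0]; first by rewrite h0.
  case: (leqP m n.*2) => hm; last by rewrite !h_out.
  by have [] := @h_main m; rewrite ?m0 // => _ ->.
- apply: fall => [x e|m]; first by rewrite f_neg oppr_eq0 !normrN.
  move=> m0 hm; have hm' : (0 < m <= n.*2)%N by lia.
  by rewrite f_pos; have [_ _] := h_main hm'; lia.
- apply: fall => [x e|m]; first by rewrite f_neg normrN => /e->.
  by rewrite f_pos => hm; rewrite h_out //; lia.
move=> i hi; have [m mE] : exists m : nat, i = m%:Z by exists (absz i); lia.
move: hi; rewrite mE => hi; have -> : m%:Z + 1 = m.+1%:Z by lia.
rewrite !f_pos; split; last by lia.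
case: (leqP m.+1 n.*2) => h1; last by left; rewrite h_out //; lia.
case: (leqP m.+1 (n + k)) => h2; last first.
  left; rewrite h_big; last by lia.
  by case: (odd _); lia.
right; have a1 : (m - n.+1 < k)%N by lia.
have a2 : (m.+1 - n.+1 < k)%N by lia.
have [i1 z1 [e1 x1]] := h_mid a1; have [i2 z2 [e2 x2]] := h_mid a2.
have E1 : (n.+1 + (m - n.+1) = m)%N by lia.
have E2 : (n.+1 + (m.+1 - n.+1) = m.+1)%N by lia.
rewrite E1 in e1; rewrite E2 in e2; rewrite e1 e2.
(* The increasing order of the partners of n + 1, ..., n + k is what prevents visible descents
   there. *)
have srt : sorted ltn (map val fx).
  apply: (subseq_sorted ltn_trans (s2 := iota 0 n)); last exact: iota_ltn_sorted.
  by rewrite -val_enum_ord; apply: map_subseq; rewrite /fx enumT; exact: filter_subseq.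
have i1f : i1 \in fx by rewrite fxP z1.
have i2f : i2 \in fx by rewrite fxP z2.
have n1 : nth 0 (map val fx) (m - n.+1) = i1 by rewrite -x1 (nth_map i1) ?index_mem // nth_index.
have n2 : nth 0 (map val fx) (m.+1 - n.+1) = i2 by rewrite -x2 (nth_map i1) ?index_mem // nth_index.
have := sorted_ltn_nth ltn_trans 0 srt (m - n.+1)%N (m.+1 - n.+1)%N.
rewrite !inE size_map -/k n1 n2 => /(_ a1 a2); lia.
Qed.

Lemma std_element : exists2 z : P n, z \in Gset t n &
  (forall i : 'I_n, zeta i != i -> apZ z i.+1%:Z = (zeta i).+1%:Z) /\
  (forall i : 'I_n, zeta i = i -> n%:Z < apZ z i.+1%:Z).
Proof.
have [fN fK f_ne fo fd] := f_gcond.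
have zE : apZ (mkP n.*2 f) =1 f.
  apply: mkPE.
  - exact: can_inj fK.
  - move=> x hx; case: (leqP (absz (f x)) n.*2) => // h1.
    by have := fo (f x); rewrite fK => H; have : f x = x by [rewrite -H //; lia]; lia.
  - by move=> x hx; apply: fo; lia.
have zE' : apZ (mkP n.*2 f) = f by apply/funext.
exists (mkP n.*2 f).
  apply/(GsetP hn); rewrite zE'; split=> //; rewrite /tcond; case: t => // [x x0|].
    rewrite zE'; have -> : x = (absz x)%:Z by lia.
    rewrite f_pos; case: (leqP (absz x) n.*2) => hx; last by rewrite h_out //; lia.
    by have [|hh _ _] := @h_main (absz x); lia.
  rewrite zE' (eq_count (a2 := pred0)) ?count_pred0 // => i /=; rewrite f_pos; lia.
split=> i zi; rewrite zE f_pos h_small; first by rewrite (negbTE zi).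
by rewrite zi eqxx; lia.
Qed.
End StdElement.

(** * An equivariant family in the regular representation *)

Section Faithful.
Variables (t : CoxType) (n : nat).
Hypothesis hn : (2 <= n)%N.
Let hnN : (2 <= n <= n.*2)%N. Proof. lia. Qed.

Notation W := (WW t n).
Notation SG := (Sgen t n).
Notation VV := {ffun P n -> rat^o}.
Notation cj s z := (permc s (permc z s)).

Lemma W_mul u w : u \in W -> w \in W -> permc u w \in W.
Proof. by rewrite (WW_gen t hn) => a b; rewrite /permc groupM. Qed.
Lemma W_inv u : u \in W -> u^-1%g \in W.
Proof. by rewrite (WW_gen t hn) => a; rewrite groupV. Qed.
Lemma W_mulE u w : u \in W -> (permc u w \in W) = (w \in W).
Proof.
move=> uW; apply/idP/idP => h; last exact: W_mul.
by have := W_mul (W_inv uW) h; rewrite /permc mulgK.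
Qed.

Definition ga (g : P n) (v : VV) : VV := [ffun w => v (permc g^-1%g w)].

Lemma ga_lin g a u v : ga g (a *: u + v) = a *: ga g u + ga g v.
Proof. by apply/ffunP => w; rewrite !ffunE. Qed.
Lemma ga_M g h v : ga (permc g h) v = ga g (ga h v).
Proof. by apply/ffunP => w; rewrite !ffunE /permc invMg mulgA. Qed.
Lemma ga_1 v : ga 1%g v = v.
Proof. by apply/ffunP => w; rewrite !ffunE /permc invg1 mulg1. Qed.
Lemma ga_Z g a u : ga g (a *: u) = a *: ga g u.
Proof. by apply/ffunP => w; rewrite !ffunE. Qed.
Lemma ga_D g u v : ga g (u + v) = ga g u + ga g v.
Proof. by apply/ffunP => w; rewrite !ffunE. Qed.
Lemma ga_0 g : ga g 0 = 0.
Proof. by apply/ffunP => w; rewrite !ffunE. Qed.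

Notation dotQ := (@dot rat (pt n.*2)).

Lemma dot_ga g u v : dotQ (ga g u) (ga g v) = dotQ u v.
Proof.
rewrite /dot [RHS](reindex_inj (mulIg g^-1%g)) /=.
by apply: eq_bigr => w _; rewrite !ffunE.
Qed.

Lemma dot_pos v : v != 0 -> 0 < dotQ v v.
Proof.
move=> nv; rewrite lt_neqAle; apply/andP; split; last first.
  by apply: sumr_ge0 => w _; rewrite -expr2 sqr_ge0.
apply: contra nv; rewrite eq_sym => /eqP h; apply/eqP/ffunP => w; rewrite ffunE.
have h2 (w' : P n) : true -> 0 <= (v w' : rat) * (v w' : rat) by move=> _; rewrite -expr2 sqr_ge0.
by have := psumr_eq0P h2 h; move=> /(_ w isT)/eqP; rewrite mulf_eq0 orbb => /eqP.
Qed.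

Section Phi.
Variables (zeta : {perm 'I_n}) (v : VV).
Hypothesis zz : (zeta * zeta = 1)%g.

Definition x1 (i : 'I_n) : int := i.+1%:Z.
(** g carries the pattern of zeta to z: matched pairs go to matched pairs, and fixed points go to
    points that z sends beyond n with positive sign. *)
Definition compat (g z : P n) := [forall i : 'I_n,
  if zeta i == i then n%:Z < apZ z (apZ g (x1 i)) else apZ z (apZ g (x1 i)) == apZ g (x1 (zeta i))].
(** The large partners of the fixed points are the true arguments. Elsewhere the filler i < n
    depends on neither g nor z and differs from all values beyond n. *)
Definition yv (g z : P n) (i : 'I_n) : rat :=
  if zeta i == i then (apZ z (apZ g (x1 i)))%:~R else (i : nat)%:R.
(** The image of the basis vector of z under the map sought at x = 1. Conjugating z merely
    translates g; the alternating weight supplies the sign -1 required at generators in Asc=. *)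
Definition phi (z : P n) : VV := \sum_(g | (g \in W) && compat g z) vdet (yv g z) *: ga g v.

Lemma ga_phi s z : s \in SG -> ga s (phi z) =
  \sum_(g | (g \in W) && compat (permc s g) z) vdet (yv (permc s g) z) *: ga g v.
Proof.
move=> sS; rewrite /phi (big_morph _ (ga_D s) (ga_0 s)).
rewrite (reindex_inj (can_inj (fun w => SS hn w sS))) /=; apply: eq_big => g.
  by rewrite W_mulE; [by [] | exact: (WWS hn sS)].
by move=> _; rewrite ga_Z -ga_M (SS hn _ sS).
Qed.

Lemma S_facts s : s \in SG ->
  [/\ forall y, n%:Z < `|y| -> apZ s y = y, forall y, `|y| <= n%:Z -> `|apZ s y| <= n%:Z &
      forall y, apZ s (apZ s y) = y].
Proof.
move=> sS; have sW := WWS hn sS; rewrite (WW_set hn) in sW; have [_ sf] := Wset_BC sW.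
split; [exact/fixBeyondP | |].
  by move=> y hy; have := fixBeyond_bound hnN (x := y) sf; lia.
by move=> y; rewrite -apZM /permc (gens_invol hnN sS) apZ1.
Qed.

Lemma phi_conj s z : s \in SG -> ga s (phi z) = phi (cj s z).
Proof.
move=> sS; rewrite ga_phi // /phi; have [sf sb sK] := S_facts sS.
have gt y : (n%:Z < apZ s y) = (n%:Z < y).
  case: (leP `|y| n%:Z) => hy; last by rewrite sf.
  by have := sb y hy; lia.
apply: eq_big => g.
  congr andb; apply: eq_forallb => i; rewrite !apZM; case: ifP => _; first by rewrite gt.
  by rewrite -(inj_eq (@apZ_inj _ s)) sK.
move=> /andP[_ /forallP c]; congr (vdet _ *: _); apply/funext => i; rewrite /yv.
have := c i; case: ifP => // _; rewrite !apZM => hi; rewrite [apZ s (apZ z _)]sf //; lia.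
Qed.

Lemma W_onto g p : g \in W -> p != 0 -> `|p| <= n%:Z -> exists i : 'I_n, apZ g (x1 i) = p \/ apZ g (x1 i) = - p.
Proof.
rewrite (WW_set hn) => /Wset_BC[/isBCP gN /fixBeyondP gf] p0 pn.
have xE := apZKV g p; move: (apZ g^-1%g p) xE => x xE.
case: (pt_cases hn x) => [x0|h|[i [e|e]]].
- by move: xE; rewrite x0; have := gN 0; rewrite oppr0; move: (apZ g 0) => y; lia.
- by have := gf x; lia.
- by exists i; left; rewrite -xE e.
- by exists i; right; rewrite -xE e gN opprK.
Qed.

(** After replacing p, q by -q, -p if necessary, z sends both points beyond n with positive sign.
    For each compatible g they are the images of two fixed points of zeta, and multiplying g by s
    transposes the two corresponding arguments of the Vandermonde determinant. *)
Lemma phi_KA s z : s \in SG -> z \in Gset t n -> zkind t s z = KA -> ga s (phi z) = - phi z.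
Proof.
move=> sS zG kA; have [sf sb sK] := S_facts sS.
have [zN _ _ _ _] := Gset_gcond hn zG.
have zetaK i : zeta (zeta i) = i by rewrite -permM zz perm1.
have [p [q [[sE pn qn pq] [p0 q0 zp zq]]]] : exists p q,
    [/\ apZ s =1 sw p q, `|p| <= n%:Z, `|q| <= n%:Z & `|p| != `|q|] /\
    [/\ p != 0, q != 0, n%:Z < apZ z p & n%:Z < apZ z q].
  have [p [q [r sE]]] := gensP hnN sS.
  have := zkindP hn sS zG; rewrite kA => /(AscEqP hn zG r sE); rewrite /kAE.
  have [p0 q0] := groot_neq0 r; have [pn qn] := groot_le hn r; have pq := groot_lt r.
  have e1 : q = - p -> apZ z q = - apZ z p by move=> ->.
  have [e2 e3] : apZ z (- p) = - apZ z p /\ apZ z (- q) = - apZ z q by rewrite !zN.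
  move: e1 e2 e3; case a0 : (n%:Z < apZ z p) => e1 e2 e3 /and3P[/eqP H h1 h2].
    have pq' : `|p| != `|q| by move: e1 H; move: (apZ z p) (apZ z q) pq => a b; clear; lia.
    have b0 : n%:Z < apZ z q by move: a0 H; move: (apZ z p) (apZ z q) => a b; clear; lia.
    by exists p, q.
  have pq' : `|q| != `|p| by move: e1 H; move: (apZ z p) (apZ z q) pq => a b; clear; lia.
  have b1 : n%:Z < apZ z (- p) by rewrite e2; move: a0 h1; move: (apZ z p) => a; clear; lia.
  have b2 : n%:Z < apZ z (- q) by rewrite e3; move: a0 H h1 h2; move: (apZ z p) (apZ z q) => a b; clear; lia.
  exists (- q), (- p); rewrite !oppr_eq0; split; split; rewrite ?normrN //; first by move=> x; rewrite swNN.
have other y : `|y| != `|p| -> `|y| != `|q| -> apZ s y = y by move=> h1 h2; rewrite sE sw_abs.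
have key g : g \in W -> compat g z -> compat (permc s g) z /\
    exists i1 i2 : 'I_n, i1 != i2 /\ forall i, yv (permc s g) z i = yv g z (tperm i1 i2 i).
  move=> gW /forallP c; have gB := gW; rewrite (WW_set hn) in gB; have [/isBCP gN gf] := Wset_BC gB.
  have gb i : `|apZ g (x1 i)| <= n%:Z.
    by have := fixBeyond_bound hnN (x := x1 i) gf; have := ltn_ord i; rewrite /x1; lia.
  have small i : zeta i != i -> `|apZ g (x1 i)| != `|p| /\ `|apZ g (x1 i)| != `|q|.
    move=> zi; have := c i; rewrite (negbTE zi) => /eqP E; have := gb (zeta i); rewrite -E.
    have a1 : apZ g (x1 i) = p \/ apZ g (x1 i) = - p -> `|apZ z (apZ g (x1 i))| = `|apZ z p|.
      by case=> ->; rewrite ?zN ?normrN.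
    have a2 : apZ g (x1 i) = q \/ apZ g (x1 i) = - q -> `|apZ z (apZ g (x1 i))| = `|apZ z q|.
      by case=> ->; rewrite ?zN ?normrN.
    move: a1 a2 zp zq; move: (apZ z (apZ g (x1 i))) (apZ z p) (apZ z q) => A B C.
    move: (apZ g (x1 i)) => D a1 a2 zp zq h; clear -a1 a2 zp zq h; lia.
  have at_ r : r != 0 -> `|r| <= n%:Z -> n%:Z < apZ z r -> (`|r| == `|p|) || (`|r| == `|q|) ->
      exists2 i, zeta i = i & apZ g (x1 i) = r.
    move=> r0 rn zr rpq; have [i hi] := W_onto gW r0 rn.
    have zi : zeta i = i.
      by apply: contrapT => /eqP /small[]; case: hi => ->; rewrite ?normrN; case/orP: rpq => ->.
    exists i => //; case: hi => // hi; have := c i; rewrite zi eqxx hi zN.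
    by move: zr; move: (apZ z r) => A; lia.
  have [i1 z1 g1] := at_ p p0 pn zp (introT orP (or_introl (eqxx _))).
  have [i2 z2 g2] := at_ q q0 qn zq (introT orP (or_intror (eqxx _))).
  have i12 : i1 != i2 by apply: contraNneq pq => e; rewrite -g1 -g2 e.
  have fixd i : zeta i = i -> i != i1 -> i != i2 -> apZ s (apZ g (x1 i)) = apZ g (x1 i).
    move=> zi n1 n2; apply: other.
      apply/eqP => e; have [E|E] : apZ g (x1 i) = p \/ apZ g (x1 i) = - p by move: e; clear; lia.
        by move: n1; rewrite -(inj_eq val_inj); have := apZ_inj (etrans E (esym g1)); rewrite /x1 /=; lia.
      by have := c i; rewrite zi eqxx E zN; move: zp; move: (apZ z p) => A; lia.
    apply/eqP => e; have [E|E] : apZ g (x1 i) = q \/ apZ g (x1 i) = - q by move: e; clear; lia.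
      by move: n2; rewrite -(inj_eq val_inj); have := apZ_inj (etrans E (esym g2)); rewrite /x1 /=; lia.
    by have := c i; rewrite zi eqxx E zN; move: zq; move: (apZ z q) => A; lia.
  split.
    apply/forallP => i; rewrite !apZM; case: eqP => zi.
      case: (eqVneq i i1) => [->|n1]; first by rewrite g1 sE sw_l.
      case: (eqVneq i i2) => [->|n2]; first by rewrite g2 sE sw_r.
      by rewrite fixd //; have := c i; rewrite zi eqxx.
    move/eqP: zi => zi; have zi' : zeta (zeta i) != zeta i by rewrite zetaK eq_sym.
    have [a1 a2] := small i zi; have [b1 b2] := small (zeta i) zi'.
    by rewrite !other //; have := c i; rewrite (negbTE zi).
  exists i1, i2; split=> // i; rewrite /yv !apZM; case: (tpermP i1 i2 i) => [->|->|n1 n2].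
  - by rewrite z1 z2 !eqxx g1 sE sw_l g2.
  - by rewrite z1 z2 !eqxx g2 sE sw_r g1.
  - by case: eqP => // zi; rewrite fixd //; apply/eqP.
rewrite ga_phi // /phi -sumrN; apply: eq_big => g.
  case gW : (g \in W) => //=; apply/idP/idP => h; last by have [] := key g gW h.
  by have [] := key _ (W_mul (WWS hn sS) gW) h; rewrite (SS hn _ sS).
move=> /andP[gW h]; have h' : compat g z.
  by have [] := key _ (W_mul (WWS hn sS) gW) h; rewrite (SS hn _ sS).
have [_ [i1 [i2 [i12 E]]]] := key g gW h'.
rewrite -scaleNr; congr (_ *: _); rewrite (_ : yv (permc s g) z = fun i => yv g z (tperm i1 i2 i)); last exact/funext.
by rewrite vdet_perm odd_tperm i12 expr1 mulN1r.
Qed.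
End Phi.

End Faithful.

(** * Faithfulness at x = 1 *)

Section Faithful.
Variables (t : CoxType) (n : nat).
Hypothesis hn : (2 <= n)%N.
Hypothesis tn : t = TD -> odd n.
Let hnN : (2 <= n <= n.*2)%N. Proof. lia. Qed.

Notation W := (WW t n).
Notation SG := (Sgen t n).
Notation VV := {ffun P n -> rat^o}.
Notation cj s z := (permc s (permc z s)).
Notation dotQ := (@dot rat (pt n.*2)).

(** The sign pattern of an element of W attached to the place a. In type D the single sign change is
    replaced by its negative, with n - 1 signs, an even number because n is odd. *)
Definition tz (a i : 'I_n) : bool := match t with TA => false | TBC => i == a | TD => i != a end.
Definition tau (a : 'I_n) : P n := sp 1%g (tz a).

Lemma tau_W a : tau a \in W.
Proof.
rewrite spW // /tz; case E : t => //; first by apply/forallP.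
have -> : [set i : 'I_n | i != a] = ~: [set a] by apply/setP => i; rewrite !inE.
have e := cardsC [set a]; rewrite cards1 card_ord in e.
by have : odd (1 + #|~: [set a]|) by [rewrite e; exact: tn]; rewrite add1n /=.
Qed.

Lemma tau_sp (a : 'I_n) (pi : {perm 'I_n}) (e : 'I_n -> bool) : permc (tau (pi a)) (sp pi e) = permc (sp pi e) (tau a).
Proof.
rewrite /tau !spM // mulg1 mul1g; apply: sp_ext => i; rewrite perm1 addbC; congr (_ (+) _).
by rewrite /tz; case: t => //; rewrite (inj_eq perm_inj).
Qed.

Lemma tau_comm a b : permc (tau a) (tau b) = permc (tau b) (tau a).
Proof. by have := tau_sp a 1%g (tz b); rewrite perm1. Qed.

Lemma tau_invol a : permc (tau a) (tau a) = 1%g.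
Proof.
rewrite /tau spM // mulg1 -(sp1 hn); apply: sp_ext => i; by rewrite perm1 addbb.
Qed.

Variable (S : P n -> 'M[rat]_#|{: Gt t n}|).
Definition zof (j : 'I_#|{: Gt t n}|) : P n := val (enum_val j).
Definition rw (Phi : P n -> rat) : 'rV[rat]_#|{: Gt t n}| := \row_j Phi (zof j).
Hypothesis S1 : S 1%g = 1%:M.
Hypothesis SM : forall u w, u \in W -> w \in W -> S (permc u w) = S u *m S w.
Hypothesis ST : forall w, w \in W -> (S w)^T = S w^-1%g.
(** The rules of M at x = 1, for a functional Phi applied to the image of the j-th basis vector; N
    will be reduced to this case. *)
Hypothesis Srule : forall s Phi j, s \in SG -> (rw Phi *m S s) 0 j =
  match zkind t s (zof j) with KD => Phi (zof j) | KA => - Phi (zof j) | _ => Phi (cj s (zof j)) end.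

Definition ann (v : VV) := (forall w, w \notin W -> v w = 0) /\ \sum_(w in W) (v w : rat) *: S w = 0.

Lemma ann_sub : sub ann.
Proof.
split; first by split=> [w _|]; [rewrite ffunE | rewrite big1 // => w _; rewrite ffunE scale0r].
move=> a u v [u1 u2] [v1 v2]; split=> [w hw|].
  by rewrite !ffunE u1 // v1 // scaler0 addr0.
rewrite (eq_bigr (fun w => a *: ((u w : rat) *: S w) + (v w : rat) *: S w)) => [|w _].
  by rewrite big_split /= -scaler_sumr u2 v2 scaler0 addr0.
by rewrite !ffunE scalerDl scalerA.
Qed.

Lemma ann_ga g v : g \in W -> ann v -> ann (ga g v).
Proof.
move=> gW [v1 v2]; split=> [w hw|].
  by rewrite ffunE v1 // W_mulE // W_inv.
rewrite (reindex_inj (mulIg g)) /= (eq_bigl (mem W)) => [|w]; last by rewrite -[(w * g)%g]/(permc g w) W_mulE.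
rewrite (eq_bigr (fun w => S g *m ((v w : rat) *: S w))) => [|w wW].
  by rewrite -mulmx_sumr v2 mulmx0.
by rewrite ffunE /permc mulgK -[(w * g)%g]/(permc g w) SM // scalemxAr.
Qed.

(** For fixed w the coordinates of all [phi z] at w form a row, which by equivariance is the row at
    1 times S of the inverse of w. Summing these rows with the coefficients of [phi z0], which
    annihilates the module, gives 0; the entry at z0 is the sum of the squares of the coordinates of
    [phi z0]. *)
Lemma phi_equivariant (phi : P n -> VV) (z0 : P n) : z0 \in Gset t n -> ann (phi z0) ->
  (forall s z, s \in SG -> z \in Gset t n -> ga s (phi z) =
     match zkind t s z with KD => phi z | KA => - phi z | _ => phi (cj s z) end) -> phi z0 = 0.
Proof.
move=> zG [sup a0] eqv.
have step s w : s \in SG -> rw (fun z => phi z (permc s w)) = rw (fun z => phi z w) *m S s.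
  move=> sS; apply/rowP => j; rewrite Srule // mxE.
  have := congr1 (fun f : VV => f w) (eqv s (zof j) sS (valP _)).
  rewrite ffunE (gensV hnN sS) => ->; case: (zkind t s (zof j)) => //.
  by rewrite ffunE.
have all w : w \in W -> rw (fun z => phi z w) = rw (fun z => phi z 1%g) *m S w^-1%g.
  move: w; apply: (W_ind hn) => [|s w sS wW _ IH]; first by rewrite invg1 S1 mulmx1.
  have pW := WWM hn sS wW; have sW := WWS hn sS.
  rewrite -{1}(SS hn w sS) step // IH -mulmxA -(SM (W_inv hn pW) sW).
  by congr (_ *m S _); rewrite /permc invMg (gensV hnN sS) mulgA (gens_invol hnN sS) mul1g.
have aT : \sum_(w in W) (phi z0 w : rat) *: S w^-1%g = 0.
  apply/matrixP => i j; have := congr1 (fun M : 'M_ _ => M j i) a0.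
  rewrite !summxE !mxE => E0; rewrite -[RHS]E0; apply: eq_bigr => w wW; by rewrite -(ST wW) !mxE.
have : \sum_(w in W) (phi z0 w : rat) *: rw (fun z => phi z w) = 0.
  rewrite -[RHS](mulmx0 _ (rw (fun z => phi z 1%g))) -aT mulmx_sumr; apply: eq_bigr => w wW.
  by rewrite all // -scalemxAr.
move/rowP/(_ (enum_rank (exist _ z0 zG : Gt t n))); rewrite summxE mxE => e0.
have e1 : \sum_(w in W) (phi z0 w : rat) ^+ 2 = 0.
  by rewrite -[RHS]e0; apply: eq_bigr => w _; rewrite !mxE /zof enum_rankK.
apply/ffunP => w; rewrite ffunE; case: (boolP (w \in W)) => wW; last exact: sup.
by have := psumr_eq0P (fun w _ => sqr_ge0 (phi z0 w : rat)) e1; move=> /(_ w wW)/eqP; rewrite sqrf_eq0 => /eqP.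
Qed.

Lemma tau_eigen (l : seq 'I_n) : (exists2 v, ann v & v != 0) ->
  exists v (col : 'I_n -> bool), [/\ ann v, v != 0 & forall a, a \in l -> ga (tau a) v = (-1) ^+ col a *: v].
Proof.
move=> [v0 a0 n0]; elim: l => [|a l [v [col [av nv ve]]]]; first by exists v0, (fun=> false); split.
suff [b nb] : exists b : bool, v + (-1) ^+ b *: ga (tau a) v != 0.
  exists (v + (-1) ^+ b *: ga (tau a) v), (fun x => if x == a then b else col x); split=> //.
    rewrite addrC; apply ann_sub.2 => //; apply: ann_ga => //; exact: tau_W.
  move=> x; rewrite inE; case: (eqVneq x a) => [->|xa] /= h.
    rewrite ga_D ga_Z -ga_M tau_invol ga_1 scalerDr scalerA -expr2 sqrr_sign scale1r addrC.
    by [].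
  by rewrite ga_D ga_Z -ga_M tau_comm ga_M ve // ga_Z scalerDr !scalerA mulrC.
apply: contrapT => no.
have z1 : v + ga (tau a) v = 0 by apply: contrapT => /eqP hh; apply: no; exists false; rewrite expr0 scale1r.
have z2 : v - ga (tau a) v = 0 by apply: contrapT => /eqP hh; apply: no; exists true; rewrite expr1 scaleN1r.
case/negP: nv; have : v + v = 0 by rewrite -[RHS](addr0 0) -{1}z1 -z2 addrACA addrN addr0.
by rewrite -mulr2n -scaler_nat => /eqP; rewrite scaler_eq0.
Qed.

(** Inside the annihilator, [star] is applied to a common eigenspace of the elements [tau a]. By
    [phi_equivariant] the resulting [ph z0] is zero. Yet its product with v is a sum whose terms are
    0 or one fixed nonzero number, attained at g = 1. *)
Theorem x1_faithful v0 : ann v0 -> v0 = 0.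
Proof.
move=> av0; apply: contrapT => /eqP nv0.
have [v1 [col [av1 nv1 ve1]]] := tau_eigen (enum 'I_n) (ex_intro2 _ _ v0 av0 nv0).
pose act (g : {perm 'I_n}) := ga (sp g (fun=> false)).
pose U (v : VV) := ann v /\ forall a, ga (tau a) v = (-1) ^+ col a *: v.
have embW g : sp g (fun=> false) \in W.
  rewrite spW //; case: (t) => //; first by apply/forallP.
  by rewrite (_ : [set _ | _] = set0) ?cards0 //; apply/setP => i; rewrite !inE.
have [||||||||||z [zz _ cz [v [[av ve] nv vE]]]] := @star rat n VV act dotQ col _ _ _ _ _ _ _ setT U.
- by move=> g a u v; exact: ga_lin.
- by move=> v; rewrite /act sp1 // ga_1.
- by move=> g h v; rewrite /act -ga_M spM //; congr ga; apply: sp_ext.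
- exact: dot_lin.
- exact: dot_sym.
- exact: dot_pos.
- by move=> g u v; exact: dot_ga.
- split; first by split=> [|a]; [case: ann_sub | rewrite ga_0 scaler0].
  move=> a u v [au ue] [av ve]; split; first by apply ann_sub.2.
  by move=> b; rewrite ga_lin ue ve scalerDr !scalerA mulrC.
- move=> g u _ cg [au ue]; split; first exact: (ann_ga (embW g)).
  move=> a; have -> : a = g ((g^-1)%g a) by rewrite permKV.
  rewrite /act -ga_M tau_sp ga_M ue ga_Z; congr (_ *: _); congr (_ ^+ _).
  by rewrite cg.
- by exists v1 => //; split=> // a; apply: ve1; rewrite mem_enum.
have zK i : z (z i) = i by rewrite -permM zz perm1.
have [z0 z0G [z0n z0f]] := std_element t hn zz.
have [z0N z0K _ _ _] := Gset_gcond hn z0G.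
pose ph := phi t z v.
have ann_ph : ann (ph z0).
  apply: (sub_sum ann_sub) => g /andP[gW _]; rewrite -[_ *: _]addr0; apply ann_sub.2; first exact: ann_ga.
  by case: ann_sub.
have ph0 : ph z0 = 0.
  apply: (phi_equivariant z0G ann_ph) => s y sS yG.
  case k : (zkind t s y).
  - rewrite phi_conj //; congr phi; have := zkindP hn sS yG; rewrite k /DesEq => h.
    by rewrite -h (SS hn _ sS).
  - exact: phi_KA.
  - exact: phi_conj.
  - exact: phi_conj.
pose F := fixS setT z.
have FE i : (i \in F) = (z i == i) by rewrite !inE.
pose y0 := yv z 1%g z0.
have D0 : vdet y0 != 0.
  apply: vdet_neq0 => i j; rewrite /y0 /yv !apZ1; case: eqP => zi; case: eqP => zj.
  - by move=> /eqP; rewrite eqr_int => /eqP/(@apZ_inj _ z0); rewrite /x1 => e; apply: val_inj => /=; move: e; clear; lia.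
  - rewrite -[RHS]/((j : nat)%:Z%:~R) => /eqP; rewrite eqr_int => /eqP e.
    by have := z0f i zi; have := ltn_ord j; move: e; rewrite /x1; move: (apZ z0 _) => A; clear; lia.
  - rewrite -[LHS]/((i : nat)%:Z%:~R) => /eqP; rewrite eqr_int => /eqP e.
    by have := z0f j zj; have := ltn_ord i; move: e; rewrite /x1; move: (apZ z0 _) => A; clear; lia.
  - by move=> /eqP; rewrite eqr_nat => /eqP e; apply: val_inj.
have term g : g \in W -> compat z g z0 ->
    exists2 b : bool, (g = 1%g -> b) & vdet (yv z g z0) * dotQ (ga g v) v = (vdet y0 * dotQ v v) *+ b.
  move=> gW /forallP c; have [pi [e gE]] := sp_ex hn gW.
  have gx i : apZ g (x1 i) = if e i then - x1 (pi i) else x1 (pi i) by rewrite gE spE // spf_pos.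
  have cF i : z i = i -> z (pi i) = pi i /\ e i = false.
    move=> zi; have := c i; rewrite zi eqxx gx.
    case E : (e i); last first.
      case: (eqVneq (z (pi i)) (pi i)) => // h; rewrite /x1 z0n //.
      by have := ltn_ord (z (pi i)); clear; lia.
    rewrite z0N; case: (eqVneq (z (pi i)) (pi i)) => h.
      by have := z0f _ h; rewrite /x1; move: (apZ _ _) => A; clear; lia.
    by rewrite /x1 z0n //; clear; lia.
  have cN i : z i != i -> [/\ z (pi i) != pi i, z (pi i) = pi (z i) & e (z i) = e i].
    move=> zi; have := c i; rewrite (negbTE zi) !gx => /eqP E.
    have zpi : z (pi i) != pi i.
      apply/eqP => /z0f; move: E; rewrite /x1; have := ltn_ord (pi (z i)).
      by case: (e i); case: (e (z i)); rewrite ?z0N; move: (apZ _ _) => A; clear; lia.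
    move: E; case e1 : (e i); case e2 : (e (z i)); rewrite ?z0N /x1 z0n // => E;
      first [by exfalso; move: E; clear; lia | by split=> //; apply: val_inj; move: E => /=; clear; lia].
  have piz : (pi * z = z * pi)%g.
    apply/permP => i; rewrite !permM; case: (eqVneq (z i) i) => zi; first by rewrite zi; case: (cF i zi).
    by case: (cN i zi).
  have g1 : permc (sp pi (fun=> false)) (sp 1%g e) = g.
    by rewrite spM // mul1g gE; apply: sp_ext => i; rewrite addbF.
  (* If pi moves a colour, [ga g v] and v belong to different eigenvalues of an orthogonal operator
     [tau], so their product is zero. *)
  case: (pselect (cp col pi)) => [cpi|]; last first.
    move=> /existsNP[b cb]; exists false.
      move=> g_1; case: cb; have := gx b; rewrite g_1 apZ1 /x1.
      case: (e b) => E; first by move: E; clear; lia.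
      by congr col; apply: val_inj => /=; move: E; clear; lia.
    have h1 : ga (tau (pi b)) (ga g v) = (-1) ^+ col b *: ga g v.
      by rewrite -ga_M gE tau_sp ga_M ve ga_Z.
    have := dot_ga (tau (pi b)) (ga g v) v; rewrite h1 ve.
    have -> : (col (pi b)) = ~~ col b by move: cb; case: (col b); case: (col (pi b)).
    have dZ a1 a2 (u1 u2 : VV) : dotQ (a1 *: u1) (a2 *: u2) = a1 * a2 * dotQ u1 u2.
      rewrite -[a1 *: u1]addr0 dot_lin (_ : dotQ 0 _ = 0) ?addr0; last by rewrite /dot big1 // => w _; rewrite ffunE mul0r.
      rewrite dot_sym -[a2 *: u2]addr0 dot_lin (_ : dotQ 0 _ = 0) ?addr0; last by rewrite /dot big1 // => w _; rewrite ffunE mul0r.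
      by rewrite [dotQ u2 u1]dot_sym mulrA.
    rewrite dZ -signr_addb addbN addbb expr1 mulN1r => /eqP; rewrite eq_sym -addr_eq0 -mulr2n mulrn_eq0 /=.
    by move=> /eqP ->; rewrite mulr0.
  exists true => //; rewrite mulr1n.
  pose E := [set i | e i].
  have evE : ~~ odd #|E|.
    apply: (even_fpf (f := z)) => i; rewrite !inE => ei.
    have zi : z i != i by apply/eqP => /cF[_]; rewrite ei.
    by have [_ _ ->] := cN i zi; rewrite ei zK.
  have evc : ~~ odd #|[set i in E | col i]|.
    apply: (even_fpf (f := z)) => i; rewrite !inE => /andP[ei ci].
    have zi : z i != i by apply/eqP => /cF[_]; rewrite ei.
    by have [_ _ ->] := cN i zi; rewrite ei zK cz ci.
  have lst (l : seq 'I_n) : ga (sp 1%g (fun i => odd (count (fun a => tz a i) l))) v = (-1) ^+ (count col l) *: v.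
    elim: l => [|a l IH]; first by rewrite /= sp1 // ga_1 scale1r.
    have -> : sp 1%g (fun i => odd (count (fun a0 => tz a0 i) (a :: l))) =
        permc (sp 1%g (fun i => odd (count (fun a0 => tz a0 i) l))) (tau a).
      by rewrite /tau spM // mulg1; apply: sp_ext => i; rewrite perm1 /= oddD oddb.
    by rewrite ga_M ve ga_Z IH scalerA /= exprD; congr (_ * _ *: _).
  (* The pattern e is trivial in type A; otherwise it is the product of the [tau a] over its support
     E, in type D because E has even size. The support is a union of pairs of z of equal colour, so
     the eigenvalues multiply to 1. *)
  have eE : ga (sp 1%g e) v = v.
    have := lst (enum E).
    have -> : sp 1%g (fun i => odd (count (fun a => tz a i) (enum E))) = sp 1%g e.
      apply: sp_ext => i; rewrite /tz; case tE : (t).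
      - rewrite count_pred0 /=; move: gW; rewrite gE spW // tE => /forallP/(_ i); by case: (e i).
      - have -> : count (fun a => i == a) (enum E) = (i \in enum E).
          by rewrite -(count_uniq_mem _ (enum_uniq _)); apply: eq_count => a; rewrite /= eq_sym.
        by rewrite mem_enum inE oddb.
      - have := count_predC (pred1 i) (enum E); rewrite count_uniq_mem ?enum_uniq // mem_enum inE -cardE.
        move=> /(congr1 odd); rewrite oddD oddb (negbTE evE) (eq_count (a2 := fun a => i != a)); last first.
          by move=> a /=; rewrite eq_sym.
        by case: (e i); case: (odd _).
    have -> : count col (enum E) = #|[set i in E | col i]|.
      rewrite -size_filter cardE; congr size; rewrite /enum_mem -filter_predI; apply: eq_filter => a.
      by rewrite /= !inE andbC.
    by rewrite -signr_odd (negbTE evc) scale1r.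
  have -> : ga g v = (-1) ^+ chi setT z pi *: v.
    rewrite -g1 ga_M eE -/(act pi v) vE //; exact/subsetP.
  have -> : vdet (yv z g z0) = (-1) ^+ chi setT z pi * vdet y0.
    rewrite /chi -vdet_perm; congr vdet; apply/funext => i; rewrite /y0 /yv.
    have st : pi \in 'N(fixS setT z | 'P)%g by apply: fix_stab => //; exact/subsetP.
    case: (eqVneq (z i) i) => zi.
      have iF : i \in fixS setT z by rewrite FE zi.
      have [zpi ei] := cF i zi; rewrite restr_permE // zpi eqxx gx ei apZ1.
      by [].
    have iF : i \notin fixS setT z by rewrite FE zi.
    by rewrite (out_perm (restr_perm_on _ _) iF) (negbTE zi).
  rewrite -[_ *: v]addr0 dot_lin (_ : dotQ 0 _ = 0) ?addr0; last by rewrite /dot big1 // => w _; rewrite ffunE mul0r.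
  by rewrite mulrACA -signr_addb addbb expr0 mul1r.
have W_1 : (1%g : P n) \in W := WW1 t hn.
have c1 : compat z 1%g z0.
  apply/forallP => i; rewrite !apZ1; case: eqP => zi; first exact: z0f.
  by rewrite /x1 z0n //; apply/eqP.
have sum0 : \sum_(g | (g \in W) && compat z g z0) vdet (yv z g z0) * dotQ (ga g v) v = 0.
  have := congr1 (fun u => dotQ u v) ph0; rewrite {2}/dot big1; last by move=> w _; rewrite ffunE mul0r.
  move=> E0; rewrite -[RHS]E0 /ph /phi.
  have dD (u1 u2 : VV) : dotQ (u1 + u2) v = dotQ u1 v + dotQ u2 v by rewrite -[u1]scale1r dot_lin mul1r scale1r.
  have d0 : dotQ 0 v = 0 by rewrite /dot big1 // => w _; rewrite ffunE mul0r.
  rewrite (big_morph (fun u => dotQ u v) dD d0); apply: eq_bigr => g _.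
  by rewrite -[_ *: _]addr0 dot_lin d0 addr0.
have c0 : vdet y0 * dotQ v v != 0 by rewrite mulf_neq0 // gt_eqF // dot_pos.
have [b hb] : exists b : P n -> bool, forall g, g \in W -> compat z g z0 ->
    (g = 1%g -> b g) /\ vdet (yv z g z0) * dotQ (ga g v) v = (vdet y0 * dotQ v v) *+ b g.
  have H g : exists b : bool, g \in W -> compat z g z0 ->
    (g = 1%g -> b) /\ vdet (yv z g z0) * dotQ (ga g v) v = (vdet y0 * dotQ v v) *+ b.
    case: (pselect (g \in W /\ compat z g z0)) => [[gW gc]|no]; last by exists true => gW gc; case: no.
    by have [b b1 b2] := term g gW gc; exists b.
  by exists (fun g => projT1 (cid (H g))) => g; case: (cid (H g)).
move: sum0; rewrite (eq_bigr (fun g => (vdet y0 * dotQ v v) *+ b g)); last first.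
  by move=> g /andP[gW gc]; case: (hb g gW gc).
rewrite (eq_bigr (fun g => (vdet y0 * dotQ v v) * (b g)%:R)) => [|g _]; last by rewrite mulr_natr.
rewrite -mulr_sumr => /eqP; rewrite mulf_eq0 (negbTE c0) /= => /eqP s0.
have := psumr_eq0P (fun g _ => ler0n rat (b g)) s0; move=> /(_ 1%g); rewrite W_1 c1 => /(_ isT).
by have [-> //] := hb 1%g W_1 c1; move/eqP; rewrite oner_eq0.
Qed.

End Faithful.

(** * Specialisation at x = 1 and formal reality of Q(x) *)

Local Notation tf := (@FracField.tofrac _).

Lemma xKX k : xK ^+ k = tf ('X^k : {poly int}).
Proof. by rewrite tofracXn. Qed.

Lemma xKX0 k : xK ^+ k != 0.
Proof. exact: expf_neq0 xK_neq0. Qed.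

Definition evR (f : K) (a : rat) :=
  exists k (p : {poly int}), f = tf p / xK ^+ k /\ a = (p.[1])%:~R.

Lemma evR_fun f a b : evR f a -> evR f b -> a = b.
Proof.
move=> [k [p [-> ->]]] [k' [p' [e ->]]].
have e2 : tf (p * 'X^k') = tf (p' * 'X^k).
  rewrite !tofracM -!xKX; have := congr1 (fun u => u * (xK ^+ k * xK ^+ k')) e.
  rewrite /= mulrA divfK ?xKX0 // => ->.
  by rewrite [xK ^+ k * _]mulrC mulrA divfK ?xKX0.
move/eqP: e2; rewrite tofrac_eq => /eqP/(congr1 (fun u => u.[1])).
by rewrite !hornerM !hornerXn !expr1n !mulr1 => ->.
Qed.

(** Evaluation at 1 of a Laurent polynomial; 0 is only a default for the other elements of the
    field. *)
Definition ev (f : K) : rat := if pselect (exists a, evR f a) is left h then projT1 (cid h) else 0.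

Lemma evE f a : evR f a -> ev f = a.
Proof.
move=> h; rewrite /ev; case: pselect => [h'|[]]; last by exists a.
by apply: evR_fun h; case: (cid h').
Qed.

Lemma ev_R f : isLaurent f -> evR f (ev f).
Proof.
move=> [k [p e]]; have h : evR f (p.[1])%:~R by exists k, p.
by rewrite (evE h).
Qed.

Lemma evRD f g a b : evR f a -> evR g b -> evR (f + g) (a + b).
Proof.
move=> [k [p [-> ->]]] [k' [p' [-> ->]]]; exists (k + k')%N, (p * 'X^k' + p' * 'X^k); split.
  by rewrite tofracD !tofracM -!xKX exprD addf_div ?xKX0.
by rewrite hornerD !hornerM !hornerXn !expr1n !mulr1 rmorphD.
Qed.

Lemma evRM f g a b : evR f a -> evR g b -> evR (f * g) (a * b).
Proof.
move=> [k [p [-> ->]]] [k' [p' [-> ->]]]; exists (k + k')%N, (p * p'); split.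
  by rewrite tofracM exprD mulf_div.
by rewrite hornerM rmorphM.
Qed.

Lemma evR_poly (p : {poly int}) : evR (tf p) (p.[1])%:~R.
Proof. by exists 0%N, p; rewrite expr0 divr1. Qed.

Lemma evRN f a : evR f a -> evR (- f) (- a).
Proof.
by move=> [k [p [-> ->]]]; exists k, (- p); rewrite tofracN mulNr hornerN rmorphN.
Qed.

Lemma ev0 : ev 0 = 0.
Proof. by have := evE (evR_poly 0); rewrite tofrac0 horner0. Qed.
Lemma ev1 : ev 1 = 1.
Proof. by have := evE (evR_poly 1); rewrite tofrac1 hornerC. Qed.
Lemma evX : ev xK = 1.
Proof. by have := evE (evR_poly 'X); rewrite hornerX. Qed.
Lemma evXV : ev xK^-1 = 1.
Proof.
have h : evR xK^-1 1 by exists 1%N, 1; rewrite tofrac1 hornerC div1r expr1.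
exact: evE h.
Qed.
Lemma evD f g : isLaurent f -> isLaurent g -> ev (f + g) = ev f + ev g.
Proof. by move=> /ev_R h1 /ev_R h2; exact: evE (evRD h1 h2). Qed.
Lemma evM f g : isLaurent f -> isLaurent g -> ev (f * g) = ev f * ev g.
Proof. by move=> /ev_R h1 /ev_R h2; exact: evE (evRM h1 h2). Qed.
Lemma evN f : isLaurent f -> ev (- f) = - ev f.
Proof. by move=> /ev_R h; exact: evE (evRN h). Qed.

Lemma laurent0 : isLaurent 0.
Proof. by have := laurentP 0; rewrite tofrac0. Qed.
Lemma laurent1 : isLaurent 1.
Proof. by have := laurentP 1; rewrite tofrac1. Qed.
Lemma laurentb (b : bool) : isLaurent b%:R.
Proof. by case: b; [exact: laurent1 | exact: laurent0]. Qed.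
Lemma evb (b : bool) : ev b%:R = b%:R.
Proof. by case: b; [exact: ev1 | exact: ev0]. Qed.

Lemma ev_sum (I : finType) (Q : pred I) (f : I -> K) :
  (forall i, Q i -> isLaurent (f i)) -> ev (\sum_(i | Q i) f i) = \sum_(i | Q i) ev (f i).
Proof.
move=> h; have [] : isLaurent (\sum_(i | Q i) f i) /\ ev (\sum_(i | Q i) f i) = \sum_(i | Q i) ev (f i); last by [].
elim/big_rec2: _ => [|i y1 y2 Qi [l e]]; first by rewrite ev0; split=> //; exact: laurent0.
by split; [apply: laurentD => //; exact: h | rewrite evD ?e //; exact: h].
Qed.

Lemma frac_rep (f : K) : exists p d : {poly int}, d != 0 /\ f * tf d = tf p.
Proof.
elim/quotW: f => r; exists (frac r).1, (frac r).2; split; first exact: denom_ratioP.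
rewrite /FracField.tofrac; unlock; rewrite -[LHS]FracField.pi_mul.
apply/eqmodP; rewrite /= FracField.equivfE /FracField.mulf.
by rewrite !numden_Ratio ?(oner_eq0, mulf_neq0, denom_ratioP) // !mulr1 mulrC.
Qed.

Lemma div_neq0 (F : fieldType) (c y : F) : c != 0 -> y != 0 -> c / y != 0.
Proof. by move=> h1 h2; rewrite mulf_neq0 ?invr_eq0. Qed.

Lemma div_cross (F : fieldType) (c y a q : F) : y != 0 -> c * a = q * y -> c / y * a = q.
Proof. by move=> y0 e; rewrite mulrAC e mulfK. Qed.

(** Among all proportional families of polynomials take one of least total size. If all its members
    vanished at 1, dividing by X - 1 would make it smaller. *)
Lemma scaling (I : finType) (a : I -> K) i0 : a i0 != 0 ->
  exists c : K, [/\ c != 0, forall i, isLaurent (c * a i) & exists i, ev (c * a i) != 0].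
Proof.
move=> a0.
pose ok (p : I -> {poly int}) := exists2 c : K, c != 0 & forall i, c * a i = tf (p i).
have ex : exists p, ok p.
  have /choice[pd hpd] : forall i, exists x : {poly int} * {poly int}, x.2 != 0 /\ a i * tf x.2 = tf x.1.
    by move=> i; have [p [d h]] := frac_rep (a i); exists (p, d).
  exists (fun i => (pd i).1 * \prod_(j | j != i) (pd j).2), (tf (\prod_j (pd j).2)).
    by rewrite tofrac_eq0; apply/prodf_neq0 => j _; case: (hpd j).
  move=> i; rewrite (bigD1 i) //= !tofracM -(hpd i).2.
  by rewrite mulrC mulrA.
have [p [c c0 pE] pmin] := nat_min (fun p : I -> {poly int} => \sum_i size (p i))%N ex.
exists c; split=> //; first by move=> i; rewrite pE; exact: laurentP.
apply: contrapT => no.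
have rt i : root (p i) 1.
  apply: contrapT => /negP nr; apply: no; exists i; rewrite pE (evE (evR_poly (p i))) intr_eq0.
  by move: nr; rewrite /root.
have /choice[q qE] : forall i, exists q, p i = q * ('X - 1%:P) by move=> i; apply/factor_theorem.
have x10 : tf ('X - 1%:P : {poly int}) != 0 by rewrite tofrac_eq0 polyXsubC_eq0.
have ok' : ok q.
  exists (c / tf ('X - 1%:P)); first exact: (div_neq0 c0 x10).
  move=> i; apply: (div_cross x10); rewrite pE qE; exact: tofracM.
have := pmin _ ok'; apply/negP; rewrite -ltnNge.
have pi0 : p i0 != 0 by rewrite -tofrac_eq0 -pE; exact: (mulf_neq0 c0 a0).
have qi0 : q i0 != 0 by apply: contraNneq pi0 => e; rewrite qE e mul0r.
have sz i : q i != 0 -> size (p i) = (size (q i)).+1.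
  by move=> qi; rewrite qE size_Mmonic ?monicXsubC // size_XsubC addn2.
rewrite (bigD1 i0) //= [X in (_ < X)%N](bigD1 i0) //= sz // addSn ltnS leq_add2l.
apply: leq_sum => i _; case: (eqVneq (q i) 0) => [->|qi]; first by rewrite size_poly0.
by rewrite sz.
Qed.

(** After [scaling], evaluation at 1 turns a nontrivial relation into a vanishing sum of rational
    squares that are not all zero. *)
Lemma K_real (I : finType) (a : I -> K) : \sum_i a i ^+ 2 = 0 -> forall i, a i = 0.
Proof.
move=> s0 i0; apply: contrapT => /eqP /scaling[c [c0 la [i ei]]].
have : \sum_i (c * a i) ^+ 2 = 0.
  by under eq_bigr do rewrite exprMn; rewrite -mulr_sumr s0 mulr0.
move/(congr1 ev); rewrite ev0 ev_sum; last by move=> j _; rewrite expr2; exact: laurentM.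
rewrite (eq_bigr (fun j => ev (c * a j) ^+ 2)) => [|j _]; last by rewrite expr2 evM.
move=> e0; have := psumr_eq0P (fun j _ => sqr_ge0 (ev (c * a j))) e0; move=> /(_ i isT)/eqP.
by rewrite sqrf_eq0 (negbTE ei).
Qed.

(** * An injection of the index set into the involutions of W *)

Section Injection.
Variables (n : nat).
Hypothesis hn : (2 <= n)%N.
Implicit Types (f g h : int -> int) (x : int).

(** Truncation of f to the points of absolute value at most n: matchings among these are kept, and a
    point matched beyond n becomes fixed or negated according to the sign of its partner. *)
Definition jf f x : int :=
  if n%:Z < `|x| then x else if `|f x| <= n%:Z then f x else if 0 < f x then `|x| else - `|x|.

Lemma jf_neg f x : gcond n f -> jf f (- x) = - jf f x.
Proof.
move=> gf; have [fN fK ff fo fd] := gf; rewrite /jf normrN fN normrN; case: ifP => // x1; case: ifP => // x2.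
have : f x != 0 by move: x2; move: (f x) => y; clear; lia.
by move: (f x) => y; clear; case: ifP; case: ifP; lia.
Qed.

Lemma jf_abs f x : gcond n f -> `|x| <= n%:Z -> x != 0 ->
  (`|jf f x| == `|x|) = (n%:Z < `|f x|).
Proof.
move=> [fN fK ff fo fd] xn x0; have := ff x x0; rewrite /jf; move: xn x0; move: (f x) => y; clear -hn.
by move=> *; repeat (case: ifP => ?); lia.
Qed.

Lemma jf_invol f x : gcond n f -> jf f (jf f x) = x.
Proof.
move=> gf; have [fN fK ff fo fd] := gf; case: (leP `|x| n%:Z) => xn; last by rewrite /jf xn xn.
case: (leP `|f x| n%:Z) => fx.
  have -> : jf f x = f x by rewrite /jf ltNge xn fx.
  by rewrite /jf ltNge fx /= fK xn.
have [E|E] : jf f x = x \/ jf f x = - x by rewrite /jf; move: xn fx; move: (f x) => y; clear; repeat (case: ifP => ?); lia.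
  by rewrite E E.
by rewrite E jf_neg // E opprK.
Qed.

(** If h i were below -n, the bound h j >= -j at j = i and at j = -h i would give h i = -i, which is
    excluded. *)
Lemma G_small h (i : int) : gcond n h -> n%:Z < i -> i <= n.*2%:Z -> n%:Z < h i \/ `|h i| <= n%:Z.
Proof.
move=> [fN fK ff fo fd] h1 h2; have [_ a1] := fd i h1; have i0 : i != 0 by lia.
have i2 : `|i| <= n.*2%:Z by lia.
have ne := ff i i0 i2; case: (leP `|h i| n%:Z) => hb; first by right.
left; case: (ltP n%:Z (h i)) => // lt.
have m1 : n%:Z < - h i by move: hb lt; clear; lia.
have [_] := fd _ m1; rewrite fN fK.
by move: ne a1 m1 i2 h1; move: (h i) => y; clear; lia.
Qed.

Lemma G_desc h (k : nat) (i : int) : gcond n h -> n%:Z < i -> `|h (i + k%:Z)| <= n%:Z -> h i <= h (i + k%:Z).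
Proof.
move=> gh; elim: k i => [|k IH] i hi; first by rewrite addr0.
have -> : i + k.+1%:Z = i + k%:Z + 1 by lia.
move=> hm; have [fN fK ff fo fd] := gh; have hk : n%:Z < i + k%:Z by lia.
have [a _] := fd _ hk.
have le : h (i + k%:Z) <= h (i + k%:Z + 1) by move: a hm hk; move: (h (i + k%:Z)) (h (i + k%:Z + 1)) => y y'; clear; lia.
apply: (le_trans _ le); apply: IH => //.
have lt : i + k%:Z <= n.*2%:Z.
  case: (leP (i + k%:Z) n.*2%:Z) => // lt; move: hm; rewrite fo; clear -lt hk; lia.
case: (G_small gh hk lt) => // lt2; exfalso.
by have := lt_le_trans lt2 (le_trans le (le_trans (ler_norm _) hm)); rewrite ltxx.
Qed.

(** If h i > i + 1, the absence of visible descents propagates h j > i from j = i up to j = h i - 1;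
    the next value h (h i) = i then creates a visible descent. *)
Lemma G_up h (i : int) : gcond n h -> n%:Z < i -> i < h i -> h i = i + 1.
Proof.
move=> gh hi lt; have [fN fK ff fo fd] := gh; apply: contrapT => ne.
have claim (k : nat) : i + k%:Z < h i -> i < h (i + k%:Z).
  elim: k => [|k IH]; first by rewrite addr0.
  move=> lk; have [a _] := fd (i + k%:Z) ltac:(lia).
  have e : i + k%:Z + 1 = i + k.+1%:Z by lia.
  have IHk := IH ltac:(lia); rewrite e in a.
  have n2 : h (i + k.+1%:Z) <> i by move=> E; have := fK (i + k.+1%:Z); rewrite E; lia.
  by move: a IHk n2; move: (h (i + k%:Z)) (h (i + k.+1%:Z)) => y y'; clear; lia.
pose k := absz (h i - 1 - i)%R.
have kE : i + k%:Z + 1 = h i by rewrite /k; move: lt ne; move: (h i) => y; clear; lia.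
have [a _] := fd (i + k%:Z) ltac:(lia); rewrite kE fK in a.
have := claim k ltac:(lia); have : k != 0%N by move: kE lt ne; move: (h i) => y; clear; lia.
by move: a; move: (h (i + k%:Z)) => y; clear; lia.
Qed.

Lemma G_le f g (i : int) : gcond n f -> gcond n g -> (forall x, jf f x = jf g x) ->
  (forall j : int, n%:Z < j -> j < i -> f j = g j) -> n%:Z < i -> `|f i| <= n%:Z -> g i <= f i.
Proof.
move=> gf gg E IH hi fi; have [fN fK ff fo fd] := gf; have [gN gK gf' go gd] := gg.
have u0 : f i != 0 by apply: (gcond_nz hn gf); move: hi; clear; lia.
have H1 : n%:Z < `|g (f i)|.
  by have := jf_abs gg fi u0; rewrite -E (jf_abs gf fi u0) fK => <-; move: hi; clear; lia.
have A : n%:Z < g (f i).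
  have := E (f i); rewrite /jf ltNge fi /= fK.
  have -> : (`|i| <= n%:Z) = false by move: hi; clear; lia.
  have -> : 0 < i by move: hi; clear; lia.
  have -> : (`|g (f i)| <= n%:Z) = false by move: H1; clear; lia.
  by move: H1 u0; move: (g (f i)) (f i) => y u; clear; case: ifP; lia.
case: (ltrgtP (g (f i)) i) => c.
- by have := IH _ A c; rewrite gK => e; have := fK (g (f i)); rewrite e fK => e'; move: c; rewrite -e' ltxx.
- have [k kE] : exists k : nat, g (f i) = i + k%:Z by exists (absz (g (f i) - i)); move: c; clear; lia.
  by have := G_desc (k := k) gg hi; rewrite -kE gK; apply.
- by rewrite -{1}c gK.
Qed.

(** Beyond n the small partners come in increasing order, and the remaining points are matched with
    their neighbours. So the truncation determines all values, by induction upwards from n + 1. *)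
Lemma G_inj f g : gcond n f -> gcond n g -> (forall x, jf f x = jf g x) -> f =1 g.
Proof.
move=> gf gg E; have [fN fK ff fo fd] := gf; have [gN gK gf' go gd] := gg.
have big (k : nat) : forall i, n%:Z < i -> i <= n%:Z + k%:Z -> f i = g i.
  elim: k => [|k IH] i hi hk; first by exfalso; move: hi hk; clear; lia.
  have {}IH j : n%:Z < j -> j < i -> f j = g j by move=> h1 h2; apply: IH => //; move: h2 hk; clear; lia.
  case: (leP i n.*2%:Z) => i2; last by rewrite fo ?go //; move: i2; clear; lia.
  have L1 := G_le gf gg E IH hi.
  have L2 : `|g i| <= n%:Z -> f i <= g i.
    by apply: (G_le gg gf) => // j h1 h2; rewrite IH.
  have F1 := G_small gf hi i2; have F2 := G_small gg hi i2.
  case: F1 => F1; last first.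
    by have := L1 F1; move: L2 F1 F2; move: (f i) (g i) => y y'; clear; lia.
  case: F2 => F2; last by have := L2 F2; move: F1 F2; move: (f i) (g i) => y y'; clear; lia.
  have ni : f i != i /\ g i != i.
    have i0 : i != 0 by move: hi; clear; lia.
    have ib : `|i| <= n.*2%:Z by move: hi i2; clear; lia.
    by have [-> _] := gcond_neq hn gf i0 ib; have [-> _] := gcond_neq hn gg i0 ib.
  case: (ltrgtP (f i) i) => c1; last by case: ni => /eqP.
    by have := IH _ F1 c1; rewrite fK => e; rewrite -[f i]gK -e.
  case: (ltrgtP (g i) i) => c2; last by case: ni => _ /eqP.
    by have := IH _ F2 c2; rewrite gK => e; rewrite -[g i]fK e.
  by rewrite (G_up gf hi c1) (G_up gg hi c2).
have bigA i : n%:Z < `|i| -> f i = g i.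
  move=> hi; have [k kE] : exists k : nat, `|i| = n%:Z + k%:Z by exists (absz (`|i| - n%:Z)); move: hi; clear; lia.
  case: (leP 0 i) => s; first by apply: (big k); move: hi kE s; clear; lia.
  have : f (- i) = g (- i) by apply: (big k); move: hi kE s; clear; lia.
  by rewrite fN gN => /oppr_inj.
move=> x; case: (leP `|x| n%:Z) => xn; last exact: bigA.
case: (eqVneq x 0) => [->|x0]; first by rewrite (gcond0 hn gf) (gcond0 hn gg).
case: (ltP n%:Z `|f x|) => fx; first by have := bigA _ fx; rewrite fK => e; rewrite -[f x]gK -e.
have := jf_abs gg xn x0; rewrite -E jf_abs // ltNge fx /= => /esym/negbT; rewrite -leNgt => gx.
by have := E x; rewrite /jf ltNge xn /= fx gx.
Qed.

Lemma jf_tcond f (i : int) : gcond n f -> 0 < i -> i <= n%:Z -> (f i < - i) = (jf f i <= - i).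
Proof.
move=> [fN fK ff fo fd] i0 iN; have i1 : i != 0 by lia.
have i2 : `|i| <= n.*2%:Z by lia.
have := ff i i1 i2; rewrite /jf; move: i0 iN; move: (f i) => y; clear.
by repeat (case: ifP => ?); lia.
Qed.

Definition tg (a : nat) x : int := if `|x| == a.+1%:Z then - x else x.

Lemma odd_toggle (c c' : pred nat) (a : nat) : (a < n)%N -> (forall i : nat, c' i = c i (+) (i == a.+1)) ->
  odd (count c' (iota 1 n)) = ~~ odd (count c (iota 1 n)).
Proof.
move=> an cE; rewrite (eq_count (a2 := fun i => c i (+) (i == a.+1))) //.
rewrite (odd_count_addb c (fun i => i == a.+1)) -addbT; congr (_ (+) _).
rewrite (eq_count (a2 := pred1 a.+1)) // count_uniq_mem ?iota_uniq // mem_iota.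
by have -> : (1 <= a.+1 < 1 + n)%N by lia.
Qed.

Variable t : CoxType.
Hypothesis tn : t = TD -> odd n.
Notation W := (WW t n).

Definition neg (f : int -> int) := odd (count (fun i : nat => f i%:Z < 0) (iota 1 n)).
Definition sing (z : P n) (i : 'I_n) : bool := n%:Z < `|apZ z i.+1%:Z|.
Definition a0 (z : P n) : nat := if [pick i | sing z i] is Some i then i else 0%N.

(** If no place were sent beyond n, i -> |z i| would be a fixed-point-free involution of a set with
    n elements, n being odd. *)
Lemma a0P z : t = TD -> z \in Gset t n -> (a0 z < n)%N /\ n%:Z < `|apZ z (a0 z).+1%:Z|.
Proof.
move=> tD zG; rewrite /a0; case: pickP => [i si|no]; first by split=> //; exact: ltn_ord.
have gz := Gset_gcond hn zG; have [fN fK ff fo fd] := gz.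
have small (i : 'I_n) : `|apZ z i.+1%:Z| <= n%:Z by have := no i; rewrite /sing; move: (apZ _ _) => y; clear; lia.
have nz (i : 'I_n) : apZ z i.+1%:Z != 0 by apply: (gcond_nz hn gz).
have b (i : 'I_n) : ((absz (apZ z i.+1%:Z)).-1 < n)%N.
  by have := small i; have := nz i; move: (apZ _ _) => y; clear -hn; lia.
have := tn tD; rewrite -{1}(card_ord n) -cardsT => /negP; case; apply/negP.
apply: (even_fpf (f := fun i => Ordinal (b i))) => i _; split=> //.
  apply: val_inj; rewrite /=.
  have e : (absz (apZ z i.+1%:Z)).-1.+1%:Z = `|apZ z i.+1%:Z| by have := nz i; move: (apZ _ _) => y; clear; lia.
  rewrite e; have : `|apZ z `|apZ z i.+1%:Z| | = i.+1%:Z.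
    by case: (ltrP (apZ z i.+1%:Z) 0) => s; rewrite ?(ltr0_norm s) ?(ger0_norm s) ?fN fK ?normrN.
  by move: (apZ z `|_|) => y; clear; lia.
have := ff i.+1%:Z isT; rewrite -(inj_eq val_inj) /=; have := nz i; have := ltn_ord i.
by move: (apZ _ _) => y; clear; lia.
Qed.

(** In type D a truncation with an odd number of negative values is not in W; it is corrected by a
    sign at the place [a0 z], where the truncation is diagonal. *)
Definition jD (z : P n) : int -> int :=
  if (if t is TD then neg (jf (apZ z)) else false) then fun x => jf (apZ z) (tg (a0 z) x) else jf (apZ z).

Lemma tgN a x : tg a (- x) = - tg a x.
Proof. by rewrite /tg normrN; case: ifP. Qed.
Lemma tg_abs a x : `|tg a x| = `|x|.
Proof. by rewrite /tg; case: ifP => //; rewrite normrN. Qed.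
Lemma tgK a x : tg a (tg a x) = x.
Proof. by rewrite {1}/tg tg_abs /tg; case: eqP => _; rewrite ?opprK. Qed.

Lemma jD_props z : z \in Gset t n -> [/\ forall x, jD z (- x) = - jD z x, forall x, jD z (jD z x) = x,
  forall x, n%:Z < `|x| -> jD z x = x &
  forall x, `|x| <= n%:Z -> x != 0 -> (`|jD z x| == `|x|) = (n%:Z < `|apZ z x|)].
Proof.
move=> zG; have gz := Gset_gcond hn zG; rewrite /jD; case E : (if t is TD then _ else _); last first.
  split=> [x|x|x h|x h1 h2]; [exact: jf_neg | exact: jf_invol | by rewrite /jf h | exact: jf_abs].
have tD : t = TD by move: E; case: (t).
have [an as_] := a0P tD zG; have [fN fK ff fo fd] := gz.
have a1 : `|(a0 z).+1%:Z| <= n%:Z by move: an; clear; lia.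
have ja : `|jf (apZ z) (a0 z).+1%:Z| = (a0 z).+1%:Z.
  by apply/eqP; rewrite -[X in _ == X]/(`|(a0 z).+1%:Z|) jf_abs.
have jt x : jf (apZ z) (tg (a0 z) x) = tg (a0 z) (jf (apZ z) x).
  rewrite {1}/tg; case: eqP => xa.
    rewrite jf_neg // /tg; have -> : `|jf (apZ z) x| = (a0 z).+1%:Z; last by rewrite eqxx.
    have [->|->] : x = (a0 z).+1%:Z \/ x = - (a0 z).+1%:Z by move: xa; clear; lia.
      exact: ja.
    by rewrite jf_neg // normrN.
  rewrite /tg; case: eqP => // h; case: xa.
  have [e|e] : jf (apZ z) x = (a0 z).+1%:Z \/ jf (apZ z) x = - (a0 z).+1%:Z by move: h; clear; lia.
    by rewrite -(jf_invol x gz) e ja.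
  by rewrite -(jf_invol x gz) e jf_neg // normrN ja.
split=> [x|x|x h|x h1 h2].
- by rewrite tgN jf_neg.
- by rewrite -jt tgK jf_invol.
- have -> : tg (a0 z) x = x; last by rewrite /jf h.
  by rewrite /tg; case: eqP => // e; exfalso; move: e h an; clear; lia.
- rewrite jt tg_abs; exact: jf_abs.
Qed.

Definition JJ (z : P n) : P n := mkP n.*2 (jD z).

Lemma JJE z : z \in Gset t n -> apZ (JJ z) =1 jD z.
Proof.
move=> zG; have [jN jK jo ja] := jD_props zG; apply: mkPE; first exact: can_inj jK.
  move=> x hx; case: (leqP (absz (jD z x)) n.*2) => // h.
  have := jo (jD z x); rewrite jK => e; have e' : x = jD z x by apply: e; move: h; clear; lia.
  by move: h hx; rewrite -e' ltnNge => /negP h /h.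
by move=> x hx; apply: jo; move: hx; clear; lia.
Qed.

Lemma JJ_W z : z \in Gset t n -> JJ z \in W /\ (JJ z)^-1%g = JJ z.
Proof.
move=> zG; have [jN jK jo ja] := jD_props zG; have JE := JJE zG; have gz := Gset_gcond hn zG.
split; last first.
  by apply: eq_apZ => x; apply: (@apZ_inj _ (JJ z)); rewrite apZKV !JE jK.
have JB : isBC (JJ z) by apply/isBCP => x; rewrite !JE jN.
have JF : fixBeyond n (JJ z) by apply/fixBeyondP => x hx; rewrite JE jo.
rewrite (WW_set hn) /Wset; case tE : t; rewrite /= !inE JB JF //=.
  apply/allP => i; rewrite mem_iota JE /jD tE => hi; have /(GsetP hn)[_] := zG; rewrite tE /= => pos.
  have p1 : 0 < apZ z i%:Z by apply: pos; move: hi; clear; lia.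
  by rewrite /jf; move: p1 hi; move: (apZ z _) => y; clear; repeat (case: ifP => ?); lia.
rewrite /evenNeg (eq_count (a2 := fun i : nat => jD z i%:Z < 0)); last by move=> i; rewrite /= JE.
rewrite /jD tE; case E : (neg _); last exact: negbT E.
have [an as_] := a0P tE zG.
rewrite (@odd_toggle (fun i : nat => jf (apZ z) i%:Z < 0) _ (a0 z)) // ?negbK; first exact: E.
move=> i; rewrite /tg.
have -> : (`|i%:Z| == (a0 z).+1%:Z) = (i == (a0 z).+1) by [].
case: eqP => [->|_]; last by rewrite addbF.
have a1 : `|(a0 z).+1%:Z| <= n%:Z by move: an; clear; lia.
have := jf_abs gz a1 isT; rewrite as_ jf_neg // => /eqP.
by move: (jf _ _) => y; clear; lia.
Qed.

(** The place of the correction can be read off the image. If only one of two truncations had been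
    corrected, they would differ by the sign at that place, which changes the parity of the number
    of i with z i < -i, against the type D condition. *)
Lemma JJ_inj : {in Gset t n &, injective JJ}.
Proof.
move=> z z' zG zG' e; have gz := Gset_gcond hn zG; have gz' := Gset_gcond hn zG'.
have JE x : jD z x = jD z' x by rewrite -JJE // e JJE.
have [jN jK jo ja] := jD_props zG; have [jN' jK' jo' ja'] := jD_props zG'.
have se : a0 z = a0 z'.
  rewrite /a0 (eq_pick (Q := sing z')) // => i; rewrite /sing.
  have i1 : `|i.+1%:Z| <= n%:Z by have := ltn_ord i; clear; lia.
  by rewrite -ja // -ja' // JE.
suff E x : jf (apZ z) x = jf (apZ z') x by apply: eq_apZ; exact: G_inj.
move: (JE); rewrite /jD -se; case tE : t => JE'; try exact: JE'.
case N1 : (neg (jf (apZ z))) JE'; case N2 : (neg (jf (apZ z'))) => JE'.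
- by rewrite -(tgK (a0 z) x) JE'.
- exfalso; move: zG zG' => /(GsetP hn)[_] t1 /(GsetP hn)[_] t2; move: t1 t2; rewrite tE /= => t1 t2.
  have zG : z \in Gset t n by apply/(GsetP hn); rewrite tE.
  have [an as_] := a0P tE zG.
  have conv (y : P n) : gcond n (apZ y) -> count (fun i : nat => apZ y i%:Z < - i%:Z) (iota 1 n) =
      count (fun i : nat => jf (apZ y) i%:Z <= - i%:Z) (iota 1 n).
    move=> gy; apply: eq_in_count => i; rewrite mem_iota => hi; apply: jf_tcond => //; move: hi; clear; lia.
  move: t1 t2; rewrite !conv //.
  rewrite (@odd_toggle (fun i : nat => jf (apZ z') i%:Z <= - i%:Z) (fun i : nat => jf (apZ z) i%:Z <= - i%:Z) (a0 z)) //.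
    by move=> /negP h1 /negP h2; case: h1; apply/negP.
  move=> i; rewrite -(JE' i%:Z) /tg.
  have -> : (`|i%:Z| == (a0 z).+1%:Z) = (i == (a0 z).+1) by [].
  case: eqP => [->|_]; last by rewrite addbF.
  have a1 : `|(a0 z).+1%:Z| <= n%:Z by move: an; clear; lia.
  have := jf_abs gz a1 isT; rewrite as_ jf_neg // => /eqP.
  by move: (jf _ _) => y; clear; lia.
- exfalso; move: (zG) (zG') => /(GsetP hn)[_] t1 /(GsetP hn)[_] t2; move: t1 t2; rewrite tE /= => t1 t2.
  have [an as_] := a0P tE zG'.
  have conv (y : P n) : gcond n (apZ y) -> count (fun i : nat => apZ y i%:Z < - i%:Z) (iota 1 n) =
      count (fun i : nat => jf (apZ y) i%:Z <= - i%:Z) (iota 1 n).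
    move=> gy; apply: eq_in_count => i; rewrite mem_iota => hi; apply: jf_tcond => //; move: hi; clear; lia.
  move: t2 t1; rewrite !conv //.
  rewrite (@odd_toggle (fun i : nat => jf (apZ z) i%:Z <= - i%:Z) (fun i : nat => jf (apZ z') i%:Z <= - i%:Z) (a0 z')) //.
    by move=> /negP h1 /negP h2; case: h1; apply/negP.
  move=> i; rewrite (JE' i%:Z) se /tg.
  have -> : (`|i%:Z| == (a0 z').+1%:Z) = (i == (a0 z').+1) by [].
  case: eqP => [->|_]; last by rewrite addbF.
  have a1 : `|(a0 z').+1%:Z| <= n%:Z by move: an; clear; lia.
  have := jf_abs gz' a1 isT; rewrite as_ jf_neg // => /eqP.
  by move: (jf _ _) => y; clear; lia.
- exact: JE'.
Qed.

Lemma card_G_le : (#|Gset t n| <= #|[set w in W | w^-1%g == w]|)%N.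
Proof.
rewrite -(card_in_imset JJ_inj); apply: subset_leq_card; apply/subsetP => _ /imsetP[z zG ->].
by rewrite inE; have [-> ->] := JJ_W zG; rewrite eqxx.
Qed.
End Injection.

(** * Lengths under conjugation at a strict ascent *)

Section LengthConj.
Variables (t : CoxType) (n : nat).
Hypothesis hn : (2 <= n)%N.
Let hN : (2 <= n.*2 <= n.*2)%N. Proof. lia. Qed.
Let hnN : (2 <= n <= n.*2)%N. Proof. lia. Qed.
Notation BG := (gens t n.*2 n.*2).
Notation cj s z := (permc s (permc z s)).

Lemma wordlen_inv (w : P n) : w \in <<[set:: BG]>>%g -> wordlen BG w^-1%g = wordlen BG w.
Proof.
have inv k (u : P n) : u \in words BG k -> u^-1%g \in words BG k.
  elim: k u => [|k IH] u; first by rewrite !words0 => /eqP->; rewrite invg1.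
  move=> /wordsS[g [a [gS aw ->]]]; rewrite invMg (gensV hN gS); apply: words_Mr => //; exact: IH.
have le (u : P n) : u \in <<[set:: BG]>>%g -> (wordlen BG u^-1%g <= wordlen BG u)%N.
  by move=> uG; apply: wordlen_le; apply: inv; exact: wordlen_words.
move=> wG; apply/eqP; rewrite eqn_leq le //=; have := le w^-1%g; rewrite invgK groupV; exact.
Qed.

(** This makes the parity of half the length usable as a twisting sign. The second multiplication by
    s is again an ascent: it could reverse z p < z q only if z p were p or -q, that is at a fixed
    point or in Des=. *)
Lemma lenBig_conj s z : s \in Sgen t n -> z \in Gset t n -> zkind t s z = KU ->
  lenBig t n (cj s z) = (lenBig t n z).+2.
Proof.
move=> sS zG k; have [p [q [r sE]]] := gensP hnN sS.
have := zkindP hn sS zG; rewrite k => /(AscLtP hn sS zG r sE)[lt nD nA].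
have gz := Gset_gcond hn zG; have [zN zK zf _ _] := gz.
have sB := Sgen_big hn sS; have zB := Gset_big hn zG; have rB := groot_big hn r.
have sgen : s \in <<[set:: BG]>>%g by apply: mem_gen; rewrite inE.
have uB : permc z s \in <<[set:: BG]>>%g by rewrite /permc groupM.
have zV : (z^-1)%g = z.
  by apply: eq_apZ => x; apply: (@apZ_inj _ z); rewrite apZKV zK.
have uV : ((permc z s)^-1)%g = permc s z by rewrite /permc invMg zV (gensV hN sB).
have step (w : P n) : w \in <<[set:: BG]>>%g -> asc t n.*2 s w -> wordlen BG (permc s w) = (wordlen BG w).+1.
  exact: (wordlen_asc (gens_invol hN) (asc_1 hN) (asc_s hN) (asc_exch hN) sB).
rewrite /lenBig step //; last first.
  rewrite (ascE _ rB sE) uV !apZM !sE ltNge; apply/negP => le.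
  have [p0 q0] := groot_neq0 r; have pq := groot_lt r; have [pn qn] := groot_le hn r.
  have zp0 := gcond_nz hn gz p0; have zq0 := gcond_nz hn gz q0.
  have [a1 a2] : apZ z p != p /\ apZ z p != - p.
    by apply: (gcond_neq hn gz p0); move: pn; clear; lia.
  move: nD; rewrite /kDE.
  case: (eqVneq (apZ z p) (- apZ z q)) => op.
    have [[e _]|[e1 e2]] := sw_opp r lt op le; first by rewrite e eqxx in a1.
    have : apZ z p = apZ z (- q) by rewrite zN.
    by move/(@apZ_inj _ z); rewrite e1 e2.
  have [[e _]|[e _]] := sw_swap r zp0 zq0 lt op le; first by rewrite e eqxx in a1.
  by rewrite e normrN eqxx.
by rewrite -(wordlen_inv uB) uV step // (asc_big hn zG r sE).
Qed.
End LengthConj.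

(** * Matrices at x = 1 and the Gelfand property over Q(x) *)

Section MatrixModel.
Variables (t : CoxType) (n : nat).
Hypothesis hn : (2 <= n)%N.
Hypothesis tn : t = TD -> odd n.
Let hnN : (2 <= n <= n.*2)%N. Proof. lia. Qed.
Notation W := (WW t n).
Notation SG := (Sgen t n).
Notation G := (Gt t n).
Notation V := (Vmod t n).
Notation cj s z := (permc s (permc z s)).
Notation d := #|{: G}|.
Notation zj := (@zof t n).

Section FromGenerators.
Variable S : P n -> 'M[rat]_d.
Hypothesis S1 : S 1%g = 1%:M.
Hypothesis Sg : forall s w, s \in SG -> w \in W -> S (permc s w) = S s *m S w.
Hypothesis Ss : forall s, s \in SG -> (S s)^T = S s.

Lemma SM u w : u \in W -> w \in W -> S (permc u w) = S u *m S w.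
Proof.
move=> uW wW; move: u uW; apply: (W_ind hn) => [|s u sS uW _ IH].
  by rewrite /permc mulg1 S1 mul1mx.
have pW := WWM hn sS uW.
have -> : permc u w = permc s (permc (permc s u) w) by rewrite -{1}(SS hn u sS) /permc mulgA.
rewrite (Sg sS (W_mul hn pW wW)) IH mulmxA -(Sg sS pW) (SS hn _ sS) //.
Qed.

Lemma ST w : w \in W -> (S w)^T = S w^-1%g.
Proof.
move: w; apply: (W_ind hn) => [|s w sS wW _ IH]; first by rewrite invg1 S1 trmx1.
have pW := WWM hn sS wW; have sW := WWS hn sS.
rewrite -{1}(SS hn w sS) (Sg sS pW) trmx_mul IH (Ss sS) -(SM (W_inv hn pW) sW); congr S.
by rewrite /permc invMg (gensV hnN sS) mulgA (gens_invol hnN sS) mul1g.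
Qed.

Hypothesis faithful : forall v : {ffun P n -> rat^o}, ann S v -> v = 0.

(** By faithfulness the span A of the matrices S w has dimension |W|, and transposition acts on it
    as inversion. The space Alt A is spanned by one difference for each pair of distinct inverse
    elements, so Sym A exceeds it by at least the number of involutions, which is at least d; then
    [comm_sym] applies. *)
Lemma commutant_sym (c : 'M[rat]_d) : (forall s, s \in SG -> S s *m c = c *m S s) -> c^T = c.
Proof.
move=> cs.
have cw w : w \in W -> S w *m c = c *m S w.
  move: w; apply: (W_ind hn) => [|s w sS wW _ IH]; first by rewrite S1 mul1mx mulmx1.
  have pW := WWM hn sS wW.
  by rewrite -(SS hn w sS) (Sg sS pW) -mulmxA IH mulmxA cs // mulmxA.
pose X := [tuple S (enum_val i) | i < #|W|].
have Xi (i : 'I_#|W|) : X`_i = S (enum_val i) by exact: nth_mktuple.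
have frX : free X.
  apply/freeP => k k0 i.
  pose v : {ffun P n -> rat^o} := [ffun w => if [pick j : 'I_#|W| | enum_val j == w] is Some j then k j else 0].
  have vE j : v (enum_val j) = k j.
    by rewrite ffunE; case: pickP => [j' /eqP/enum_val_inj->|/(_ j)] //; rewrite eqxx.
  suff : v = 0 by move/ffunP/(_ (enum_val i)); rewrite vE ffunE.
  apply: faithful; split=> [w wW|].
    by rewrite ffunE; case: pickP => // j /eqP e; case/negP: wW; rewrite -e enum_valP.
  rewrite big_enum_val -[RHS]k0; apply: eq_bigr => j _; by rewrite vE Xi.
pose A := <<X>>%VS.
have SA w : w \in W -> S w \in A.
  move=> wW; rewrite -(enum_rankK_in wW wW) -Xi; apply: memv_span; apply: mem_nth.
  by rewrite size_tuple.
have Aex a : a \in A -> exists k : 'I_#|W| -> rat, a = \sum_i k i *: S (enum_val i).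
  move=> aA; exists (fun i => coord X i a); rewrite {1}(coord_span aA).
  by apply: eq_bigr => i _; rewrite Xi.
have Asum k : \sum_(i < #|W|) k i *: S (enum_val i) \in A.
  by apply: memv_suml => i _; apply: memvZ; apply: SA; exact: enum_valP.
have AM a b : a \in A -> b \in A -> a *m b \in A.
  move=> /Aex[k ->] /Aex[l ->]; rewrite mulmx_suml; apply: memv_suml => i _.
  rewrite mulmx_sumr; apply: memv_suml => j _; rewrite -scalemxAl -scalemxAr.
  by do 2!apply: memvZ; rewrite -SM ?enum_valP //; apply: SA; apply: W_mul => //; exact: enum_valP.
have AT a : a \in A -> a^T \in A.
  move=> /Aex[k ->]; rewrite linear_sum; apply: memv_suml => i _; rewrite linearZ /=.
  by apply: memvZ; rewrite ST ?enum_valP //; apply: SA; apply: W_inv => //; exact: enum_valP.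
suff dimA : (\dim (altA A) + d <= \dim (symA A))%N.
  have CS := comm_sym AM dimA; apply: CS => a /Aex[k ->]; rewrite mulmx_suml mulmx_sumr; apply: eq_bigr => i _.
  by rewrite -scalemxAl -scalemxAr cw // enum_valP.
pose rk (w : P n) : nat := enum_rank w.
(* One element of each pair of distinct inverses, selected by its rank in the enumeration. *)
pose Rs := [set w in W | (rk w < rk w^-1%g)%N].
pose Inv := [set w in W | w^-1%g == w].
have WVi w : (w^-1%g \in W) = (w \in W).
  by apply/idP/idP => /(W_inv hn) //; rewrite invgK.
have cW : (#|W| = #|Rs| + #|Rs| + #|Inv|)%N.
  have -> : W = (Rs :|: [set w^-1%g | w in Rs]) :|: Inv.
    apply/setP => w; rewrite !inE; have -> : (w \in [set u^-1%g | u in Rs]) = (w \in W) && (rk w^-1%g < rk w)%N.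
      apply/imsetP/andP => [[u]|[wW h]]; last by exists w^-1%g; rewrite ?invgK // inE WVi wW invgK.
      by rewrite inE => /andP[uW h] ->; rewrite invgK WVi.
    case: (boolP (w \in W)) => //= wW; case: (ltngtP (rk w) (rk w^-1%g)) => //= e.
    by apply/esym/eqP/enum_rank_inj/val_inj.
  rewrite !cardsU (card_imset _ invg_inj).
  have -> : Rs :&: [set w^-1%g | w in Rs] = set0.
    apply/setP => w; rewrite !inE; apply/negP => /andP[/andP[_ h] /imsetP[u]]; rewrite inE => /andP[_ h'] e.
    by move: h; rewrite e invgK ltnNge (ltnW h').
  have -> : (Rs :|: [set w^-1%g | w in Rs]) :&: Inv = set0.
    apply/setP => w; rewrite !inE; apply/negP => /andP[/orP[/andP[_ h]|/imsetP[u uR E]] /andP[_ /eqP e]].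
      by move: h; rewrite e ltnn.
    move: uR; rewrite inE => /andP[_ h]; move: e; rewrite E invgK => eu.
    by rewrite -eu ltnn in h.
  by rewrite !cards0 !subn0.
have dA : \dim A = #|W| by move: frX; rewrite /free size_tuple => /eqP.
have half (M : 'M[rat]_d) : M = 2%:R^-1 *: (M + M).
  by rewrite -mulr2n -scaler_nat scalerA mulVf ?pnatr_eq0 // scale1r.
have d1 : (#|W| <= \dim (symA A) + \dim (altA A))%N.
  rewrite -dA; apply: leq_trans (dimv_add_leqif (symA A) (altA A)).1; apply: dimvS; apply/subvP => a aA.
  have E2 : a + a = (a + a^T) + (a - a^T) by rewrite addrACA subrr addr0.
  rewrite (half a) E2 scalerDr; apply: memv_add.
    by rewrite memvZ // symAP memvD ?AT //= linearD /= trmxK addrC.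
  by rewrite memvZ // altAP memvB ?AT //= linearB /= trmxK opprB.
have d2 : (\dim (altA A) <= #|Rs|)%N.
  pose Y := [seq S w - S w^-1%g | w <- enum Rs].
  have -> : #|Rs| = size Y by rewrite size_map -cardE.
  apply: leq_trans (dim_span Y); apply: dimvS; apply/subvP => a; rewrite altAP => /andP[aA /eqP aT].
  have [k aE] := Aex a aA.
  have E2 : a + a = a - a^T by rewrite aT opprK.
  rewrite (half a) E2 aE linear_sum /= -sumrN -big_split /=; apply: memvZ; apply: memv_suml => i _.
  rewrite linearZ /= ST ?enum_valP // -scalerBr; apply: memvZ.
  have wW := enum_valP i; move: (enum_val i) wW => w wW.
  case: (ltngtP (rk w) (rk w^-1%g)) => h.
  - by apply: memv_span; apply/mapP; exists w => //; rewrite mem_enum inE wW.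
  - rewrite -opprB memvN; apply: memv_span; apply/mapP; exists w^-1%g; last by rewrite invgK.
    by rewrite mem_enum inE WVi wW invgK.
  - have <- : w = w^-1%g by apply/enum_rank_inj/val_inj.
    by rewrite subrr mem0v.
have d3 : (d <= #|Inv|)%N.
  have dG : d = #|Gset t n| by first [by rewrite card_sig | rewrite card_sig; apply: eq_card => x; rewrite ?inE].
  by rewrite dG; exact: card_G_le.
by move: cW d1 d2 d3; clear; lia.
Qed.
End FromGenerators.

(** At x = 1 the scalars (eA, eD) become (-1, 1) for M and (1, -1) for N; [b] is false for M and
    true for N. *)
Variables (eA eD : K) (b : bool).
Hypotheses (evA : ev eA = - (-1) ^+ b) (evDD : ev eD = (-1) ^+ b) (lA : isLaurent eA) (lD : isLaurent eD).
Variable rho : P n -> V -> V.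
Hypothesis H : isHrep t n rho.
Hypothesis R : rulesG eA eD rho.
Notation a := (xK - xK^-1).

Lemma la : isLaurent a.
Proof. by apply: laurentD; [exact: laurentX | apply: laurentN; exact: laurentXV]. Qed.
Lemma eva : ev a = 0.
Proof.
by rewrite evD ?evN ?evX ?evXV ?subrr //; [exact: laurentXV | exact: laurentX | apply: laurentN; exact: laurentXV].
Qed.

Lemma vaddE (u v : V) y : (u + v) y = u y + v y.
Proof. by rewrite ffunE. Qed.
Lemma vscaleE (k : K) (u : V) y : (k *: u) y = k * u y.
Proof. by rewrite ffunE. Qed.

Lemma rho_coef s (z y : G) : s \in SG -> rho s (bM t n (val z)) y =
  match zkind t s (val z) with
  | KD => eD * (val y == val z)%:R
  | KA => eA * (val y == val z)%:R
  | KU => (val y == cj s (val z))%:R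
  | KL => (val y == cj s (val z))%:R + a * (val y == val z)%:R
  end.
Proof.
move=> sS; have [U [L [A D]]] := R sS (valP z); have := zkindP hn sS (valP z).
by case: (zkind t s (val z)) => k; [rewrite D | rewrite A | rewrite U | rewrite L]; rewrite // !ffunE.
Qed.

Lemma rho_sym s (z y : G) : s \in SG -> rho s (bM t n (val z)) y = rho s (bM t n (val y)) z.
Proof.
move=> sS; rewrite !rho_coef //.
have E : (val y == cj s (val z)) = (val z == cj s (val y)).
  by apply/eqP/eqP => ->; rewrite (cjK hn _ sS).
rewrite E [val z == val y]eq_sym; case: (eqVneq y z) => [->|yz].
  by rewrite eqxx.
have -> : (val y == val z) = false by rewrite (inj_eq val_inj) (negbTE yz).
rewrite !mulr0 !addr0; have [fz1 fz2] := zkind_flip hn sS (valP z); have [fy1 fy2] := zkind_flip hn sS (valP y).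
case: eqP => [e|_]; last by case: (zkind t s (val z)); case: (zkind t s (val y)).
have e' : val y = cj s (val z) by apply/eqP; rewrite E; apply/eqP.
move: fz1 fz2 fy1 fy2; rewrite -e -e'.
case: (zkind t s (val z)); case: (zkind t s (val y)) => // h1 h2 h3 h4;
  by first [have := h1 erefl | have := h2 erefl | have := h3 erefl | have := h4 erefl].
Qed.

Lemma rho_expand w (u : V) y : w \in W -> rho w u y = \sum_(z : G) u z * rho w (bM t n (val z)) y.
Proof.
move=> wW; have [[L _] _] := H.
have r0 : rho w 0 = 0.
  by have := L w wW (-1) 0 0; rewrite scaler0 addr0 scaleN1r => e; rewrite {1}e addNr.
have E : rho w u = \sum_(z : G) u z *: rho w (bM t n (val z)).
  by rewrite {1}(bM_expand u); elim/big_rec2: _ => // z u1 u2 _ <-; rewrite L.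
by rewrite E sum_ffunE; apply: eq_bigr => z _; rewrite ffunE.
Qed.

Lemma laurent_coef w (z y : G) : w \in W -> isLaurent (rho w (bM t n (val z)) y).
Proof. by move=> wW; apply H.2 => // x; rewrite ffunE; exact: laurentb. Qed.

Definition Smx (w : P n) : 'M[rat]_d := \matrix_(i, j) ev (rho w (bM t n (zj j)) (enum_val i)).

Lemma sum_G (F : G -> rat) : \sum_z F z = \sum_(i < d) F (enum_val i).
Proof. by rewrite (reindex _ (onW_bij _ (enum_val_bij G))). Qed.

Lemma Smx1 : Smx 1%g = 1%:M.
Proof.
have [[_ [r1 _]] _] := H; apply/matrixP => i j; rewrite !mxE r1 ffunE.
by rewrite -[X in ev X]/((val (enum_val i) == val (enum_val j))%:R) evb (inj_eq val_inj) (inj_eq enum_val_inj).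
Qed.

Lemma Smx_gen s w : s \in SG -> w \in W -> Smx (permc s w) = Smx s *m Smx w.
Proof.
move=> sS wW; apply/matrixP => i j; rewrite !mxE.
have [[L [r1 r2]] _] := H; have sW := WWS hn sS; have pW := WWM hn sS wW.
have := congr1 (fun u : V => ev (u (enum_val i))) (r2 s w (bM t n (zj j)) sS wW).
rewrite rho_expand // ev_sum; last by move=> z _; apply: laurentM; exact: laurent_coef.
rewrite sum_G => E; rewrite [RHS](eq_bigr (fun k => ev (rho w (bM t n (zj j)) (enum_val k) *
   rho s (bM t n (val (enum_val k))) (enum_val i)))) => [|k _]; last first.
  rewrite !mxE; apply: (etrans (mulrC _ _)); apply: esym; apply: evM.
    exact: (laurent_coef (enum_val j) (enum_val k) wW).
  exact: (laurent_coef (enum_val k) (enum_val i) sW).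
rewrite [RHS]E; case: ifP => _; first by [].
have l1 := laurent_coef (enum_val j) (enum_val i) pW; have l2 := laurent_coef (enum_val j) (enum_val i) wW.
have e := evD l1 (laurentM la l2); rewrite (evM la l2) eva mul0r addr0 in e.
rewrite vaddE vscaleE; exact: esym e.
Qed.

Lemma Smx_sym s : s \in SG -> (Smx s)^T = Smx s.
Proof. by move=> sS; apply/matrixP => i j; rewrite !mxE rho_sym. Qed.

Lemma Smx_rule s Phi j : s \in SG -> (rw t Phi *m Smx s) 0 j =
  match zkind t s (zj j) with
  | KD => (-1) ^+ b * Phi (zj j) | KA => - (-1) ^+ b * Phi (zj j) | _ => Phi (cj s (zj j)) end.
Proof.
move=> sS; rewrite mxE.
under eq_bigr do rewrite !mxE rho_coef //.
have pick1 (c : rat) : \sum_(k < d) Phi (zj k) * (c * (val (enum_val k) == zj j)%:R) = c * Phi (zj j).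
  rewrite (bigD1 j) //= eqxx mulr1 big1 ?addr0 1?mulrC // => k kj.
  by rewrite (inj_eq val_inj) (inj_eq enum_val_inj) (negbTE kj) mulr0 mulr0.
have pick2 : zkind t s (zj j) = KU \/ zkind t s (zj j) = KL ->
    \sum_(k < d) Phi (zj k) * (val (enum_val k) == cj s (zj j))%:R = Phi (cj s (zj j)).
  move=> kk; have cG := cj_G hn sS (valP (enum_val j)) kk.
  pose j' := enum_rank (mkG cG); have ej : zj j' = cj s (zj j) by rewrite /zof enum_rankK.
  rewrite (bigD1 j') //= -[val (enum_val j')]/(zj j') ej eqxx mulr1 big1 ?addr0 // => k kj.
  by rewrite -ej (inj_eq val_inj) (inj_eq enum_val_inj) (negbTE kj) mulr0.
case k : (zkind t s (zj j)) pick2 => pick2.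
- by rewrite -pick1; apply: eq_bigr => i _; rewrite (evM lD (laurentb _)) evb evDD.
- by rewrite -pick1; apply: eq_bigr => i _; rewrite (evM lA (laurentb _)) evb evA.
- by rewrite -pick2 ?k; [apply: eq_bigr => i _; rewrite evb | left].
- rewrite -pick2 ?k; last by right.
  apply: eq_bigr => i _; rewrite (evD (laurentb _) (laurentM la (laurentb _))) (evM la (laurentb _)).
  by rewrite eva mul0r addr0 evb.
Qed.

(* Twisting by the sign character exchanges the two modules at [x = 1]. *)
Definition eta (z : P n) : rat := if b then (-1) ^+ (lenBig t n z)./2 else 1.
Definition sgnW (w : P n) : rat := if b then (-1) ^+ lenW t n w else 1.
Definition Dm : 'M[rat]_d := diag_mx (rw t eta).
Definition Tmx w := sgnW w *: (Dm *m Smx w *m Dm).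

Lemma DmD : Dm *m Dm = 1%:M.
Proof.
apply/matrixP => i j; rewrite mul_diag_mx !mxE /eta; case: b; last by rewrite mul1r.
by case: eqP => [->|_]; rewrite ?mulr0n ?mulr0 // mulr1n -expr2 sqrr_sign.
Qed.

Lemma sgnW_gen s w : s \in SG -> w \in W -> sgnW (permc s w) = (-1) ^+ b * sgnW w.
Proof.
move=> sS wW; rewrite /sgnW; case: b; last by rewrite expr0 mul1r.
rewrite expr1; have pW := WWM hn sS wW; case: (boolP (asc t n s w)) => sa.
  rewrite (len_desc hn sS pW (Sasc_perm hn sS wW sa)) (SS hn _ sS) exprS.
  by [].
by rewrite [in RHS](len_desc hn sS wW sa) exprS mulrA -expr2 sqrrN expr1n mul1r.
Qed.

Lemma sgnW1 : sgnW 1%g = 1.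
Proof. by rewrite /sgnW; case: b => //; rewrite /lenW wordlen1. Qed.

Lemma eta_conj s z : s \in SG -> z \in Gset t n -> zkind t s z = KU \/ zkind t s z = KL ->
  eta (cj s z) = (-1) ^+ b * eta z.
Proof.
move=> sS zG k; rewrite /eta; case: b; last by rewrite expr0 mul1r.
have cG := cj_G hn sS zG k; have [f1 f2] := zkind_flip hn sS zG; rewrite expr1.
case: k => k; first by rewrite (lenBig_conj hn sS zG k) /= exprS.
have := lenBig_conj hn sS cG (f2 k); rewrite (cjK hn _ sS) => ->.
by rewrite /= exprS mulrA -expr2 sqrrN expr1n mul1r.
Qed.

(** The twisted matrices [Tmx] obey the rules of M whatever [b] is, and twisting only changes signs
    of the coefficients of v, so [x1_faithful] applies. *)
Lemma Smx_faithful (v : {ffun P n -> rat^o}) : ann Smx v -> v = 0.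
Proof.
move=> [v1 v2].
have T1 : Tmx 1%g = 1%:M by rewrite /Tmx sgnW1 Smx1 mulmx1 DmD scale1r.
have sgs s : s \in SG -> sgnW s = (-1) ^+ b.
  by move=> sS; have := sgnW_gen sS (WW1 t hn); rewrite sgnW1 mulr1 /permc mul1g.
have Tg s w : s \in SG -> w \in W -> Tmx (permc s w) = Tmx s *m Tmx w.
  move=> sS wW; rewrite /Tmx (Smx_gen sS wW) (sgnW_gen sS wW) (sgs s sS) -scalemxAl -scalemxAr scalerA; congr (_ *: _).
  by rewrite -!mulmxA (mulmxA Dm Dm) DmD mul1mx !mulmxA.
have DT : Dm^T = Dm by exact: tr_diag_mx.
have Ts s : s \in SG -> (Tmx s)^T = Tmx s.
  by move=> sS; rewrite /Tmx linearZ /= !trmx_mul DT Smx_sym // mulmxA.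
have Tr s Phi j : s \in SG -> (rw t Phi *m Tmx s) 0 j =
    match zkind t s (zj j) with KD => Phi (zj j) | KA => - Phi (zj j) | _ => Phi (cj s (zj j)) end.
  move=> sS; rewrite /Tmx -scalemxAr mxE sgs // !mulmxA.
  have -> : rw t Phi *m Dm = rw t (fun z => Phi z * eta z).
    by apply/rowP => i; rewrite mul_mx_diag !mxE.
  rewrite mul_mx_diag mxE Smx_rule // mxE.
  have e2 : eta (zj j) * eta (zj j) = 1 by rewrite /eta; case: b; rewrite ?mulr1 // -expr2 sqrr_sign.
  have b2 : (-1) ^+ b * (-1) ^+ b = 1 :> rat by rewrite -expr2 sqrr_sign.
  have ec := @eta_conj s (zj j) sS (valP _).
  have alg (x y u : rat) : x * x = 1 -> y * y = 1 ->
      [/\ x * (x * (u * y) * y) = u, x * (- x * (u * y) * y) = - u & x * (u * (x * y) * y) = u].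
    move=> hx hy; have h : x * x * u * (y * y) = u by rewrite hx hy mul1r mulr1.
    by split; rewrite -[in RHS]h; ring.
  case: (zkind t s (zj j)) ec => ec.
  - have [g _ _] := alg _ _ (Phi (zj j)) b2 e2; by first [exact: g | rewrite -[RHS]g; ring].
  - have [_ g _] := alg _ _ (Phi (zj j)) b2 e2; by first [exact: g | rewrite -[RHS]g; ring].
  - have [_ _ g] := alg _ _ (Phi (cj s (zj j))) b2 e2; rewrite ec; last by left.
    by first [exact: g | rewrite -[RHS]g; ring].
  - have [_ _ g] := alg _ _ (Phi (cj s (zj j))) b2 e2; rewrite ec; last by right.
    by first [exact: g | rewrite -[RHS]g; ring].
have sg2 w : sgnW w * sgnW w = 1 by rewrite /sgnW; case: b; rewrite ?mulr1 // -expr2 sqrr_sign.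
pose v' : {ffun P n -> rat^o} := [ffun w => (v w : rat) * sgnW w].
have : v' = 0.
  apply: (x1_faithful hn tn T1 (SM T1 Tg) (ST T1 Tg Ts) Tr); split=> [w wW|].
    by rewrite ffunE v1 // mul0r.
  have -> : \sum_(w in W) (v' w : rat) *: Tmx w = Dm *m (\sum_(w in W) (v w : rat) *: Smx w) *m Dm.
    rewrite mulmx_sumr mulmx_suml; apply: eq_bigr => w _.
    by rewrite ffunE /Tmx scalerA -mulrA sg2 mulr1 -scalemxAr -scalemxAl.
  by rewrite v2 mulmx0 mul0mx.
move=> /ffunP e; apply/ffunP => w; have := e w; rewrite !ffunE => h.
by rewrite -[LHS]mulr1 -(sg2 w) mulrA h mul0r.
Qed.

(** Each of the two conditions of [gelfand_criterion] is refuted at x = 1 if it fails: a violating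
    family is rescaled to Laurent polynomials that do not all vanish at 1, and then evaluated. *)
Lemma gelfand_of_rules : gelfandModel W SG (lenW t n) xK rho.
Proof.
have [HH HL] := H; have [L [r1 r2]] := HH.
pose B (u v : {ffun G -> K^o}) : K := \sum_(y : G) (u y : K) * (v y : K).
have bE (z y : G) : bM t n (val z) y = (y == z)%:R by rewrite ffunE (inj_eq val_inj).
have Bb (u : V) z : B u (bM t n (val z)) = u z.
  rewrite /B (bigD1 z) //= bE eqxx mulr1 big1 ?addr0 // => y yz; by rewrite bE (negbTE yz) mulr0.
have Bsy u v : B u v = B v u by apply: eq_bigr => y _; rewrite mulrC.
apply: (@gelfand_criterion K (pt n.*2) W SG (lenW t n) xK _ _ _ _ _ _ {ffun G -> K^o} rho B).
- exact: WW1.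
- move=> Q Q1 QS; apply: (W_ind hn) => // s w sS wW sa Qw.
  have pW := WWM hn sS wW; rewrite -(SS hn w sS); apply: QS => //.
  by rewrite (len_ltE hn sS pW) (Sdesc_perm hn sS wW sa).
- exact: WWS.
- by move=> s w sS; rewrite W_mulE // (WWS hn).
- by move=> s w sS; exact: (SS hn w sS).
- exact: K_real.
- exact: HH.
- move=> k u v w; rewrite /B mulr_sumr -big_split; apply: eq_bigr => y _.
  by rewrite vaddE vscaleE mulrDl -mulrA.
- exact: Bsy.
- move=> v v0; apply/ffunP => y; rewrite ffunE; apply: (K_real (a := fun y => v y : K)).
  by rewrite -[RHS]v0; apply: eq_bigr => x _; rewrite expr2.
- move=> s u v sS; have sW := WWS hn sS; rewrite /B.
  under eq_bigr do rewrite rho_expand // mulr_suml.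
  under [RHS]eq_bigr do rewrite rho_expand // mulr_sumr.
  rewrite exchange_big; apply: eq_bigr => y _; apply: eq_bigr => z _.
  by rewrite rho_sym // -!mulrA; congr (_ * _); rewrite mulrC.
- move=> f f0 w wW; apply: contrapT => /eqP nz.
  (* Cut off outside W, where nothing is known about f, so that [scaling] finds a nonzero value
     inside W. *)
  pose g w := if w \in W then f w else 0.
  have gw : g w != 0 by rewrite /g wW.
  have [c [c0 lc [w1 e1]]] := scaling gw.
  pose v : {ffun P n -> rat^o} := [ffun w => ev (c * g w)].
  suff v0 : v = 0 by move: e1; have /ffunP/(_ w1) := v0; rewrite !ffunE => ->; rewrite eqxx.
  apply: Smx_faithful; split=> [u uW|].
    by rewrite ffunE /g (negbTE uW) mulr0 ev0.
  apply/matrixP => i j; rewrite summxE mxE.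
  have := congr1 (fun u : V => c * u (enum_val i)) (f0 (bM t n (zj j))).
  rewrite sum_ffunE ffunE mulr0 mulr_sumr => /(congr1 ev); rewrite ev0 ev_sum.
    move=> E; rewrite -[RHS]E; apply: eq_bigr => u uW; rewrite !mxE vscaleE mulrA.
    have lu : isLaurent (c * f u) by have := lc u; rewrite /g uW.
    rewrite [v u]ffunE /g uW; exact: (esym (evM lu (laurent_coef (enum_val j) (enum_val i) uW))).
  move=> u uW; rewrite vscaleE mulrA.
  have lu : isLaurent (c * f u) by have := lc u; rewrite /g uW.
  exact: (laurentM lu (laurent_coef (enum_val j) (enum_val i) uW)).
(* The rescaled matrix of k at x = 1 is antisymmetric because k is skew-adjoint, and symmetric by
   [commutant_sym]; hence it is zero, against the choice of the scaling. *)
move=> k kl ks ka v; apply: contrapT => nv.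
have kexp (u : V) : k u = \sum_(z : G) u z *: k (bM t n (val z)).
  have k0 : k 0 = 0 by have := kl (-1) 0 0; rewrite scaler0 addr0 scaleN1r => e; rewrite {1}e addNr.
  by rewrite {1}(bM_expand u); elim/big_rec2: _ => // z u1 u2 _ <-; rewrite kl.
have kexpE (u : V) y : k u y = \sum_(z : G) u z * k (bM t n (val z)) y.
  by rewrite kexp sum_ffunE; apply: eq_bigr => z _; rewrite vscaleE.
have [z0 nz0] : exists zy : G * G, (k (bM t n (val zy.1)) zy.2 : K) != 0.
  apply: contrapT => no; apply: nv; apply/ffunP => y; rewrite kexpE ffunE big1 // => z _.
  have -> : k (bM t n (val z)) y = 0; last by rewrite mulr0.
  by apply: contrapT => h; apply: no; exists (z, y); apply/eqP.
have [c [c0 lc [zy e]]] := scaling (a := fun zy : G * G => k (bM t n (val zy.1)) zy.2 : K) nz0.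
pose C : 'M[rat]_d := \matrix_(i, j) ev (c * k (bM t n (zj j)) (enum_val i)).
have lcc z y : isLaurent (c * k (bM t n (val z)) y) := lc (z, y).
have CT : C^T = - C.
  apply/matrixP => i j; rewrite !mxE; apply: (etrans _ (evN (lcc (enum_val j) (enum_val i)))).
  congr ev; rewrite -mulrN; congr (_ * _).
  by have := ka (bM t n (zj i)) (bM t n (zj j)); rewrite Bb Bsy Bb.
have CC : C^T = C.
  apply: (commutant_sym Smx1 Smx_gen Smx_sym Smx_faithful) => s sS; have sW := WWS hn sS.
  apply/matrixP => i j; rewrite !mxE.
  have := congr1 (fun u : V => ev (c * u (enum_val i))) (ks s (bM t n (zj j)) sS).
  have h1 (z : G) : isLaurent (c * (rho s (bM t n (zj j)) z * k (bM t n (val z)) (enum_val i))).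
    rewrite mulrCA; exact: (laurentM (laurent_coef (enum_val j) z sW) (lcc z (enum_val i))).
  have h2 (z : G) : isLaurent (c * (k (bM t n (zj j)) z * rho s (bM t n (val z)) (enum_val i))).
    rewrite mulrA; exact: (laurentM (lcc (enum_val j) z) (laurent_coef z (enum_val i) sW)).
  rewrite kexpE (rho_expand _ _ sW) !mulr_sumr (ev_sum (fun z _ => h1 z)) (ev_sum (fun z _ => h2 z)) !sum_G => E.
  transitivity (\sum_(l < d) ev (c * (k (bM t n (zj j)) (enum_val l) * rho s (bM t n (val (enum_val l))) (enum_val i)))).
    apply: eq_bigr => l _; rewrite !mxE [in RHS]mulrA.
    exact: (etrans (mulrC _ _) (esym (evM (lcc (enum_val j) (enum_val l)) (laurent_coef (enum_val l) (enum_val i) sW)))).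
  rewrite -E; apply: eq_bigr => l _; rewrite !mxE [in LHS]mulrCA.
  exact: (etrans (evM (laurent_coef (enum_val j) (enum_val l) sW) (lcc (enum_val l) (enum_val i))) (mulrC _ _)).
have C0 : C = 0.
  have : C + C = 0 by rewrite -{2}CC CT subrr.
  by rewrite -mulr2n -scaler_nat => /eqP; rewrite scaler_eq0 pnatr_eq0 /= => /eqP.
case/negP: e; have /matrixP/(_ (enum_rank zy.2) (enum_rank zy.1)) := C0.
by rewrite !mxE /zof !enum_rankK => ->.
Qed.

End MatrixModel.

(** * The two eigenvalues of a generator, and the theorem *)

Lemma quad_neg_inv (F : fieldType) (x : F) : x != 0 ->
  (- x^-1) * (- x^-1) = 1 + (x - x^-1) * (- x^-1).
Proof. by move=> x0; rewrite mulrNN mulrN mulrBl divff // opprB [RHS]addrC subrK. Qed.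

Lemma quad_id (F : fieldType) (x : F) : x != 0 -> x * x = 1 + (x - x^-1) * x.
Proof. by move=> x0; rewrite mulrBl mulVf // [RHS]addrC subrK. Qed.

Theorem mainTheorem2 (t : CoxType) (n : nat) (hn : (2 <= n)%N) :
  (forall s z : P n, s \in Sgen t n -> z \in Gset t n ->
     AscLt t n s z \/ DesLt t n s z -> permc s (permc z s) \in Gset t n) /\
  ((exists rho, modM t n rho) /\
   (forall rho1 rho2, modM t n rho1 -> modM t n rho2 ->
      forall w, w \in WW t n -> rho1 w =1 rho2 w)) /\
  ((exists rho, modN t n rho) /\
   (forall rho1 rho2, modN t n rho1 -> modN t n rho2 ->
      forall w, w \in WW t n -> rho1 w =1 rho2 w)) /\
  (~ (t = TD /\ ~~ odd n) ->
     (forall rho, modM t n rho -> gelfandModel (WW t n) (Sgen t n) (lenW t n) xK rho) /\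
     (forall rho, modN t n rho -> gelfandModel (WW t n) (Sgen t n) (lenW t n) xK rho)).
Proof.
have hnN : (2 <= n <= n.*2)%N by lia.
have x0 := xK_neq0.
have q1 : (- xK^-1) * (- xK^-1) = 1 + (xK - xK^-1) * (- xK^-1).
  exact: quad_neg_inv x0.
have q2 : xK * xK = 1 + (xK - xK^-1) * xK := quad_id x0.
have l1 : isLaurent (- xK^-1) by apply: laurentN; exact: laurentXV.
have l2 := laurentX.
split; [|split; [|split]].
- move=> s z sS zG k; have [p [q [r sE]]] := gensP hnN sS.
  case: k => [/(AscLtP hn sS zG r sE)|/(DesLtP hn sS zG r sE)] [_ nD nA]; exact: (conj_Gset hn zG r sE).
- split; first by have [rho [h1 h2]] := module_exists t hn q1 q2 l1 l2; exists rho.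
  move=> r1 r2 [h1 e1] [h2 e2]; exact: (module_unique hn (eA := - xK^-1) (eD := xK) h1 e1 h2 e2).
- split; first by have [rho [h1 h2]] := module_exists t hn q2 q1 l2 l1; exists rho.
  move=> r1 r2 [h1 e1] [h2 e2]; exact: (module_unique hn (eA := xK) (eD := - xK^-1) h1 e1 h2 e2).
move=> ntD; have tn : t = TD -> odd n by move=> tD; apply: contrapT => /negP no; apply: ntD.
have e1 : ev (- xK^-1) = -1 by rewrite evN ?evXV //; exact: laurentXV.
split=> rho [h1 h2].
  by apply: (gelfand_of_rules hn tn (eA := - xK^-1) (eD := xK) (b := false)) => //; rewrite ?e1 ?evX ?expr0.
by apply: (gelfand_of_rules hn tn (eA := xK) (eD := - xK^-1) (b := true)) => //; rewrite ?e1 ?evX ?expr1 ?opprK.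
Qed.
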